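(* Let $\varphi:\mathbb{R}\to\mathbb{R}$ be nondecreasing and continuous, let $u_0\in L^1(\mathbb{R}^N)\cap L^\infty(\mathbb{R}^N)$, let $f$ be measurable on $Q_T$ with $\int_0^T\big(\|f(\cdot,t)\|_{L^1(\mathbb{R}^N)}+\|f(\cdot,t)\|_{L^\infty(\mathbb{R}^N)}\big)dt<\infty$, let $\sigma\in\mathbb{R}^{N\times P}$, and let $\mu$ be a nonnegative symmetric Radon measure on $\mathbb{R}^N\setminus\{0\}$ with $\int_{|z|\le1}|z|^2\,d\mu(z)+\int_{|z|>1}1\,d\mu(z)<\infty$. Then there exists a unique distributional solution $u$ of the Cauchy problem $$\partial_tu-\mathfrak{L}^{\sigma,\mu}[\varphi(u)]=f\ \text{ in } Q_T,\qquad u(x,0)=u_0(x)\ \text{ on }\mathbb{R}^N,$$ such that $u\in L^1(Q_T)\cap L^\infty(Q_T)\cap C([0,T];L^1_{\mathrm{loc}}(\mathbb{R}^N))$.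
   Context: $N,P\in\mathbb{N}$, $T>0$, $Q_T=\mathbb{R}^N\times(0,T)$. A measure $\mu$ is symmetric if $\mu(-B)=\mu(B)$. For $\psi\in C_c^2(\mathbb{R}^N)$ (and acting in the $x$-variable for functions of $(x,t)$), $$\mathfrak{L}^{\sigma,\mu}[\psi](x)=\mathrm{tr}\big(\sigma\sigma^TD^2\psi(x)\big)+\int_{\mathbb{R}^N\setminus\{0\}}\big(\psi(x+z)-\psi(x)-z\cdot D\psi(x)\mathbf{1}_{|z|\le1}\big)\,d\mu(z).$$ A function $u\in L^1_{\mathrm{loc}}(Q_T)$ is a distributional solution if for all $\psi\in C_c^\infty(\mathbb{R}^N\times[0,T))$ one has $\varphi(u)\mathfrak{L}^{\sigma,\mu}[\psi]\in L^1(Q_T)$ and $$\int_0^T\int_{\mathbb{R}^N}\big(u\,\partial_t\psi+\varphi(u)\mathfrak{L}^{\sigma,\mu}[\psi]+f\psi\big)\,dx\,dt+\int_{\mathbb{R}^N}u_0(x)\psi(x,0)\,dx=0.$$ *)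

(* Defs.v *)
From HB Require Import structures.
From mathcomp Require Import all_boot all_order all_algebra.
From mathcomp Require Import all_classical all_reals all_analysis.
From mathcomp Require Import measurable_realfun.
Set Implicit Arguments.
Unset Strict Implicit.
Unset Printing Implicit Defensive.
Import Order.TTheory GRing.Theory Num.Theory.
Import numFieldNormedType.Exports.
Local Open Scope classical_set_scope.
Local Open Scope ring_scope.

(* R^N is 'rV[R]_N. Its sigma-algebra is the one generated by the coordinate
   functions, as the library does for n.-tuple; measurable_rV_borel below shows
   that it is the Borel sigma-algebra. *)
Section measurable_rV.
Variables (R : realType) (n : nat).

Let coors : 'I_n -> 'rV[R]_n -> R := fun i x => x 0 i.

Let rV_set0 : g_sigma_preimage coors set0.
Proof. exact: sigma_algebra0. Qed.

Let rV_setC A : g_sigma_preimage coors A -> g_sigma_preimage coors (~` A).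
Proof. exact: sigma_algebraC. Qed.

Let rV_bigcup (F : _^nat) : (forall i, g_sigma_preimage coors (F i)) ->
  g_sigma_preimage coors (\bigcup_i (F i)).
Proof. exact: sigma_algebra_bigcup. Qed.

HB.instance Definition _ :=
  @isMeasurable.Build (measure_tuple_display default_measure_display)
    'rV[R]_n (g_sigma_preimage coors) rV_set0 rV_setC rV_bigcup.

Lemma measurable_coor (i : 'I_n) :
  measurable_fun [set: 'rV[R]_n] (fun x : 'rV[R]_n => x 0 i).
Proof.
move=> _ Y mY; rewrite setTI; apply: sub_sigma_algebra => /=.
rewrite -bigcup_seq/=; exists i => /=; first by rewrite mem_index_enum.
by exists Y => //; rewrite setTI.
Qed.

Lemma measurable_fun_coorP d (T : measurableType d) (f : T -> 'rV[R]_n) :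
  (forall i, measurable_fun [set: T] (fun x => f x 0 i)) ->
  measurable_fun [set: T] f.
Proof.
move=> mf _ Y mY; rewrite setTI.
pose G := [set A : set 'rV[R]_n | measurable (f @^-1` A)].
suff : @measurable _ 'rV[R]_n `<=` G by apply.
apply: smallest_sub.
  split.
  - by rewrite /G /= preimage_set0.
  - by move=> A; rewrite /G /= setTD preimage_setC; exact: measurableC.
  - by move=> F mF; rewrite /G /= preimage_bigcup; exact: bigcupT_measurable.
move=> A; rewrite -bigcup_seq => -[i _ [B mB <-]].
by rewrite setTI /G /=; have := mf i measurableT B mB; rewrite setTI.
Qed.

Lemma open_measurable_rV (U : set 'rV[R]_n) : open U -> measurable U.
Proof.
move=> oU.
pose box (p : 'rV[rat]_n * nat) : set 'rV[R]_n :=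
  [set x | forall i, `|x 0 i - ratr (p.1 0 i)| < p.2.+1%:R^-1].
have mbox p : measurable (box p).
  rewrite (_ : box p = \bigcap_(i in [set: 'I_n])
      ((fun x : 'rV[R]_n => x 0 i) @^-1`
        ball (ratr (p.1 0 i) : R) p.2.+1%:R^-1)); last first.
    apply/seteqP; split => x /= h i => [_|]; have := h i; rewrite /= /ball /=.
      by rewrite distrC.
    by rewrite distrC; exact.
  apply: fin_bigcap_measurable => // i _.
  rewrite -[X in measurable X]setTI; apply: measurable_coor => //.
  exact: (open_measurable (ball_open _ _)).
rewrite (_ : U = \bigcup_(p in [set p | box p `<=` U]) box p); last first.
  apply/seteqP; split => [x Ux|x [p /= pU] /pU //].
  have /nbhs_ballP[e /= e0 eU] : nbhs x U by exact: open_nbhs_nbhs.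
  have e20 : 0 < e / 2 by rewrite divr_gt0.
  near \oo => k.
  have ke : k.+1%:R^-1 < e / 2 :> R by near: k; exact: near_infty_natSinv_lt (PosNum e20).
  have k0 : 0 < k.+1%:R^-1 :> R by rewrite invr_gt0.
  have /choice[q qP] : forall i, exists r : rat, `|x 0 i - ratr r| < k.+1%:R^-1.
    move=> i; have /rat_in_itvoo[r] : x 0 i - k.+1%:R^-1 < x 0 i + k.+1%:R^-1.
      by rewrite ltrD2l (lt_trans _ k0) // oppr_lt0.
    by rewrite in_itv /= => xr; exists r; rewrite distrC ltr_distl.
  exists (\row_i q i, k) => /=; last by move=> i /=; rewrite mxE.
  move=> y yb; apply: eU; split => // i j; rewrite ord1 /ball /=.
  have := yb j; rewrite /= mxE => yq.
  rewrite (le_lt_trans (ler_distD (ratr (q j)) _ _))// (splitr e).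
  by rewrite ltrD// ?(lt_trans _ ke)// distrC.
rewrite bigcup_mkcond; apply: countable_bigcupT_measurable => [|p].
  exact: countableP.
by case: ifP.
Unshelve. all: by end_near. Qed.

Lemma measurable_rV_borel :
  @measurable _ 'rV[R]_n = <<s [set U : set 'rV[R]_n | open U] >>.
Proof.
apply/seteqP; split; last first.
  apply: smallest_sub; first exact: sigma_algebra_measurable.
  by move=> U; exact: open_measurable_rV.
apply: smallest_sub; first exact: smallest_sigma_algebra.
move=> A; rewrite -bigcup_seq => -[i _ [B mB <-]]; rewrite setTI.
pose G := [set C : set R |
  <<s [set U : set 'rV[R]_n | open U] >> ((fun x : 'rV[R]_n => x 0 i) @^-1` C)].
suff : @measurable _ R `<=` G by apply.
rewrite [X in X `<=` _](RGenOpens.measurableE R).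
apply: smallest_sub.
  split.
  - by rewrite /G /= preimage_set0; exact: sigma_algebra0.
  - by move=> C; rewrite /G /= setTD preimage_setC; exact: sigma_algebraC.
  - by move=> F mF; rewrite /G /= preimage_bigcup; exact: sigma_algebra_bigcup.
move=> _ [a [b ->]]; apply: sub_sigma_algebra => /=.
apply: open_comp => [x _|]; first exact: coord_continuous.
exact: interval_open.
Qed.

End measurable_rV.

Section lebesgue_rV.
Variable R : realType.

Definition cons_rV n (p : R * 'rV[R]_n) : 'rV[R]_n.+1 :=
  \row_i (if unlift ord0 i is Some j then p.2 0 j else p.1).

Lemma measurable_cons_rV n :
  measurable_fun [set: (R * 'rV[R]_n)%type] (@cons_rV n).
Proof.
apply: measurable_fun_coorP => i.
under eq_fun do rewrite mxE.
case: unliftP => [j|] _.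
- exact: (measurableT_comp (measurable_coor j) measurable_snd).
- exact: measurable_fst.
Qed.

Section step.
Variables (n : nat) (m : {sigma_finite_measure set 'rV[R]_n -> \bar R}).

Definition lebesgue_rV_step : set 'rV[R]_n.+1 -> \bar R :=
  pushforward (@lebesgue_measure R \x m)%E (@cons_rV n).

Let step0 : lebesgue_rV_step set0 = 0%E.
Proof. by rewrite /lebesgue_rV_step /pushforward preimage_set0 measure0. Qed.

Let step_ge0 A : (0 <= lebesgue_rV_step A)%E.
Proof. by rewrite /lebesgue_rV_step /pushforward; exact: measure_ge0. Qed.

Let mcons_preimage A :
  measurable A -> measurable (@cons_rV n @^-1` A).
Proof.
by move=> mA; rewrite -[X in measurable X]setTI; exact: measurable_cons_rV.
Qed.

Let step_sigma_additive : semi_sigma_additive lebesgue_rV_step.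
Proof.
move=> F mF tF mUF; rewrite /lebesgue_rV_step /pushforward preimage_bigcup.
apply: measure_semi_sigma_additive.
- by move=> k; exact: mcons_preimage.
- apply/trivIsetP => /= i j _ _ ij; rewrite -preimage_setI.
  by move/trivIsetP : tF => /(_ _ _ _ _ ij) ->//; rewrite preimage_set0.
- by rewrite -preimage_bigcup; exact: mcons_preimage.
Qed.

HB.instance Definition _ := isMeasure.Build _ _ _ lebesgue_rV_step
  step0 step_ge0 step_sigma_additive.

Let uncons_rV (x : 'rV[R]_n.+1) : R * 'rV[R]_n :=
  (x 0 ord0, \row_j x 0 (lift ord0 j)).

Let cons_rVK : cancel (@cons_rV n) uncons_rV.
Proof.
move=> [a y]; rewrite /uncons_rV mxE unlift_none; congr (_, _).
by apply/rowP => j; rewrite !mxE liftK.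
Qed.

Let measurable_uncons : measurable_fun [set: 'rV[R]_n.+1] uncons_rV.
Proof.
apply: measurable_fun_pair; first exact: measurable_coor.
apply: measurable_fun_coorP => i; under eq_fun do rewrite mxE.
exact: measurable_coor.
Qed.

Let step_sigma_finite : sigma_finite setT lebesgue_rV_step.
Proof.
have /sigma_finiteP[F [TF ndF Foo]] := sigma_finiteT (@lebesgue_measure R).
have /sigma_finiteP[G [TG ndG Goo]] := sigma_finiteT m.
exists (fun k => uncons_rV @^-1` (F k `*` G k)).
  rewrite predeqE => x; split => // _.
  have : (\bigcup_k F k) (x 0 ord0) by rewrite -TF.
  have : (\bigcup_k G k) (\row_j x 0 (lift ord0 j)) by rewrite -TG.
  move=> [k _ Gk] [l _ Fl]; exists (maxn k l) => //; split.
    by move: Fl; exact/subsetPset/ndF/leq_maxr.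
  by move: Gk; exact/subsetPset/ndG/leq_maxl.
move=> k; have [mF Fk] := Foo k; have [mG Gk] := Goo k; split.
  rewrite -[X in measurable X]setTI; apply: measurable_uncons => //.
  exact: measurableX.
rewrite /lebesgue_rV_step /pushforward -comp_preimage.
rewrite (_ : uncons_rV \o _ = idfun); last first.
  by apply/funext => p /=; rewrite cons_rVK.
by rewrite preimage_id product_measure1E// lte_mul_pinfty// ge0_fin_numE.
Qed.

HB.instance Definition _ := @Measure_isSigmaFinite.Build _ _ _
  lebesgue_rV_step step_sigma_finite.

End step.

Section base.

Definition lebesgue_rV0 : set 'rV[R]_0 -> \bar R := dirac (0 : 'rV[R]_0).

HB.instance Definition _ := Measure.on lebesgue_rV0.

Let base_sigma_finite : sigma_finite setT lebesgue_rV0.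
Proof.
exists (fun=> setT); first by rewrite bigcup_const.
by move=> _; split => //; rewrite /lebesgue_rV0 diracT ltry.
Qed.

HB.instance Definition _ := @Measure_isSigmaFinite.Build _ _ _
  lebesgue_rV0 base_sigma_finite.

End base.

Fixpoint lebesgue_rV n : {sigma_finite_measure set 'rV[R]_n -> \bar R} :=
  match n with
  | 0%N => lebesgue_rV0
  | n'.+1 => lebesgue_rV_step (lebesgue_rV n')
  end.

Lemma lebesgue_rV_box n (A : 'I_n -> set R) : (forall i, measurable (A i)) ->
  lebesgue_rV n [set x | forall i, A i (x 0 i)] =
  (\prod_(i < n) lebesgue_measure (A i))%E.
Proof.
elim: n A => [|n IHn] A mA.
  rewrite big_ord0 /= /lebesgue_rV0 diracE mem_set //; by case.
rewrite big_ord_recl /= /lebesgue_rV_step /pushforward.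
rewrite -IHn//.
pose B := [set x : 'rV[R]_n | forall i, A (lift ord0 i) (x 0 i)].
have mB : measurable B.
  rewrite (_ : B = \bigcap_(i in [set: 'I_n])
      ((fun x : 'rV[R]_n => x 0 i) @^-1` A (lift ord0 i))).
    apply: fin_bigcap_measurable => // i _.
    by rewrite -[X in measurable X]setTI; exact: measurable_coor.
  by apply/seteqP; split => x /= h i => [_|]; exact: h.
transitivity ((@lebesgue_measure R \x lebesgue_rV n)%E (A ord0 `*` B)); last first.
  by rewrite product_measure1E; [|exact: mA|exact: mB].
congr ((_ \x _)%E _); apply/seteqP; split => -[a y] /=.
- move=> h; split; first by have := h ord0; rewrite mxE unlift_none.
  by move=> i; have := h (lift ord0 i); rewrite mxE liftK.
- by move=> [h0 h] i; rewrite mxE; case: unliftP => [j|] ->.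
Qed.

End lebesgue_rV.

Section euclidean.
Variables (R : realType) (N : nat).
Implicit Types x y : 'rV[R]_N.

(* The library norm on 'rV is the sup norm. *)
Definition dotp x y : R := \sum_(i < N) x 0 i * y 0 i.
Definition enorm x : R := Num.sqrt (dotp x x).

End euclidean.

Section differential.
Variable R : realType.

Fixpoint Ck (V : normedModType R) (k : nat) (f : V -> R) : Prop :=
  match k with
  | 0%N => continuous f
  | k'.+1 => continuous f /\
      forall v : V, (forall x, derivable f x v) /\ Ck k' ('D_v f)
  end.

Definition smooth (V : normedModType R) (f : V -> R) : Prop :=
  forall k, Ck k f.

Definition grad N (f : 'rV[R]_N -> R) (x : 'rV[R]_N) : 'rV[R]_N :=
  \row_i 'D_(delta_mx 0 i) f x.

Definition hessian N (f : 'rV[R]_N -> R) (x : 'rV[R]_N) : 'M[R]_N :=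
  \matrix_(i, j) 'D_(delta_mx 0 i) ('D_(delta_mx 0 j) f) x.

End differential.

Section levy_measure.
Variables (R : realType) (N : nat).
Variable mu : {measure set 'rV[R]_N -> \bar R}.

(* A measure on R^N \ {0} is represented by a measure on R^N of which only the
   restriction to ~` [set 0] is ever used. *)
Definition radon_punctured : Prop :=
  (forall K : set 'rV[R]_N, compact K -> K `<=` ~` [set 0] ->
    (mu K < +oo)%E) /\
  (forall B : set 'rV[R]_N, measurable B -> B `<=` ~` [set 0] ->
    mu B = ereal_sup [set mu K | K in [set K | compact K /\ K `<=` B]]).

Definition symmetric_punctured : Prop :=
  forall B : set 'rV[R]_N, measurable B -> B `<=` ~` [set 0] ->
    mu [set - z | z in B] = mu B.

Definition levy_integrable : Prop :=
  let inner : set 'rV[R]_N := [set z | z != 0 /\ enorm z <= 1] in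
  let outer : set 'rV[R]_N := [set z | 1 < enorm z] in
  (\int[mu]_(z in inner) (enorm z ^+ 2)%:E + \int[mu]_(z in outer) 1 < +oo)%E.

End levy_measure.

Definition levy_op (R : realType) (N P : nat) (sigma : 'M[R]_(N, P))
    (mu : {measure set 'rV[R]_N -> \bar R})
    (psi : 'rV[R]_N -> R) (x : 'rV[R]_N) : R :=
  \tr (sigma *m sigma^T *m hessian psi x) +
  \int[mu]_(z in ~` [set 0])
    (psi (x + z) - psi x - dotp z (grad psi x) * \1_[set z | enorm z <= 1] z).

Section cauchy_problem.
Variables (R : realType) (N : nat).
Local Notation V := 'rV[R]_N.
Local Notation leb1 := (@lebesgue_measure R).
Local Notation lebN := (lebesgue_rV R N).
Local Notation lebQ := (lebN \x leb1)%E.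
Implicit Types (T : R) (u f psi : V * R -> R).

Definition QT T : set (V * R) := [set: V] `*` `]0, T[.

(* C_c^oo(R^N x [0,T)): the elements are the restrictions to R^N x [0,T) of
   smooth functions on R^N x R, here represented by such an extension; the
   support condition only concerns the restriction. *)
Definition test_function T psi : Prop :=
  smooth psi /\
  exists K : set (V * R), [/\ compact K, K `<=` [set: V] `*` `[0, T[ &
    forall p, ([set: V] `*` `[0, T[) p -> ~ K p -> psi p = 0].

Definition L1loc_RN (v : V -> R) : Prop :=
  measurable_fun [set: V] v /\
  forall K : set V, compact K -> lebN.-integrable K (EFin \o v).

Definition L1loc_QT T u : Prop :=
  measurable_fun (QT T) u /\
  forall K : set (V * R), compact K -> K `<=` QT T ->
    lebQ.-integrable K (EFin \o u).

Definition distributional_solution P (sigma : 'M[R]_(N, P))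
    (mu : {measure set V -> \bar R}) (phi : R -> R) T (u0 : V -> R) f u : Prop :=
  L1loc_QT T u /\
  forall psi, test_function T psi ->
    let Lpsi := fun p : V * R =>
      levy_op sigma mu (fun y => psi (y, p.2)) p.1 in
    lebQ.-integrable (QT T) (EFin \o (fun p => phi (u p) * Lpsi p)) /\
    (\int[leb1]_(t in `]0%R, T[) \int[lebN]_x
        (u (x, t) * derive1 (fun s => psi (x, s)) t + phi (u (x, t)) * Lpsi (x, t)
         + f (x, t) * psi (x, t))%:E
     + \int[lebN]_x (u0 x * psi (x, 0%R))%:E = 0)%E.

Definition L1_QT T u : Prop := lebQ.-integrable (QT T) (EFin \o u).

Definition Linfty_QT T u : Prop :=
  measurable_fun (QT T) u /\ (Lnorm lebQ +oo ((EFin \o u) \_ (QT T)) < +oo)%E.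

(* u is an almost-everywhere class on Q_T: it belongs to C([0,T]; L^1_loc) when
   almost all its time slices agree with those of a continuous curve v. *)
Definition C_L1loc T u : Prop :=
  exists v : R -> V -> R,
    [/\ forall t, 0 <= t <= T -> L1loc_RN (v t),
        forall K : set V, compact K -> forall t0, 0 <= t0 <= T ->
          (\int[lebN]_(x in K) `|v t x - v t0 x|%:E)%E
            @[t --> within `[0, T] (nbhs t0)] --> 0%E &
        {ae leb1, forall t, 0 < t < T ->
          {ae lebN, forall x, u (x, t) = v t x}}].

End cauchy_problem.

(* Main.v *)
(** Both halves rest on one estimate, a form of Brezis and Crandall's argument
    for u_t = Delta phi(u).  If w is the difference of two solutions and z the
    difference of their images under phi, then w_t = L z, so that W, the time
    integral of z mollified in space, satisfies W_t = L W + (data).  Testing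
    with the resolvent (de - L)^-1 W, whose quadratic form is nonnegative
    because the jumps are symmetric, yields the vanishing of the integral of
    z w, where z w >= 0 by monotonicity of phi.  Hence z = 0, and then w = 0
    since the mollified w solves w_t = 0 with zero initial value.

    Everything is reduced to finite symmetric jump measures nu n: the local
    part is a second difference along the columns of sigma and the small jumps
    are cut off, so L is approximated uniformly on test functions.  For nu n
    and a Lipschitz approximation of phi, the explicit Euler scheme with a small
    step is order preserving and an L^1 contraction; this gives bounds in L^1
    and L^oo and translation moduli that do not depend on n.  Running the same
    energy estimate on the difference of two approximations, whose equation
    holds up to a small error, shows that they form a Cauchy sequence in
    C([0,T]; L^1_loc), and the limit inherits the weak formulation. *)

(* For a finite jump measure the operator is bounded on L^1 and on L^oo, so its resolvent is a
   Neumann series and every manipulation reduces to Fubini. The mass of [nu n] may blow up, however.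
   It must therefore not occur in the final bound of [core_estimate], which contains only sup and
   L^1 norms; this is what lets n tend to infinity. The obstacle is that z is bounded but not known
   to be integrable, while w and W are integrable. So the resolvent acts on W, and a term de * z v
   is left over. Uniform continuity of phi on bounded sets rescues it: for each kappa > 0 there is s
   > 0 such that everywhere |z| <= kappa or s |z| <= z w. The part of z above kappa is then square
   integrable and can be absorbed; the part below costs kappa times the L^1 norm of de * v, which is
   at most that of W. The weight T - t arises because the energy identity is integrated once more in
   time, so that no trace at a fixed time is taken. In the existence half the scheme runs up to S =
   T + 1, because the weight S - t is at least 1 on [0,T]. *)
From HB Require Import structures.
Require Import Defs.
From mathcomp Require Import all_boot all_order all_algebra.
From mathcomp Require Import all_classical all_reals all_analysis.
From mathcomp Require Import measurable_realfun ess_sup_inf ring lra.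
Set Implicit Arguments.
Unset Strict Implicit.
Unset Printing Implicit Defensive.
Import Order.TTheory GRing.Theory Num.Theory.
Import numFieldNormedType.Exports.
Local Open Scope classical_set_scope.
Local Open Scope ring_scope.

(** * Integrable real-valued functions *)

Section real_integrals.
Context d (T : measurableType d) (R : realType).
Variable m : {measure set T -> \bar R}.
Implicit Types f g h : T -> R.

(** Real values keep [ring] and [lra] available under the integral; extended reals come back only
    for finiteness proofs and for limits. *)
Definition L1 f : Prop := m.-integrable [set: T] (EFin \o f).

Lemma L1_measurable f : L1 f -> measurable_fun [set: T] f.
Proof. by move=> /integrableP[/measurable_EFinP]. Qed.

Lemma L1P f : measurable_fun [set: T] f -> (\int[m]_x `|f x|%:E < +oo)%E -> L1 f.
Proof. by move=> mf ?; apply/integrableP; split=> //; apply/measurable_EFinP. Qed.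

Lemma L1_lty f : L1 f -> (\int[m]_x `|f x|%:E < +oo)%E.
Proof. by move=> /integrableP[]. Qed.

Lemma L1_le f g : measurable_fun [set: T] f -> L1 g ->
  (forall x, `|f x| <= g x) -> L1 f.
Proof.
move=> mf ig fg; apply: le_integrable ig => //; first exact/measurable_EFinP.
by move=> x _ /=; rewrite lee_fin (le_trans (fg x))// ler_norm.
Qed.

Lemma L10 : L1 (fun=> 0).
Proof. exact: integrable0. Qed.

Lemma L1D f g : L1 f -> L1 g -> L1 (fun x => f x + g x).
Proof. by move=> f1 g1; exact: (integrableD measurableT f1 g1). Qed.

Lemma L1N f : L1 f -> L1 (fun x => - f x).
Proof. by move=> f1; exact: (integrableN f1). Qed.

Lemma L1B f g : L1 f -> L1 g -> L1 (fun x => f x - g x).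
Proof. by move=> f1 g1; exact: L1D f1 (L1N g1). Qed.

Lemma L1Z c f : L1 f -> L1 (fun x => c * f x).
Proof. by move=> f1; exact: (integrableZl measurableT c f1). Qed.

Lemma L1_norm f : L1 f -> L1 (fun x => `|f x|).
Proof. by move=> f1; exact: integrable_norm. Qed.

Lemma L1Ml f g c : L1 f -> measurable_fun [set: T] g -> (forall x, `|g x| <= c) ->
  L1 (fun x => f x * g x).
Proof.
move=> f1 mg gc; apply: (L1_le _ (L1Z c (L1_norm f1))) => [|x].
  by apply: measurable_funM => //; exact: L1_measurable.
by rewrite normrM mulrC ler_wpM2r.
Qed.

Lemma L1Mr f g c : measurable_fun [set: T] g -> (forall x, `|g x| <= c) -> L1 f ->
  L1 (fun x => g x * f x).
Proof. by move=> mg gc f1; under eq_fun do rewrite mulrC; exact: L1Ml gc. Qed.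

Lemma L1_sum (I : Type) (s : seq I) (F : I -> T -> R) :
  (forall i, L1 (F i)) -> L1 (fun x => \sum_(i <- s) F i x).
Proof.
move=> hF; elim: s => [|i s ih]; first by under eq_fun do rewrite big_nil; exact: L10.
by under eq_fun do rewrite big_cons; exact: L1D.
Qed.

Lemma L1_eq f g : f =1 g -> L1 f -> L1 g.
Proof. by move=> /funext ->. Qed.

Lemma L1_indic (A : set T) : measurable A -> (m A < +oo)%E -> L1 \1_A.
Proof.
move=> mA Aoo; apply: L1P => //.
under eq_integral do rewrite ger0_norm//.
by rewrite integral_indic// setIT.
Qed.

Lemma intD f g : L1 f -> L1 g ->
  \int[m]_x (f x + g x) = \int[m]_x f x + \int[m]_x g x.
Proof. by move=> f1 g1; rewrite RintegralD. Qed.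

Lemma intB f g : L1 f -> L1 g ->
  \int[m]_x (f x - g x) = \int[m]_x f x - \int[m]_x g x.
Proof. by move=> f1 g1; rewrite RintegralB. Qed.

Lemma intZ c f : L1 f -> \int[m]_x (c * f x) = c * \int[m]_x f x.
Proof. by move=> f1; rewrite RintegralZl. Qed.

Lemma int0 : \int[m]_x (0 : R) = 0.
Proof. by rewrite /Rintegral integral0. Qed.

Lemma intN f : L1 f -> \int[m]_x (- f x) = - \int[m]_x f x.
Proof.
move=> f1; rewrite -[RHS]mulN1r -intZ//.
by apply: eq_Rintegral => x _; rewrite mulN1r.
Qed.

Lemma le_int f g : L1 f -> L1 g -> (forall x, f x <= g x) ->
  \int[m]_x f x <= \int[m]_x g x.
Proof. by move=> f1 g1 fg; exact: le_Rintegral. Qed.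

Lemma int_ge0 f : (forall x, 0 <= f x) -> 0 <= \int[m]_x f x.
Proof. by move=> f0; exact: Rintegral_ge0. Qed.

Lemma le_norm_int f : L1 f -> `|\int[m]_x f x| <= \int[m]_x `|f x|.
Proof. by move=> f1; exact: le_normr_Rintegral. Qed.

Lemma le_norm_int_le f g : L1 f -> L1 g -> (forall x, `|f x| <= g x) ->
  `|\int[m]_x f x| <= \int[m]_x g x.
Proof.
move=> f1 g1 fg; apply: (le_trans (le_norm_int f1)).
by apply: le_int => //; exact: L1_norm.
Qed.

Lemma EFin_int f : L1 f -> (\int[m]_x f x)%:E = (\int[m]_x (f x)%:E)%E.
Proof. by move=> f1; rewrite /Rintegral fineK//; exact: integrable_fin_num. Qed.

End real_integrals.
Arguments L1 {d T R} m f.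
#[global] Hint Resolve L10 : core.

(** * Fubini and Tonelli for real-valued integrands *)

Section real_fubini.
Context d1 d2 (X : measurableType d1) (Y : measurableType d2) (R : realType).
Variables (m1 : {sigma_finite_measure set X -> \bar R}).
Variables (m2 : {sigma_finite_measure set Y -> \bar R}).
Implicit Type F : X * Y -> R.

Lemma measurable_fine (f : X -> \bar R) : measurable_fun [set: X] f ->
  measurable_fun [set: X] (fine \o f).
Proof. by move=> mf; exact: measurableT_comp. Qed.

Lemma measurable_slice1 d3 (Z : measurableType d3) (F : X * Y -> Z) x :
  measurable_fun [set: X * Y] F -> measurable_fun [set: Y] (fun y => F (x, y)).
Proof. by move=> mF; exact: measurableT_comp mF (pair1_measurable _). Qed.

Lemma measurable_slice2 d3 (Z : measurableType d3) (F : X * Y -> Z) y :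
  measurable_fun [set: X * Y] F -> measurable_fun [set: X] (fun x => F (x, y)).
Proof. by move=> mF; exact: measurableT_comp mF (pair2_measurable _). Qed.

(** No integrability is assumed: Tonelli makes the slice integrals of the positive and negative
    parts measurable, and their difference in [\bar R] is measurable as well. *)
Lemma measurable_eint1 F : measurable_fun [set: X * Y] F ->
  measurable_fun [set: X] (fun x => \int[m2]_y (F (x, y))%:E)%E.
Proof.
move=> mF.
have mE : measurable_fun [set: X * Y] (EFin \o F) by exact/measurable_EFinP.
under eq_fun do rewrite integralE.
apply: emeasurable_funB.
- rewrite (_ : (fun x => _) = fubini_F m2 (EFin \o F)^\+%E).
    by apply: measurable_fun_fubini_tonelli_F => //; exact: measurable_funepos.
  by apply/funext => x; apply: eq_integral => y _; rewrite !funeposE.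
- rewrite (_ : (fun x => _) = fubini_F m2 (EFin \o F)^\-%E).
    by apply: measurable_fun_fubini_tonelli_F => //; exact: measurable_funeneg.
  by apply/funext => x; apply: eq_integral => y _; rewrite !funenegE.
Qed.

Lemma measurable_int1 F : measurable_fun [set: X * Y] F ->
  measurable_fun [set: X] (fun x => \int[m2]_y F (x, y)).
Proof. by move=> mF; apply: measurable_fine; exact: measurable_eint1. Qed.

Lemma tonelli1 F : measurable_fun [set: X * Y] F -> (forall p, 0 <= F p) ->
  (\int[m1 \x m2]_p (F p)%:E = \int[m1]_x \int[m2]_y (F (x, y))%:E)%E.
Proof.
move=> mF F0; rewrite (fubini_tonelli1 (EFin \o F))//; exact/measurable_EFinP.
Qed.

Lemma tonelli2 F : measurable_fun [set: X * Y] F -> (forall p, 0 <= F p) ->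
  (\int[m1 \x m2]_p (F p)%:E = \int[m2]_y \int[m1]_x (F (x, y))%:E)%E.
Proof.
move=> mF F0; rewrite (fubini_tonelli2 (EFin \o F))//; exact/measurable_EFinP.
Qed.

Lemma L1_prod1 F : measurable_fun [set: X * Y] F ->
  (\int[m1]_x \int[m2]_y `|F (x, y)|%:E < +oo)%E -> L1 (m1 \x m2)%E F.
Proof.
move=> mF h; apply: L1P => //; rewrite (@tonelli1 (fun p => `|F p|))//.
exact: measurableT_comp.
Qed.

Lemma L1_prod2 F : measurable_fun [set: X * Y] F ->
  (\int[m2]_y \int[m1]_x `|F (x, y)|%:E < +oo)%E -> L1 (m1 \x m2)%E F.
Proof.
move=> mF h; apply: L1P => //; rewrite (@tonelli2 (fun p => `|F p|))//.
exact: measurableT_comp.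
Qed.

Lemma L1_tensor (f : X -> R) (g : Y -> R) : L1 m1 f -> L1 m2 g ->
  L1 (m1 \x m2)%E (fun p => f p.1 * g p.2).
Proof.
move=> f1 g1; have mf := L1_measurable f1; have mg := L1_measurable g1.
apply: L1_prod1; first by apply: measurable_funM; exact: measurableT_comp.
have e x : (\int[m2]_y `|f x * g y|%:E = `|f x|%:E * \int[m2]_y `|g y|%:E)%E.
  under eq_integral do rewrite normrM EFinM.
  rewrite ge0_integralZl_EFin//.
  by apply/measurable_EFinP; exact: measurableT_comp.
under eq_integral do rewrite e.
rewrite -EFin_int; last exact: L1_norm.
rewrite ge0_integralZr//.
- by rewrite -EFin_int ?ltry//; exact: L1_norm.
- by apply/measurable_EFinP; exact: measurableT_comp.
- by rewrite lee_fin; exact: int_ge0.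
Qed.

Lemma L1_ae1 F : L1 (m1 \x m2)%E F -> {ae m1, forall x, L1 m2 (fun y => F (x, y))}.
Proof. exact: ae_integrable1. Qed.

Lemma L1_ae2 F : L1 (m1 \x m2)%E F -> {ae m2, forall y, L1 m1 (fun x => F (x, y))}.
Proof. exact: ae_integrable2. Qed.

Lemma L1_int1 F : L1 (m1 \x m2)%E F -> L1 m1 (fun x => \int[m2]_y F (x, y)).
Proof.
move=> F1; have mF := L1_measurable F1.
apply: L1P; first exact: measurable_int1.
apply: (@le_lt_trans _ _ (\int[m1]_x \int[m2]_y `|F (x, y)|%:E)%E).
  apply: ae_ge0_le_integral => //.
  - by apply/measurable_EFinP; apply: measurableT_comp => //; exact: measurable_int1.
  - by move=> x _; exact: integral_ge0.
  - by apply: (@measurable_eint1 (fun p => `|F p|)); exact: measurableT_comp.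
  (* The comparison is made for almost every x only: on a slice that is not integrable the real
     integral is a default value. *)
  apply: filterS (L1_ae1 F1) => x Fx _.
  by rewrite -EFin_int ?lee_fin ?le_norm_int//; exact: L1_norm.
rewrite -(@tonelli1 (fun p => `|F p|))//; first exact: L1_lty.
exact: measurableT_comp.
Qed.

Lemma int_prod1 F : L1 (m1 \x m2)%E F ->
  \int[(m1 \x m2)%E]_p F p = \int[m1]_x \int[m2]_y F (x, y).
Proof.
move=> F1; have mF := L1_measurable F1.
congr fine; rewrite -(integral12_prod_meas1 F1); apply: ae_eq_integral => //.
- exact: measurable_eint1.
- by apply/measurable_EFinP; exact: measurable_int1.
- by apply: filterS (L1_ae1 F1) => x Fx _; rewrite EFin_int.
Qed.

End real_fubini.

Section real_fubini_swap.
Context d1 d2 (X : measurableType d1) (Y : measurableType d2) (R : realType).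
Variables (m1 : {sigma_finite_measure set X -> \bar R}).
Variables (m2 : {sigma_finite_measure set Y -> \bar R}).
Implicit Type F : X * Y -> R.

Lemma measurable_swapf d3 (Z : measurableType d3) (F : X * Y -> Z) :
  measurable_fun [set: X * Y] F -> measurable_fun [set: Y * X] (fun p => F (p.2, p.1)).
Proof. by move=> mF; apply: (measurableT_comp mF); exact: measurable_fun_pair. Qed.

Lemma measurable_eint2 F : measurable_fun [set: X * Y] F ->
  measurable_fun [set: Y] (fun y => \int[m1]_x (F (x, y))%:E)%E.
Proof.
by move=> mF; exact: (@measurable_eint1 _ _ _ _ _ m1 _ (measurable_swapf mF)).
Qed.

Lemma L1_swap F : L1 (m1 \x m2)%E F -> L1 (m2 \x m1)%E (fun p => F (p.2, p.1)).
Proof.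
move=> F1; have mF := L1_measurable F1.
apply: L1_prod1; first exact: measurable_swapf.
rewrite /= -(@tonelli2 _ _ _ _ _ m1 m2 (fun p => `|F p|))//; first exact: L1_lty.
exact: measurableT_comp.
Qed.

Lemma int_prod2 F : L1 (m1 \x m2)%E F ->
  \int[(m1 \x m2)%E]_p F p = \int[m2]_y \int[m1]_x F (x, y).
Proof.
move=> F1; rewrite -(@int_prod1 _ _ _ _ _ m2 m1 (fun p => F (p.2, p.1))); last exact: L1_swap.
congr fine; rewrite -(integral21_prod_meas1 F1) -(integral12_prod_meas1 (L1_swap F1)).
by [].
Qed.

Lemma L1_int2 F : L1 (m1 \x m2)%E F -> L1 m2 (fun y => \int[m1]_x F (x, y)).
Proof. by move=> F1; exact: (L1_int1 (L1_swap F1)). Qed.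

Lemma int_fubini F : L1 (m1 \x m2)%E F ->
  \int[m1]_x \int[m2]_y F (x, y) = \int[m2]_y \int[m1]_x F (x, y).
Proof. by move=> F1; rewrite -int_prod1// int_prod2. Qed.

End real_fubini_swap.

(** * Measure-preserving maps and changes of variables *)

Section measure_preserving.
Context d1 d2 (X : measurableType d1) (Y : measurableType d2) (R : realType).
Variables (m1 : {measure set X -> \bar R}) (m2 : {measure set Y -> \bar R}).

Definition mpres (f : X -> Y) : Prop := measurable_fun [set: X] f /\
  forall A, measurable A -> m1 (f @^-1` A) = m2 A.

Variable f : X -> Y.
Hypothesis fP : mpres f.

Lemma mpres_ge0 (F : Y -> \bar R) : measurable_fun [set: Y] F ->
  (forall y, 0 <= F y)%E -> (\int[m1]_x F (f x) = \int[m2]_y F y)%E.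
Proof.
move=> mF F0; have [mf fE] := fP.
rewrite -[LHS](@ge0_integral_pushforward _ _ _ _ _ _ mf m1 setT F)//; last first.
by apply: eq_measure_integral => A mA _; rewrite -fE.
Qed.

Lemma mpres_L1 (F : Y -> R) : L1 m2 F -> L1 m1 (F \o f).
Proof.
move=> F1; have mF := L1_measurable F1; apply: L1P.
  by apply: measurableT_comp => //; case: fP.
rewrite (mpres_ge0 (F := fun y => `|F y|%:E))//; first exact: L1_lty.
by apply/measurable_EFinP; exact: measurableT_comp.
Qed.

Lemma mpres_eint (F : Y -> R) : measurable_fun [set: Y] F ->
  (\int[m1]_x (F (f x))%:E = \int[m2]_y (F y)%:E)%E.
Proof.
move=> mF; rewrite integralE [RHS]integralE.
have mE : measurable_fun [set: Y] (EFin \o F) by exact/measurable_EFinP.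
rewrite -(mpres_ge0 (measurable_funepos mE))// -(mpres_ge0 (measurable_funeneg mE))//.
by congr (_ - _)%E; apply: eq_integral => y _; rewrite ?funeposE ?funenegE.
Qed.

Lemma mpres_int (F : Y -> R) : measurable_fun [set: Y] F ->
  \int[m1]_x F (f x) = \int[m2]_y F y.
Proof. by move=> mF; congr fine; exact: mpres_eint. Qed.

Lemma mpres_ae (P : set Y) : {ae m2, forall y, P y} -> {ae m1, forall x, P (f x)}.
Proof.
have [mf fE] := fP.
move=> [A [mA A0 PA]]; exists (f @^-1` A); split => //.
- by rewrite -[X in measurable X]setTI; exact: mf.
- by rewrite fE.
- by move=> x /= nP; apply: PA.
Qed.

End measure_preserving.

Lemma mpres_comp d1 d2 d3 (X : measurableType d1) (Y : measurableType d2)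
  (Z : measurableType d3) (R : realType) (m1 : {measure set X -> \bar R})
  (m2 : {measure set Y -> \bar R}) (m3 : {measure set Z -> \bar R})
  (f : X -> Y) (g : Y -> Z) : mpres m1 m2 f -> mpres m2 m3 g -> mpres m1 m3 (g \o f).
Proof.
move=> [mf fE] [mg gE]; split; first exact: measurableT_comp.
move=> A mA; rewrite comp_preimage fE ?gE//.
by rewrite -[X in measurable X]setTI; exact: mg.
Qed.

Lemma mpres_id d (X : measurableType d) (R : realType) (m : {measure set X -> \bar R}) :
  mpres m m id.
Proof. by split. Qed.

Section mpres_prod.
Context d1 d2 d3 d4 (X : measurableType d1) (Y : measurableType d2)
  (X' : measurableType d3) (Y' : measurableType d4) (R : realType).
Variables (m1 : {sigma_finite_measure set X -> \bar R})
  (m2 : {sigma_finite_measure set Y -> \bar R})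
  (m1' : {sigma_finite_measure set X' -> \bar R})
  (m2' : {sigma_finite_measure set Y' -> \bar R}).

(** The pushforward of the product measure agrees with the target product on measurable rectangles,
    and these determine a product of sigma-finite measures. *)
Lemma mpres_prod (f : X -> X') (g : Y -> Y') : mpres m1 m1' f -> mpres m2 m2' g ->
  mpres (m1 \x m2)%E (m1' \x m2')%E (fun p => (f p.1, g p.2)).
Proof.
move=> [mf fE] [mg gE]; set h := fun p => _.
have mh : measurable_fun [set: X * Y] h.
  by apply: measurable_fun_pair; exact: measurableT_comp.
split => // A mA.
pose hm := isMeasurableFun.Build _ _ _ _ _ mh.
pose h' : {mfun _ >-> _} := HB.pack h hm.
apply/esym; apply: (@product_measure_unique _ _ _ _ _ m1' m2'
  (pushforward (m1 \x m2)%E h')) => // B C mB mC.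
transitivity ((m1 \x m2)%E ((f @^-1` B) `*` (g @^-1` C))); first by [].
have mfB : measurable (f @^-1` B) by rewrite -[X in measurable X]setTI; exact: mf.
have mgC : measurable (g @^-1` C) by rewrite -[X in measurable X]setTI; exact: mg.
by rewrite product_measure1E// fE// gE.
Qed.

End mpres_prod.

Lemma mpres_swap d1 d2 (X : measurableType d1) (Y : measurableType d2) (R : realType)
  (m1 : {sigma_finite_measure set X -> \bar R})
  (m2 : {sigma_finite_measure set Y -> \bar R}) :
  mpres (m1 \x m2)%E (m2 \x m1)%E (fun p => (p.2, p.1)).
Proof.
have mh : measurable_fun [set: X * Y] (fun p => (p.2, p.1)) by exact: measurable_fun_pair.
split => // A mA.
pose hm := isMeasurableFun.Build _ _ _ _ _ mh.
pose h' : {mfun _ >-> _} := HB.pack (fun p : X * Y => (p.2, p.1)) hm.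
apply/esym; apply: (@product_measure_unique _ _ _ _ _ m2 m1
  (pushforward (m1 \x m2)%E h')) => // B C mB mC.
transitivity ((m1 \x m2)%E (C `*` B)).
  by apply: (congr1 (m1 \x m2)%E); apply/seteqP; split=> -[? ?] [].
by rewrite product_measure1E// muleC.
Qed.

Section rV_measurability.
Variables (R : realType) (n : nat).
Local Notation V := 'rV[R]_n.
Context d (T : measurableType d).
Implicit Types f g : T -> V.

Lemma measurable_coor_fun f i : measurable_fun [set: T] f ->
  measurable_fun [set: T] (fun x => f x 0 i).
Proof. by move=> mf; exact: (measurableT_comp (measurable_coor i) mf). Qed.

Lemma measurable_addv f g : measurable_fun [set: T] f -> measurable_fun [set: T] g ->
  measurable_fun [set: T] (fun x => f x + g x).
Proof.
move=> mf mg; apply: measurable_fun_coorP => i; under eq_fun do rewrite mxE.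
by apply: measurable_funD; exact: measurable_coor_fun.
Qed.

Lemma measurable_scalev c f : measurable_fun [set: T] f ->
  measurable_fun [set: T] (fun x => c *: f x).
Proof.
move=> mf; apply: measurable_fun_coorP => i; under eq_fun do rewrite mxE.
by apply: measurable_funM => //; exact: measurable_coor_fun.
Qed.

Lemma measurable_oppv f : measurable_fun [set: T] f ->
  measurable_fun [set: T] (fun x => - f x).
Proof. by move=> mf; under eq_fun do rewrite -scaleN1r; exact: measurable_scalev. Qed.

Lemma measurable_subv f g : measurable_fun [set: T] f -> measurable_fun [set: T] g ->
  measurable_fun [set: T] (fun x => f x - g x).
Proof. by move=> mf mg; apply: measurable_addv => //; exact: measurable_oppv. Qed.

End rV_measurability.

(** * Invariance of Lebesgue measure under translation and reflection *)

Section lebesgue_invariance.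
Variable R : realType.

(** The boolean [s] is the sign, so that translations and reflections share one induction on the
    dimension. Lebesgue measure is determined by its values on half-open intervals; under a
    reflection the open end of the interval changes side. *)
Lemma mpres_affine1 (a : R) (s : bool) :
  mpres (@lebesgue_measure R) (@lebesgue_measure R) (fun x => a + (-1) ^+ s * x).
Proof.
have mf : measurable_fun [set: R] (fun x : R => a + (-1) ^+ s * x).
  by apply: measurable_funD => //; exact: measurable_funM.
split => // A mA.
have mf' : @measurable_fun _ _ (measurableTypeR R) (measurableTypeR R) setT
  (fun x : measurableTypeR R => a + (-1) ^+ s * x) by exact: mf.
pose hm := isMeasurableFun.Build _ _ _ _ _ mf'.
pose h' : {mfun (measurableTypeR R) >-> (measurableTypeR R)} :=
  HB.pack (fun x : measurableTypeR R => a + (-1) ^+ s * x) hm.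
apply/esym; apply: (@lebesgue_measure_unique R (pushforward lebesgue_measure h')) => //= _ [[x y]] _ <-.
rewrite -[RHS]/(lebesgue_measure ((fun t : R => a + (-1) ^+ s * t) @^-1` `]x, y]%classic)).
clear h' hm mf' mf; case: s => /=.
  rewrite (_ : _ @^-1` _ = `[a - y, a - x[%classic); last first.
    by apply/seteqP; split => t /=; rewrite !in_itv/= expr1; lra.
  rewrite !lebesgue_measure_itv/= !lte_fin ltrD2l ltrN2.
  by case: ifPn => // _; congr EFin; ring.
rewrite (_ : _ @^-1` _ = `]x - a, y - a]%classic); last first.
  by apply/seteqP; split => t /=; rewrite !in_itv/= expr0; lra.
rewrite !lebesgue_measure_itv/= !lte_fin ltrD2r.
by case: ifPn => // _; congr EFin; ring.
Qed.

Lemma mpres_cons n : mpres (@lebesgue_measure R \x lebesgue_rV R n)%E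
  (lebesgue_rV R n.+1) (@cons_rV R n).
Proof. by split => //; exact: measurable_cons_rV. Qed.

Lemma mpres_affine n (a : 'rV[R]_n) (s : bool) :
  mpres (lebesgue_rV R n) (lebesgue_rV R n) (fun x => a + (-1) ^+ s *: x).
Proof.
have ma k (b : 'rV[R]_k) : measurable_fun [set: 'rV[R]_k] (fun x => b + (-1) ^+ s *: x).
  by apply: measurable_addv => //; exact: measurable_scalev.
elim: n a => [|n ih] a.
  split; first exact: ma.
  move=> A mA; rewrite (_ : _ @^-1` A = A)//.
  by apply/seteqP; split => x /=; rewrite (_ : a + _ = x)//; apply/rowP; case.
split; first exact: ma.
move=> A mA; have [mf fE] := mpres_prod (mpres_affine1 (a 0 ord0) s) (ih (\row_j a 0 (lift ord0 j))).
have mcA : measurable (@cons_rV R n @^-1` A).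
  by rewrite -[X in measurable X]setTI; exact: measurable_cons_rV.
transitivity ((@lebesgue_measure R \x lebesgue_rV R n)%E (@cons_rV R n @^-1` A)); last by [].
rewrite -fE//.
transitivity ((@lebesgue_measure R \x lebesgue_rV R n)%E
  (@cons_rV R n @^-1` ((fun x => a + (-1) ^+ s *: x) @^-1` A))); first by [].
apply: (congr1 (@lebesgue_measure R \x lebesgue_rV R n)%E); apply/seteqP; split => -[x y] /=; congr (A _);
  apply/rowP => i; rewrite !mxE; case: unliftP => [j ->|->]; rewrite ?mxE ?liftK ?unlift_none ?mxE ?ord1//.
Qed.

Lemma mpres_shift n (a : 'rV[R]_n) :
  mpres (lebesgue_rV R n) (lebesgue_rV R n) (fun x => x + a).
Proof.
have := mpres_affine a false; congr (mpres _ _).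
by apply/funext => x; rewrite expr0 scale1r addrC.
Qed.

Lemma mpres_opp n : mpres (lebesgue_rV R n) (lebesgue_rV R n) (fun x => - x).
Proof.
have := mpres_affine (0 : 'rV[R]_n) true; congr (mpres _ _).
by apply/funext => x; rewrite expr1 scaleN1r add0r.
Qed.

Lemma mpres_shiftX n d (Y : measurableType d) (m : {sigma_finite_measure set Y -> \bar R})
    (a : 'rV[R]_n) :
  mpres (lebesgue_rV R n \x m)%E (lebesgue_rV R n \x m)%E (fun p => (p.1 + a, p.2)).
Proof. exact: (mpres_prod (mpres_shift a) (mpres_id m)). Qed.

End lebesgue_invariance.

(** * Measurability of continuous functions on space and space-time *)

Section continuous_measurable.
Variable R : realType.

Lemma continuous_measurable_rV n (f : 'rV[R]_n -> R) : continuous f ->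
  measurable_fun [set: 'rV[R]_n] f.
Proof.
move=> cf; apply: (measurability _ (RGenOpens.measurableE R)) => //.
move=> _ [_ [a [b ->]] <-]; rewrite setTI; apply: open_measurable_rV.
by apply: open_comp => [x _|]; [exact: cf|exact: interval_open].
Qed.

(** Space-time carries a product sigma-algebra, for which open sets are not measurable by
    definition. The function is pulled back to R^(n+1), where the sigma-algebra is the Borel one. *)
Lemma continuous_measurable_VR n (f : 'rV[R]_n * R -> R) : continuous f ->
  measurable_fun [set: 'rV[R]_n * R] f.
Proof.
move=> cf.
pose u (x : 'rV[R]_n.+1) : 'rV[R]_n * R := (\row_j x 0 (lift ord0 j), x 0 ord0).
have cu : continuous u.
  move=> x.
  have c1 : (fun y : 'rV[R]_n.+1 => (\row_j y 0 (lift ord0 j) : 'rV[R]_n)) @ x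
      --> (\row_j x 0 (lift ord0 j) : 'rV[R]_n).
    move=> A /nbhs_ballP[e /= e0 eA].
    apply/nbhs_ballP; exists e => //= y [_ xy]; apply: eA; split => // i j.
    by rewrite !mxE; exact: xy.
  have c2 : (fun y : 'rV[R]_n.+1 => y 0 ord0) @ x --> x 0 ord0.
    exact: coord_continuous.
  exact: (cvg_pair c1 c2).
rewrite (_ : f = (f \o u) \o (fun p => cons_rV (p.2, p.1))).
  apply: measurableT_comp.
    by apply: continuous_measurable_rV => x; apply: continuous_comp; [exact: cu|exact: cf].
  by apply: measurableT_comp; [exact: measurable_cons_rV|exact: measurable_fun_pair].
apply/funext => -[x t] /=; congr f; rewrite /u; congr pair.
  by apply/rowP => j; rewrite !mxE liftK.
by rewrite mxE unlift_none.
Qed.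

End continuous_measurable.

(** * Bounded measurable functions *)

Section bounded_measurable.
Context d (X : measurableType d) (R : realType).
Implicit Types f g : X -> R.

(** The bound holds everywhere and not just almost everywhere, so that convolutions are defined at
    every point. *)
Definition bm (c : R) f : Prop := measurable_fun [set: X] f /\ forall x, `|f x| <= c.

Lemma bmD a b f g : bm a f -> bm b g -> bm (a + b) (fun x => f x + g x).
Proof.
move=> [mf fa] [mg gb]; split; first exact: measurable_funD.
by move=> x; rewrite (le_trans (ler_normD _ _))// lerD.
Qed.

Lemma bmN a f : bm a f -> bm a (fun x => - f x).
Proof.
by move=> [mf fa]; split; [exact: measurableT_comp|move=> x; rewrite normrN].
Qed.

Lemma bmB a b f g : bm a f -> bm b g -> bm (a + b) (fun x => f x - g x).
Proof. by move=> fa gb; exact: bmD fa (bmN gb). Qed.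

Lemma bmM a b f g : bm a f -> bm b g -> bm (a * b) (fun x => f x * g x).
Proof.
move=> [mf fa] [mg gb]; split; first exact: measurable_funM.
by move=> x; rewrite normrM ler_pM.
Qed.

Lemma bm_cst c : bm `|c| (fun _ : X => c).
Proof. by split. Qed.

Lemma bm_norm a f : bm a f -> bm a (fun x => `|f x|).
Proof. by move=> [mf fa]; split; [exact: measurableT_comp|move=> x; rewrite normr_id]. Qed.

Lemma bmZ k a f : bm a f -> bm (`|k| * a) (fun x => k * f x).
Proof. by move=> fa; exact: bmM (bm_cst k) fa. Qed.

Lemma bm_le a b f : a <= b -> bm a f -> bm b f.
Proof. by move=> ab [mf fa]; split => // x; exact: le_trans (fa x) ab. Qed.

Lemma bm_ge0 a f (x : X) : bm a f -> 0 <= a.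
Proof. by move=> [_ /(_ x)]; exact: le_trans. Qed.

Variable m : {measure set X -> \bar R}.

Lemma L1_bm a f g : L1 m f -> bm a g -> L1 m (fun x => f x * g x).
Proof. by move=> f1 [mg ga]; exact: L1Ml ga. Qed.

Lemma bm_L1 a f g : bm a g -> L1 m f -> L1 m (fun x => g x * f x).
Proof. by move=> [mg ga] f1; exact: L1Mr ga f1. Qed.

End bounded_measurable.

Lemma L1Zr d (T : measurableType d) (R : realType) (m : {measure set T -> \bar R})
  (f : T -> R) c : L1 m f -> L1 m (fun x => f x * c).
Proof. by move=> f1; under eq_fun do rewrite mulrC; exact: L1Z. Qed.

Lemma int_Zr d (T : measurableType d) (R : realType) (m : {measure set T -> \bar R})
  (f : T -> R) c : L1 m f -> \int[m]_x (f x * c) = (\int[m]_x f x) * c.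
Proof. by move=> f1; rewrite mulrC -intZ//; apply: eq_Rintegral => x _; rewrite mulrC. Qed.

(** * Convolution with symmetric kernels *)

Section kernels.
Variables (R : realType) (N : nat).
Local Notation V := 'rV[R]_N.

(** One notion for two uses: a mollifier, as an even density [rho] against Lebesgue measure, and a
    finite symmetric jump measure, with density 1. *)
Definition kern (m : {measure set V -> \bar R}) (rho : V -> R) : Prop :=
  [/\ forall y, 0 <= rho y, L1 m rho, mpres m m (fun y : V => - y) &
      forall y, rho (- y) = rho y].

Context d (X : measurableType d) (M : {sigma_finite_measure set X -> \bar R}).
(** The action by translation is abstract because it is used on space ([shV]) and, in the space
    variable only, on space-time ([shX]). *)
Variable sh : V -> X -> X.
Hypothesis msh : measurable_fun [set: V * X] (fun p => sh p.1 p.2).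
Hypothesis shM : forall y, mpres M M (sh y).
Hypothesis shK : forall y x, sh y (sh (- y) x) = x.
Hypothesis shC : forall y z x, sh y (sh z x) = sh z (sh y x).
Implicit Types (f g : X -> R).

Definition cv (m : {measure set V -> \bar R}) (rho : V -> R) f (x : X) : R :=
  \int[m]_y (rho y * f (sh y x)).

Lemma measurable_shl f x : measurable_fun [set: X] f ->
  measurable_fun [set: V] (fun y => f (sh y x)).
Proof.
move=> mf; apply: (measurableT_comp mf).
exact: (measurable_slice2 x msh).
Qed.

Lemma measurable_shr f : measurable_fun [set: X] f ->
  measurable_fun [set: X * V] (fun p => f (sh p.2 p.1)).
Proof.
by move=> mf; apply: (measurableT_comp mf); exact: (measurable_swapf msh).
Qed.

Section one_kernel.
Variables (m : {sigma_finite_measure set V -> \bar R}) (rho : V -> R).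
Hypothesis mrho : kern m rho.
Let mass : R := \int[m]_y rho y.
Local Notation K := (cv m rho).

Let rho0 y : 0 <= rho y. Proof. by case: mrho. Qed.
Let rho1 : L1 m rho. Proof. by case: mrho. Qed.
Let rhom : measurable_fun [set: V] rho. Proof. exact: L1_measurable rho1. Qed.

Lemma mass_ge0 : 0 <= mass. Proof. exact: int_ge0. Qed.

Lemma cv_L1y c f x : bm c f -> L1 m (fun y => rho y * f (sh y x)).
Proof.
by move=> [mf fc]; apply: (@L1Ml _ _ _ _ _ _ c) => //; exact: measurable_shl.
Qed.

Lemma measurable_cv f : measurable_fun [set: X] f -> measurable_fun [set: X] (K f).
Proof.
move=> mf; apply: (@measurable_int1 _ _ _ _ _ m (fun p : X * V => rho p.2 * f (sh p.2 p.1))).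
apply: measurable_funM; first exact: measurableT_comp.
exact: measurable_shr.
Qed.

Lemma cv_bm c f : bm c f -> bm (mass * c) (K f).
Proof.
move=> fc; split; first by apply: measurable_cv; case: fc.
move=> x; rewrite -int_Zr//; apply: le_norm_int_le.
- exact: cv_L1y fc.
- exact: (L1Ml rho1 (measurable_cst c) (fun=> lexx `|c|)).
- by move=> y; rewrite normrM ger0_norm// ler_wpM2l//; case: fc.
Qed.

Lemma cvD a b f g x : bm a f -> bm b g -> K (fun x => f x + g x) x = K f x + K g x.
Proof.
move=> fa gb; rewrite /cv -intD; [|exact: cv_L1y fa|exact: cv_L1y gb].
by apply: eq_Rintegral => y _; rewrite mulrDr.
Qed.

Lemma cvZ a k f x : bm a f -> K (fun x => k * f x) x = k * K f x.
Proof.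
move=> fa; rewrite /cv -intZ; last exact: cv_L1y fa.
by apply: eq_Rintegral => y _; rewrite mulrCA.
Qed.

Lemma cvB a b f g x : bm a f -> bm b g -> K (fun x => f x - g x) x = K f x - K g x.
Proof.
move=> fa gb; rewrite /cv -intB; [|exact: cv_L1y fa|exact: cv_L1y gb].
by apply: eq_Rintegral => y _; rewrite mulrBr.
Qed.

Lemma cv_cst c x : K (fun=> c) x = mass * c.
Proof. by rewrite /cv int_Zr. Qed.

Lemma cv_le a b f g x : bm a f -> bm b g -> (forall x, f x <= g x) -> K f x <= K g x.
Proof.
move=> fa gb fg; apply: le_int; [exact: cv_L1y fa|exact: cv_L1y gb|].
by move=> y; rewrite ler_wpM2l.
Qed.

Lemma cv_abs a f x : bm a f -> `|K f x| <= K (fun x => `|f x|) x.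
Proof.
move=> fa; apply: le_norm_int_le; [exact: cv_L1y fa|exact: cv_L1y (bm_norm fa)|].
by move=> y; rewrite normrM ger0_norm.
Qed.

Lemma L1_shift f : L1 M f -> L1 (M \x m)%E (fun p : X * V => rho p.2 * f (sh p.2 p.1)).
Proof.
move=> f1; have mf := L1_measurable f1.
apply: L1_prod2 => /=.
  apply: measurable_funM; first exact: measurableT_comp.
  exact: measurable_shr.
under eq_integral => y _.
  under eq_integral do rewrite normrM ger0_norm// EFinM.
  rewrite ge0_integralZl_EFin//; last first.
    apply/measurable_EFinP; apply: measurableT_comp => //.
    exact: (measurable_slice2 y (measurable_shr mf)).
  rewrite (mpres_ge0 (shM y) (F := fun x => `|f x|%:E))//; last first.
    by apply/measurable_EFinP; exact: measurableT_comp.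
  over.
have foo := L1_lty f1.
rewrite -(@fineK _ (\int[M]_x `|f x|%:E)%E); last by rewrite ge0_fin_numE// integral_ge0.
rewrite ge0_integralZr//; last 3 first.
- exact/measurable_EFinP.
- by move=> y _; rewrite lee_fin.
- by rewrite lee_fin fine_ge0// integral_ge0.
rewrite -EFin_int// -EFinM ltry//.
Qed.

Lemma cv_L1 f : L1 M f -> L1 M (K f).
Proof. by move=> f1; exact: (L1_int1 (L1_shift f1)). Qed.

(** After Fubini, the change of variables x -> x - y moves the shift from [g] to [f] with the
    opposite sign; evenness of the kernel and of its measure restores the sign. *)
Lemma cv_sym a b f g : bm a f -> bm b g -> L1 M f ->
  \int[M]_x (f x * K g x) = \int[M]_x (K f x * g x).
Proof.
move=> fa gb f1; have [mf _] := fa; have [mg gb'] := gb.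
have mgs : measurable_fun [set: X * V] (fun p => g (sh p.2 p.1)) by exact: measurable_shr.
have L1G : L1 (M \x m)%E (fun p : X * V => f p.1 * (rho p.2 * g (sh p.2 p.1))).
  apply: (@L1_le _ _ _ _ _ (fun p : X * V => `|f p.1| * (rho p.2 * b))).
  - apply: measurable_funM; first exact: measurableT_comp.
    by apply: measurable_funM => //; exact: measurableT_comp.
  - apply: (L1_tensor (L1_norm f1) (g := fun y => rho y * b)).
    by apply: (@L1Ml _ _ _ _ _ _ `|b|).
  - by move=> p; rewrite normrM ler_wpM2l// normrM ger0_norm// ler_wpM2l.
have L1H : L1 (M \x m)%E (fun p : X * V => rho p.2 * f (sh p.2 p.1) * g p.1).
  by apply: (@L1_bm _ _ _ _ b); [exact: L1_shift|split => //; exact: measurableT_comp].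
transitivity (\int[M]_x \int[m]_y (f x * (rho y * g (sh y x)))).
  by apply: eq_Rintegral => x _; rewrite intZ//; exact: cv_L1y gb.
rewrite (int_fubini L1G) /=.
pose phi y := \int[M]_x (rho y * f (sh y x) * g x).
transitivity (\int[m]_y phi (- y)).
  apply: eq_Rintegral => y _; rewrite /phi.
  rewrite -(mpres_int (shM (- y)) (F := fun x => f x * (rho y * g (sh y x)))); last first.
    apply: measurable_funM => //; apply: measurable_funM => //.
    exact: (measurable_slice2 y mgs).
  apply: eq_Rintegral => x _; rewrite shK mulrCA mulrA.
  by case: mrho => _ _ _ ->.
have -> : \int[m]_y phi (- y) = \int[m]_y phi y.
  case: mrho => _ _ mo _; apply: (mpres_int mo).
  exact: L1_measurable (L1_int2 L1H).
rewrite -(int_fubini L1H)/=; apply: eq_Rintegral => x _.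
by rewrite int_Zr//; exact: cv_L1y fa.
Qed.

(** Symmetry of the convolution, tested against the constant 1. *)
Lemma int_cv a f : bm a f -> L1 M f -> \int[M]_x K f x = mass * \int[M]_x f x.
Proof.
move=> fa f1; have := cv_sym fa (bm_cst X (1 : R)) f1.
under eq_Rintegral do rewrite cv_cst mulr1 mulrC.
rewrite intZ// => ->; apply: eq_Rintegral => x _; rewrite mulr1//.
Qed.

Lemma cv_L1_le a f : bm a f -> L1 M f ->
  \int[M]_x `|K f x| <= mass * \int[M]_x `|f x|.
Proof.
move=> fa f1; rewrite -(int_cv (bm_norm fa))//; last exact: L1_norm.
apply: le_int; first exact/L1_norm/cv_L1.
  exact/cv_L1/L1_norm.
by move=> x; exact: cv_abs fa.
Qed.

(* AM-GM under the integral sign. *)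
Lemma cv_amgm a b th f g x : 0 < th -> bm a f -> bm b g ->
  K f x * g x <= th / 4 * K (fun x => f x ^+ 2) x + mass * (g x ^+ 2 / th).
Proof.
move=> th0 fa gb.
have f2 : bm (a * a) (fun x => f x ^+ 2) by exact: (bmM fa fa).
rewrite -(cvZ _ x f2) -(cv_cst _ x) -(cvD x (bmZ (th / 4) f2) (bm_cst X (g x ^+ 2 / th))).
rewrite /cv -int_Zr; last exact: cv_L1y fa.
apply: le_int.
- exact: (L1_bm (cv_L1y x fa) (bm_cst V (g x))).
- exact: (cv_L1y x (bmD (bmZ (th / 4) f2) (bm_cst X (g x ^+ 2 / th)))).
move=> y; rewrite -mulrA ler_wpM2l//.
rewrite -subr_ge0; set u := f _; set v := g x.
rewrite (_ : _ - _ = (th * u / 2 - v) ^+ 2 / th).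
  by rewrite divr_ge0 ?sqr_ge0 ?ltW.
by field; rewrite gt_eqF.
Qed.

End one_kernel.

Lemma cv_comm (m m' : {sigma_finite_measure set V -> \bar R}) rho rho' c f x :
  kern m rho -> kern m' rho' -> bm c f ->
  cv m rho (cv m' rho' f) x = cv m' rho' (cv m rho f) x.
Proof.
move=> mr mr' fc; have [mf fb] := fc.
have [r0 r1 _ _] := mr; have [r0' r1' _ _] := mr'.
have mF : measurable_fun [set: V * V] (fun p => f (sh p.2 (sh p.1 x))).
  apply: (measurableT_comp mf).
  apply: (measurableT_comp msh (g := fun p : V * V => (p.2, sh p.1 x))).
  apply: measurable_fun_pair => //.
  exact: (measurableT_comp (measurable_slice2 x msh) measurable_fst).
have L1F : L1 (m \x m')%E (fun p => rho p.1 * (rho' p.2 * f (sh p.2 (sh p.1 x)))).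
  have mr1 := L1_measurable r1; have mr1' := L1_measurable r1'.
  apply: (@L1_le _ _ _ _ _ (fun p : V * V => rho p.1 * (rho' p.2 * c))).
  - apply: measurable_funM; first exact: measurableT_comp.
    by apply: measurable_funM => //; exact: measurableT_comp.
  - apply: (L1_tensor r1 (g := fun y => rho' y * c)).
    by apply: (@L1Ml _ _ _ _ _ _ `|c|).
  - by move=> p; rewrite normrM ger0_norm// ler_wpM2l// normrM ger0_norm// ler_wpM2l.
transitivity (\int[m]_y \int[m']_z (rho y * (rho' z * f (sh z (sh y x))))).
  by apply: eq_Rintegral => y _; rewrite intZ//; exact: (cv_L1y _ _ fc).
rewrite (int_fubini L1F)/=; apply: eq_Rintegral => z _.
rewrite -intZ; last exact: (cv_L1y _ _ fc).
by apply: eq_Rintegral => y _; rewrite mulrCA shC.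
Qed.

End kernels.

(* Lebesgue measure on R for the canonical measurable structure of R, whose
   display differs from that of measurableTypeR. *)
Section lebR.
Variable R : realType.

Definition lebR_fun : set R -> \bar R := @lebesgue_measure R.

Let lebR0 : lebR_fun set0 = 0%E. Proof. exact: measure0. Qed.

Let lebR_ge0 A : (0 <= lebR_fun A)%E. Proof. exact: measure_ge0. Qed.

Let lebR_sigma : semi_sigma_additive lebR_fun.
Proof. exact: (@measure_semi_sigma_additive _ _ _ (@lebesgue_measure R)). Qed.

HB.instance Definition _ := isMeasure.Build _ _ _ lebR_fun lebR0 lebR_ge0 lebR_sigma.

Let lebR_sigma_finite : sigma_finite setT lebR_fun.
Proof. exact: (sigma_finiteT (@lebesgue_measure R)). Qed.

HB.instance Definition _ := @Measure_isSigmaFinite.Build _ _ _ lebR_fun lebR_sigma_finite.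

Definition lebR : {sigma_finite_measure set R -> \bar R} := lebR_fun.

Lemma mpres_lebR : mpres (@lebesgue_measure R) lebR id.
Proof. by split. Qed.

Lemma mpres_lebR_inv : mpres lebR (@lebesgue_measure R) id.
Proof. by split. Qed.

End lebR.

Section lebX.
Variables (R : realType) (N : nat).

Definition lebX_fun : set ('rV[R]_N * R) -> \bar R := (lebesgue_rV R N \x lebR R)%E.

HB.instance Definition _ := Measure.on lebX_fun.

Let lebX_sigma_finite : sigma_finite setT lebX_fun.
Proof.
have /sigma_finiteP[F [TF ndF Foo]] := sigma_finiteT (lebesgue_rV R N).
have /sigma_finiteP[G [TG ndG Goo]] := sigma_finiteT (lebR R).
exists (fun k => F k `*` G k).
  apply/seteqP; split => // -[x t] _.
  have : (\bigcup_k F k) x by rewrite -TF.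
  have : (\bigcup_k G k) t by rewrite -TG.
  move=> [k _ Gk] [l _ Fl]; exists (maxn k l) => //; split.
    by move: Fl; exact/subsetPset/ndF/leq_maxr.
  by move: Gk; exact/subsetPset/ndG/leq_maxl.
move=> k; have [mF Fk] := Foo k; have [mG Gk] := Goo k; split.
  exact: measurableX.
by rewrite /lebX_fun product_measure1E// lte_mul_pinfty// ge0_fin_numE.
Qed.

HB.instance Definition _ := @Measure_isSigmaFinite.Build _ _ _ lebX_fun lebX_sigma_finite.

Definition lebX : {sigma_finite_measure set ('rV[R]_N * R)%type -> \bar R} := lebX_fun.

End lebX.

Section fubini_lebX.
Variables (R : realType) (N : nat).
Local Notation V := 'rV[R]_N.
Local Notation lebN := (lebesgue_rV R N).
Implicit Type F : V * R -> R.

Lemma tonelliX1 F : measurable_fun [set: V * R] F -> (forall p, 0 <= F p) ->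
  (\int[lebX R N]_p (F p)%:E = \int[lebN]_x \int[lebR R]_t (F (x, t))%:E)%E.
Proof. exact: tonelli1. Qed.

Lemma tonelliX2 F : measurable_fun [set: V * R] F -> (forall p, 0 <= F p) ->
  (\int[lebX R N]_p (F p)%:E = \int[lebR R]_t \int[lebN]_x (F (x, t))%:E)%E.
Proof. exact: tonelli2. Qed.

Lemma L1X_prod2 F : measurable_fun [set: V * R] F ->
  (\int[lebR R]_t \int[lebN]_x `|F (x, t)|%:E < +oo)%E -> L1 (lebX R N) F.
Proof. exact: L1_prod2. Qed.

Lemma L1X_ae2 F : L1 (lebX R N) F -> {ae lebR R, forall t, L1 lebN (fun x => F (x, t))}.
Proof. exact: L1_ae2. Qed.

Lemma L1X_int1 F : L1 (lebX R N) F -> L1 lebN (fun x => \int[lebR R]_t F (x, t)).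
Proof. exact: L1_int1. Qed.

Lemma L1X_int2 F : L1 (lebX R N) F -> L1 (lebR R) (fun t => \int[lebN]_x F (x, t)).
Proof. exact: L1_int2. Qed.

Lemma intX1 F : L1 (lebX R N) F ->
  \int[lebX R N]_p F p = \int[lebN]_x \int[lebR R]_t F (x, t).
Proof. exact: int_prod1. Qed.

Lemma intX2 F : L1 (lebX R N) F ->
  \int[lebX R N]_p F p = \int[lebR R]_t \int[lebN]_x F (x, t).
Proof. exact: int_prod2. Qed.

Lemma L1X_tensor (f : V -> R) (g : R -> R) : L1 lebN f -> L1 (lebR R) g ->
  L1 (lebX R N) (fun p => f p.1 * g p.2).
Proof. exact: L1_tensor. Qed.

End fubini_lebX.

(** * Primitives in time and integration by parts *)

Section time_primitive.
Variable R : realType.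
Notation leb := (lebR R).

Lemma measurable_boolR d (T : measurableType d) (b : T -> bool) :
  measurable_fun [set: T] b -> measurable_fun [set: T] (fun x => (b x)%:R : R).
Proof.
move=> mb; rewrite (_ : (fun x => _) = \1_[set x | b x]); last first.
  by apply/funext => x; rewrite indicE mem_setE.
apply: measurable_indic; rewrite -[X in measurable X]setTI.
exact: (mb measurableT [set true]).
Qed.

Lemma boolR_bm d (T : measurableType d) (b : T -> bool) :
  measurable_fun [set: T] b -> bm 1 (fun x => (b x)%:R : R).
Proof.
move=> mb; split; first exact: measurable_boolR.
by move=> x; case: (b x); rewrite /= ?normr1 ?normr0.
Qed.

Lemma measurable_itvb d (T : measurableType d) (f g h : T -> R) :
  measurable_fun [set: T] f -> measurable_fun [set: T] g -> measurable_fun [set: T] h ->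
  measurable_fun [set: T] (fun x => f x < g x < h x).
Proof. by move=> mf mg mh; apply: measurable_and; exact: measurable_fun_ltr. Qed.

Lemma itvb_L1 (a b : R) : L1 leb (fun s : R => (a < s < b)%R%:R).
Proof.
rewrite (_ : (fun s : R => _) = \1_(`]a, b[%classic : set R)); last first.
  by apply/funext => s; rewrite indicE mem_setE in_itv.
have h : (leb (`]a, b[%classic : set R) < +oo)%E.
  rewrite -[leb _]/(lebesgue_measure (`]a, b[%classic : set R)).
  by rewrite lebesgue_measure_itv /=; case: ifP => _; rewrite ?ltry// -EFinB ltry.
exact: L1_indic.
Qed.

Lemma int_itvb (a b : R) : a <= b -> \int[leb]_s ((a < s < b)%R%:R : R) = b - a.
Proof.
move=> ab; transitivity (\int[leb]_s (\1_(`]a, b[%classic : set R) s : R)).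
  by apply: eq_Rintegral => s _; rewrite indicE mem_setE in_itv.
rewrite /Rintegral integral_indic// setIT.
have h : leb (`]a, b[%classic : set R) = (b - a)%:E.
  rewrite -[leb _]/(lebesgue_measure (`]a, b[%classic : set R)).
  rewrite lebesgue_measure_itv /= lte_fin -EFinB.
  case: ltP => //= h; congr EFin; apply/eqP; rewrite eq_sym subr_eq0; apply/eqP/le_anti.
  by rewrite ab h.
exact: (congr1 fine h).
Qed.

(** The domain of integration is a 0-1 factor, so that the integrand is one function of (s, t) to
    which measurability and Fubini apply. For t <= 0 the value is 0. *)
Definition prim (a : R -> R) (t : R) : R := \int[leb]_s ((0 < s < t)%R%:R * a s).

Lemma prim_le0 a t : t <= 0 -> prim a t = 0.
Proof.
move=> t0; rewrite /prim (_ : (fun s => _) = fun=> 0) ?int0//.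
apply/funext => s; case: (ltP 0 s) => s0 /=; rewrite ?mul0r//.
by rewrite ltNge (le_trans t0 (ltW s0))/= mul0r.
Qed.

Lemma prim_L1 a t : L1 leb a -> L1 leb (fun s => (0 < s < t)%R%:R * a s).
Proof.
move=> a1; apply: (bm_L1 _ a1); apply: boolR_bm.
exact: measurable_itvb.
Qed.

Lemma prim_closed a t : L1 leb a -> \int[leb]_s ((0 < s <= t)%R%:R * a s) = prim a t.
Proof.
move=> a1; have ma := L1_measurable a1.
have mcl : measurable_fun [set: R] (fun s : R => (0 < s <= t)%R%:R * a s).
  apply: measurable_funM => //; apply: measurable_boolR.
  by apply: measurable_and; [exact: measurable_fun_ltr|exact: measurable_fun_ler].
congr fine; apply: ae_eq_integral => //.
- exact/measurable_EFinP.
- by apply/measurable_EFinP; apply: L1_measurable (prim_L1 t a1).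
- exists [set t]; split => //; first exact: lebesgue_measure_set1.
  move=> s /= h; apply/eqP/negPn/negP => st; apply: h => _; congr (_ * _)%:E.
  by rewrite [s < t]lt_neqAle st.
Qed.

Lemma measurable_prim a : measurable_fun [set: R] a -> measurable_fun [set: R] (prim a).
Proof.
move=> ma; apply: (@measurable_int1 _ _ _ _ _ leb (fun p : R * R => (0 < p.2 < p.1)%R%:R * a p.2)).
apply: measurable_funM; last exact: measurableT_comp.
by apply: measurable_boolR; exact: measurable_itvb.
Qed.

Lemma prim_abs a t : L1 leb a -> `|prim a t| <= \int[leb]_s `|a s|.
Proof.
move=> a1; apply: le_norm_int_le; [exact: prim_L1|exact: L1_norm|].
by move=> s; rewrite normrM; case: (_ < _ < _); rewrite ?normr1 ?mul1r ?normr0 ?mul0r.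
Qed.

(* Integration by parts: split the square ]0,t[ x ]0,t[ along its diagonal. *)
Lemma prim_mul a b t : L1 leb a -> L1 leb b ->
  prim a t * prim b t = prim (fun s => a s * prim b s + prim a s * b s) t.
Proof.
move=> a1 b1; have ma := L1_measurable a1; have mb := L1_measurable b1.
have pa1 := prim_L1 t a1; have pb1 := prim_L1 t b1.
pose F (p : R * R) := ((0 < p.1 < t)%R%:R * a p.1) * ((0 < p.2 < t)%R%:R * b p.2).
have F1 : L1 (leb \x leb)%E F by exact: (L1_tensor pa1 pb1).
have blt : bm 1 (fun p : R * R => (p.2 < p.1)%R%:R : R).
  by apply: boolR_bm; exact: measurable_fun_ltr.
have ble : bm 1 (fun p : R * R => (p.1 <= p.2)%R%:R : R).
  by apply: boolR_bm; exact: measurable_fun_ler.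
have Fl := L1_bm F1 blt; have Fu := L1_bm F1 ble.
have e1 : \int[leb]_s \int[leb]_r (F (s, r) * (r < s)%R%:R) =
    prim (fun s => a s * prim b s) t.
  apply: eq_Rintegral => s _; rewrite mulrA -intZ; last exact: prim_L1.
  apply: eq_Rintegral => r _; rewrite /F /=.
  case: (ltP 0 s) => s0 /=; last by rewrite !mul0r.
  case: (ltP s t) => st /=; last by rewrite !mul0r.
  case: (ltP 0 r) => r0 /=; last by rewrite !(mul0r, mulr0).
  by case: (ltP r s) => rs; rewrite ?(lt_trans rs st) !(mul0r, mulr0, mul1r, mulr1).
have e2 : \int[leb]_r \int[leb]_s (F (s, r) * (s <= r)%R%:R) =
    prim (fun r => prim a r * b r) t.
  apply: eq_Rintegral => r _; rewrite -prim_closed// mulrCA -int_Zr; last first.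
    apply: (bm_L1 _ a1); apply: boolR_bm.
    by apply: measurable_and; [exact: measurable_fun_ltr|exact: measurable_fun_ler].
  apply: eq_Rintegral => s _; rewrite /F /=.
  case: (ltP 0 s) => s0 /=; last by rewrite !mul0r.
  case: (ltP 0 r) => r0 /=; last by rewrite !(mul0r, mulr0).
  case: (ltP r t) => rt /=; last by rewrite !(mul0r, mulr0).
  by case: (leP s r) => sr; rewrite ?(le_lt_trans sr rt) !(mul0r, mulr0, mul1r, mulr1).
have pb : bm (\int[leb]_s `|b s|) (prim b).
  by split; [exact: measurable_prim|move=> s; exact: prim_abs].
have pa : bm (\int[leb]_s `|a s|) (prim a).
  by split; [exact: measurable_prim|move=> s; exact: prim_abs].
rewrite [RHS](_ : _ = prim (fun s => a s * prim b s) t + prim (fun r => prim a r * b r) t); last first.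
  rewrite /prim -intD.
  - by apply: eq_Rintegral => s _; rewrite mulrDr.
  - exact: (prim_L1 t (L1_bm a1 pb)).
  - exact: (prim_L1 t (bm_L1 (m := leb) pa b1)).
rewrite -e1 -e2 -(int_fubini Fu) -(int_prod1 Fl) -(int_prod1 Fu) -intD//.
transitivity (\int[(leb \x leb)%E]_p F p); last first.
  apply: eq_Rintegral => p _; rewrite -mulrDr.
  by case: (ltP p.2 p.1); rewrite /= (addr0, add0r) mulr1.
rewrite int_prod1// /prim -int_Zr//; apply: eq_Rintegral => s _.
by rewrite -intZ.
Qed.

(** Exchanges a function that is integrable only on ]0,T[ for its cut-off, to which the lemmas with
    global integrability apply. *)
Lemma prim_is_L1 (a : R -> R) T : measurable_fun [set: R] a ->
  L1 leb (fun s => (0 < s < T)%R%:R * a s) ->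
  forall t, t <= T -> prim (fun s => (0 < s < T)%R%:R * a s) t = prim a t.
Proof.
move=> ma a1 t tT; apply: eq_Rintegral => s _; rewrite mulrA.
case: (ltP 0 s) => s0 /=; last by rewrite !mul0r.
case: (ltP s t) => st /=; last by rewrite !mul0r.
by rewrite (lt_le_trans st tT) mul1r.
Qed.

End time_primitive.

(** * The time primitive on space-time and its weight *)

Section time_integral.
Variables (R : realType) (N : nat) (T : R).
Notation leb := (lebR R).
Local Notation V := 'rV[R]_N.
Local Notation lebQ := (lebX R N).
Implicit Types (g h : V * R -> R).

(** The factor cuts the primitive off at time T, so that [J] maps bounded functions to bounded
    functions. *)
Definition J g (p : V * R) : R := (p.2 < T)%R%:R * prim (fun s => g (p.1, s)) p.2.

(** This is the adjoint of [J] applied to the constant 1: in the triangle 0 < s < t < T a given s is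
    met for a length T - s of times t. *)
Definition weight (p : V * R) : R := (0 < p.2 < T)%R%:R * (T - p.2).

Hypothesis T0 : 0 < T.

Lemma weight_bm : bm T weight.
Proof.
split.
  apply: measurable_funM; last by apply: measurable_funB => //; exact: measurable_snd.
  by apply: measurable_boolR; apply: measurable_itvb => //; exact: measurable_snd.
move=> [x s]; rewrite /weight /=; case: (ltP 0 s) => s0 /=; last by rewrite mul0r normr0 ltW.
case: (ltP s T) => sT /=; last by rewrite mul0r normr0 ltW.
by rewrite mul1r ger0_norm; [rewrite gerBl ltW|rewrite subr_ge0 ltW].
Qed.

Lemma weight_ge0 p : 0 <= weight p.
Proof.
rewrite /weight; case: (ltP 0 p.2) => //= s0; rewrite ?mul0r//.
by case: (ltP p.2 T) => sT; rewrite ?mul0r// mul1r subr_ge0 ltW.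
Qed.

Let chi (q : (V * R) * R) : R := (0 < q.2 < q.1.2)%R%:R * (q.1.2 < T)%R%:R.

Let mchi : measurable_fun [set: (V * R) * R] chi.
Proof.
have m12 : measurable_fun [set: (V * R) * R] (fun q => q.1.2).
  exact: (measurableT_comp measurable_snd measurable_fst).
apply: measurable_funM; apply: measurable_boolR.
  by apply: measurable_itvb => //; exact: measurable_snd.
by apply: measurable_fun_ltr.
Qed.

Let mg g : measurable_fun [set: V * R] g ->
  measurable_fun [set: (V * R) * R] (fun q => g (q.1.1, q.2)).
Proof.
move=> m; apply: (measurableT_comp m); apply: measurable_fun_pair.
  exact: (measurableT_comp measurable_fst measurable_fst).
exact: measurable_snd.
Qed.

Lemma measurable_primX g : measurable_fun [set: V * R] g ->
  measurable_fun [set: V * R] (fun p => prim (fun s => g (p.1, s)) p.2).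
Proof.
move=> m.
have mF : measurable_fun [set: (V * R) * R]
    (fun q => (0 < q.2 < q.1.2)%R%:R * g (q.1.1, q.2)).
  apply: measurable_funM; last exact: mg.
  apply: measurable_boolR; apply: measurable_itvb => //.
  exact: (measurableT_comp measurable_snd measurable_fst).
exact: (@measurable_int1 _ _ _ _ _ leb _ mF).
Qed.

Lemma measurable_J g : measurable_fun [set: V * R] g -> measurable_fun [set: V * R] (J g).
Proof.
move=> m; apply: measurable_funM; last exact: measurable_primX.
by apply: measurable_boolR; apply: measurable_fun_ltr => //; exact: measurable_snd.
Qed.

Let Tind_L1 c g x : bm c g -> L1 leb (fun s => (0 < s < T)%R%:R * g (x, s)).
Proof.
move=> [m gc]; apply: (@L1Ml _ _ _ _ _ _ c) => //; first exact: itvb_L1.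
exact: measurable_slice1.
Qed.

Lemma J_L1x c g (p : V * R) : bm c g -> p.2 <= T ->
  L1 leb (fun s => (0 < s < p.2)%R%:R * g (p.1, s)).
Proof.
move=> [m gc] pT; apply: (@L1Ml _ _ _ _ _ _ c) => //; first exact: itvb_L1.
exact: measurable_slice1.
Qed.

Lemma J_bm c g : bm c g -> bm (T * c) (J g).
Proof.
move=> gc; split; first by apply: measurable_J; case: gc.
move=> p; have c0 := bm_ge0 p gc.
rewrite /J; case: ltP => pT /=; last by rewrite mul0r normr0 mulr_ge0// ltW.
rewrite mul1r.
apply: (@le_trans _ _ (\int[leb]_s ((0 < s < T)%R%:R * c))).
  apply: le_norm_int_le; first exact: J_L1x gc (ltW pT).
    by apply: (@L1Ml _ _ _ _ _ _ `|c|) => //; exact: itvb_L1.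
  move=> s; rewrite normrM; case: (ltP 0 s) => //= s0; last by rewrite normr0 !mul0r.
  case: (ltP s p.2) => sp /=; last by rewrite normr0 mul0r mulr_ge0.
  by rewrite (lt_trans sp pT) normr1 !mul1r; case: gc.
by rewrite int_Zr; [rewrite int_itvb ?subr0// ltW|exact: itvb_L1].
Qed.

Lemma JD a b g h p : bm a g -> bm b h -> J (fun p => g p + h p) p = J g p + J h p.
Proof.
move=> ga hb; rewrite /J; case: (ltP p.2 T) => pT /=; last by rewrite !mul0r addr0.
rewrite !mul1r -intD; [|exact: J_L1x ga (ltW pT)|exact: J_L1x hb (ltW pT)].
by apply: eq_Rintegral => s _; rewrite mulrDr.
Qed.

Lemma JZ a k g p : bm a g -> J (fun p => k * g p) p = k * J g p.
Proof.
move=> ga; rewrite /J; case: (ltP p.2 T) => pT /=; last by rewrite !mul0r mulr0.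
rewrite !mul1r -intZ; last exact: J_L1x ga (ltW pT).
by apply: eq_Rintegral => s _; rewrite mulrCA.
Qed.

Lemma J_mul a b g h p : bm a g -> bm b h ->
  J g p * J h p = J (fun p => g p * J h p + J g p * h p) p.
Proof.
move=> ga hb; case: p => x t; rewrite /J /=.
case: (ltP t T) => tT /=; last by rewrite !mul0r.
rewrite !mul1r.
have [mg' _] := ga; have [mh' _] := hb.
have ig := Tind_L1 x ga; have ih := Tind_L1 x hb.
rewrite -(prim_is_L1 _ ig (ltW tT)); last exact: measurable_slice1.
rewrite -[prim (fun s => h _) t](prim_is_L1 _ ih (ltW tT)); last exact: measurable_slice1.
rewrite prim_mul//; apply: eq_Rintegral => s _.
case: (ltP 0 s) => s0; rewrite /= ?mul0r//; case: (ltP s t) => st; rewrite /= ?mul0r// !mul1r.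
have sT := lt_trans st tT; rewrite sT !mul1r.
rewrite (prim_is_L1 _ ig (ltW sT)); last exact: measurable_slice1.
by rewrite (prim_is_L1 _ ih (ltW sT))//; exact: measurable_slice1.
Qed.

Lemma int_J c h : bm c h -> L1 lebQ h ->
  \int[lebQ]_p J h p = \int[lebQ]_p (weight p * h p).
Proof.
move=> hc h1; have [mh _] := hc.
(* integrate over (x, s) first and then over t *)
pose F (q : (V * R) * R) : R := h q.1 * ((0 < q.1.2 < q.2)%R%:R * (q.2 < T)%R%:R).
have mF : measurable_fun [set: (V * R) * R] F.
  apply: measurable_funM; first exact: measurableT_comp.
  have m12 : measurable_fun [set: (V * R) * R] (fun q => q.1.2).
    exact: (measurableT_comp measurable_snd measurable_fst).
  apply: measurable_funM; apply: measurable_boolR.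
    by apply: measurable_itvb => //; exact: measurable_snd.
  by apply: measurable_fun_ltr => //; exact: measurable_snd.
have F1 : L1 (lebQ \x leb)%E F.
  have D1 := L1_tensor (L1_norm h1) (itvb_L1 0 T).
  apply: (@L1_le _ _ _ _ F _ _ D1) => [|q]; first exact: mF.
  rewrite /F normrM ler_wpM2l// ger0_norm ?mulr_ge0//.
  case: (ltP q.2 T) => qT; rewrite ?mulr0//= mulr1.
  case: (ltP 0 q.1.2) => //= q0; case: (ltP q.1.2 q.2) => //= qq.
  by rewrite (lt_trans q0 qq).
have -> : \int[lebQ]_p (weight p * h p) = \int[lebQ]_p \int[leb]_t F (p, t).
  apply: eq_Rintegral => -[x s] _; rewrite /F/=.
  rewrite intZ; last first.
    apply: (L1_le _ (itvb_L1 0 T)) => [|t].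
      apply: measurable_funM; apply: measurable_boolR; first exact: measurable_itvb.
      exact: measurable_fun_ltr.
    rewrite ger0_norm ?mulr_ge0//; case: (ltP t T) => tT; rewrite ?mulr0//= mulr1.
    by case: (ltP 0 s) => //= s0; case: (ltP s t) => //= st; rewrite (lt_trans s0 st).
  rewrite mulrC; congr (_ * _); rewrite /weight /=.
  case: (ltP 0 s) => s0 /=; last first.
    by rewrite mul0r; under eq_Rintegral do rewrite mul0r; rewrite int0.
  case: (ltP s T) => sT /=.
    rewrite mul1r -(int_itvb (ltW sT)); apply: eq_Rintegral => t _.
    by case: (s < t); rewrite ?mul0r ?mul1r.
  rewrite mul0r (_ : (fun t => _) = fun=> 0) ?int0//.
  apply/funext => t; case: (ltP s t) => st; rewrite ?mul0r//= mul1r.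
  by rewrite ltNge (le_trans sT (ltW st)).
rewrite (int_fubini F1) /=.
have Jm := measurable_J mh.
have J1 : L1 lebQ (J h).
  (* |J h| <= J |h|, whose integral is controlled by the same Fubini *)
  apply: L1X_prod2 => //.
  apply: (@le_lt_trans _ _ (\int[leb]_t \int[lebQ]_p `|F (p, t)|%:E)%E).
    apply: ge0_le_integral => //.
    - by move=> t _; exact: integral_ge0.
    - by apply: (@measurable_eint2 _ _ _ _ _ _ (fun p => `|J h p|)); exact: measurableT_comp.
    - by apply: (@measurable_eint2 _ _ _ _ _ _ (fun p => `|F p|)); exact: measurableT_comp.
    move=> t _; rewrite (@tonelliX1 _ _ (fun p => `|F (p, t)|))//; last first.
      by apply: measurableT_comp => //; exact: measurable_slice2.
    apply: ge0_le_integral => //.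
    - by apply/measurable_EFinP; apply: measurableT_comp => //; exact: measurable_slice2.
    - apply: (@measurable_eint1 _ _ _ _ _ _ (fun p => `|F (p, t)|)).
      by apply: measurableT_comp => //; exact: measurable_slice2.
    move=> x _; rewrite /J /=.
    case: (ltP t T) => tT /=; last by rewrite mul0r normr0 integral_ge0.
    have L1x := J_L1x (p := (x, t)) hc (ltW tT).
    rewrite mul1r; apply: (@le_trans _ _ (\int[leb]_s `|(0 < s < t)%R%:R * h (x, s)|)%:E).
      by rewrite lee_fin; exact: le_norm_int.
    rewrite EFin_int; last exact: L1_norm.
    apply: ge0_le_integral => //.
    - by apply/measurable_EFinP; apply: measurableT_comp => //; exact: L1_measurable L1x.
    - apply/measurable_EFinP; apply: measurableT_comp => //.
      apply: (measurableT_comp mF).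
      by apply: measurable_fun_pair => //; exact: measurable_fun_pair.
    by move=> s _; rewrite lee_fin /F /= tT mulr1 mulrC.
  rewrite -(@tonelli2 _ _ _ _ _ _ _ (fun p => `|F p|))//; first exact: L1_lty.
  exact: measurableT_comp.
rewrite (intX2 J1); apply: eq_Rintegral => t _.
have F1t : L1 lebQ (fun p => F (p, t)).
  apply: (@L1Ml _ _ _ _ _ _ 1) => //.
  - rewrite /=; apply: measurable_funM => //.
    by apply: measurable_boolR; apply: measurable_itvb.
  by move=> p; case: (_ < _ < _); case: (_ < _); rewrite /= ?(mul0r,mulr0,mulr1) ?normr0 ?normr1.
rewrite (intX1 F1t); apply: eq_Rintegral => x _; rewrite /J /= /F /=.
case: (ltP t T) => tT /=.
  by rewrite mul1r; apply: eq_Rintegral => s _; rewrite mulr1 mulrC.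
by rewrite mul0r; under eq_Rintegral do rewrite !mulr0; rewrite int0.
Qed.

End time_integral.

(** * Space translations acting on space-time *)

Section shiftX.
Variables (R : realType) (N : nat).
Local Notation V := 'rV[R]_N.

Definition shX (y : V) (p : V * R) : V * R := (p.1 + y, p.2).

Lemma measurable_shX : measurable_fun [set: V * (V * R)] (fun q => shX q.1 q.2).
Proof.
apply: measurable_fun_pair; last exact: (measurableT_comp measurable_snd measurable_snd).
by apply: measurable_addv => //; exact: (measurableT_comp measurable_fst measurable_snd).
Qed.

Lemma mpres_shX y : mpres (lebX R N) (lebX R N) (shX y).
Proof. exact: (mpres_shiftX (lebR R) y). Qed.

Lemma shXK y p : shX y (shX (- y) p) = p.
Proof. by case: p => x t; rewrite /shX /= subrK. Qed.

Lemma shXC y z p : shX y (shX z p) = shX z (shX y p).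
Proof. by rewrite /shX /= addrAC. Qed.

End shiftX.
#[global] Hint Resolve measurable_shX mpres_shX shXK shXC : core.

Section cv_time.
Variables (R : realType) (N : nat) (T : R).
Local Notation V := 'rV[R]_N.
Implicit Types (f g : V * R -> R).
Variables (m : {sigma_finite_measure set V -> \bar R}) (rho : V -> R).
Hypothesis mrho : kern m rho.
Local Notation K := (cv (@shX R N) m rho).
Hypothesis T0 : 0 < T.

Lemma cv_timeM c (a : R -> R) f p : bm c f -> K (fun p => a p.2 * f p) p = a p.2 * K f p.
Proof.
move=> fc; rewrite /cv -intZ; last exact: (cv_L1y _ mrho _ fc).
by apply: eq_Rintegral => y _; rewrite mulrCA.
Qed.

Lemma cv_J c g p : bm c g -> K (J T g) p = J T (K g) p.
Proof.
move=> gc; have [mg gb] := gc; case: p => x t; rewrite /cv /J /=.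
case: (ltP t T) => tT /=; last first.
  by under eq_Rintegral do rewrite mul0r mulr0; rewrite int0 mul0r.
rewrite mul1r.
have [r0 r1 _ _] := mrho; have mr := L1_measurable r1.
pose F (q : V * R) : R := rho q.1 * ((0 < q.2 < t)%R%:R * g (x + q.1, q.2)).
have mF : measurable_fun [set: V * R] F.
  apply: measurable_funM; first exact: measurableT_comp.
  apply: measurable_funM.
    by apply: measurable_boolR; apply: measurable_itvb.
  apply: (measurableT_comp mg); apply: measurable_fun_pair => //.
  exact: measurable_addv.
have F1 : L1 (m \x lebR R)%E F.
  apply: (L1_le mF (L1_tensor (g := fun s : R => (0 < s < t)%R%:R * c) r1 _)).
    by apply: (@L1Ml _ _ _ _ _ _ `|c|) => //; exact: itvb_L1.
  move=> q; rewrite /F !normrM ger0_norm// ler_wpM2l//.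
  by rewrite ger0_norm// ler_wpM2l.
transitivity (\int[m]_y \int[lebR R]_s F (y, s)).
  apply: eq_Rintegral => y _; rewrite mul1r /prim -intZ//.
  exact: (J_L1x (T := T) (p := (x + y, t)) gc (ltW tT)).
rewrite (int_fubini F1); apply: eq_Rintegral => s _.
rewrite -intZ; last exact: (cv_L1y _ mrho (x, s) gc).
by apply: eq_Rintegral => y _; rewrite /F /= mulrCA.
Qed.

End cv_time.

(* truncated Neumann series of (de - L)^-1, where L = K - la is the operator of
   the finite measure nu of mass la and K the sum over the jumps *)
Section resolvent.
Variables (R : realType) (N : nat).
Local Notation V := 'rV[R]_N.
Local Notation M := (lebX R N).
Implicit Types (f g : V * R -> R).
Variables (nu : {sigma_finite_measure set V -> \bar R}).
Hypothesis knu : kern nu (fun=> 1).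
Local Notation K := (cv (@shX R N) nu (fun=> 1)).
Let la : R := \int[nu]_y 1.
Variable de : R.
Hypothesis de0 : 0 < de.
Let ka : R := (la + de)^-1.

Let la0 : 0 <= la. Proof. exact: (mass_ge0 knu). Qed.
Let lade0 : 0 < la + de. Proof. by rewrite ltr_wpDl. Qed.
Let ka0 : 0 < ka. Proof. by rewrite invr_gt0. Qed.

Fixpoint neumann (k : nat) f : V * R -> R :=
  if k is k'.+1 then fun p => ka * (f p + K (neumann k' f) p) else fun=> 0.

Definition residual k f p := f p - (la + de) * neumann k f p + K (neumann k f) p.

Lemma neumann_bm k c f : bm c f -> bm (c / de) (neumann k f).
Proof.
move=> fc; elim: k => [|k ih] /=.
  split => // p; rewrite normr0; apply: divr_ge0; first exact: bm_ge0 p fc.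
  exact: ltW.
have h := bmZ ka (bmD fc (cv_bm (@measurable_shX R N) knu ih)).
(* The bound c / de is the fixed point of x -> (c + la * x) / (la + de), the recursion obeyed by the
   sup norms. *)
apply: bm_le h; rewrite gtr0_norm// /ka -/la le_eqVlt; apply/orP; left; apply/eqP.
by field; rewrite !gt_eqF.
Qed.

Let mX := @measurable_shX R N.
Let pX := @mpres_shX R N.

Lemma neumann_L1 k c f : bm c f -> L1 M f ->
  L1 M (neumann k f) /\ \int[M]_p `|neumann k f p| <= (\int[M]_p `|f p|) / de.
Proof.
move=> fc f1; elim: k => [|k [ih1 ih2]] /=.
  split => //; under eq_Rintegral do rewrite normr0; rewrite int0 divr_ge0//.
    exact: int_ge0.
  exact: ltW.
have K1 := cv_L1 mX pX knu ih1.
split; first exact/L1Z/L1D.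
apply: (@le_trans _ _ (ka * (\int[M]_p `|f p| + la * \int[M]_p `|neumann k f p|))).
  apply: (@le_trans _ _ (ka * (\int[M]_p `|f p| + \int[M]_p `|K (neumann k f) p|))); last first.
    rewrite ler_pM2l// lerD2l.
    exact: (cv_L1_le mX pX (@shXK R N) knu (neumann_bm k fc) ih1).
  rewrite -intD; [|exact: L1_norm|exact: L1_norm].
  rewrite -intZ; last by apply: L1D; exact: L1_norm.
  apply: le_int; [exact/L1_norm/L1Z/L1D|by apply/L1Z/L1D; exact: L1_norm|].
  by move=> p; rewrite normrM gtr0_norm// ler_pM2l// ler_normD.
apply: (@le_trans _ _ (ka * (\int[M]_p `|f p| + la * ((\int[M]_p `|f p|) / de)))).
  by rewrite ler_pM2l// lerD2l ler_wpM2l.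
by rewrite le_eqVlt; apply/orP; left; apply/eqP; rewrite /ka; field; rewrite !gt_eqF.
Qed.

Lemma neumann_cv k c f p : bm c f -> neumann k (K f) p = K (neumann k f) p.
Proof.
move=> fc; elim: k p => [|k ih] p /=; first by rewrite (cv_cst _ knu) mulr0.
have nc := neumann_bm k fc; have Knc := cv_bm mX knu nc.
rewrite (cvZ mX knu _ p (bmD fc Knc)) (cvD mX knu p fc Knc); congr (_ * (_ + _)).
by congr (cv _ _ _ _ p); apply/funext => p'; rewrite ih.
Qed.

Lemma neumann_sym k a b f g : bm a f -> bm b g -> L1 M f ->
  \int[M]_p (f p * neumann k g p) = \int[M]_p (neumann k f p * g p).
Proof.
move=> + gb; elim: k a f => [|k ih] a f fa f1 /=.
  by under eq_Rintegral do rewrite mulr0; under [RHS]eq_Rintegral do rewrite mul0r.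
have nf := neumann_bm k fa; have ng := neumann_bm k gb.
have Knf := cv_bm mX knu nf; have Kng := cv_bm mX knu ng.
have [nf1 _] := neumann_L1 k fa f1; have Knf1 := cv_L1 mX pX knu nf1.
have Kf1 := cv_L1 mX pX knu f1; have Kfa := cv_bm mX knu fa.
transitivity (ka * (\int[M]_p (f p * g p) + \int[M]_p (f p * K (neumann k g) p))).
  rewrite -intD; [|exact: L1_bm f1 gb|exact: L1_bm f1 Kng].
  rewrite -intZ; last by apply: L1D; [exact: L1_bm f1 gb|exact: L1_bm f1 Kng].
  by apply: eq_Rintegral => p _; ring.
rewrite (cv_sym mX pX (@shXK R N) knu fa ng f1) (ih _ _ Kfa Kf1).
under [X in _ + X]eq_Rintegral do rewrite (neumann_cv k _ fa).
rewrite -intD; [|exact: L1_bm f1 gb|exact: L1_bm Knf1 gb].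
rewrite -intZ; last by apply: L1D; [exact: L1_bm f1 gb|exact: L1_bm Knf1 gb].
by apply: eq_Rintegral => p _; ring.
Qed.

Lemma neumann_J T k c g p : 0 < T -> bm c g -> neumann k (J T g) p = J T (neumann k g) p.
Proof.
move=> T0 gc; elim: k p => [|k ih] p /=.
  by rewrite /J /prim; under eq_Rintegral do rewrite mulr0; rewrite int0 mulr0.
have ng := neumann_bm k gc; have Kng := cv_bm mX knu ng.
rewrite (JZ T _ p (bmD gc Kng)) (JD T p gc Kng); congr (_ * (_ + _)).
rewrite -(cv_J T knu p ng); congr (cv _ _ _ _ p).
by apply/funext => p'; rewrite ih.
Qed.

Lemma neumann_timeM k c (a : R -> R) f p : bm c f ->
  neumann k (fun p => a p.2 * f p) p = a p.2 * neumann k f p.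
Proof.
move=> fc; elim: k p => [|k ih] p /=; first by rewrite mulr0.
rewrite [RHS]mulrCA [in RHS]mulrDr; congr (_ * (_ + _)).
rewrite -(cv_timeM knu a p (neumann_bm k fc)); congr (cv _ _ _ _ p).
by apply/funext => p'; rewrite ih.
Qed.

Lemma residual0 f : residual 0 f = f.
Proof. by apply/funext => p; rewrite /residual /= mulr0 subr0 (cv_cst _ knu) mulr0 addr0. Qed.

Lemma residual_bm k c f : bm c f -> exists c', bm c' (residual k f).
Proof.
move=> fc; have nc := neumann_bm k fc; eexists.
exact: bmD (bmB fc (bmZ (la + de) nc)) (cv_bm mX knu nc).
Qed.

(** The recursion makes the residual equal to [la + de] times the next increment of the series, and
    the next residual is [K] of that increment. Its L^1 norm therefore shrinks by the factor la /
    (la + de) < 1. *)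
Lemma residualS k c f : bm c f -> residual k.+1 f = fun p => ka * K (residual k f) p.
Proof.
move=> fc; have nc := neumann_bm k fc; have Knc := cv_bm mX knu nc.
have nc' := neumann_bm k.+1 fc.
apply/funext => p; rewrite /residual [in RHS](_ : (fun p => _) =
   fun p => (la + de) * (neumann k.+1 f p - neumann k f p)); last first.
  apply/funext => p' /=; rewrite /ka; field; rewrite gt_eqF//.
rewrite (cvZ mX knu _ p (bmB nc' nc)) (cvB mX knu p nc' nc).
rewrite /= /ka; field; rewrite gt_eqF//.
Qed.

Lemma residual_L1 k c f : bm c f -> L1 M f ->
  L1 M (residual k f) /\ \int[M]_p `|residual k f p| <= (la * ka) ^+ k * \int[M]_p `|f p|.
Proof.
move=> fc f1; elim: k => [|k [ih1 ih2]]; first by rewrite residual0 expr0 mul1r.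
have [c' rc] := residual_bm k fc.
rewrite (residualS k fc); split; first exact/L1Z/(cv_L1 mX pX knu).
under eq_Rintegral do rewrite normrM (gtr0_norm ka0).
rewrite intZ; last exact/L1_norm/(cv_L1 mX pX knu).
rewrite exprS (_ : la * ka * _ * _ =
  ka * (la * ((la * ka) ^+ k * \int[M]_p `|f p|))); last by ring.
rewrite ler_pM2l//; apply: le_trans (cv_L1_le mX pX (@shXK R N) knu rc ih1) _.
by rewrite ler_wpM2l.
Qed.

(* (de - L) neumann = id - residual, tested against neumann: the form
   <f, neumann f> is coercive up to the residual. *)
Lemma neumann_coercive k c f : bm c f -> L1 M f ->
  de * \int[M]_p (neumann k f p ^+ 2) <= \int[M]_p (f p * neumann k f p) +
    c / de * \int[M]_p `|residual k f p|.
Proof.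
move=> fc f1; have nc := neumann_bm k fc; have Knc := cv_bm mX knu nc.
have [n1 _] := neumann_L1 k fc f1; have [r1 _] := residual_L1 k fc f1.
have Kn1 := cv_L1 mX pX knu n1.
set v := neumann k f; set r := residual k f.
have v2 : L1 M (fun p => v p ^+ 2) by exact: (L1_bm n1 nc).
have vv : bm (c / de * (c / de)) (fun p => v p ^+ 2) by exact: (bmM nc nc).
have L1fv : L1 M (fun p => f p * v p) by exact: (L1_bm f1 nc).
have L1rv : L1 M (fun p => r p * v p) by exact: (L1_bm r1 nc).
have L1Kv : L1 M (fun p => K v p * v p) by exact: (L1_bm Kn1 nc).
have e : \int[M]_p (f p * v p) = (la + de) * \int[M]_p (v p ^+ 2) -
    \int[M]_p (K v p * v p) + \int[M]_p (r p * v p).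
  rewrite -intZ// -intB//; last exact: L1Z.
  rewrite -intD//; last by apply: L1B => //; exact: L1Z.
  by apply: eq_Rintegral => p _; rewrite /r /residual -/v; ring.
(* AM-GM with parameter 2, together with conservation of mass under [K]: this is the nonnegativity
   of the quadratic form of -L. *)
have h1 : \int[M]_p (K v p * v p) <= la * \int[M]_p (v p ^+ 2).
  have K2 := cv_L1 mX pX knu v2.
  apply: (@le_trans _ _ (\int[M]_p (2 / 4 * K (fun p => v p ^+ 2) p + la * (v p ^+ 2 / 2)))).
    apply: le_int => //; first by apply: L1D; apply: L1Z => //; exact: L1Zr.
    by move=> p; apply: (cv_amgm (@measurable_shX R N) knu p _ nc nc); rewrite ltr0n.
  rewrite intD; [|exact: L1Z|by apply: L1Z; exact: L1Zr].
  rewrite !intZ//; last exact: L1Zr.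
  rewrite (int_cv mX pX (@shXK R N) knu vv v2) int_Zr// -/la.
  by rewrite le_eqVlt; apply/orP; left; apply/eqP; field.
have h2 : - (c / de * \int[M]_p `|r p|) <= \int[M]_p (r p * v p).
  rewrite lerNl -intN// -intZ; last exact: L1_norm.
  apply: le_int; [exact: L1N|exact/L1Z/L1_norm|].
  move=> p; rewrite (le_trans (ler_norm _))// normrN normrM mulrC ler_wpM2r//.
  by case: nc.
rewrite e; lra.
Qed.

End resolvent.

(** Removes the truncation of the Neumann series, whose order k enters the estimates only through a
    geometric error. *)
Lemma le_geometric_eps (R : realType) (x a c q : R) : 0 <= q < 1 ->
  (forall k, x <= a + c * q ^+ k) -> x <= a.
Proof.
move=> /andP[q0 q1] h; rewrite leNgt; apply/negP => ax.
have cq : (fun k => a + c * q ^+ k) @ \oo --> a.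
  rewrite -[X in _ --> X]addr0 -[X in _ --> _ + X](mulr0 c).
  apply: cvgD; first exact: cvg_cst.
  by apply: cvgM; [exact: cvg_cst|apply: cvg_expr; rewrite ger0_norm].
suff : x <= a by rewrite leNgt ax.
apply: (ler_cvg_to (cvg_cst x) cq); exact: nearW.
Qed.

(** * The energy estimate for a finite jump measure *)

Section core.
Variables (R : realType) (N : nat).
Local Notation V := 'rV[R]_N.
Local Notation M := (lebX R N).
Variables (nu : {sigma_finite_measure set V -> \bar R}) (rho : V -> R).
Hypothesis knu : kern nu (fun=> 1).
Hypothesis krho : kern (lebesgue_rV R N) rho.
Hypothesis rho1 : \int[lebesgue_rV R N]_y rho y = 1.
Local Notation K := (cv (@shX R N) nu (fun=> 1)).
Local Notation S := (cv (@shX R N) (lebesgue_rV R N) rho).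
Let la : R := \int[nu]_y 1.
Let mX := @measurable_shX R N.
Let pX := @mpres_shX R N.
Let kX := @shXK R N.
Variables (T Z0 kappa s eps : R) (z w W r : V * R -> R).
Hypotheses (T0 : 0 < T) (Z00 : 0 < Z0) (s0 : 0 < s) (ka0 : 0 <= kappa).
Hypotheses (zb : bm Z0 z) (rb : bm eps r) (w1 : L1 M w) (W1 : L1 M W).
Hypothesis zw0 : forall p, 0 <= z p * w p.
Hypothesis zs : forall p, `|z p| <= kappa \/ s * `|z p| <= z p * w p.
Hypothesis WE : W = J T (fun p => K (S z) p - la * S z p + r p).

(* Test the equation of W against the resolvent v of W: the elliptic part
   gives - z W + de * z v; the part of z above the level kappa is absorbed by
   the coercivity of <W, v>, the rest is O(kappa). *)
Lemma core_estimate :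
  \int[M]_p (weight T p * (z p * w p)) <=
  2 * T * (Z0 * \int[M]_p `|S W p - w p| +
           (kappa + eps * T * Z0 / s) * \int[M]_p `|W p|).
Proof.
(* With this value the bound of the term in z v contains exactly (de / 2) times the integral of v^2.
   The energy identity doubles it, and it cancels the left-hand side of the coercivity estimate. *)
pose de := s / (T * Z0).
have de0 : 0 < de by rewrite divr_gt0 ?mulr_gt0.
have la0 : 0 <= la by exact: (mass_ge0 knu).
have [mz _] := zb; have mw := L1_measurable w1.
have Sz : bm Z0 (S z).
  by have := cv_bm mX krho zb; rewrite rho1 mul1r.
have KSz := cv_bm mX knu Sz.
have [c0 gb] : exists c, bm c (fun p => K (S z) p - la * S z p + r p).
  by eexists; exact: bmD (bmB KSz (bmZ la Sz)) rb.
have WE' := WE; set g := fun p => _ in WE' gb.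
have Wb : bm (T * c0) W by rewrite WE'; exact: J_bm.
set c := T * c0 in Wb.
have wt := weight_bm N T0; have wt0 := @weight_ge0 _ N T.
set A := \int[M]_p _; set n1 := \int[M]_p `|W p|; set n2 := \int[M]_p `|_ - _|.
have n10 : 0 <= n1 by exact: int_ge0.
have SW1 : L1 M (S W) by exact: (cv_L1 mX pX krho W1).
have D1 : L1 M (fun p => S W p - w p) by exact: L1B.
pose q := la * (la + de)^-1.
have q01 : 0 <= q < 1.
  rewrite /q divr_ge0 ?addr_ge0 ?(ltW de0)//= ltr_pdivrMr ?ltr_wpDl// mul1r ltrDl//.
apply: (@le_geometric_eps _ _ _ ((c / de + 2 * T * Z0) * n1) q q01) => k.
pose v := neumann nu de k W; pose e := residual nu de k W.
have vb : bm (c / de) v by exact: neumann_bm.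
have [v1 vn] : L1 M v /\ \int[M]_p `|v p| <= n1 / de by exact: neumann_L1 Wb W1.
have [e1 en] : L1 M e /\ \int[M]_p `|e p| <= q ^+ k * n1 by exact: residual_L1 Wb W1.
have [ce eb] : exists c', bm c' e by exact: residual_bm Wb.
have coer : de * \int[M]_p (v p ^+ 2) <= \int[M]_p (W p * v p) + c / de * \int[M]_p `|e p|.
  exact: neumann_coercive Wb W1.
have gv1 : L1 M (fun p => g p * v p) by exact: bm_L1 gb v1.
have wv1 : L1 M (fun p => weight T p * v p) by exact: bm_L1 wt v1.
have wvb : bm (T * (c / de)) (fun p => weight T p * v p) by exact: bmM wt vb.
(* the energy identity *)
have energy : \int[M]_p (W p * v p) = 2 * \int[M]_p (weight T p * (g p * v p)).
  have ng := neumann_bm knu de0 k gb.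
  have vE : v = J T (neumann nu de k g).
    by apply/funext => p; rewrite /v WE' (neumann_J knu de0 k p T0 gb).
  have hb : bm (c0 * (c / de) + c * (c0 / de)) (fun p => g p * v p + W p * neumann nu de k g p).
    exact: bmD (bmM gb vb) (bmM Wb ng).
  have Wn1 : L1 M (fun p => W p * neumann nu de k g p) by exact: L1_bm W1 ng.
  transitivity (\int[M]_p (J T (fun p => g p * v p + W p * neumann nu de k g p) p)).
    apply: eq_Rintegral => p _.
    by have := J_mul T p gb ng; rewrite -vE -WE'.
  rewrite (int_J T hb (L1D gv1 Wn1)).
  transitivity (\int[M]_p (weight T p * (g p * v p) + (weight T p * W p) * neumann nu de k g p)).
    by apply: eq_Rintegral => p _; ring.
  rewrite intD; [|exact: bm_L1 wt gv1|exact: L1_bm (bm_L1 wt W1) ng].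
  (* The truncated resolvent is symmetric and commutes with factors depending on time only, so the
     two terms of the product rule have the same integral; hence the factor 2. *)
  rewrite (neumann_sym knu de0 k (bmM wt Wb) gb (bm_L1 wt W1)).
  rewrite [X in _ + X](_ : _ = \int[M]_p (weight T p * (g p * v p))); first by ring.
  apply: eq_Rintegral => p _.
  by rewrite (neumann_timeM knu de0 k (fun t => (0 < t < T)%R%:R * (T - t)) p Wb) /weight /v; ring.
(* the part of z above the level kappa *)
pose hi p := (kappa < `|z p|)%R%:R * z p.
have hib : bm Z0 hi.
  split.
    apply: measurable_funM => //; apply: measurable_boolR.
    by apply: measurable_fun_ltr => //; exact: measurableT_comp.
  move=> p; rewrite /hi normrM; case: ltP => _; rewrite ?normr1 ?normr0 ?mul1r ?mul0r.
    by case: zb.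
  exact: ltW.
(* Above the level kappa, |z|^2 <= Z0 |z| <= (Z0 / s) z w. This makes [hi] square integrable,
   although z itself is only bounded. *)
have hiw p : hi p ^+ 2 <= Z0 / s * (z p * w p).
  rewrite /hi; case: ltP => h; rewrite /= ?mul1r ?mul0r; last first.
    by rewrite expr0n /= mulr_ge0// divr_ge0 ?ltW.
  case: (zs p) => [|hs]; first by rewrite leNgt h.
  rewrite (_ : Z0 / s * _ = Z0 * (z p * w p) / s); last by ring.
  rewrite ler_pdivlMr// -(real_normK (num_real _)).
  apply: (@le_trans _ _ (Z0 * (s * `|z p|))); last by rewrite ler_pM2l.
  rewrite (_ : _ * s = `|z p| * (s * `|z p|)); last by ring.
  by rewrite ler_wpM2r ?mulr_ge0 ?(ltW s0)//; case: zb.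
have zw1 : L1 M (fun p => z p * w p) by exact: bm_L1 zb w1.
have hi2 : L1 M (fun p => hi p ^+ 2).
  apply: (L1_le _ (L1Z (Z0 / s) zw1)) => [|p].
    by apply: measurable_funX; case: hib.
  by rewrite ger0_norm ?sqr_ge0.
have hi2b : bm (Z0 * Z0) (fun p => hi p ^+ 2) by exact: (bmM hib hib).
have lob : bm kappa (fun p => z p - hi p).
  split; first by apply: measurable_funB => //; case: hib.
  by move=> p; rewrite /hi; case: leP => h /=; rewrite ?mul0r ?subr0 ?mul1r ?subrr ?normr0.
have Slo : bm kappa (S (fun p => z p - hi p)).
  by have := cv_bm mX krho lob; rewrite rho1 mul1r.
have v2 : L1 M (fun p => v p ^+ 2) by exact: (L1_bm v1 vb).
have Shi2 : L1 M (S (fun p => hi p ^+ 2)) by exact: (cv_L1 mX pX krho hi2).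
(* The AM-GM parameter for which the part [hi] contributes at most A / 2; the cost de * T / th in
   front of v^2 is then de / 2 by the choice of [de]. *)
pose th := 2 * s / (de * Z0).
have th0 : 0 < th by apply: divr_gt0; apply: mulr_gt0 => //; rewrite ltr0n.
(* - z W + de z v *)
have bound_zv : \int[M]_p (weight T p * (de * (S z p * v p))) <=
    A / 2 + de / 2 * \int[M]_p (v p ^+ 2) + T * (kappa * n1).
  have Sh1 : L1 M (fun p => weight T p * (Z0 / s * (z p * w p))) by exact/(bm_L1 wt)/L1Z.
  pose G p := de * (th / 4) * (weight T p * S (fun p => hi p ^+ 2) p) +
      (de * T / th) * v p ^+ 2 + T * de * kappa * `|v p|.
  have G1 : L1 M G.
    apply: L1D; last exact/L1Z/L1_norm.
    by apply: L1D; apply: L1Z => //; exact: bm_L1 wt Shi2.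
  apply: (@le_trans _ _ (\int[M]_p G p)).
    apply: le_int => //; first exact/(bm_L1 wt)/L1Z/(bm_L1 Sz).
    move=> p; rewrite /G.
    have -> : S z p = S hi p + S (fun p => z p - hi p) p.
      rewrite -(cvD mX krho p hib lob); congr (cv _ _ _ _ p).
      by apply/funext => p'; ring.
    have h1 := cv_amgm mX krho p th0 hib vb.
    rewrite rho1 mul1r in h1.
    have h2 : S (fun p => z p - hi p) p * v p <= kappa * `|v p|.
      by rewrite (le_trans (ler_norm _))// normrM ler_wpM2r//; case: Slo.
    have wp0 := wt0 p.
    have wT : weight T p <= T by rewrite (le_trans (ler_norm _))//; case: wt.
    have h3 : weight T p * (de * (S hi p * v p)) <=
        weight T p * (de * (th / 4 * S (fun p => hi p ^+ 2) p)) + de * T / th * v p ^+ 2.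
      apply: (@le_trans _ _ (weight T p * (de * (th / 4 * S (fun p => hi p ^+ 2) p + v p ^+ 2 / th)))).
        by rewrite ler_wpM2l// ler_pM2l.
      rewrite !mulrDr lerD2l.
      rewrite [leRHS](_ : _ = T * (de * (v p ^+ 2 / th))); last by field; rewrite gt_eqF.
      by rewrite ler_wpM2r// mulr_ge0 ?(ltW de0)// divr_ge0 ?sqr_ge0 ?ltW.
    have h4 : weight T p * (de * (S (fun p => z p - hi p) p * v p)) <= T * de * kappa * `|v p|.
      apply: (@le_trans _ _ (weight T p * (de * (kappa * `|v p|)))).
        by rewrite ler_wpM2l// ler_pM2l.
      rewrite [leRHS](_ : _ = T * (de * (kappa * `|v p|))); last by ring.
      apply: ler_wpM2r => //; apply: mulr_ge0; first exact: ltW.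
      exact: mulr_ge0.
    rewrite mulrDl !mulrDr; lra.
  rewrite /G intD; [|by apply: L1D; apply: L1Z => //; exact: bm_L1 wt Shi2|exact/L1Z/L1_norm].
  rewrite intD; [|by apply: L1Z; exact: bm_L1 wt Shi2|exact: L1Z].
  rewrite !intZ//; [|exact: L1_norm|exact: bm_L1 wt Shi2].
  have e3 : \int[M]_p (weight T p * S (fun p => hi p ^+ 2) p) = \int[M]_p (weight T p * hi p ^+ 2).
    have wh1 : L1 M (fun p => weight T p * hi p ^+ 2) by exact: bm_L1 wt hi2.
    rewrite -[RHS]mul1r -rho1 -(int_cv mX pX kX krho (bmM wt hi2b) wh1).
    apply: eq_Rintegral => p _.
    by rewrite -(cv_timeM krho (fun t => (0 < t < T)%R%:R * (T - t)) p hi2b).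
  have e4 : \int[M]_p (weight T p * hi p ^+ 2) <= Z0 / s * A.
    rewrite /A -intZ; last exact: bm_L1 wt zw1.
    apply: le_int; [exact: bm_L1 wt hi2|exact/L1Z/(bm_L1 wt)|].
    by move=> p; rewrite [leRHS]mulrCA ler_wpM2l.
  rewrite e3.
  have e5 : de * (th / 4) * \int[M]_p (weight T p * hi p ^+ 2) <= A / 2.
    apply: (@le_trans _ _ (de * (th / 4) * (Z0 / s * A))).
      apply: ler_wpM2l => //; apply: mulr_ge0; first exact: ltW.
      by apply: divr_ge0 => //; exact: ltW.
    by rewrite le_eqVlt /th; apply/orP; left; apply/eqP; field; rewrite !gt_eqF.
  have e6 : de * T / th = de / 2.
    by rewrite /th /de; field; rewrite !gt_eqF.
  have e7 : T * de * kappa * \int[M]_p `|v p| <= T * (kappa * n1).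
    apply: (@le_trans _ _ (T * de * kappa * (n1 / de))).
      apply: ler_wpM2l => //; apply: mulr_ge0 => //; apply: mulr_ge0; exact: ltW.
    by rewrite le_eqVlt; apply/orP; left; apply/eqP; field; rewrite gt_eqF.
  by rewrite e6; lra.
(* The mollifier is moved from z to W, and S W is then replaced by w at the price of n2. *)
have bound_zW : - (\int[M]_p (weight T p * (S z p * W p))) <= - A + T * (Z0 * n2).
  have wW1 : L1 M (fun p => weight T p * W p) by exact: bm_L1 wt W1.
  have -> : \int[M]_p (weight T p * (S z p * W p)) = \int[M]_p (weight T p * (z p * S W p)).
    transitivity (\int[M]_p ((weight T p * W p) * S z p)).
      by apply: eq_Rintegral => p _; ring.
    rewrite (cv_sym mX pX kX krho (bmM wt Wb) zb wW1); apply: eq_Rintegral => p _.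
    rewrite (cv_timeM krho (fun t => (0 < t < T)%R%:R * (T - t)) p Wb) /weight; ring.
  suff h : A - \int[M]_p (weight T p * (z p * S W p)) <= T * (Z0 * n2) by rewrite -(lerD2l A) addNKr.
  rewrite /A -intB; [|exact: bm_L1 wt zw1|exact/(bm_L1 wt)/(bm_L1 zb)].
  rewrite /n2 mulrA -intZ; last exact: L1_norm.
  apply: le_int; [|exact/L1Z/L1_norm|].
    by apply: L1B; [exact: bm_L1 wt zw1|exact/(bm_L1 wt)/(bm_L1 zb)].
  move=> p; rewrite -!mulrBr (le_trans (ler_norm _))// !normrM [leLHS]mulrA (distrC (w p)) ler_wpM2r//.
  by apply: ler_pM => //; [rewrite -normrM; exact: (proj2 wt p)|exact: (proj2 zb)].
have bound_ze : \int[M]_p (weight T p * (S z p * e p)) <= T * Z0 * (q ^+ k * n1).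
  apply: (@le_trans _ _ (T * Z0 * \int[M]_p `|e p|)); last first.
    by apply: ler_wpM2l => //; apply: mulr_ge0; exact: ltW.
  rewrite -intZ; last exact: L1_norm.
  apply: le_int; [exact/(bm_L1 wt)/(bm_L1 Sz)|exact/L1Z/L1_norm|].
  move=> p; rewrite (le_trans (ler_norm _))// !normrM [leLHS]mulrA ler_wpM2r//.
  by apply: ler_pM => //; [rewrite -normrM; exact: (proj2 wt p)|exact: (proj2 Sz)].
have bound_rv : \int[M]_p (weight T p * (r p * v p)) <= T * eps * (n1 / de).
  have eps0 := bm_ge0 ((0, 0) : V * R) rb.
  apply: (@le_trans _ _ (T * eps * \int[M]_p `|v p|)); last first.
    by apply: ler_wpM2l => //; apply: mulr_ge0 => //; exact: ltW.
  rewrite -intZ; last exact: L1_norm.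
  apply: le_int; [exact/(bm_L1 wt)/(bm_L1 rb)|exact/L1Z/L1_norm|].
  move=> p; rewrite (le_trans (ler_norm _))// !normrM [leLHS]mulrA ler_wpM2r//.
  by apply: ler_pM => //; [rewrite -normrM; exact: (proj2 wt p)|exact: (proj2 rb)].
(* splitting of \int weight g v *)
have split_g : \int[M]_p (weight T p * (g p * v p)) =
    \int[M]_p (weight T p * (de * (S z p * v p))) -
    \int[M]_p (weight T p * (S z p * W p)) +
    \int[M]_p (weight T p * (S z p * e p)) + \int[M]_p (weight T p * (r p * v p)).
  have K1 : L1 M (K v) by exact: (cv_L1 mX pX knu v1).
  have L1a : L1 M (fun p => weight T p * (de * (S z p * v p))) by exact/(bm_L1 wt)/L1Z/(bm_L1 Sz).
  have L1b : L1 M (fun p => weight T p * (S z p * W p)) by exact/(bm_L1 wt)/(bm_L1 Sz).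
  have L1c : L1 M (fun p => weight T p * (S z p * e p)) by exact/(bm_L1 wt)/(bm_L1 Sz).
  have L1d : L1 M (fun p => weight T p * (r p * v p)) by exact/(bm_L1 wt)/(bm_L1 rb).
  have L1e : L1 M (fun p => weight T p * (S z p * v p)) by exact/(bm_L1 wt)/(bm_L1 Sz).
  have L1f : L1 M (fun p => weight T p * (S z p * K v p)) by exact/(bm_L1 wt)/(bm_L1 Sz).
  have Kwv : \int[M]_p ((weight T p * v p) * K (S z) p) =
      \int[M]_p (weight T p * (S z p * K v p)).
    rewrite (cv_sym mX pX kX knu wvb Sz wv1); apply: eq_Rintegral => p _.
    rewrite (cv_timeM knu (fun t => (0 < t < T)%R%:R * (T - t)) p vb) /weight; ring.
  transitivity (\int[M]_p ((weight T p * v p) * K (S z) p) -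
     la * \int[M]_p (weight T p * (S z p * v p)) + \int[M]_p (weight T p * (r p * v p))).
    rewrite -intZ// -intB; [|exact: L1_bm wv1 KSz|exact: L1Z].
    rewrite -intD//; last by apply: L1B; [exact: L1_bm wv1 KSz|exact: L1Z].
    by apply: eq_Rintegral => p _; rewrite /g; ring.
  rewrite Kwv; congr (_ + _).
  rewrite -(intB L1a L1b) -(intD (L1B L1a L1b) L1c).
  rewrite -(intZ la L1e) -(intB L1f (L1Z la L1e)).
  by apply: eq_Rintegral => p _; rewrite /e /residual -/v -/la; ring.
have eps_eq : T * eps * (n1 / de) = T * (eps * T * Z0 / s * n1).
  by rewrite /de; field; rewrite !gt_eqF.
have cde : c / de * \int[M]_p `|e p| <= c / de * (q ^+ k * n1).
  apply: ler_wpM2l => //; apply: divr_ge0; last exact: ltW.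
  exact: bm_ge0 ((0, 0) : V * R) Wb.
rewrite eps_eq in bound_rv; rewrite energy split_g in coer.
move: bound_zv bound_zW bound_ze bound_rv coer cde; clear -de0.
set I1 := \int[M]_p _; set I2 := \int[M]_p _; set I3 := \int[M]_p _.
set I4 := \int[M]_p _; set I5 := \int[M]_p _; set I6 := \int[M]_p _.
set x := c / de; set y := q ^+ k; set o := _ / s.
lra.
Qed.

End core.

(** * Dominated convergence and measures of balls *)

Section dominated.
Context d (X : measurableType d) (R : realType) (m : {measure set X -> \bar R}).

Lemma dct_L1 (f_ : nat -> X -> R) (f g : X -> R) :
  (forall n, measurable_fun [set: X] (f_ n)) -> measurable_fun [set: X] f ->
  L1 m g -> (forall n x, `|f_ n x| <= g x) ->
  {ae m, forall x, f_ ^~ x @ \oo --> f x} ->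
  (fun n => \int[m]_x `|f_ n x - f x|) @ \oo --> (0 : R).
Proof.
move=> mf_ mf g1 fg cv.
have [| | | | |_ h _] := @dominated_convergence _ _ _ m setT measurableT
   (fun n => EFin \o f_ n) (EFin \o f) (EFin \o g).
- by move=> n; exact/measurable_EFinP.
- exact/measurable_EFinP.
- by apply: filterS cv => x cx _; apply: cvg_EFin => //; exact: nearW.
- exact: g1.
- by apply: aeW => x n _ /=; rewrite lee_fin.
exact: (fine_cvg h).
Qed.

End dominated.

Lemma cvg0_le (R : realType) (u : nat -> R) : u @ \oo --> (0 : R) ->
  forall e, 0 < e -> exists n, forall k, (n <= k)%N -> `|u k| <= e.
Proof.
move=> /cvgrPdist_le h e e0; have [n _ hn] := h e e0.
by exists n => k nk; have := hn k nk; rewrite /= sub0r normrN.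
Qed.

Section ball_measure.
Variables (R : realType) (N : nat).
Local Notation V := 'rV[R]_N.
Local Notation lebN := (lebesgue_rV R N).

Lemma box_fin (a b : 'I_N -> R) :
  (lebN [set x : V | forall i, (`]a i, b i[%classic : set R) (x 0%R i)] < +oo)%E.
Proof.
rewrite (@lebesgue_rV_box R N (fun i => `]a i, b i[%classic))//.
suff : (\prod_(i < N) lebesgue_measure (`]a i, b i[%classic : set R))%E \is a fin_num.
  by rewrite ge0_fin_numE// prode_ge0.
apply: (big_ind (fun x => x \is a fin_num)) => //.
  by move=> x y; exact: fin_numM.
move=> i _; rewrite lebesgue_measure_itv /= -EFinB; by case: ifP.
Qed.

Lemma ball_fin (x : V) k : (lebN (ball x k) < +oo)%E.
Proof.
have [k0|k0] := leP k 0; first rewrite (_ : ball x k = set0) ?measure0//.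
  by apply/seteqP; split => // y [+ _]; rewrite ltNge k0.
apply: (@le_lt_trans _ _ (lebN [set y : V | forall i, (`](x 0%R i - k)%R, (x 0%R i + k)%R[%classic : set R) (y 0%R i)])).
  apply: le_measure; rewrite ?inE.
  - by apply: open_measurable_rV; exact: ball_open.
  - rewrite (_ : [set y | _] = \bigcap_(i in [set: 'I_N])
      ((fun y : V => y 0 i) @^-1` `]x 0 i - k, x 0 i + k[%classic)); last first.
      by apply/seteqP; split => y h i => [_|]; exact: h.
    apply: fin_bigcap_measurable => // i _; rewrite -[X in measurable X]setTI.
    exact: measurable_coor.
  - by move=> y [_ h] i /=; have := h 0 i; rewrite /ball /= ltr_distlC in_itv.
exact: box_fin.
Qed.

Lemma ball_L1 (x : V) k : L1 lebN (\1_(ball x k) : V -> R).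
Proof.
apply: L1_indic; last exact: ball_fin.
by apply: open_measurable_rV; exact: ball_open.
Qed.

End ball_measure.

(** * Continuity of translations in L^1 *)

Section translation_continuity.
Variables (R : realType) (N : nat).
Local Notation V := 'rV[R]_N.
Local Notation lebN := (lebesgue_rV R N).
Implicit Type g : V -> R.

(** The functions satisfying this form a linear class, closed in L^1, which is enlarged from
    indicators of open sets until it contains every integrable function. *)
Definition tc g : Prop := L1 lebN g /\ forall e, 0 < e -> exists2 h, 0 < h &
  forall b : V, `|b| <= h -> \int[lebN]_x `|g (x + b) - g x| <= e.

Lemma L1_shiftV g b : L1 lebN g -> L1 lebN (fun x => g (x + b)).
Proof. exact: (mpres_L1 (mpres_shift b)). Qed.

Lemma int_shiftV g b : measurable_fun [set: V] g ->
  \int[lebN]_x g (x + b) = \int[lebN]_x g x.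
Proof. exact: (mpres_int (mpres_shift b)). Qed.

Lemma tc_dist g g' b e : L1 lebN g -> L1 lebN g' -> \int[lebN]_x `|g x - g' x| <= e ->
  \int[lebN]_x `|g (x + b) - g x| <= \int[lebN]_x `|g' (x + b) - g' x| + e + e.
Proof.
move=> g1 g1' ge.
have d1 : L1 lebN (fun x => `|g x - g' x|) by exact/L1_norm/L1B.
have d1b := L1_shiftV b d1.
have g1b := L1_shiftV b g1; have g1b' := L1_shiftV b g1'.
apply: (@le_trans _ _ (\int[lebN]_x `|g' (x + b) - g' x| +
   \int[lebN]_x `|g (x + b) - g' (x + b)| + \int[lebN]_x `|g x - g' x|)); last first.
  rewrite -!addrA lerD2l lerD//.
  by rewrite (int_shiftV (g := fun x => `|g x - g' x|))//; exact: L1_measurable d1.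
have t1 : L1 lebN (fun x => `|g' (x + b) - g' x|) by exact/L1_norm/L1B.
rewrite -(intD t1 d1b) -(intD (L1D t1 d1b) d1).
apply: le_int; [exact/L1_norm/L1B|by do 2 apply: L1D => //|].
move=> x; rewrite (_ : _ - _ = (g' (x + b) - g' x) + (g (x + b) - g' (x + b)) + (g' x - g x)).
  by rewrite (le_trans (ler_normD _ _))// distrC lerD2r ler_normD.
ring.
Qed.

Lemma tc_closed g : L1 lebN g ->
  (forall e, 0 < e -> exists2 g', tc g' & \int[lebN]_x `|g x - g' x| <= e) -> tc g.
Proof.
move=> g1 h; split => // e e0.
have e3 : 0 < e / 3 by rewrite divr_gt0.
have [g' [g1' tg'] gg'] := h _ e3.
have [h0 h00 hb] := tg' _ e3; exists h0 => // b bh.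
apply: (le_trans (tc_dist b g1 g1' gg')).
by have := hb b bh; lra.
Qed.

Lemma tcD g g' : tc g -> tc g' -> tc (fun x => g x + g' x).
Proof.
move=> [g1 tg] [g1' tg']; split; first exact: L1D.
move=> e e0; have e2 : 0 < e / 2 by rewrite divr_gt0.
have [h h0 hb] := tg _ e2; have [h' h0' hb'] := tg' _ e2.
exists (Num.min h h'); first by rewrite lt_min h0.
move=> b; rewrite le_min => /andP[bh bh'].
have t1 : L1 lebN (fun x => `|g (x + b) - g x|) by exact/L1_norm/L1B/g1/L1_shiftV.
have t1' : L1 lebN (fun x => `|g' (x + b) - g' x|) by exact/L1_norm/L1B/g1'/L1_shiftV.
apply: (@le_trans _ _ (\int[lebN]_x (`|g (x + b) - g x| + `|g' (x + b) - g' x|))).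
  apply: le_int; [|exact: L1D|].
    by apply/L1_norm/L1B; [apply: L1D; exact: L1_shiftV|exact: L1D].
  by move=> x; rewrite opprD addrACA ler_normD.
by rewrite intD//; have := hb b bh; have := hb' b bh'; lra.
Qed.

Lemma tcZ k g : tc g -> tc (fun x => k * g x).
Proof.
move=> [g1 tg]; split; first exact: L1Z.
move=> e e0; have e2 : 0 < e / (`|k| + 1) by rewrite divr_gt0// ltr_wpDl.
have [h h0 hb] := tg _ e2; exists h => // b bh.
have t1 : L1 lebN (fun x => `|g (x + b) - g x|) by exact/L1_norm/L1B/g1/L1_shiftV.
under eq_Rintegral do rewrite -mulrBr normrM.
rewrite intZ//; apply: (@le_trans _ _ ((`|k| + 1) * (e / (`|k| + 1)))).
  apply: ler_pM => //; [exact: int_ge0|by rewrite lerDl|exact: hb].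
by rewrite mulrC divfK// gt_eqF// ltr_wpDl.
Qed.

Lemma tc0 : tc (fun=> 0).
Proof.
split => // e e0; exists 1 => // b _.
by under eq_Rintegral do rewrite subrr normr0; rewrite int0 ltW.
Qed.

Lemma tc_sum (I : Type) (s : seq I) (F : I -> V -> R) : (forall i, tc (F i)) ->
  tc (fun x => \sum_(i <- s) F i x).
Proof.
move=> hF; elim: s => [|i s ih]; first by under eq_fun do rewrite big_nil; exact: tc0.
by under eq_fun do rewrite big_cons; exact: tcD.
Qed.

(* By translation invariance the L1 distance of 1_U and its translate is twice
   the integral of (1_U - 1_U(. + b))^+, which tends to 0 since U is open. *)
Lemma tc_open (U : set V) : open U -> (lebN U < +oo)%E -> tc \1_U.
Proof.
move=> oU Uoo; have mU : measurable U by exact: open_measurable_rV.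
have U1 : L1 lebN (\1_U : V -> R) by exact: L1_indic.
split => // e e0; apply: contrapT => H.
have /choice[b bP] : forall k : nat, exists b : V, `|b| <= k.+1%:R^-1 /\
    e < \int[lebN]_x `|\1_U (x + b) - \1_U x|.
  move=> k; apply: contrapT => Hk; apply: H; exists k.+1%:R^-1; first by rewrite invr_gt0.
  move=> b bk; rewrite leNgt; apply/negP => be; apply: Hk; by exists b.
pose u (k : nat) (x : V) : R := Num.max 0 (\1_U x - \1_U (x + b k)).
have mUb k : measurable_fun [set: V] (fun x : V => \1_U (x + b k) : R).
  by have /L1_measurable := L1_shiftV (b k) U1.
have u0 k x : 0 <= u k x by rewrite /u le_max lexx.
have uU k x : u k x <= \1_U x.
  rewrite /u ge_max; apply/andP; split; first by rewrite indicE.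
  by rewrite gerBl indicE.
have mu_ k : measurable_fun [set: V] (u k).
  by apply: measurable_maxr => //; exact: measurable_funB.
have cu : (fun k => \int[lebN]_x `|u k x - 0|) @ \oo --> (0 : R).
  apply: (dct_L1 (g := \1_U)) => //.
    by move=> n x; rewrite ger0_norm.
  apply: aeW => x.
  apply: cvg_near_cst.
  have [xU|xU] := boolP (x \in U); last first.
    apply: nearW => k; rewrite /u [\1_U x]indicE (negbTE xU) sub0r.
    by apply: max_l; rewrite oppr_le0 indicE.
  move: (xU); rewrite inE => /oU /nbhs_ballP[r /= r0 rU].
  have [n _ hn] := near_infty_natSinv_lt (PosNum r0).
  exists n => //= k nk; rewrite /u !indicE xU.
  rewrite (_ : x + b k \in U) ?subrr ?maxxx//.
  rewrite inE; apply: rU.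
  rewrite -ball_normE /ball_ /= opprD addrA subrr sub0r normrN.
  exact: le_lt_trans (bP k).1 (hn k nk).
have [n hn] := cvg0_le cu (e := e / 2) (divr_gt0 e0 (ltr0n _ 2)).
have := hn n (leqnn n); rewrite ger0_norm; last exact: int_ge0.
under eq_Rintegral do rewrite subr0 (ger0_norm (u0 _ _)).
move=> hu; have := (bP n).2; rewrite ltNge => /negP; apply.
have uL1 : L1 lebN (u n) by apply: (L1_le (mu_ n) U1) => x; rewrite ger0_norm.
have Ub1 := L1_shiftV (b n) U1.
rewrite (_ : \int[lebN]_x `|_| = \int[lebN]_x (2 * u n x + (\1_U (x + b n) - \1_U x))).
  rewrite intD; [|exact: L1Z|exact: L1B].
  rewrite intZ// intB// int_shiftV// subrr addr0; lra.
apply: eq_Rintegral => x _; rewrite /u.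
move: (\1_U x : R) (\1_U (x + b n) : R) => p q.
by case: (leP 0 (p - q)) => h; [rewrite ler0_norm|rewrite gtr0_norm]; lra.
Qed.

Let B (k : nat) : set V := ball 0 k.+1%:R.

Let mB k : measurable (B k).
Proof. by apply: open_measurable_rV; exact: ball_open. Qed.

(** Open sets are stable under intersection and generate the Borel sets, so Dynkin induction
    applies. The intersection with a ball keeps all measures finite: complements become differences
    and disjoint unions converge in L^1. *)
Lemma tc_setI_ball (A : set V) k : measurable A -> tc \1_(A `&` B k).
Proof.
rewrite measurable_rV_borel => mA; move: A mA k.
apply: dynkin_induction; first exact: measurable_rV_borel.
- by move=> U W; exact: openI.
- by move=> k; rewrite setTI; apply: tc_open; [exact: ball_open|exact: ball_fin].
- move=> U oU k; apply: tc_open; first by apply: openI => //; exact: ball_open.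
  apply: le_lt_trans (ball_fin 0 k.+1%:R); apply: le_measure; rewrite ?inE//.
    by apply: open_measurable_rV; apply: openI => //; exact: ball_open.
  exact: mB.
- move=> A mA ih k.
  rewrite (_ : \1__ = fun x => \1_(B k) x + (-1) * \1_(A `&` B k) x).
    apply: tcD; last exact/tcZ/ih.
    by apply: tc_open; [exact: ball_open|exact: ball_fin].
  apply/funext => x; rewrite !indicE !in_setI in_setC.
  by case: (x \in A); case: (x \in B k); rewrite /=; lra.
- move=> F mF tF ih k.
  have mUF : measurable (\bigcup_n F n) by exact: bigcupT_measurable.
  have sub1 (C : set V) : measurable C -> L1 lebN (\1_(C `&` B k) : V -> R).
    move=> mC; apply: L1_indic; first exact: measurableI.
    apply: le_lt_trans (ball_fin 0 k.+1%:R); apply: le_measure; rewrite ?inE//.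
      exact: measurableI.
    exact: mB.
  apply: (@tc_closed (\1_((\bigcup_n F n) `&` B k))); first exact: sub1.
  move=> e e0.
  pose s n x : R := \sum_(i < n) \1_(F i `&` B k) x.
  have sE n x : s n x = \1_((\bigcup_(i < n) F i) `&` B k) x.
    rewrite /s indicE; elim: n => [|n IH].
      by rewrite big_ord0 bigcup_mkord big_ord0 set0I in_set0.
    rewrite big_ord_recr /= IH indicE !bigcup_mkord big_ord_recr /= setIUl in_setU.
    have [xF|xF] := boolP (x \in F n `&` B k); last by rewrite addr0 orbF.
    rewrite (_ : x \in _ = false) ?add0r//; apply/negbTE/negP; rewrite inE => -[].
    move: xF; rewrite inE => -[xFn _]; rewrite -bigcup_mkord => -[i /= ilt xFi] _.
    move/trivIsetP : tF => /(_ i n I I (negbT (ltn_eqF ilt))).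
    by move/seteqP => [+ _] => /(_ x (conj xFi xFn)).
  have sm n : measurable_fun [set: V] (s n).
    apply: measurable_sum => i; apply: measurable_indic; exact: measurableI.
  have cs : (fun n => \int[lebN]_x `|s n x - \1_((\bigcup_n F n) `&` B k) x|) @ \oo --> (0 : R).
    apply: (dct_L1 (g := \1_((\bigcup_n F n) `&` B k))) => //.
    + exact: L1_measurable (sub1 _ mUF).
    + exact: sub1.
    + move=> n x; rewrite sE ger0_norm ?indicE// ler_nat.
      have [|//] := boolP (x \in (\bigcup_(i < n) F i) `&` B k); rewrite inE => -[[i _ xFi] xB].
      by rewrite (_ : x \in _)// inE; split => //; exists i.
    apply: aeW => x; apply: cvg_near_cst.
    have [xF|xF] := pselect ((\bigcup_n F n) x).
      have [i _ xFi] := xF; exists i.+1 => //= n /= ni.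
      rewrite sE !indicE !in_setI (_ : x \in \bigcup_n F n); last by rewrite inE.
      by rewrite (_ : x \in \bigcup_(i < n) F i)// inE; exists i.
    apply: nearW => n; rewrite sE !indicE !in_setI.
    rewrite (_ : x \in \bigcup_n F n = false); last by apply/negbTE/negP; rewrite inE.
    rewrite (_ : x \in \bigcup_(i < n) F i = false)//; apply/negbTE/negP; rewrite inE.
    by move=> [i _ xFi]; apply: xF; exists i.
  have [n hn] := cvg0_le cs e0; exists (s n); first by apply: tc_sum => i; exact: ih.
  have := hn n (leqnn n); rewrite ger0_norm; last exact: int_ge0.
  by under eq_Rintegral do rewrite distrC.
Qed.

Import HBSimple.

(** Cut off to a large ball, a simple function is a finite combination of the indicators of
    [tc_setI_ball], and such functions are dense in L^1. *)
Lemma L1_tc g : L1 lebN g -> tc g.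
Proof.
move=> g1; have mg := L1_measurable g1.
have gB1 k : L1 lebN (fun x => g x * \1_(B k) x).
  by apply: (L1_bm (a := 1) g1); split; [exact: measurable_indic|
    move=> x; rewrite indicE; case: (_ \in _); rewrite /= ?normr1 ?normr0].
have cg : (fun k => \int[lebN]_x `|g x * \1_(B k) x - g x|) @ \oo --> (0 : R).
  apply: (dct_L1 (g := fun x => `|g x|)) => //.
  - by move=> n; exact: L1_measurable (gB1 n).
  - exact: L1_norm.
  - by move=> n x; rewrite normrM ler_piMr// indicE; case: (_ \in _); rewrite /= ?normr1 ?normr0.
  apply: aeW => x; apply: cvg_near_cst.
  exists (Num.bound `|x|) => //= k /= xk.
  rewrite indicE (_ : x \in B k) ?mulr1// inE /B -ball_normE /ball_ /= sub0r normrN.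
  rewrite (lt_le_trans (archi_boundP (normr_ge0 x)))// ler_nat.
  exact: leq_trans xk (leqnSn k).
apply: tc_closed => // e e0.
have e2 : 0 < e / 2 by rewrite divr_gt0.
have [k hk] := cvg0_le cg e2.
have [s_ [s1 _ cs]] := approximation_sfun_integrable measurableT g1.
have cs' : (fun n => \int[lebN]_x `|g x - s_ n x|) @ \oo --> (0 : R).
  exact: (fine_cvg cs).
have [n hn] := cvg0_le cs' e2.
have ms : measurable_fun [set: V] (s_ n) by exact: L1_measurable (s1 n).
exists (fun x => s_ n x * \1_(B k) x).
  rewrite (_ : (fun x => _) = fun x => \sum_(y <- finmap.enum_fset (fset_set (range (s_ n))))
      y * \1_(s_ n @^-1` [set y] `&` B k) x).
    apply: tc_sum => y; apply: tcZ; apply: tc_setI_ball.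
    by rewrite -[X in measurable X]setTI; exact: ms.
  apply/funext => x; rewrite {1}(fimfunE (s_ n) x) fsbig_finite//= mulr_suml.
  by apply: eq_bigr => y _; rewrite -mulrA; congr (_ * _); rewrite indicI.
have hk' := hk k (leqnn k); have hn' := hn n (leqnn n).
rewrite ger0_norm in hk'; last exact: int_ge0.
rewrite ger0_norm in hn'; last exact: int_ge0.
have d1 : L1 lebN (fun x => `|g x * \1_(B k) x - g x|) by exact/L1_norm/L1B.
have d2 : L1 lebN (fun x => `|g x - s_ n x|) by exact/L1_norm/L1B/s1.
have sB1 : L1 lebN (fun x => s_ n x * \1_(B k) x).
  apply: (L1_bm (a := 1) (s1 n)); split; [exact: measurable_indic|
    move=> x; rewrite indicE; case: (_ \in _); rewrite /= ?normr1 ?normr0//].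
apply: (@le_trans _ _ (\int[lebN]_x (`|g x * \1_(B k) x - g x| + `|g x - s_ n x|))).
  apply: le_int; [exact/L1_norm/L1B|exact: L1D|].
  move=> x; rewrite indicE; case: (_ \in _); rewrite /= ?mulr1 ?mulr0 ?subrr ?subr0 ?sub0r ?normrN ?normr0 ?add0r//.
  by rewrite lerDl.
by rewrite intD//; lra.
Qed.

End translation_continuity.

Section translation_continuity_X.
Variables (R : realType) (N : nat).
Local Notation V := 'rV[R]_N.
Local Notation M := (lebX R N).

Let c (p : V * R) : 'rV[R]_N.+1 := cons_rV (p.2, p.1).
Let u (x : 'rV[R]_N.+1) : V * R := (\row_j x 0 (lift ord0 j), x 0 ord0).

Let cK p : u (c p) = p.
Proof.
case: p => x t; rewrite /u /c; congr pair; last by rewrite mxE unlift_none.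
by apply/rowP => j; rewrite !mxE liftK.
Qed.

Let uK x : c (u x) = x.
Proof.
by apply/rowP => i; rewrite /c /u mxE; case: unliftP => [j ->|->]; rewrite ?mxE.
Qed.

Let pc : mpres M (lebesgue_rV R N.+1) c.
Proof.
have h1 := mpres_swap (lebesgue_rV R N) (lebR R).
have h2 := mpres_prod (m1' := [the {sigma_finite_measure set (measurableTypeR R) -> \bar R}
  of @lebesgue_measure R]) (@mpres_lebR_inv R) (mpres_id (lebesgue_rV R N)).
exact: (mpres_comp (mpres_comp h1 h2) (mpres_cons R N)).
Qed.

Let mu_ : measurable_fun [set: 'rV[R]_N.+1] u.
Proof.
apply: measurable_fun_pair; last exact: measurable_coor.
apply: measurable_fun_coorP => i; under eq_fun do rewrite mxE.
exact: measurable_coor.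
Qed.

Let pu : mpres (lebesgue_rV R N.+1) M u.
Proof.
split => // A mA; have [_ <-] := pc.
  by rewrite -comp_preimage (_ : u \o c = id)//; apply/funext => p /=; rewrite cK.
by rewrite -[X in measurable X]setTI; exact: mu_.
Qed.

(** Space-time is R^(N+1) up to reordering of the coordinates, and a space shift by b is the shift
    by (b, 0), which has the same sup norm. *)
Lemma L1_translation (g : V * R -> R) : L1 M g -> forall e, 0 < e -> exists2 h, 0 < h &
  forall b : V, `|b| <= h -> \int[M]_p `|g (p.1 + b, p.2) - g p| <= e.
Proof.
move=> g1 e e0; have mg := L1_measurable g1.
have [_ /(_ e e0)[h h0 hb]] := L1_tc (mpres_L1 pu g1).
exists h => // b bh.
have := hb (c (b, 0)); rewrite -(mpres_int pc); last first.
  have mgu : measurable_fun [set: 'rV[R]_N.+1] (g \o u) by exact: (measurableT_comp mg mu_).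
  apply: measurableT_comp => //; apply: measurable_funB; last exact: mgu.
  by apply: (measurableT_comp mgu); exact: measurable_addv.
have -> : \int[M]_p `|(g \o u) (c p + c (b, 0)) - (g \o u) (c p)| =
    \int[M]_p `|g (p.1 + b, p.2) - g p|.
  apply: eq_Rintegral => -[x t] _ /=; rewrite cK; congr `|g _ - _|.
  rewrite /u; congr pair; last by rewrite !mxE unlift_none addr0.
  by apply/rowP => j; rewrite !mxE liftK.
apply; rewrite /Num.norm /= mx_normrE; apply/bigmax_leP; split => [|[i j] _]; first exact: ltW.
rewrite /c mxE; case: unliftP => [k _|_]; last by rewrite normr0 ltW.
by apply: le_trans bh; rewrite [leRHS]/Num.norm /= mx_normrE; apply: (le_bigmax _ (fun k : 'I_1 * 'I_N => `|b k.1 k.2|) (0, k)).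
Qed.

End translation_continuity_X.

(** * Distance between a function and its mollification *)

Section mollification.
Variables (R : realType) (N : nat).
Local Notation V := 'rV[R]_N.
Context d (X : measurableType d) (M : {sigma_finite_measure set X -> \bar R}).
Variable sh : V -> X -> X.
Hypothesis msh : measurable_fun [set: V * X] (fun p => sh p.1 p.2).
Hypothesis shM : forall y, mpres M M (sh y).
Variables (m : {sigma_finite_measure set V -> \bar R}) (rho : V -> R).
Hypothesis krho : kern m rho.
Hypothesis rho1 : \int[m]_y rho y = 1.

(** The difference is the average, with weight [rho], of the translation differences of [g]; only
    shifts y with rho y != 0 count. *)
Lemma mollify_L1 c g e : bm c g -> L1 M g ->
  (forall y, rho y != 0 -> \int[M]_x `|g (sh y x) - g x| <= e) ->
  \int[M]_x `|cv sh m rho g x - g x| <= e.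
Proof.
move=> gc g1 h; have [r0 r1 _ _] := krho; have mg := L1_measurable g1.
pose F (q : X * V) := rho q.2 * g (sh q.2 q.1) - rho q.2 * g q.1.
have F1 : L1 (M \x m)%E F.
  apply: L1B; first exact: (L1_shift msh shM krho g1).
  by have := L1_tensor g1 r1; under eq_fun do rewrite mulrC.
have aF1 := L1_norm F1.
have cE x : cv sh m rho g x - g x = \int[m]_y F (x, y).
  rewrite /F /= intB; [|exact: (cv_L1y msh krho x gc)|exact: L1Zr].
  by rewrite int_Zr// rho1 mul1r.
have Ix : L1 M (fun x => cv sh m rho g x - g x).
  by under eq_fun do rewrite cE; exact: L1_int1.
have Fx x : L1 m (fun y => F (x, y)).
  by rewrite /F /=; apply: L1B; [exact: (cv_L1y msh krho x gc)|exact: L1Zr].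
apply: (@le_trans _ _ (\int[M]_x \int[m]_y `|F (x, y)|)).
  apply: le_int; [exact: L1_norm|exact: L1_int1 aF1|].
  by move=> x; rewrite cE; exact: le_norm_int.
rewrite (int_fubini aF1) -[leRHS]mul1r -rho1 -int_Zr//.
apply: le_int; [exact: L1_int2 aF1|exact: L1Zr|].
move=> y; have d1 : L1 M (fun x => `|g (sh y x) - g x|).
  by apply/L1_norm/L1B => //; exact: (mpres_L1 (shM y) g1).
rewrite [leLHS](_ : _ = rho y * \int[M]_x `|g (sh y x) - g x|).
  have [->|ry] := eqVneq (rho y) 0; first by rewrite !mul0r.
  by rewrite ler_wpM2l// h.
by rewrite -intZ//; apply: eq_Rintegral => x _; rewrite /F -mulrBr normrM ger0_norm.
Qed.

End mollification.

(** * Closure properties of smooth functions *)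

Section smooth_closure.
Variable R : realType.
Implicit Types V : normedModType R.

Lemma Ck_continuous V k (f : V -> R) : Ck k f -> continuous f.
Proof. by case: k => [|k] // []. Qed.

Lemma Ck_derivable V k (f : V -> R) v x : Ck k.+1 f -> derivable f x v.
Proof. by move=> [_ /(_ v)[]]. Qed.

Lemma Ck_derive V k (f : V -> R) v : Ck k.+1 f -> Ck k ('D_v f).
Proof. by move=> [_ /(_ v)[]]. Qed.

Lemma CkW V k (f : V -> R) : Ck k.+1 f -> Ck k f.
Proof.
elim: k f => [|k ih] f [cf hf] //; split => // v; have [df Df] := hf v.
by split => //; exact: ih.
Qed.

Lemma Ck_cst V k (c : R) : Ck k (fun _ : V => c).
Proof.
elim: k c => [|k ih] c; first by move=> x; exact: cvg_cst.
split; first by move=> x; exact: cvg_cst.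
move=> v; split => [x|]; first exact: derivable_cst.
rewrite (_ : 'D_v _ = fun=> 0); first exact: ih.
by apply/funext => x; exact: derive_cst.
Qed.

Lemma Ck_add V k (f g : V -> R) : Ck k f -> Ck k g -> Ck k (fun x => f x + g x).
Proof.
elim: k f g => [|k ih] f g; first by move=> cf cg x; apply: cvgD; [exact: cf|exact: cg].
move=> [cf hf] [cg hg]; split; first by move=> x; apply: cvgD; [exact: cf|exact: cg].
move=> v; have [df Df] := hf v; have [dg Dg] := hg v; split.
  by move=> x; exact: (derivableD (df x) (dg x)).
rewrite (_ : 'D_v _ = fun x => 'D_v f x + 'D_v g x); first exact: ih.
by apply/funext => x; exact: (deriveD (df x) (dg x)).
Qed.

Lemma Ck_mul V k (f g : V -> R) : Ck k f -> Ck k g -> Ck k (fun x => f x * g x).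
Proof.
elim: k f g => [|k ih] f g; first by move=> cf cg x; apply: cvgM; [exact: cf|exact: cg].
move=> kf kg; have kf0 := CkW kf; have kg0 := CkW kg.
move: kf kg => [cf hf] [cg hg]; split; first by move=> x; apply: cvgM; [exact: cf|exact: cg].
move=> v; have [df Df] := hf v; have [dg Dg] := hg v; split.
  by move=> x; exact: (derivableM (df x) (dg x)).
rewrite (_ : 'D_v _ = fun x => f x * 'D_v g x + g x * 'D_v f x).
  by apply: Ck_add; exact: ih.
by apply/funext => x; exact: (deriveM (df x) (dg x)).
Qed.

Lemma Ck_inv V k (f : V -> R) : (forall x, f x != 0) -> Ck k f -> Ck k (fun x => (f x)^-1).
Proof.
move=> f0; elim: k => [|k ih]; first by move=> cf x; apply: cvgV => //; exact: cf.
move=> kf; have kf0 := CkW kf; move: kf => [cf hf].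
split; first by move=> x; apply: cvgV => //; exact: cf.
move=> v; have [df Df] := hf v; split.
  by move=> x; exact: (derivableV (f0 x) (df x)).
rewrite (_ : 'D_v _ = fun x => (-1 * ((f x)^-1 * (f x)^-1)) * 'D_v f x).
  apply: Ck_mul => //; apply: Ck_mul; first exact: Ck_cst.
  by apply: Ck_mul; exact: ih.
apply/funext => x; rewrite (deriveV (f0 x) (df x)) /GRing.scale /= mulN1r.
by rewrite -invfM expr2.
Qed.

Lemma Ck_prod V k (I : Type) (s : seq I) (F : I -> V -> R) : (forall i, Ck k (F i)) ->
  Ck k (fun x => \prod_(i <- s) F i x).
Proof.
move=> hF; elim: s => [|i s ih]; first by under eq_fun do rewrite big_nil; exact: Ck_cst.
by under eq_fun do rewrite big_cons; exact: Ck_mul.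
Qed.

(** A directional derivative only sees the function on one line, so it suffices that [l] is affine
    along that line; the two difference quotients are then the same function of h. *)
Lemma derivable_line V (U : normedModType R) (f : U -> R) (l : V -> U) (l0 : V) (u : U) (x : V) :
  (forall h : R, l (h *: l0 + x) = h *: u + l x) ->
  derivable f (l x) u -> derivable (f \o l) x l0 /\ 'D_l0 (f \o l) x = 'D_u f (l x).
Proof.
move=> lE df; rewrite /derivable /derive.
have -> : (fun h : R => h^-1 *: ((f \o l) (h *: l0 + x) - (f \o l) x)) =
    (fun h => h^-1 *: (f (h *: u + l x) - f (l x))).
  by apply/funext => h /=; rewrite lE.
by split.
Qed.

(** For an affine [l] with linear part [l0], each directional derivative of f \o l is a directional
    derivative of [f] composed with [l], which gives the induction on k. *)
Lemma Ck_comp V (U : normedModType R) k (f : U -> R) (l : V -> U) (l0 : V -> U) :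
  continuous l -> (forall x v h, l (h *: v + x) = h *: l0 v + l x) ->
  Ck k f -> Ck k (f \o l).
Proof.
move=> cl lE; elim: k f => [|k ih] f.
  by move=> cf x; apply: continuous_comp; [exact: cl|exact: cf].
move=> [cf hf]; split; first by move=> x; apply: continuous_comp; [exact: cl|exact: cf].
move=> v; have [df Df] := hf (l0 v).
have H x := derivable_line (fun h => lE x v h) (df (l x)).
split => [x|]; first by case: (H x).
rewrite (_ : 'D_v _ = 'D_(l0 v) f \o l); first exact: ih.
by apply/funext => x; case: (H x).
Qed.

End smooth_closure.
Arguments Ck_derivable {R V k f} v x _.
Arguments Ck_derive {R V k f} v _.

(** * Linearity in the direction and Taylor estimates *)

Section directional.
Variables (R : realType) (W : normedModType R).
Implicit Types (f : W -> R) (x y u v : W).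

Lemma line_is_derive f x v s : derivable f (x + s *: v) v ->
  is_derive s 1 (fun t : R => f (x + t *: v)) ('D_v f (x + s *: v)).
Proof.
move=> df; have lE h : x + (h *: (1 : R) + s) *: v = h *: v + (x + s *: v).
  by rewrite scalerDl addrCA -[h *: 1]/(h * 1) mulr1.
have [d1 d2] := @derivable_line R R^o W f (fun t : R => x + t *: v) 1 v s lE df.
by apply: DeriveDef.
Qed.

Lemma line_MVT f x v : (forall y, derivable f y v) ->
  exists2 s, 0 <= s <= 1 & f (x + v) - f x = 'D_v f (x + s *: v).
Proof.
move=> df; pose g (t : R) := f (x + t *: v).
have dg (t : R) : is_derive t 1 g ('D_v f (x + t *: v)) by exact: line_is_derive.
have [|c c01] := @MVT R g (fun t => 'D_v f (x + t *: v)) 0 1 ltr01 (fun t _ => dg t).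
  by apply: derivable_within_continuous => t _; exact: ex_derive.
rewrite /g scale1r scale0r addr0 subr0 mulr1 => ->; exists c => //.
by move: c01; rewrite in_itv /= => /andP[/ltW -> /ltW ->].
Qed.

Lemma derivable_scale f x v c : derivable f x v -> derivable f x (c *: v) /\
  'D_(c *: v) f x = c * 'D_v f x.
Proof.
move=> df; pose g (h : R) := f (x + h *: v).
have g0 : is_derive (0 : R) 1 g ('D_v f x).
  have := @line_is_derive f x v 0; rewrite scale0r addr0; exact.
have dc : is_derive (0 : R) 1 (fun h : R => c * h) c.
  by apply: is_derive_eq; rewrite /GRing.scale /= mulr1.
have gc : is_derive (0 : R) 1 (g \o (fun h : R => c * h)) ('D_v f x * c).
  by apply: is_derive1_comp => //; rewrite mulr0.
have lE : (fun h : R => h^-1 *: ((f \o shift x) (h *: (c *: v)) - f x)) =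
    (fun h : R => h^-1 *: (((g \o (fun h : R => c * h)) \o shift 0) (h *: 1) - (g \o (fun h : R => c * h)) 0)).
  apply/funext => h; rewrite /g /= /shift /= mulr0 scale0r addr0.
  by rewrite [h *: 1]mulr1 addr0 scalerA (mulrC h) (addrC _ x).
rewrite /derivable /derive lE; split; first by case: gc.
by rewrite mulrC; case: gc.
Qed.

(** Directional derivatives alone need not be additive in the direction. The increment along v
    starts at the moving point x + h u; the mean value theorem writes it as a value of ['D_v f] near
    x, and continuity of ['D_v f] concludes. *)
Lemma derivable_add f x u v : (forall y, derivable f y u) -> (forall y, derivable f y v) ->
  {for x, continuous ('D_v f)} ->
  derivable f x (u + v) /\ 'D_(u + v) f x = 'D_u f x + 'D_v f x.
Proof.
move=> du dv cv.
suff h : (fun h : R => h^-1 *: ((f \o shift x) (h *: (u + v)) - f x)) @ 0^' -->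
    'D_u f x + 'D_v f x.
  by split; [apply/cvg_ex; eexists; exact: h|exact: cvg_lim h].
rewrite (_ : (fun h : R => _) = fun h =>
  h^-1 *: ((f \o shift x) (h *: u) - f x) +
  h^-1 *: (f (h *: u + x + h *: v) - f (h *: u + x))); last first.
  apply/funext => h; rewrite /= /shift -scalerDr; congr (_ *: _).
  rewrite (_ : h *: (u + v) + x = h *: u + x + h *: v); first by ring.
  by rewrite scalerDr addrAC.
apply: cvgD; first exact: du.
apply/cvgrPdist_le => e e0.
have /cvgrPdist_le /(_ e e0) /nbhs_ballP[r /= r0 hr] := cv.
have k0 : 0 < `|u| + `|v| + 1 by rewrite ltr_wpDl// addr_ge0.
exists (r / (`|u| + `|v| + 1)) => /=; first by rewrite divr_gt0.
move=> h /=; rewrite sub0r normrN => hr' h0.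
have dhv y : derivable f y (h *: v) by case: (derivable_scale h (dv y)).
have [s /andP[s0 s1] ->] := line_MVT (h *: u + x) dhv.
have [_ ->] := derivable_scale h (dv (h *: u + x + s *: (h *: v))).
rewrite [h^-1 *: _]mulrA mulVf// mul1r; apply: hr.
rewrite -ball_normE /ball_ /= -addrA addrCA opprD addNKr normrN.
apply: (@le_lt_trans _ _ (`|h| * (`|u| + `|v|))).
  rewrite (le_trans (ler_normD _ _))// !normrZ mulrDr lerD2l.
  by rewrite ger0_norm// ler_piMl// mulr_ge0.
apply: (@le_lt_trans _ _ (`|h| * (`|u| + `|v| + 1))).
  by rewrite ler_wpM2l// lerDl.
by rewrite -ltr_pdivlMr.
Qed.

Lemma D_scale f x v c : Ck 1 f -> 'D_(c *: v) f x = c * 'D_v f x.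
Proof. by move=> kf; case: (derivable_scale c (Ck_derivable v x kf)). Qed.

Lemma D_add f x u v : Ck 1 f -> 'D_(u + v) f x = 'D_u f x + 'D_v f x.
Proof.
move=> kf; have cv : {for x, continuous ('D_v f)} by exact: (Ck_continuous (Ck_derive v kf)).
by case: (derivable_add (fun y => Ck_derivable u y kf) (fun y => Ck_derivable v y kf) cv).
Qed.

Lemma D_sum f x (I : Type) (s : seq I) (c : I -> R) (v : I -> W) : Ck 1 f ->
  'D_(\sum_(i <- s) c i *: v i) f x = \sum_(i <- s) c i * 'D_(v i) f x.
Proof.
move=> kf; elim: s => [|i s ih]; first by rewrite !big_nil derive0.
by rewrite !big_cons D_add// D_scale// ih.
Qed.

(** Two uses of the mean value theorem; they give the constant 1 in place of the sharp 1/2, which is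
    enough. *)
Lemma taylor2 f x v C : Ck 2 f -> (forall s, 0 <= s <= 1 -> `|'D_v ('D_v f) (x + s *: v)| <= C) ->
  `|f (x + v) - f x - 'D_v f x| <= C.
Proof.
move=> kf hC; have [s /andP[s0 s1] ->] := line_MVT x (fun y => Ck_derivable v y kf).
have kf1 := Ck_derive v kf.
have dsv y : derivable ('D_v f) y (s *: v) by case: (derivable_scale s (Ck_derivable v y kf1)).
have [r /andP[r0 r1] ->] := line_MVT x dsv.
rewrite D_scale// scalerA normrM ger0_norm//.
rewrite -[leRHS]mul1r ler_pM// hC// mulr_ge0//= mulr_ile1//.
Qed.

(** The odd terms cancel in the symmetric difference. Once [D2 * t ^+ 2] is subtracted, the
    derivative in t is a combination of differences of second derivatives, each of which is
    controlled by the third derivative. *)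
Lemma taylor3 f x v C : Ck 3 f ->
  (forall s, -1 <= s <= 1 -> `|'D_v ('D_v ('D_v f)) (x + s *: v)| <= C) ->
  `|f (x + v) + f (x - v) - 2 * f x - 'D_v ('D_v f) x| <= 2 * C.
Proof.
move=> kf hC; have kf1 := Ck_derive v kf; have kf2 := Ck_derive v kf1.
have [D2 D2E] : exists d : R, d = 'D_v ('D_v f) x by eexists.
rewrite -D2E.
pose g (t : R) := f (x + t *: v) + f (x + t *: - v) - D2 * (t ^+ 2).
have dNv y : derivable f y (- v) /\ 'D_(- v) f y = - 'D_v f y.
  by have := derivable_scale (-1) (Ck_derivable v y kf); rewrite scaleN1r mulN1r.
have dg (t : R) : is_derive t 1 g ('D_v f (x + t *: v) - 'D_v f (x + t *: - v) - D2 * (2 * t)).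
  have d1 := line_is_derive (Ck_derivable v (x + t *: v) kf).
  have d2 := line_is_derive (dNv (x + t *: - v)).1.
  rewrite (dNv _).2 in d2.
  have d3 : is_derive t 1 (fun t : R => D2 * t ^+ 2) (D2 * (2 * t)).
    apply: is_derive_eq; rewrite /GRing.scale /=.
    by congr (D2 * _); rewrite !mulr1 [RHS]mulr_natl mulr2n.
  exact: (is_deriveB (is_deriveD d1 d2) d3).
have [|c] := @MVT R g _ 0 1 ltr01 (fun t _ => dg t).
  apply: derivable_within_continuous => t _; exact: ex_derive.
rewrite in_itv /= => /andP[/ltW c0 /ltW c1].
rewrite /g !scale1r !scale0r addr0 subr0 mulr1 expr1n expr0n /= mulr0 subr0 mulr1 => e.
have -> : f (x + v) + f (x - v) - 2 * f x - D2 = 'D_v f (x + c *: v) - 'D_v f (x + c *: - v) - D2 * (2 * c).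
  by rewrite -e; move: (f (x + v)) (f (x - v)) (f x) => a b a'; ring.
have line2 y (k : R) : exists2 r, 0 <= r <= 1 & 'D_v f (y + k *: v) - 'D_v f y = k * 'D_v ('D_v f) (y + (r * k) *: v).
  have dkv z : derivable ('D_v f) z (k *: v) by case: (derivable_scale k (Ck_derivable v z kf1)).
  have [r r01 e'] := line_MVT y dkv; exists r => //; apply: etrans e' _.
  by apply: etrans (D_scale _ v k (CkW kf1)) _; rewrite scalerA.
have line3 (k : R) : -1 <= k <= 1 -> `|'D_v ('D_v f) (x + k *: v) - D2| <= C.
  move=> /andP[k0 k1].
  have dkv z : derivable ('D_v ('D_v f)) z (k *: v) by case: (derivable_scale k (Ck_derivable v z kf2)).
  have [r /andP[r0 r1] h] := line_MVT x dkv.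
  rewrite D2E (etrans h (D_scale _ v k kf2)) scalerA normrM -[leRHS]mul1r ler_pM//.
    by rewrite ler_norml k0.
  apply: hC; rewrite -ler_norml normrM ger0_norm//.
  by rewrite mulr_ile1// ler_norml k0.
have [r1 /andP[r10 r11] e1] := line2 x c.
have [r2 /andP[r20 r21] e2] := line2 x (- c).
have -> : 'D_v f (x + c *: v) - 'D_v f (x + c *: - v) - D2 * (2 * c) =
  c * (('D_v ('D_v f) (x + (r1 * c) *: v) - D2) + ('D_v ('D_v f) (x + (r2 * - c) *: v) - D2)).
  rewrite scalerN -scaleNr.
  move: e1 e2; move: ('D_v f (x + c *: v)) ('D_v f (x + (- c) *: v)) ('D_v f x) => a b a'.
  move: ('D_v ('D_v f) _) ('D_v ('D_v f) _) => p q /eqP; rewrite subr_eq => /eqP -> /eqP.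
  by rewrite subr_eq => /eqP ->; ring.
rewrite normrM ger0_norm// -[leRHS]mul1r ler_pM//.
rewrite (le_trans (ler_normD _ _))// mulrDl mul1r lerD// line3//.
  by rewrite (le_trans _ (mulr_ge0 r10 c0))//= mulr_ile1.
rewrite mulrN; have h : 0 <= r2 * c <= 1 by rewrite mulr_ge0//= mulr_ile1.
by move: h; lra.
Qed.

End directional.

(** * Smooth functions that are flat at a point; cut-offs *)

Section flat_function.
Variable R : realType.
Implicit Types (p : {poly R}) (x y : R).

(** Polynomials in 1/x times exp(-1/x) are stable under differentiation, so carrying [p] along makes
    smoothness a single induction. *)
Definition flat p x : R := if 0 < x then p.[x^-1] * expR (- x^-1) else 0.

Lemma horner_expR_bound p : exists2 C, 0 <= C & forall y, 0 <= y -> `|p.[y]| * expR (- y) <= C.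
Proof.
exists (\sum_(i < size p) `|p`_i| * i`!%:R).
  by apply: sumr_ge0 => i _; rewrite mulr_ge0.
move=> y y0; rewrite horner_coef.
apply: (@le_trans _ _ ((\sum_(i < size p) `|p`_i| * y ^+ i) * expR (- y))).
  rewrite ler_wpM2r ?expR_ge0// (le_trans (ler_norm_sum _ _ _))//.
  by apply: ler_sum => i _; rewrite normrM normrX (ger0_norm y0).
rewrite mulr_suml; apply: ler_sum => i _; rewrite -mulrA ler_wpM2l//.
rewrite expRN ler_pdivrMr ?expR_gt0//.
case: (nat_of_ord i) => [|j].
  rewrite expr0 fact0 mul1r; apply: le_trans (expR_ge1Dx y); by rewrite lerDl.

rewrite mulrC -ler_pdivrMr ?ltr0n ?fact_gt0// (le_trans _ (expR_ge1Dxn j y0))//.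
by rewrite lerDr.
Qed.

(** The exponential bound for X^2 p gains a factor x^2; this quadratic vanishing is what makes the
    derivative at 0 equal to 0. *)
Lemma flat_bound p : exists2 C, 0 <= C & forall x, `|flat p x| <= C * x ^+ 2.
Proof.
have [C C0 hC] := horner_expR_bound ('X^2 * p); exists C => // x.
rewrite /flat; case: ltP => x0; last by rewrite normr0 mulr_ge0// sqr_ge0.
have xV : 0 <= x^-1 by rewrite invr_ge0 ltW.
have := hC _ xV; rewrite hornerM hornerXn normrM ger0_norm ?exprn_ge0// => h.
rewrite normrM (ger0_norm (expR_ge0 _)).
rewrite -ler_pdivrMr ?exprn_gt0// mulrC mulrA -exprVn; exact: h.
Qed.

Lemma flat_is_derive p x : is_derive x 1 (flat p) (flat ('X^2 * (p - p^`())) x).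
Proof.
have [x0|x0|->] := ltgtP x 0.
- (* locally zero *)
  have E : flat ('X^2 * (p - p^`())) x = 0 by rewrite /flat ltNge (ltW x0).
  rewrite E; apply: (near_eq_is_derive (f := cst 0)) => //.
  near=> y; rewrite /flat ltNge (_ : y <= 0)//.
  by apply: ltW; near: y; exact: lt_nbhsl.
- have xn0 : x != 0 by rewrite gt_eqF.
  rewrite {2}/flat x0.
  apply: (near_eq_is_derive (f := fun y => p.[y^-1] * expR (- y^-1))) => //.

  near=> y; rewrite /flat (_ : 0 < y)//.
    by near: y; exact: lt_nbhsr.
  have dV : is_derive x 1 (fun y : R => y^-1) (- x ^- 2).
    have := @is_deriveV R id x 1 1 xn0 _.
    by rewrite /GRing.scale /= mulr1; apply.
  have dh y : is_derive y 1 (horner p) (p^`().[y]).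
    by rewrite derivE derive1E; apply: derivableP; exact: derivable_horner.
  have dp : is_derive x 1 (fun y : R => p.[y^-1]) (p^`().[x^-1] * - x ^- 2).
    exact: (@is_derive1_comp _ (horner p) (fun y : R => y^-1) x _ _ (dh _) dV).
  have dN : is_derive x 1 (fun y : R => - y^-1) (x ^- 2).
    by have := is_deriveN dV; rewrite opprK.
  have de : is_derive x 1 (fun y : R => expR (- y^-1)) (expR (- x^-1) * x ^- 2).
    exact: (@is_derive1_comp _ expR (fun y : R => - y^-1) x _ _ (is_derive_expR _) dN).
  have dM := is_deriveM dp de.
  set D := (X in is_derive _ _ _ X) in dM.
  rewrite (_ : _ * _ = D); first exact: dM.
  rewrite /D hornerM hornerXn hornerD hornerN exprVn.
  rewrite -[_ *: _]/(_ * _) -[expR _ *: _]/(_ * _).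
  move: (p.[_]) (p^`().[_]) (expR _) (x ^- 2) => a b c e; ring.
- rewrite {2}/flat ltxx.
  have [C C0 hC] := flat_bound p.
  have f0 : flat p 0 = 0 by rewrite /flat ltxx.
  suff h : (fun h : R => h^-1 *: ((flat p \o shift 0) (h *: (1 : R)) - flat p 0)) @ 0^' --> (0 : R).
    by apply: DeriveDef; [apply/cvg_ex; exists 0; exact: h|exact: cvg_lim h].
  apply/cvgrPdist_le => e e0.
  exists (e / (C + 1)) => /=; first by rewrite divr_gt0// ltr_wpDl.
  move=> h /=; rewrite sub0r normrN => he h0.
  rewrite sub0r normrN /shift /= addr0 f0 subr0 [h *: 1]mulr1 [h^-1 *: _]/(h^-1 * _).
  rewrite normrM normfV ler_pdivrMl ?normr_gt0//.
  apply: (le_trans (hC h)); rewrite -real_normK ?num_real// expr2 mulrA [leLHS]mulrC.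
  rewrite ler_pM2l ?normr_gt0//.
  apply: (@le_trans _ _ ((C + 1) * `|h|)); first by rewrite ler_wpM2r// lerDl.
  by rewrite mulrC -ler_pdivlMr ?ltr_wpDl// ltW.
Unshelve. all: by end_near. Qed.

Lemma flat_Ck k p : Ck k (flat p).
Proof.
elim: k p => [|k ih] p; have dp := flat_is_derive p.
  move=> x; apply: differentiable_continuous; apply/derivable1_diffP.
  by case: (dp x).
split.
  move=> x; apply: differentiable_continuous; apply/derivable1_diffP.
  by case: (dp x).
move=> v; have d1 x : derivable (flat p) x 1 by case: (dp x).
have H x : derivable (flat p) x v /\ 'D_v (flat p) x = v * 'D_1 (flat p) x.
  have := derivable_scale v (d1 x); rewrite [v *: 1]mulr1; exact.
split; first by move=> x; case: (H x).
rewrite (_ : 'D_v (flat p) = fun x => v * flat ('X^2 * (p - p^`())) x).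
  by apply: Ck_mul; [exact: Ck_cst|exact: ih].
by apply/funext => x; rewrite (H x).2; case: (dp x) => _ ->.
Qed.

Definition flat1 := flat 1.

Lemma flat1_gt0 x : 0 < x -> 0 < flat1 x.
Proof. by move=> x0; rewrite /flat1 /flat x0 hornerC mul1r expR_gt0. Qed.

Lemma flat1_le0 x : x <= 0 -> flat1 x = 0.
Proof. by rewrite /flat1 /flat ltNge => ->. Qed.

Lemma flat1_ge0 x : 0 <= flat1 x.
Proof. by have [/flat1_le0 ->//|/flat1_gt0/ltW] := leP x 0. Qed.

Definition bumpf x := flat1 (1 - x) * flat1 (1 + x).

Lemma bump_ge0 x : 0 <= bumpf x.
Proof. by rewrite mulr_ge0// flat1_ge0. Qed.

Lemma bumpN x : bumpf (- x) = bumpf x.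
Proof. by rewrite /bumpf opprK mulrC. Qed.

Lemma bump0 x : 1 <= `|x| -> bumpf x = 0.
Proof.
move=> x1; rewrite /bumpf; have [h|h] := leP (1 - x) 0; first by rewrite flat1_le0 ?mul0r.
by rewrite [X in _ * X]flat1_le0 ?mulr0//; move: x1; rewrite ler_normr; lra.
Qed.

Lemma bump_gt0 x : `|x| < 1 -> 0 < bumpf x.
Proof. by rewrite ltr_norml => /andP[x1 x2]; rewrite mulr_gt0// flat1_gt0//; lra. Qed.

(** A smooth nonincreasing transition from 1 to 0 across [0,1], the time profile of the test
    functions below. *)
Definition step x := flat1 (1 - x) / (flat1 (1 - x) + flat1 x).

Lemma step_den x : flat1 (1 - x) + flat1 x != 0.
Proof.
rewrite gt_eqF//; have [x0|x0] := leP x 0.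
  by rewrite ltr_pwDl// ?flat1_ge0// flat1_gt0//; lra.
by rewrite ltr_wpDl ?flat1_ge0// flat1_gt0.
Qed.

Lemma step_le0 x : x <= 0 -> step x = 1.
Proof.
move=> x0; rewrite /step (flat1_le0 x0) addr0 divff//.
by have := step_den x; rewrite (flat1_le0 x0) addr0.
Qed.

Lemma step_ge1 x : 1 <= x -> step x = 0.
Proof. by move=> x1; rewrite /step flat1_le0 ?mul0r//; lra. Qed.

Lemma step_bound x : 0 <= step x <= 1.
Proof.
have h : 0 < flat1 (1 - x) + flat1 x by rewrite lt_def step_den addr_ge0// flat1_ge0.
rewrite /step divr_ge0 ?flat1_ge0 ?(ltW h)//= ler_pdivrMr// mul1r lerDl flat1_ge0//.
Qed.

End flat_function.

Section smooth_affine.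
Variables (R : realType) (W : normedModType R).

Lemma smooth_affine (f : R -> R) (l : W -> R) (l0 : W -> R) :
  continuous l -> (forall x v h, l (h *: v + x) = h * l0 v + l x) ->
  (forall k, Ck k f) -> smooth (fun w => f (l w)).
Proof. by move=> cl lE sf k; exact: (@Ck_comp R W R^o k f l l0 cl lE (sf k)). Qed.

Lemma smooth_flat1 (l : W -> R) (l0 : W -> R) :
  continuous l -> (forall x v h, l (h *: v + x) = h * l0 v + l x) ->
  smooth (fun w => flat1 (l w)).
Proof. by move=> cl lE; apply: smooth_affine cl lE _ => k; exact: flat_Ck. Qed.

Lemma smooth_bump (l : W -> R) (l0 : W -> R) :
  continuous l -> (forall x v h, l (h *: v + x) = h * l0 v + l x) ->
  smooth (fun w => bumpf (l w)).
Proof.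
move=> cl lE k; apply: Ck_mul.
- apply: (@smooth_flat1 (fun w => 1 - l w) (fun v => - l0 v)) => [x|x v h].
    by apply: cvgB; [exact: cvg_cst|exact: cl].
  by rewrite lE; ring.
- apply: (@smooth_flat1 (fun w => 1 + l w) l0) => [x|x v h].
    by apply: cvgD; [exact: cvg_cst|exact: cl].
  by rewrite lE; ring.
Qed.

Lemma smooth_step (l : W -> R) (l0 : W -> R) :
  continuous l -> (forall x v h, l (h *: v + x) = h * l0 v + l x) ->
  smooth (fun w => step (l w)).
Proof.
move=> cl lE k.
have s1 : Ck k (fun w => flat1 (1 - l w)).
  apply: (@smooth_flat1 (fun w => 1 - l w) (fun v => - l0 v)) => [x|x v h].
    by apply: cvgB; [exact: cvg_cst|exact: cl].
  by rewrite lE; ring.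
apply: Ck_mul => //; apply: Ck_inv; first by move=> x; exact: step_den.
by apply: Ck_add => //; exact: (smooth_flat1 cl lE).
Qed.

End smooth_affine.

(** * Finite measures and the Euclidean norm *)

Section finite_measures.
Context d (T : measurableType d) (R : realType).
Implicit Types (m : {measure set T -> \bar R}) (f : T -> R).

Lemma L1_fin m c f : (m setT < +oo)%E -> bm c f -> L1 m f.
Proof.
move=> moo [mf fc]; apply: (@L1_le _ _ _ _ _ (fun=> c)) => //.
apply: L1P => //; rewrite integral_cst//.
by apply: lte_mul_pinfty => //; rewrite ?lee_fin.
Qed.

Lemma int_add m1 m2 f : L1 m1 f -> L1 m2 f ->
  \int[measure_add m1 m2]_x f x = \int[m1]_x f x + \int[m2]_x f x.
Proof.
move=> f1 f2; rewrite /Rintegral integral_measure_add// fineD//; exact: integrable_fin_num.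
Qed.

Lemma int_scale_dirac (k : {nonneg R}) (a : T) f : measurable_fun [set: T] f ->
  \int[mscale k (dirac a)]_x f x = k%:num * f a.
Proof.
move=> mf; have mE : measurable_fun [set: T] (EFin \o f) by exact/measurable_EFinP.
rewrite /Rintegral integralE !ge0_integral_mscale//; [|exact: measurable_funeneg|exact: measurable_funepos].
rewrite !integral_dirac//; [|exact: measurable_funeneg|exact: measurable_funepos].
rewrite !diracT !mul1e funeposE funenegE -!EFinN -!EFin_max -!EFinM -EFinB /= -mulrBr; congr (_ * _).
by rewrite /= !maxElt; move: (f a) => y; case: ltP => h1; case: ltP => h2; lra.
Qed.

Lemma int_mrestr m (D : set T) (mD : measurable D) f : measurable_fun [set: T] f ->
  \int[mrestr m mD]_x f x = \int[m]_(x in D) f x.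
Proof.
move=> mf; have mE : measurable_fun [set: T] (EFin \o f) by exact/measurable_EFinP.
have H g : measurable_fun [set: T] g -> (forall x, 0 <= g x)%E ->
    (\int[mrestr m mD]_x g x = \int[m]_(x in D) g x)%E.
  move=> mg g0; rewrite -(setUv D) ge0_integral_setU//.
  - rewrite [X in (_ + X)%E](_ : _ = 0)%E ?adde0.
      by apply: eq_measure_integral => A mA AD; rewrite /= /mrestr (setIidl AD).
    rewrite (eq_measure_integral mzero) ?integral_measure_zero//.
    move=> A mA AD; rewrite /= /mrestr (_ : A `&` D = set0) ?measure0//.
    by apply/seteqP; split => // x [/AD].
  - exact: measurableC.
  - exact: measurable_funTS.
  - by apply/disj_setPCl.
by rewrite /Rintegral integralE [in RHS]integralE !H//; [exact: measurable_funeneg|exact: measurable_funepos].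
Qed.

End finite_measures.

Section euclidean_norm.
Variables (R : realType) (N : nat).
Local Notation V := 'rV[R]_N.
Implicit Types z : V.

Lemma enorm_ge0 z : 0 <= enorm z. Proof. exact: sqrtr_ge0. Qed.

Lemma coor_enorm z i : `|z 0 i| <= enorm z.
Proof.
rewrite -sqrtr_sqr ler_wsqrtr// /dotp (bigD1 i)//= -expr2 lerDl.
by apply: sumr_ge0 => j _; rewrite -expr2 sqr_ge0.
Qed.

Lemma norm_enorm z : `|z| <= enorm z.
Proof.
rewrite /Num.norm /= mx_normrE; apply/bigmax_leP; split => [|[i j] _]; first exact: enorm_ge0.
by rewrite ord1; exact: coor_enorm.
Qed.

Lemma enormN z : enorm (- z) = enorm z.
Proof.
by rewrite /enorm; congr Num.sqrt; apply: eq_bigr => i _; rewrite mxE mulrNN.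
Qed.

Lemma enorm_eq0 z : enorm z = 0 -> z = 0.
Proof.
move=> h; apply/rowP => i; rewrite mxE; apply/eqP; rewrite -normr_le0 -h.
exact: coor_enorm.
Qed.

Lemma enorm_gt0 z : z != 0 -> 0 < enorm z.
Proof. by move=> z0; rewrite lt_def enorm_ge0 andbT; apply: contraNneq z0 => /enorm_eq0 ->. Qed.

Lemma enorm0 : enorm (0 : V) = 0.
Proof. by rewrite /enorm /dotp big1 ?sqrtr0// => i _; rewrite mxE mul0r. Qed.

Lemma measurable_enorm : measurable_fun [set: V] (@enorm R N).
Proof.
have ms : measurable_fun [set: R] (@Num.sqrt R).
  by apply: continuous_measurable_fun; exact: sqrt_continuous.
have md : measurable_fun [set: V] (fun z => dotp z z).
  by apply: measurable_sum => i; apply: measurable_funM; exact: measurable_coor.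
exact: (measurableT_comp ms md).
Qed.

End euclidean_norm.

(** * Symmetric sums of Dirac masses *)

Section jumps.
Variables (R : realType) (N : nat).
Local Notation V := 'rV[R]_N.

(** Each a contributes the atoms a and -a with mass c, so that the jump operator of this measure is
    a sum of symmetric second differences. *)
Fixpoint jumps (c : {nonneg R}) (s : seq V) : {measure set V -> \bar R} :=
  if s is a :: s' then
    measure_add (measure_add (mscale c (dirac a)) (mscale c (dirac (- a)))) (jumps c s')
  else mzero.

Lemma jumps_cons c a s A : jumps c (a :: s) A =
  (c%:num%:E * dirac a A + c%:num%:E * dirac (- a)%R A + jumps c s A)%E.
Proof.
transitivity (measure_add (measure_add (mscale c (dirac a)) (mscale c (dirac (- a))))
  (jumps c s) A); first by [].
rewrite measure_addE; congr (_ + _)%E.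
transitivity (measure_add (mscale c (dirac a)) (mscale c (dirac (- a))) A); first by [].
by rewrite measure_addE.
Qed.

Lemma jumpsT c s : (jumps c s setT < +oo)%E.
Proof.
elim: s => [|a s ih]; first by rewrite /= /mzero ltry.
by rewrite jumps_cons !diracT mule1 lte_add_pinfty// -EFinD ltry.
Qed.

Lemma scale_diracT (c : {nonneg R}) (a : V) : (mscale c (dirac a) setT < +oo)%E.
Proof.
apply: (@le_lt_trans _ _ (c%:num%:E * dirac a [set: V])%E); first by [].
by rewrite diracT mule1 ltry.
Qed.

Lemma jumps_int c s C (f : V -> R) : bm C f ->
  \int[jumps c s]_x f x = \sum_(a <- s) c%:num * (f a + f (- a)).
Proof.
move=> fC; have [mf _] := fC; elim: s => [|a s ih].
  by rewrite big_nil /Rintegral /= integral_measure_zero.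
rewrite big_cons -ih.
have fa := L1_fin (scale_diracT c a) fC; have fNa := L1_fin (scale_diracT c (- a)) fC.
rewrite mulrDr -(int_scale_dirac c a mf) -(int_scale_dirac c (- a) mf) -(int_add fa fNa).
have fs := L1_fin (jumpsT c s) fC.
have faa : L1 (measure_add (mscale c (dirac a)) (mscale c (dirac (- a)))) f.
  apply: (L1_fin _ fC).
  apply: (@le_lt_trans _ _ (mscale c (dirac a) setT + mscale c (dirac (- a)%R) setT)%E).
    by rewrite -measure_addE.
  apply: lte_add_pinfty; exact: scale_diracT.
exact: (int_add faa fs).
Qed.

Lemma jumpsN c s (A : set V) : jumps c s ((fun y => - y) @^-1` A) = jumps c s A.
Proof.
elim: s => [|a s ih]; first by [].
rewrite !jumps_cons ih; congr (_ + _)%E; rewrite !diracE addeC.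
have E b : (b \in (fun y : V => - y) @^-1` A) = (- b \in A).
  by apply/idP/idP; rewrite !inE.
by rewrite !E opprK.
Qed.

End jumps.

Section finite_pack.
Context d (T : measurableType d) (R : realType) (m : {measure set T -> \bar R}).
Hypothesis moo : (m setT < +oo)%E.

(** The proof of finiteness is an argument, so that the sigma-finite structure can be attached to
    this copy of [m]. *)
Definition finm of (m setT < +oo)%E : set T -> \bar R := m.

Let finm0 : finm moo set0 = 0%E. Proof. exact: measure0. Qed.

Let finm_ge0 A : (0 <= finm moo A)%E. Proof. exact: measure_ge0. Qed.

Let finm_sigma : semi_sigma_additive (finm moo).
Proof. exact: (@measure_semi_sigma_additive _ _ _ m). Qed.

HB.instance Definition _ := isMeasure.Build _ _ _ (finm moo) finm0 finm_ge0 finm_sigma.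

Let finm_sigma_finite : sigma_finite setT (finm moo).
Proof. by exists (fun=> setT); [rewrite bigcup_const|move=> _; split]. Qed.

HB.instance Definition _ := @Measure_isSigmaFinite.Build _ _ _ (finm moo) finm_sigma_finite.

Lemma finite_pack : exists m' : {sigma_finite_measure set T -> \bar R}, forall A, m' A = m A.
Proof. by exists (finm moo). Qed.

End finite_pack.

(** * Second derivatives in coordinates and second differences *)

Section second_derivatives.
Variables (R : realType) (N : nat).
Local Notation V := 'rV[R]_N.
Implicit Types (g : V -> R) (u v x : V).

Lemma D_coor g x v : Ck 1 g -> 'D_v g x = \sum_i v 0 i * 'D_(delta_mx 0 i) g x.
Proof. by move=> kg; rewrite {1}(row_sum_delta v) (D_sum _ _ (fun i => v 0 i) _ kg). Qed.

Lemma D2_coor g x u v : Ck 2 g ->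
  'D_u ('D_v g) x = \sum_i \sum_j u 0 i * v 0 j * 'D_(delta_mx 0 i) ('D_(delta_mx 0 j) g) x.
Proof.
move=> kg; rewrite (D_coor x u (Ck_derive v kg)); apply: eq_bigr => i _.
rewrite (_ : 'D_v g = \sum_j (v 0 j \*: 'D_(delta_mx 0 j) g)); last first.
  apply/funext => y; rewrite (D_coor y v (CkW kg)) fct_sumE; by apply: eq_bigr.
have dj j : derivable ('D_(delta_mx 0 j) g) x (delta_mx 0 i).
  exact: Ck_derivable (Ck_derive _ kg).
rewrite derive_sum; last by move=> j; exact: derivableZ.
rewrite mulr_sumr; apply: eq_bigr => j _; rewrite deriveZ// -[_ *: _]/(_ * _).
by rewrite mulrA.
Qed.

Lemma D2_bound g x v A : Ck 2 g ->
  (forall i j, `|'D_(delta_mx 0 i) ('D_(delta_mx 0 j) g) x| <= A) ->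
  `|'D_v ('D_v g) x| <= N%:R ^+ 2 * A * enorm v ^+ 2.
Proof.
move=> kg hA; rewrite D2_coor//.
apply: (@le_trans _ _ (\sum_(i < N) \sum_(j < N) A * enorm v ^+ 2)); last first.
  have e (c : R) : \sum_(i < N) c = N%:R * c by rewrite sumr_const card_ord mulr_natl.
  by rewrite !e expr2 !mulrA.
rewrite (le_trans (ler_norm_sum _ _ _))//; apply: ler_sum => i _.
rewrite (le_trans (ler_norm_sum _ _ _))//; apply: ler_sum => j _.
rewrite !normrM mulrC ler_pM// ?mulr_ge0// expr2.
by rewrite ler_pM// coor_enorm.
Qed.

Let DZ f c v y : Ck 1 f -> 'D_(c *: v) (fun y : V => c * f y) y = c * (c * 'D_v f y).
Proof.
move=> kf; apply: (etrans (D_scale y v c (Ck_mul (Ck_cst _ _ _) kf))); congr (_ * _).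
exact: (deriveZ c (Ck_derivable v y kf)).
Qed.

Let D2_scale g v c y : Ck 2 g -> 'D_(c *: v) ('D_(c *: v) g) y = c ^+ 2 * 'D_v ('D_v g) y.
Proof.
move=> kg; have -> : 'D_(c *: v) g = fun y => c * 'D_v g y.
  by apply/funext => z; exact: D_scale (CkW kg).
apply: (etrans (DZ c v y (Ck_derive v kg))); by rewrite mulrA expr2.
Qed.

Let D3_scale g v c y : Ck 3 g ->
  'D_(c *: v) ('D_(c *: v) ('D_(c *: v) g)) y = c ^+ 3 * 'D_v ('D_v ('D_v g)) y.
Proof.
move=> kg; have -> : 'D_(c *: v) ('D_(c *: v) g) = fun y => c ^+ 2 * 'D_v ('D_v g) y.
  by apply/funext => z; exact: D2_scale (CkW kg).
have k1 : Ck 1 ('D_v ('D_v g)) := Ck_derive v (Ck_derive v kg).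
apply: (etrans (D_scale y v c (Ck_mul (Ck_cst _ _ _) k1))).
rewrite exprS -mulrA; congr (_ * _).
exact: (deriveZ (c ^+ 2) (Ck_derivable v y k1)).
Qed.

Let algebra (a b c d M e : R) : M * e = 1 ->
  d - M ^+ 2 * ((a - c) + (b - c)) = - (M ^+ 2) * (a + b - 2 * c - e ^+ 2 * d).
Proof.
move=> q0; have q : M ^+ 2 * e ^+ 2 = 1 by rewrite -exprMn q0 expr1n.
apply/eqP; rewrite -subr_eq0; apply/eqP; transitivity ((1 - M ^+ 2 * e ^+ 2) * d); first by ring.
by rewrite q subrr mul0r.
Qed.

Lemma second_difference g x v h A : 0 < h -> Ck 3 g ->
  (forall y, `|'D_v ('D_v ('D_v g)) y| <= A) ->
  `|'D_v ('D_v g) x - h^-1 ^+ 2 * ((g (x + h *: v) - g x) + (g (x - h *: v) - g x))| <=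
    2 * A * h.
Proof.
move=> h0 kg gA.
have h3 : 0 <= h ^+ 3 by apply: exprn_ge0; exact: ltW.
have t3 : `|g (x + h *: v) + g (x - h *: v) - 2 * g x - 'D_(h *: v) ('D_(h *: v) g) x|
    <= 2 * (h ^+ 3 * A).
  apply: (taylor3 kg) => s _; rewrite (D3_scale _ _ _ kg) normrM (ger0_norm h3).
  exact: (ler_wpM2l h3 (gA _)).
rewrite (D2_scale _ _ _ (CkW kg)) in t3; move: t3.
move: (g (x + _)) (g (x - _)) (g x) ('D_v _ x) => a b c d t3.
rewrite (algebra a b c d (mulVf (lt0r_neq0 h0))) normrM normrN (ger0_norm (sqr_ge0 h^-1)).
apply: (@le_trans _ _ (h^-1 ^+ 2 * (2 * (h ^+ 3 * A)))).
  apply: ler_wpM2l; [exact: sqr_ge0|exact: t3].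
rewrite le_eqVlt; apply/orP; left; apply/eqP; field.
exact: lt0r_neq0.
Qed.

Lemma derive_vanish g r v : (forall x, r < `|x| -> g x = 0) ->
  forall x, r < `|x| -> 'D_v g x = 0.
Proof.
move=> g0 x rx; rewrite (near_eq_derive v (g := cst 0)); first exact: derive_cst.
have oU : open [set y : V | r < `|y|].
  rewrite (_ : [set _ | _] = (fun y : V => `|y|) @^-1` `]r, +oo[); last first.
    by apply/seteqP; split => y; rewrite /= in_itv /= andbT.
  by apply: open_comp => [y _|]; [exact: norm_continuous|exact: interval_open].
have : nbhs x [set y : V | r < `|y|] by exact: open_nbhs_nbhs.
by apply: filterS => y /g0.
Qed.

End second_derivatives.

(** * Approximation of the operator by finite jump measures *)

Section levy_approximation.
Variables (R : realType) (N P : nat) (sigma : 'M[R]_(N, P)).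
Local Notation V := 'rV[R]_N.
Variable mu : {measure set V -> \bar R}.
Hypotheses (musym : symmetric_punctured mu) (muint : levy_integrable mu).

Let D (r : R) : set V := [set z | r < enorm z].
Let inner : set V := [set z | z != 0 /\ enorm z <= 1].

Let mD r : measurable (D r).
Proof.
rewrite (_ : D r = (@enorm R N) @^-1` `]r, +oo[%classic); last first.
  by apply/seteqP; split => z; rewrite /D /= in_itv /= andbT.
by rewrite -[X in measurable X]setTI; apply: measurable_enorm.
Qed.

Let minner : measurable inner.
Proof.
rewrite (_ : inner = D 0 `&` ~` D 1); first by apply: measurableI => //; exact: measurableC.
apply/seteqP; split => z [] /=.
  by move=> z0 z1; split; [exact: enorm_gt0|apply/negP; rewrite -leNgt].
move=> z0 /negP; rewrite -leNgt => z1; split => //.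
by apply: contraTneq z0 => ->; rewrite /D /= enorm0 ltxx.
Qed.

Let en2 (z : V) : R := \1_inner z * enorm z ^+ 2.

Let L1_en2 : L1 mu en2.
Proof.
have me : measurable_fun [set: V] (fun z : V => enorm z ^+ 2).
  by apply: measurable_funX; exact: measurable_enorm.
apply: L1P; first by apply: measurable_funM.
have h : (\int[mu]_(z in inner) (enorm z ^+ 2)%:E < +oo)%E.
  apply: le_lt_trans muint; rewrite leeDl//; exact: integral_ge0.
apply: le_lt_trans h; rewrite [leRHS]integral_mkcond; apply: ge0_le_integral => //.
- by apply/measurable_EFinP; apply: measurableT_comp => //; apply: measurable_funM.
- by apply/(measurable_restrictT _ _).1 => //; apply: measurable_funTS; exact/measurable_EFinP.
move=> z _; rewrite patchE /en2 indicE; case: (z \in inner) => /=; last by rewrite mul0r normr0.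
by rewrite mul1r ger0_norm// sqr_ge0.
Qed.

Let muD r : 0 < r -> (mu (D r) < +oo)%E.
Proof.
move=> r0.
have h1 : (mu (D 1) < +oo)%E.
  apply: le_lt_trans muint; rewrite -[leLHS]mul1e -integral_cst//.
  by rewrite leeDr//; apply: integral_ge0 => z _; rewrite lee_fin sqr_ge0.
have mDI : measurable (D r `&` inner) by exact: measurableI.
have h2 : (mu (D r `&` inner) < +oo)%E.
  (* Chebyshev's inequality: |z|^2 is at least r^2 on this set. *)
  have : (\int[mu]_z (r ^+ 2 * \1_(D r `&` inner) z)%:E < +oo)%E.
    apply: le_lt_trans (L1_lty L1_en2); apply: ge0_le_integral => //.
    - by move=> z _; rewrite lee_fin mulr_ge0// sqr_ge0.
    - by apply/measurable_EFinP; apply: measurable_funM.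
    - apply/measurable_EFinP; apply: measurableT_comp => //; exact: L1_measurable L1_en2.
    move=> z _; rewrite lee_fin /en2 !indicE in_setI.
    have [zr|_] := boolP (z \in D r); last by rewrite mulr0.
    case: (z \in inner); last by rewrite mulr0.
    rewrite /= mulr1 mul1r ger0_norm ?sqr_ge0// ler_sqr ?nnegrE ?enorm_ge0 ?(ltW r0)//.
    by move: zr; rewrite inE => /ltW.
  under eq_integral do rewrite EFinM.
  rewrite ge0_integralZl_EFin//; last 2 first.
  - exact/measurable_EFinP.
  - exact: sqr_ge0.
  rewrite integral_indic// setIT => h; rewrite ltNge leye_eq; apply/negP => /eqP hoo.
  by move: h; rewrite hoo gt0_muley ?ltxx// lte_fin exprn_gt0.
apply: (@le_lt_trans _ _ (mu (D r `&` inner `|` D 1))).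
  apply: le_measure; rewrite ?inE//; first exact: measurableU.
  move=> z zr; have [z1|z1] := leP (enorm z) 1; [left; split => //|by right].
  split => //; apply/eqP => z0; move: zr; rewrite z0 /D /= enorm0 ltNge; by rewrite ltW.
by apply: (le_lt_trans (measureU2 _ mDI (mD 1))); exact: lte_add_pinfty.
Qed.


(** The data on which the approximation error depends: a radius for the support, a bound for the
    second derivatives (small jumps) and for the third derivatives along the columns of [sigma]
    (second differences). *)
Definition levy_nice (A r : R) (g : V -> R) : Prop :=
  [/\ Ck 3 g, forall x, r <= `|x| -> g x = 0, forall x, `|g x| <= A,
     forall i j x, `|'D_(delta_mx 0 i) ('D_(delta_mx 0 j) g) x| <= A &
     forall k x, let v := (col k sigma)^T in `|'D_v ('D_v ('D_v g)) x| <= A].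

Let sv (k : 'I_P) : V := (col k sigma)^T.

Lemma trace_hessian g x : Ck 2 g ->
  \tr (sigma *m sigma^T *m hessian g x) = \sum_k 'D_(sv k) ('D_(sv k) g) x.
Proof.
move=> kg; rewrite /mxtrace.
under eq_bigr do rewrite mxE; under [RHS]eq_bigr do rewrite (D2_coor _ _ _ kg) exchange_big.
rewrite [RHS]exchange_big /=; apply: eq_bigr => i _.
rewrite [RHS]exchange_big /=; apply: eq_bigr => j _.
rewrite !mxE mulr_suml; apply: eq_bigr => k _; rewrite /sv !mxE.
by congr (_ * _); rewrite mulrC.
Qed.

(** The same number is the cut-off radius of the jumps and the step of the second differences;
    [cc n] is its inverse square. *)
Let rr (n : nat) : R := n.+1%:R^-1.
Let rr0 n : 0 < rr n. Proof. by rewrite invr_gt0. Qed.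
Let cc (n : nat) : {nonneg R} := NngNum (sqr_ge0 (n.+1%:R : R)).
Let js n : seq V := [seq rr n *: sv k | k <- enum 'I_P].

Let nuf n : {measure set V -> \bar R} :=
  measure_add (mrestr mu (mD (rr n))) (jumps (cc n) (js n)).

Let nufE n A : nuf n A = (mu (A `&` D (rr n)) + jumps (cc n) (js n) A)%E.
Proof. exact: (measure_addE (mrestr mu (mD (rr n))) (jumps (cc n) (js n))). Qed.

Let nufT n : (nuf n setT < +oo)%E.
Proof.
rewrite (nufE n setT); by apply: lte_add_pinfty; [rewrite setTI muD|exact: jumpsT].
Qed.

Let nufN n (A : set V) : measurable A -> nuf n ((fun y => - y) @^-1` A) = nuf n A.
Proof.
move=> mA.
rewrite (nufE n A) (nufE n (_ @^-1` A)) jumpsN; congr (_ + _)%E.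
rewrite -[RHS]musym; last 2 first.
- exact: measurableI.
- by move=> z [_ +] z0; rewrite z0 /D /= enorm0 ltNge ltW.
congr (mu _); apply/seteqP; split => z /=.
  by move=> [Az zr]; exists (- z); rewrite ?opprK//; split => //; rewrite /D /= enormN.
by move=> [y [Ay yr] <-]; rewrite opprK /D /= enormN.
Qed.

Let nuf_int n C (F : V -> R) : bm C F -> \int[nuf n]_z F z =
  \int[mu]_(z in D (rr n)) F z + \sum_k (n.+1%:R) ^+ 2 * (F (rr n *: sv k) + F (- (rr n *: sv k))).
Proof.
move=> FC; have [mF _] := FC.
have f1 : L1 (mrestr mu (mD (rr n))) F.
  by apply: (L1_fin _ FC); rewrite /= /mrestr setTI muD.
have f2 := L1_fin (jumpsT (cc n) (js n)) FC.
rewrite -(int_mrestr mu (mD (rr n)) mF).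
transitivity (\int[mrestr mu (mD (rr n))]_z F z + \int[jumps (cc n) (js n)]_z F z).
  exact: (int_add f1 f2).
by congr (_ + _); rewrite (jumps_int _ _ FC) big_map big_enum.
Qed.

(** The second moment of the jumps that are cut off, which tends to 0 by dominated convergence. *)
Let theta n : R := \int[mu]_z ((1 - \1_(D (rr n)) z) * en2 z).

Let theta_cvg : theta @ \oo --> (0 : R).
Proof.
have h := @dct_L1 _ _ _ mu (fun n z => (1 - \1_(D (rr n)) z) * en2 z) (fun=> 0) en2.
have en20 z : 0 <= en2 z by rewrite mulr_ge0// ?sqr_ge0// indicE.
have ch n z : 0 <= (1 - \1_(D (rr n)) z : R) <= 1.
  by rewrite indicE; case: (z \in D _) => /=; apply/andP; split; lra.
have cv : (fun n => \int[mu]_z `|(1 - \1_(D (rr n)) z) * en2 z - 0|) @ \oo --> (0 : R).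
  apply: h => //.
  - move=> n; apply: measurable_funM; last exact: L1_measurable L1_en2.
    by apply: measurable_funB => //; exact: measurable_indic.
  - move=> n z; have /andP[c0 c1] := ch n z.
    rewrite normrM (ger0_norm c0) (ger0_norm (en20 z)); exact: ler_piMl.
  apply: aeW => z; apply: cvg_near_cst.
  have [->|z0] := eqVneq z 0.
    by apply: nearW => n; rewrite /en2 enorm0 expr0n /= !mulr0.
  have [n _ hn] := near_infty_natSinv_lt (PosNum (enorm_gt0 z0)).
  exists n => //= k nk; rewrite indicE (_ : z \in D (rr k)) ?subrr ?mul0r// inE.
  exact: hn.
apply: cvg_trans cv; apply: near_eq_cvg; apply: nearW => n.
apply: eq_Rintegral => z _; have /andP[c0 _] := ch n z.
by rewrite subr0 ger0_norm// mulr_ge0.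
Qed.

(** First term: the omitted jumps, with the constant of [D2_bound]. Second term: the error
    [2 * A * h] of [second_difference], with h = rr n, once for each of the P columns and with the
    factor A left out. *)
Let en n : R := N%:R ^+ 2 * theta n + P%:R * 2 * rr n.

Let en_cvg : en @ \oo --> (0 : R).
Proof.
rewrite (_ : 0 = N%:R ^+ 2 * 0 + P%:R * 2 * (0 : R)); last by rewrite !mulr0 addr0.
apply: cvgD; apply: cvgM; [exact: cvg_cst|exact: theta_cvg|exact: cvg_cst|].
apply/cvgrPdist_le => e e0.
have [n _ hn] := near_infty_natSinv_lt (PosNum e0).
by exists n => // k nk; rewrite sub0r normrN ger0_norm ?ltW// ?hn.
Qed.

(** The error looks at g only within this distance: omitted jumps have length at most 1, and the
    atoms are bounded by the norms of the columns. *)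
Let c0 : R := 1 + \sum_k `|sv k|.

(* Split the jumps at radius rr n: the odd part of the compensator cancels by
   symmetry on D (rr n), the rest is of second order. *)
Let levy_est A r g n x : levy_nice A r g ->
  `|levy_op sigma mu g x - \int[nuf n]_z (g (x + z) - g x)| <=
  A * en n * \1_(ball (0 : V) (r + c0)) x.
Proof.
move=> [kg gr gA gA2 gA3]; have kg2 := CkW kg; have kg1 := CkW kg2.
have cg := Ck_continuous kg; have mg := continuous_measurable_rV cg.
have A0 : 0 <= A by exact: le_trans (gA 0).
have rr1 : rr n <= 1 by rewrite invf_le1// ler1n.
pose F z := g (x + z) - g x.
have Fb : bm (A + A) F.
  apply: bmB; split => //; first by apply: measurableT_comp => //; exact: measurable_addv.
pose lin z := dotp z (grad g x) * \1_[set z | enorm z <= 1] z.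
have mle1 : measurable [set z : V | enorm z <= 1].
  rewrite (_ : [set _ | _] = ~` D 1); first exact: measurableC.
  by apply/seteqP; split => z /=; rewrite /D /=; [move=> z1; apply/negP; rewrite -leNgt|move=> /negP; rewrite -leNgt].
have mlin : measurable_fun [set: V] lin.
  apply: measurable_funM; last exact: measurable_indic.
  by apply: measurable_sum => i; apply: measurable_funM => //; exact: measurable_coor.
have linE z : dotp z (grad g x) = 'D_z g x.
  by rewrite (D_coor x z kg1); apply: eq_bigr => i _; rewrite mxE.
pose G z := F z - lin z.
have mG : measurable_fun [set: V] G by apply: measurable_funB => //; case: Fb.
have FA z : `|F z| <= 2 * A by case: Fb => _ /(_ z); lra.
have Gin z : enorm z <= 1 -> `|G z| <= N%:R ^+ 2 * A * enorm z ^+ 2.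
  move=> z1; rewrite /G /lin indicE (_ : z \in _) ?mulr1; last by rewrite inE.
  by rewrite linE; apply: taylor2 => // s _; exact: D2_bound.
have Gout z : 1 < enorm z -> G z = F z.
  move=> z1; rewrite /G /lin indicE (_ : (z \in _) = false) ?mulr0 ?subr0//.
  by apply/negbTE/negP; rewrite inE /= leNgt z1.
have NA0 : 0 <= N%:R ^+ 2 * A by apply: mulr_ge0 => //; exact: sqr_ge0.
have en20 z : 0 <= en2 z by apply: mulr_ge0; [rewrite indicE|exact: sqr_ge0].
have D11 : L1 mu \1_(D 1) by apply: L1_indic => //; exact: muD.
have G1 : L1 mu G.
  apply: (L1_le mG (L1D (L1Z (N%:R ^+ 2 * A) L1_en2) (L1Z (2 * A) D11))) => z.
  have [z1|z1] := leP (enorm z) 1.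
    rewrite (le_trans (Gin z z1))// /en2 indicE; have [zi|zi] := boolP (z \in inner).
      by rewrite mul1r lerDl mulr_ge0 ?mulr_ge0// indicE.
    rewrite (_ : z = 0) ?enorm0 ?expr0n /= ?mulr0; first by rewrite add0r mulr_ge0 ?mulr_ge0// indicE.
    by apply/eqP/negPn/negP => z0; move/negP: zi; apply; rewrite inE.
  rewrite Gout// (le_trans (FA z))// [\1_(D 1) z]indicE (_ : z \in D 1) ?mulr1 ?inE//.
  by rewrite lerDr; apply: mulr_ge0 => //; exact: en20.
have G0 : G 0 = 0 by rewrite /G /F /lin addr0 subrr sub0r linE derive0 mul0r oppr0.
(* The integrand vanishes at 0, so whatever [mu] does at the origin is invisible. *)
have levyE : \int[mu]_(z in ~` [set 0]) G z = \int[mu]_z G z.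
  rewrite Rintegral_mkcond; apply: eq_Rintegral => z _; rewrite patchE.
  have [//|] := boolP (z \in ~` [set 0]); rewrite notin_setE /= => /contrapT ->.
  by rewrite G0.
pose ch : V -> R := \1_(D (rr n)).
have chb : bm 1 ch.
  by split; [exact: measurable_indic|move=> z; rewrite /ch indicE; case: (_ \in _); rewrite /= ?normr1 ?normr0].
have ch1b : bm 1 (fun z => 1 - ch z).
  split; first by apply: measurable_funB => //; case: chb.
  by move=> z; rewrite /ch indicE; case: (_ \in _); rewrite /= ?subrr ?subr0 ?normr1 ?normr0.
have chE f : \int[mu]_(z in D (rr n)) f z = \int[mu]_z (ch z * f z).
  rewrite Rintegral_mkcond; apply: eq_Rintegral => z _; rewrite patchE /ch indicE.
  by case: (_ \in _); rewrite ?mul1r ?mul0r.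
have chL1 : L1 mu ch by apply: L1_indic => //; exact: muD.
have chF : L1 mu (fun z => ch z * F z) by exact: L1_bm chL1 Fb.
have chG : L1 mu (fun z => ch z * G z) by exact: bm_L1 chb G1.
have chlin1 : L1 mu (fun z => ch z * lin z).
  by apply: L1_eq (L1B chF chG) => z; rewrite /G; ring.
have lin0 : \int[mu]_z (ch z * lin z) = 0.
  rewrite -chE -(int_mrestr mu (mD (rr n)) mlin).
  have pN : mpres (mrestr mu (mD (rr n))) (mrestr mu (mD (rr n))) (fun y : V => - y).
    split; first exact: measurable_oppv.
    move=> B mB; rewrite /= /mrestr -[RHS]musym; last 2 first.
    - exact: measurableI.
    - by move=> z [_ +] z0; rewrite z0 /D /= enorm0 ltNge ltW.
    congr (mu _); apply/seteqP; split => z /=.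
      by move=> [Bz zr]; exists (- z); rewrite ?opprK//; split => //; rewrite /D /= enormN.
    by move=> [y [By yr] <-]; rewrite opprK /D /= enormN.
  have e := mpres_int pN mlin.
  have l1 : L1 (mrestr mu (mD (rr n))) lin.
    have h : bm (N%:R * \sum_i `|grad g x 0 i|) lin.
      split => // z; rewrite /lin indicE; have [|_] := boolP (z \in _); last first.
        by rewrite mulr0 normr0 mulr_ge0// sumr_ge0.
      rewrite inE /= => z1; rewrite mulr1 (le_trans (ler_norm_sum _ _ _))//.
      rewrite mulr_sumr; apply: ler_sum => i _; rewrite normrM ler_wpM2r//.
      rewrite (le_trans (coor_enorm z i))// (le_trans z1)// ler1n.
      by case: i => i /=; case: N.
    by apply: (L1_fin _ h); rewrite /= /mrestr setTI muD.
  have : \int[mrestr mu (mD (rr n))]_z lin (- z) = - \int[mrestr mu (mD (rr n))]_z lin z.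
    rewrite -intN//; apply: eq_Rintegral => z _; rewrite /lin !indicE.
    rewrite (_ : - z \in _ = (z \in [set z : V | enorm z <= 1])); last first.
      by apply/idP/idP; rewrite !inE /= enormN.
    rewrite -mulNr; congr (_ * _); rewrite /dotp -sumrN; apply: eq_bigr => i _.
    by rewrite mxE mulNr.
  by rewrite e => /esym/eqP; rewrite eqNr => /eqP.
have sb k : `|sv k| <= c0.
  rewrite /c0 (bigD1 k)//= addrCA lerDl addr_ge0// sumr_ge0//.
have est k : `|'D_(sv k) ('D_(sv k) g) x - n.+1%:R ^+ 2 * (F (rr n *: sv k) + F (- (rr n *: sv k)))| <= 2 * A * rr n.
  by have := second_difference x (rr0 n) kg (gA3 k); rewrite /rr invrK.
have lE : levy_op sigma mu g x - \int[nuf n]_z F z =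
    \sum_k ('D_(sv k) ('D_(sv k) g) x - n.+1%:R ^+ 2 * (F (rr n *: sv k) + F (- (rr n *: sv k)))) +
    \int[mu]_z ((1 - ch z) * G z).
  have -> : levy_op sigma mu g x = \sum_k 'D_(sv k) ('D_(sv k) g) x + \int[mu]_z G z.
    by rewrite /levy_op trace_hessian// -levyE.
  rewrite (nuf_int n Fb) chE sumrB.
  have -> : \int[mu]_z (ch z * F z) = \int[mu]_z (ch z * G z).
    rewrite -[RHS]addr0 -lin0 -intD//; apply: eq_Rintegral => z _; rewrite /G; ring.
  have -> : \int[mu]_z ((1 - ch z) * G z) = \int[mu]_z G z - \int[mu]_z (ch z * G z).
    by rewrite -intB//; apply: eq_Rintegral => z _; ring.
  ring.
rewrite lE indicE; have [xr|xr] := boolP (x \in (ball (0 : V) (r + c0) : set V)).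
  rewrite mulr1 (le_trans (ler_normD _ _))// /en mulrDr [leRHS]addrC lerD//.
    rewrite (le_trans (ler_norm_sum _ _ _))//.
    apply: (@le_trans _ _ (\sum_(k < P) 2 * A * rr n)); first by apply: ler_sum => k _; exact: est.
    rewrite sumr_const card_ord -mulr_natl le_eqVlt; apply/orP; left; apply/eqP; ring.
  have b1 : L1 mu (fun z => N%:R ^+ 2 * A * ((1 - ch z) * en2 z)).
    by apply: L1Z; exact: bm_L1 ch1b L1_en2.
  rewrite (_ : A * _ = \int[mu]_z (N%:R ^+ 2 * A * ((1 - ch z) * en2 z))); last first.
    by rewrite intZ; [rewrite /theta; ring|exact: bm_L1 ch1b L1_en2].
  apply: le_norm_int_le => //; first exact: bm_L1 ch1b G1.
  move=> z; rewrite normrM /ch indicE; have [zr|zr] := boolP (z \in D (rr n)).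
    by rewrite subrr normr0 !mul0r mulr0.
  rewrite subr0 normr1 !mul1r; have [->|z0] := eqVneq z 0.
    by rewrite G0 normr0; apply: mulr_ge0 => //; exact: en20.
  have z1 : enorm z <= 1.
    by move: zr; rewrite notin_setE /D /= => /negP; rewrite -leNgt => /le_trans; apply.
  by rewrite /en2 indicE (_ : z \in inner) ?mul1r ?Gin// inE.
(* Outside the enlarged ball, g vanishes around x and at all points x + z with |z| <= c0, so each
   term of the error is zero. *)
have xr' : r + c0 <= `|x|.
  by move: xr; rewrite notin_setE -ball_normE /= sub0r normrN => /negP; rewrite -leNgt.
have c01 : 1 <= c0 by rewrite lerDl sumr_ge0.
have grp y : r < `|y| -> g y = 0 by move=> /ltW; exact: gr.
have xrr : r < `|x| by lra.
have gx z : `|z| <= c0 -> g (x + z) = 0.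
  move=> zc; apply: gr; have := ler_normB (x + z) z; rewrite addrK; lra.
have Fz z : `|z| <= c0 -> F z = 0 by move=> zc; rewrite /F gx// grp// subrr.
rewrite mulr0 big1 ?add0r; last first.
  move=> k _; rewrite (derive_vanish (sv k) (derive_vanish (sv k) grp) xrr).
  have sk : `|rr n *: sv k| <= c0.
    by rewrite normrZ (le_trans _ (sb k))// ler_piMl// ger0_norm// ltW.
  by rewrite !Fz ?normrN// addr0 mulr0 subr0.
rewrite (_ : \int[mu]_z _ = 0) ?normr0// -[RHS](int0 mu); apply: eq_Rintegral => z _.
rewrite /ch indicE; have [zr|zr] := boolP (z \in D (rr n)); first by rewrite subrr mul0r.
have z1 : enorm z <= 1.
  by move: zr; rewrite notin_setE /D /= => /negP; rewrite -leNgt => /le_trans; apply.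
rewrite subr0 mul1r /G Fz; last by rewrite (le_trans (norm_enorm z))// (le_trans z1).
by rewrite /lin linE (derive_vanish z grp xrr) mul0r subr0.
Qed.

Lemma levy_approx : exists (nu : nat -> {sigma_finite_measure set V -> \bar R}) (e : nat -> R) (c : R),
  [/\ e @ \oo --> (0 : R), forall n, kern (nu n) (fun=> 1) &
    forall A r g n x, levy_nice A r g ->
      `|levy_op sigma mu g x - \int[nu n]_z (g (x + z) - g x)| <=
      A * e n * \1_(ball (0 : V) (r + c)) x].
Proof.
have /choice[nu nuE] n := finite_pack (nufT n).
exists nu, en, c0; split => //.
  move=> n; split => //.
  - by apply: (@L1_fin _ _ _ (nu n) 1); [apply: (@le_lt_trans _ _ (nuf n setT)); [rewrite le_eqVlt; apply/orP; left; apply/eqP; exact: nuE|exact: nufT]|split => // y; rewrite normr1].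
  - split; first exact: measurable_oppv.
    by move=> A mA; exact: (etrans (nuE n _) (etrans (nufN n mA) (esym (nuE n A)))).
move=> A r g n x gn; rewrite (_ : \int[nu n]_z _ = \int[nuf n]_z (g (x + z) - g x)).
  exact: levy_est gn.
by rewrite /Rintegral; congr fine; apply: eq_measure_integral => B mB _; exact: nuE.
Qed.

End levy_approximation.

Lemma measurable_cvgR d (T : measurableType d) (R : realType) (f_ : nat -> T -> R) (f : T -> R) :
  (forall n, measurable_fun [set: T] (f_ n)) -> (forall x, f_ ^~ x @ \oo --> f x) ->
  measurable_fun [set: T] f.
Proof.
move=> mf fc; apply/measurable_EFinP.
apply: (emeasurable_fun_cvg (fun n x => (f_ n x)%:E)) => [n|x _].
  by apply/measurable_EFinP.
by apply: cvg_EFin; [exact: nearW|exact: fc].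
Qed.

(** * Time slices of test functions *)

Section slices.
Variables (R : realType) (N : nat).
Local Notation V := 'rV[R]_N.
Implicit Types f psi : V * R -> R.

Lemma pair_continuousl (y : V) (t : R) : (fun z : V => (z, t)) @ y --> (y, t).
Proof.
have F : Filter (nbhs y) by exact: nbhs_filter.
have c1 : (fun z : V => z) @ y --> y by exact: cvg_id.
have c2 : (fun _ : V => t) @ y --> t by exact: cvg_cst.
exact: (cvg_pair c1 c2).
Qed.

Lemma pair_continuousr (y : V) (t : R) : (fun s : R => (y, s)) @ t --> (y, t).
Proof.
have c1 : (fun _ : R => y) @ t --> y by exact: cvg_cst.
have c2 : (fun s : R => s) @ t --> t by exact: cvg_id.
exact: (cvg_pair c1 c2).
Qed.

Lemma slice_Ck k f t : Ck k f -> Ck k (fun y : V => f (y, t)).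
Proof.
move=> kf; apply: (Ck_comp (l := fun y : V => (y, t)) (l0 := fun v : V => (v, 0))) => //.
  by move=> y; exact: pair_continuousl.
by move=> x v h; apply: injective_projections; rewrite /= ?scaler0 ?add0r.
Qed.

Lemma D_slice f t (v : V) : Ck 1 f ->
  'D_v (fun y : V => f (y, t)) = fun y => 'D_((v, 0) : V * R) f (y, t).
Proof.
move=> kf; apply/funext => y.
have [|_ ->//] := derivable_line (l := fun y : V => (y, t)) (l0 := v) _ (Ck_derivable ((v, 0) : V * R) (y, t) kf).
by move=> h; apply: injective_projections; rewrite /= ?scaler0 ?add0r.
Qed.

Lemma D2_slice f t (u v : V) : Ck 2 f -> 'D_u ('D_v (fun y : V => f (y, t))) =
  fun y => 'D_((u, 0) : V * R) ('D_((v, 0) : V * R) f) (y, t).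
Proof.
move=> kf; rewrite (D_slice t v (CkW kf)).
exact: (D_slice t u (Ck_derive ((v, 0) : V * R) kf)).
Qed.

Lemma D3_slice f t (v : V) : Ck 3 f -> 'D_v ('D_v ('D_v (fun y : V => f (y, t)))) =
  fun y => 'D_((v, 0) : V * R) ('D_((v, 0) : V * R) ('D_((v, 0) : V * R) f)) (y, t).
Proof.
move=> kf; rewrite (D2_slice t v v (CkW kf)).
exact: (D_slice t v (Ck_derive ((v, 0) : V * R) (Ck_derive ((v, 0) : V * R) kf))).
Qed.

Lemma D_time f x t : Ck 1 f -> derivable (fun s : R => f (x, s)) t 1 /\
  derive1 (fun s => f (x, s)) t = 'D_((0, 1) : V * R) f (x, t).
Proof.
move=> kf.
have [|h1 h2] := derivable_line (l := fun s : R => (x, s)) (l0 := 1) _ (Ck_derivable ((0, 1) : V * R) (x, t) kf).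
  by move=> h; apply: injective_projections; rewrite /= ?scaler0 ?add0r.
by split => //; rewrite derive1E.
Qed.

Section vanishing.
Variables (T : R) (K : set (V * R)).
Hypotheses (cK : compact K) (KT : K `<=` [set: V] `*` `[0, T[).

Definition vanish f := forall p, 0 <= p.2 < T -> ~ K p -> f p = 0.

Let closedK : closed K.
Proof. by apply: compact_closed => //; exact: norm_hausdorff. Qed.

Lemma vanish_bound f : continuous f -> vanish f ->
  exists2 A, 0 <= A & forall p, 0 <= p.2 < T -> `|f p| <= A.
Proof.
move=> cf vf.
have /compact_bounded[M [_ hM]] : compact (f @` K).
  by apply: continuous_compact => //; exact: continuous_subspaceT.
exists (`|M| + 1) => [|p pT]; first by rewrite addr_ge0.
have [Kp|nKp] := pselect (K p); last by rewrite vf// normr0 addr_ge0.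
by apply: hM; [rewrite ltr_pwDr// ler_norm|exists p].
Qed.

Lemma vanish_space f v : Ck 1 f -> vanish f -> vanish ('D_((v, 0) : V * R) f).
Proof.
move=> kf vf -[x t] /= tT nK.
have := D_slice t v kf => /(congr1 (fun g => g x)) <-.
rewrite (near_eq_derive v (g := cst 0)); first exact: derive_cst.
have : nbhs (x, t) (~` K) by apply: open_nbhs_nbhs; split => //; exact: closed_openC.
move=> nb; have : \forall y \near x, (~` K) (y, t).
  have cl : (fun y : V => (y, t)) @ x --> (x, t).
    by exact: pair_continuousl.
  exact: (cl _ nb).
by apply: filterS => y; exact: vf.
Qed.

(** Time 0 is excluded because the extension to negative times is unconstrained; for space
    derivatives the slice t = 0 causes no difficulty. *)
Lemma vanish_time f p : Ck 1 f -> vanish f -> 0 < p.2 < T -> ~ K p ->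
  'D_((0, 1) : V * R) f p = 0.
Proof.
move=> kf vf /andP[p0 pT] nK.
rewrite (near_eq_derive _ (g := cst 0)); first exact: derive_cst.
have nb : nbhs p (~` K) by apply: open_nbhs_nbhs; split => //; exact: closed_openC.
have nb2 : nbhs p [set q : V * R | 0 < q.2 < T].
  have cl : (fun q : V * R => q.2) @ p --> p.2 by exact: cvg_snd.
  have : nbhs p.2 (`]0, T[%classic : set R).
    by apply: open_nbhs_nbhs; split; [exact: interval_open|rewrite /= in_itv /= p0 pT].
  have F : Filter (nbhs p) by exact: nbhs_filter.
  move=> /cl nb3; apply: (@filterS _ (nbhs p) F _ _ _ nb3) => q; by rewrite /= in_itv /=.
have F : Filter (nbhs p) by exact: nbhs_filter.
by apply: filterS2 nb nb2 => q nq /andP[q0 qT]; apply: vf => //; rewrite (ltW q0).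
Qed.

(** The closed set K does not meet time T, so [f] vanishes at the times just before T, and by
    continuity at T. *)
Lemma vanish_end f x : continuous f -> vanish f -> 0 < T -> f (x, T) = 0.
Proof.
move=> cf vf T0; apply/eqP/negPn/negP => f0.
have nK : ~ K (x, T) by move=> /KT[_]; rewrite /= in_itv /= ltxx andbF.
have cl : (fun t : R => (x, t)) @ T --> (x, T).
  by exact: pair_continuousr.
have nb1 : \forall t \near T, (~` K) (x, t).
  by apply: (cl); apply: open_nbhs_nbhs; split => //; exact: closed_openC.
have nb2 : \forall t \near T, f (x, t) != 0.
  have h := cvg_comp _ _ cl (cf (x, T)).
  have nn : nbhs (f (x, T)) [set r : R | r != 0].
    by apply: open_nbhs_nbhs; split => //; exact: open_neq.
  exact: (h _ nn).
have nb3 : \forall t \near T, 0 < t by exact: lt_nbhsr.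
have FT : Filter (nbhs T) by exact: nbhs_filter.
have nb4 := filterI (filterI nb1 nb2) nb3.
have [e /= e0 he] := (nbhs_ballP T _).1 (nb4 FT FT).
have e2 : 0 < e / 2 by rewrite divr_gt0.
have [|[h1 h2] h3] := he (T - e / 2).
  by rewrite /ball /= opprB addrC subrK gtr0_norm//; lra.
by move/eqP : h2; apply; apply: vf => //=; rewrite (ltW h3) /=; lra.
Qed.

End vanishing.

(** One pair of constants serves all slices, so the approximation of the operator is uniform in
    time. *)
Lemma test_slices P (sigma : 'M[R]_(N, P)) T psi : test_function T psi ->
  exists A r, [/\ 0 < A, 0 < r,
    forall t, 0 <= t < T -> levy_nice sigma A r (fun y => psi (y, t)) &
    forall x t, 0 < t < T -> `|'D_((0, 1) : V * R) psi (x, t)| <= A /\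
      (r <= `|x| -> 'D_((0, 1) : V * R) psi (x, t) = 0)].
Proof.
move=> [sp [K [cK KT vp]]].
have vK : vanish T K psi.
  by move=> p pT; apply: vp; split => //; rewrite /= in_itv.
have k1 : Ck 1 psi := sp 1%N. have k2 : Ck 2 psi := sp 2%N. have k3 : Ck 3 psi := sp 3%N.
have /compact_bounded[M [_ hM]] := cK.
pose r := `|M| + 2.
have rK x t : r <= `|x| -> ~ K (x, t).
  move=> rx Kx; have M1 : M < `|M| + 1 by rewrite ltr_pwDr// ler_norm.
  have : `|(x, t) : V * R| <= `|M| + 1 by exact: hM.
  rewrite prod_normE /= ge_max => /andP[h _]; move: rx; rewrite /r; lra.
pose e (v : V) : V * R := (v, 0).
have [A0 A00 hA0] := vanish_bound cK (Ck_continuous k1) vK.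
have /choice[B hB] (ij : 'I_N * 'I_N) : exists B : R, 0 <= B /\ forall p, 0 <= p.2 < T ->
    `|'D_(e (delta_mx 0 ij.1)) ('D_(e (delta_mx 0 ij.2)) psi) p| <= B.
  have v2 : vanish T K ('D_(e (delta_mx 0 ij.1)) ('D_(e (delta_mx 0 ij.2)) psi)).
    by apply: vanish_space => //; [exact: Ck_derive|exact: vanish_space].
  have [B B0 hB] := vanish_bound cK (Ck_continuous (k := 0) (Ck_derive _ (Ck_derive _ k2))) v2.
  by exists B.
have /choice[C hC] (k : 'I_P) : exists B : R, 0 <= B /\ forall p, 0 <= p.2 < T ->
    `|'D_(e (col k sigma)^T) ('D_(e (col k sigma)^T) ('D_(e (col k sigma)^T) psi)) p| <= B.
  have v3 : vanish T K ('D_(e (col k sigma)^T) ('D_(e (col k sigma)^T) ('D_(e (col k sigma)^T) psi))).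
    apply: vanish_space => //; first exact: Ck_derive (Ck_derive _ k3).
    by apply: vanish_space => //; [exact: Ck_derive|exact: vanish_space].
  have [B' B0 hB'] := vanish_bound cK (Ck_continuous (k := 0) (Ck_derive _ (Ck_derive _ (Ck_derive _ k3)))) v3.
  by exists B'.
have [F F0 hF] : exists2 F, 0 <= F & forall p, 0 < p.2 < T -> `|'D_((0, 1) : V * R) psi p| <= F.
  have /compact_bounded[Q [_ hQ]] : compact ('D_((0, 1) : V * R) psi @` K).
    apply: continuous_compact => //; apply: continuous_subspaceT.
    exact: (Ck_continuous (k := 0) (Ck_derive _ k1)).
  exists (`|Q| + 1) => [|p pT]; first by rewrite addr_ge0.
  have [Kp|nKp] := pselect (K p); last by rewrite (vanish_time cK k1 vK pT nKp) normr0 addr_ge0.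
  by apply: hQ; [rewrite ltr_pwDr// ler_norm|exists p].
have SB : 0 <= \sum_ij B ij by apply: sumr_ge0 => i _; case: (hB i).
have SC : 0 <= \sum_k C k by apply: sumr_ge0 => i _; case: (hC i).
have leB q : q <= \sum_ij B ij -> q <= A0 + \sum_ij B ij + \sum_k C k + F + 1 by move=> ?; lra.
have leC q : q <= \sum_k C k -> q <= A0 + \sum_ij B ij + \sum_k C k + F + 1 by move=> ?; lra.
exists (A0 + \sum_ij B ij + \sum_k C k + F + 1), r; split.
- lra.
- by rewrite /r ltr_wpDl.
- move=> t tT; split.
  + exact: slice_Ck.
  + by move=> x rx; apply: vK => //; exact: rK.
  + by move=> x; have := hA0 (x, t) tT; lra.
  + move=> i j x.
    have [_ /(_ (x, t) tT) /= h] := hB (i, j).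
    have h2 : B (i, j) <= \sum_ij B ij by rewrite (bigD1 (i, j))//= lerDl sumr_ge0// => k _; case: (hB k).
    have eq := congr1 (fun g => `|g x|) (D2_slice t (delta_mx 0 i) (delta_mx 0 j) k2).
    apply: (@le_trans _ _ (B (i, j))); last exact: leB.
    by apply: le_trans h; rewrite le_eqVlt; apply/orP; left; apply/eqP; exact: eq.
  + move=> k x; cbv zeta; set v := (col k sigma)^T.
    have [_ /(_ (x, t) tT) /= h] := hC k.
    have h2 : C k <= \sum_k C k by rewrite (bigD1 k)//= lerDl sumr_ge0// => i _; case: (hC i).
    have eq := congr1 (fun g => `|g x|) (D3_slice t v k3).
    apply: (@le_trans _ _ (C k)); last exact: leC.
    by apply: le_trans h; rewrite le_eqVlt; apply/orP; left; apply/eqP; exact: eq.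
- move=> x t tT; split; first by have := hF (x, t) tT; lra.
  by move=> rx; exact: (@vanish_time T K cK psi (x, t) k1 vK tT (rK x t rx)).
Qed.

End slices.

Lemma int0_ae d (T : measurableType d) (R : realType) (m : {measure set T -> \bar R})
  (f : T -> R) : L1 m f -> (forall x, 0 <= f x) -> \int[m]_x f x <= 0 ->
  {ae m, forall x, f x = 0}.
Proof.
move=> f1 f0 i0; have mf := L1_measurable f1.
have e0 : (\int[m]_x `|(f x)%:E| = 0)%E.
  have i00 : \int[m]_x f x = 0 by apply/eqP; rewrite eq_le i0 int_ge0.
  under eq_integral => x _ do rewrite gee0_abs ?lee_fin//.
  by rewrite -EFin_int// i00.
have /(ae_eq_integral_abs m measurableT (f := EFin \o f) _).1 := e0.
move=> /(_ ltac:(exact/measurable_EFinP)).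
by apply: filterS => x /(_ I) /= -[].
Qed.

(** How functions defined through [levy_op] become measurable, bounded and integrable: they are
    uniform limits, with an integrable profile of the error, of the same expressions for finite jump
    measures. *)
Lemma unif_limit d (X : measurableType d) (R : realType) (m : {measure set X -> \bar R})
    (g_ : nat -> X -> R) (G chi : X -> R) (a : nat -> R) :
  (forall n, exists b, bm b (g_ n)) -> (forall n, L1 m (g_ n)) -> L1 m chi ->
  (forall x, 0 <= chi x <= 1) -> a @ \oo --> (0 : R) ->
  (forall n x, `|G x - g_ n x| <= a n * chi x) ->
  [/\ exists b, bm b G, L1 m G & forall n, \int[m]_x `|G x - g_ n x| <= a n * \int[m]_x chi x].
Proof.
move=> gb g1 chi1 chi01 a0 h.
have mg n : measurable_fun [set: X] (g_ n) by exact: L1_measurable.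
have habs n x : `|G x - g_ n x| <= `|a n|.
  have /andP[c0 c1] := chi01 x; apply: (le_trans (h n x)).
  apply: (le_trans (ler_norm _)); rewrite normrM (ger0_norm c0); exact: ler_piMr.
have mG : measurable_fun [set: X] G.
  apply: (measurable_cvgR mg) => x; apply/cvgrPdist_le => ep ep0.
  have [n hn] := cvg0_le a0 ep0; exists n => // k /= nk.
  exact: le_trans (habs k x) (hn k nk).
have G1 : L1 m G.
  have l1 : L1 m (fun x => a 0%N * chi x + `|g_ 0%N x|) by apply: L1D; [exact: L1Z|exact: L1_norm].
  apply: (L1_le mG l1) => x; have := ler_normD (G x - g_ 0%N x) (g_ 0%N x).
  rewrite subrK; have := h 0%N x; lra.
split => //.
- have [b [_ hb]] := gb 0%N; exists (`|a 0%N| + b); split => // x.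
  have := ler_normD (G x - g_ 0%N x) (g_ 0%N x); rewrite subrK.
  have := habs 0%N x; have := hb x; lra.
- move=> n; rewrite -intZ//; apply: le_int => //; last exact: L1Z.
  by apply: L1_norm; exact: L1B.
Qed.

Lemma le_cvg0 (R : realType) (a : nat -> R) (x C : R) : a @ \oo --> (0 : R) -> 0 <= C ->
  (forall n, x <= C * `|a n|) -> x <= 0.
Proof.
move=> a0 C0 h; rewrite leNgt; apply/negP => x0.
have d0 : 0 < x / (C + 1) / 2 by rewrite !divr_gt0// ltr_wpDl.
have [n /(_ n (leqnn n)) hn] := cvg0_le a0 d0.
have hx := h n; have C1 : 0 < C + 1 by lra.
have : C * `|a n| <= (C + 1) * (x / (C + 1) / 2).
  apply: (@le_trans _ _ ((C + 1) * `|a n|)); first by rewrite ler_wpM2r//; lra.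
  by apply: ler_wpM2l => //; lra.
rewrite (_ : (C + 1) * _ = x / 2); last by field; rewrite gt_eqF.
by lra.
Qed.

(** * Space translations and convolution with an integrable function *)

Section shV.
Variables (R : realType) (N : nat).
Local Notation V := 'rV[R]_N.
Local Notation lebN := (lebesgue_rV R N).

Definition shV (y x : V) : V := x + y.

Lemma measurable_shV : measurable_fun [set: V * V] (fun q => shV q.1 q.2).
Proof. by apply: measurable_addv; [exact: measurable_snd|exact: measurable_fst]. Qed.

Lemma mpres_shV y : mpres lebN lebN (shV y). Proof. exact: mpres_shift. Qed.

Lemma shVK y x : shV y (shV (- y) x) = x.
Proof. by rewrite /shV subrK. Qed.

(** Unlike a kernel, [h] may change sign: it will be the image of a mollifier under the operator. *)
Definition cvl (h : V -> R) (z : V * R -> R) := cv (@shX R N) lebN h z.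

Lemma cvl_L1 h c z p : L1 lebN h -> bm c z -> L1 lebN (fun y => h y * z (shX y p)).
Proof.
move=> h1 [mz zc]; apply: (L1_bm (a := c)) => //; split => //.
exact: (measurable_shl (@measurable_shX R N) p mz).
Qed.

Lemma measurable_cvl h z : measurable_fun [set: V] h -> measurable_fun [set: V * R] z ->
  measurable_fun [set: V * R] (cvl h z).
Proof.
move=> mh mz.
have := @measurable_int1 _ _ _ _ R lebN (fun q : (V * R) * V => h q.2 * z (shX q.2 q.1)).
apply; apply: measurable_funM.
- exact: (measurableT_comp mh measurable_snd).
- exact: (measurable_shr (@measurable_shX R N) mz).
Qed.

Lemma cvl_bm h c z : L1 lebN h -> bm c z -> bm (c * \int[lebN]_y `|h y|) (cvl h z).
Proof.
move=> h1 zc; split.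
  by apply: measurable_cvl; [exact: L1_measurable h1|case: zc].
move=> p; rewrite -intZ; last exact: L1_norm.
apply: le_norm_int_le; [exact: cvl_L1 h1 zc|by apply: L1Z; exact: L1_norm|].
by move=> y; rewrite normrM mulrC ler_wpM2r//; case: zc.
Qed.

Lemma cvlB h h' c z p : L1 lebN h -> L1 lebN h' -> bm c z ->
  cvl (fun y => h y - h' y) z p = cvl h z p - cvl h' z p.
Proof.
move=> h1 h1' zc; rewrite /cvl /cv -intB; [|exact: cvl_L1 h1 zc|exact: cvl_L1 h1' zc].
by apply: eq_Rintegral => y _; rewrite mulrBl.
Qed.

Lemma cvl_subr h c c' z z' p : L1 lebN h -> bm c z -> bm c' z' ->
  cvl h (fun q => z q - z' q) p = cvl h z p - cvl h z' p.
Proof.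
move=> h1 zc zc'; rewrite /cvl /cv -intB; [|exact: cvl_L1 h1 zc|exact: cvl_L1 h1 zc'].
by apply: eq_Rintegral => y _; rewrite mulrBr.
Qed.

End shV.

(** * Smooth mollifiers *)

Section mollifier.
Variables (R : realType) (N : nat).
Local Notation V := 'rV[R]_N.
Local Notation lebN := (lebesgue_rV R N).

Definition mollifier (eta : R) (rho : V -> R) : Prop :=
  [/\ smooth rho, kern lebN rho, \int[lebN]_y rho y = 1 & forall y, eta < `|y| -> rho y = 0].

Lemma flat1_le1 (x : R) : flat1 x <= 1.
Proof.
have [x0|x0] := leP x 0; first by rewrite flat1_le0.
rewrite /flat1 /flat x0 hornerC mul1r -expR0 ler_expR oppr_le0 invr_ge0; exact: ltW.
Qed.

Lemma mollifier_exists eta : 0 < eta -> exists rho, mollifier eta rho.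
Proof.
move=> eta0.
pose l (i : 'I_N) (w : V) : R := eta^-1 * w 0 i.
pose mo (w : V) : R := \prod_(i < N) bumpf (l i w).
have cl i : continuous (l i).
  move=> w; apply: (@continuous_comp _ _ _ (fun w : V => w 0 i) ( *%R eta^-1)).
    exact: coord_continuous.
  exact: mulrl_continuous.
have ll i x v h : l i (h *: v + x) = h * l i v + l i x.
  by rewrite /l !mxE; ring.
have smo : smooth mo by move=> k; apply: Ck_prod => i; exact: (smooth_bump (cl i) (ll i)).
have b01 (x : R) : 0 <= bumpf x <= 1.
  rewrite bump_ge0 /= /bumpf -[leRHS](mulr1 1).
  by apply: ler_pM; rewrite ?flat1_ge0 ?flat1_le1.
have mo0 w : 0 <= mo w by apply: prodr_ge0 => i _; exact: bump_ge0.
have mo1 w : mo w <= 1.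
  rewrite (_ : (1 : R) = \prod_(i < N) (1 : R)); last by rewrite big1.
  by apply: ler_prod => i _; exact: b01.
have moN w : mo (- w) = mo w.
  by apply: eq_bigr => i _; rewrite /l mxE mulrN bumpN.
(* In dimension 0 the empty product is 1 and not 0; but then w = 0, which the strict inequality of
   [mov2] rules out. *)
have mov w : eta <= `|w| -> mo w = 0 \/ N = 0%N.
  move=> ew; have [N0|N0] := eqVneq N 0%N; [by right|left].
  apply/eqP; rewrite /mo prodf_seq_eq0; apply/negPn/negP => /hasPn hN.
  have hi i : `|w 0 i| < eta.
    rewrite ltNge; apply/negP => wi; have := hN i (mem_index_enum _).
    rewrite /= bump0 ?eqxx// /l normrM normfV (gtr0_norm eta0).
    by rewrite mulrC ler_pdivlMr// mul1r.
  have : `|w| < eta; last by rewrite ltNge ew.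
  move: ew => _; rewrite /Num.norm /= mx_normrE.
  apply/bigmax_ltP; split => // -[i j] _ /=; by rewrite ord1.
have mov2 w : eta < `|w| -> mo w = 0.
  move=> ew; have [//|N0] := mov w (ltW ew).
  exfalso; move: ew; rewrite (_ : w = 0) ?normr0; first by rewrite ltNge ltW.
  by apply/rowP => -[i Hi]; exfalso; rewrite N0 in Hi.
have mmo : measurable_fun [set: V] mo.
  exact: continuous_measurable_rV (Ck_continuous (smo 0%N)).
have mo_1 : L1 lebN mo.
  apply: (L1_le mmo (ball_L1 (0 : V) (eta + 1))) => w; rewrite ger0_norm// indicE.
  have [wb|] := boolP (w \in _) => //=.
  rewrite notin_setE -ball_normE /= sub0r normrN => /negP; rewrite -leNgt => wb.
  by rewrite mov2//; lra.
have I0 : 0 < \int[lebN]_y mo y.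
  rewrite ltNge; apply/negP => Ile.
  have [A [mA A0 sA]] := int0_ae mo_1 mo0 Ile.
  pose B := [set x : V | forall i, (`]- eta, eta[%classic : set R) (x 0%R i)].
  have BA : B `<=` A.
    move=> w wB; apply: sA => /= m0.
    have : 0 < mo w; last by rewrite m0 ltxx.
    apply: prodr_gt0 => i _; apply: bump_gt0.
    have := wB i; rewrite /= in_itv /= -ltr_norml => wi.
    by rewrite /l normrM normfV (gtr0_norm eta0) mulrC ltr_pdivrMr// mul1r.
  have mB : measurable B.
    rewrite (_ : B = \bigcap_(i in [set: 'I_N]) ((fun x : V => x 0 i) @^-1` `]- eta, eta[%classic)).
      apply: fin_bigcap_measurable => // i _.
      by rewrite -[X in measurable X]setTI; apply: measurable_coor.
    by apply/seteqP; split => x /= h i => [_|]; exact: h.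
  have hBA : (lebN B <= lebN A)%E by apply: le_measure => //; rewrite inE.
  have hB : (0 < lebN B)%E.
    rewrite (lebesgue_rV_box (A := fun=> `]- eta, eta[%classic)) //.
    rewrite (eq_bigr (fun=> (eta + eta)%:E)); last first.
      by move=> i _; rewrite lebesgue_measure_itv /= lte_fin ifT ?opprK//; lra.
    by rewrite prodEFin lte_fin prodr_gt0// => i _; lra.
  by have /eqP := A0; rewrite gt_eqF//; exact: lt_le_trans hB hBA.
pose k := (\int[lebN]_y mo y)^-1.
have k0 : 0 < k by rewrite invr_gt0.
exists (fun w => k * mo w); split.
- by move=> n; apply: Ck_mul => //; exact: Ck_cst.
- split.
  + by move=> y; rewrite mulr_ge0// ltW.
  + exact: L1Z.
  + exact: mpres_opp.
  + by move=> y; rewrite moN.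
- by rewrite intZ// mulVf// gt_eqF.
- by move=> y ey; rewrite mov2// mulr0.
Qed.

End mollifier.

(** * The limit operator on mollifiers and the energy estimate for it *)

Section levy_limit.
Variables (R : realType) (N P : nat) (sigma : 'M[R]_(N, P)).
Local Notation V := 'rV[R]_N.
Local Notation lebN := (lebesgue_rV R N).
Variable mu : {measure set V -> \bar R}.
Variables (nu : nat -> {sigma_finite_measure set V -> \bar R}) (e : nat -> R) (c : R).
Hypothesis e0 : e @ \oo --> (0 : R).
Hypothesis knu : forall n, kern (nu n) (fun=> 1).
Hypothesis levyE : forall A r g n x, levy_nice sigma A r g ->
  `|levy_op sigma mu g x - \int[nu n]_z (g (x + z) - g x)| <=
  A * e n * \1_(ball (0 : V) (r + c)) x.

Definition rate n : R := \int[nu n]_y 1.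
Definition LV n (g : V -> R) (x : V) : R := cv (@shV R N) (nu n) (fun=> 1) g x - rate n * g x.
Definition LX n (f : V * R -> R) (p : V * R) : R :=
  cv (@shX R N) (nu n) (fun=> 1) f p - rate n * f p.

Let mV := @measurable_shV R N.
Let pV := @mpres_shV R N.
Let kV := @shVK R N.
Let mX := @measurable_shX R N.
Let pX := @mpres_shX R N.
Let kX := @shXK R N.

Lemma LVE n b g x : bm b g -> \int[nu n]_z (g (x + z) - g x) = LV n g x.
Proof.
move=> gb; have [_ n1 _ _] := knu n.
have g1 : L1 (nu n) (fun z => 1 * g (x + z)) by exact: (cv_L1y mV (knu n) x gb).
rewrite /LV /cv -int_Zr// -intB//; last exact: L1Zr.
by apply: eq_Rintegral => z _; rewrite !mul1r.
Qed.

Lemma LV_bm n b g : bm b g -> bm (rate n * b + `|rate n| * b) (LV n g).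
Proof. by move=> gb; apply: bmB; [exact: (cv_bm mV (knu n) gb)|exact: bmZ]. Qed.

Lemma LV_L1 n g : L1 lebN g -> L1 lebN (LV n g).
Proof. by move=> g1; apply: L1B; [exact: (cv_L1 mV pV (knu n) g1)|exact: L1Z]. Qed.

Lemma LX_bm n b g : bm b g -> bm (rate n * b + `|rate n| * b) (LX n g).
Proof. by move=> gb; apply: bmB; [exact: (cv_bm mX (knu n) gb)|exact: bmZ]. Qed.

Lemma LX_L1 n g : L1 (lebX R N) g -> L1 (lebX R N) (LX n g).
Proof. by move=> g1; apply: L1B; [exact: (cv_L1 mX pX (knu n) g1)|exact: L1Z]. Qed.

Lemma LX_slice n g p : LX n g p = LV n (fun y => g (y, p.2)) p.1.
Proof. by case: p. Qed.

Lemma test_moll T eta rho x0 t0 ep : mollifier eta rho -> 0 < ep -> 0 <= t0 -> t0 + ep < T ->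
  test_function T (fun p : V * R => rho (p.1 - x0) * step ((p.2 - t0) / ep)).
Proof.
move=> [srho _ _ rho0] ep0 t00 tT; split.
  move=> k; apply: Ck_mul.
    apply: (Ck_comp (l := fun p : V * R => p.1 - x0) (l0 := fun p : V * R => p.1)) => //.
      move=> p; have FF : Filter (nbhs p) by exact: nbhs_filter.
      have c1 : (fun p : V * R => p.1) @ p --> p.1 by exact: cvg_fst.
      have c2 : (fun p : V * R => x0) @ p --> x0 by exact: cvg_cst.
      exact: (cvgB c1 c2).
    by move=> x v h; rewrite /= addrA.
  apply: (@smooth_step R _ (fun w : V * R => (w.2 - t0) / ep) (fun w => w.2 / ep)).
    move=> p; have FF : Filter (nbhs p) by exact: nbhs_filter.
    have c1 : (fun p : V * R => p.2) @ p --> p.2 by exact: cvg_snd.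
    have c2 : (fun p : V * R => t0) @ p --> t0 by exact: cvg_cst.
    have c3 : (fun p : V * R => ep^-1) @ p --> ep^-1 by exact: cvg_cst.
    exact: (cvgM (cvgB c1 c2) c3).
  by move=> x v h /=; rewrite -[_ *: _]/(_ * _); ring.
pose B := [set y : V | `|y - x0| <= eta].
have cB : compact B.
  apply: bounded_closed_compact.
    exists (eta + `|x0|); split; first exact: num_real.
    move=> M hM y yB; apply: (le_trans _ (ltW hM)).
    have := ler_normD (y - x0) x0; rewrite subrK => h.
    by apply: (le_trans h); rewrite lerD2r.
  rewrite (_ : B = (fun y : V => `|y - x0|) @^-1` [set r : R | r <= eta])//.
  apply: closed_comp; last exact: closed_le.
  move=> y _; have FF : Filter (nbhs y) by exact: nbhs_filter.
  have c1 : (fun y : V => y) @ y --> y by exact: cvg_id.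
  have c2 : (fun y : V => x0) @ y --> x0 by exact: cvg_cst.
  exact: (cvg_norm (cvgB c1 c2)).
exists (B `*` `[0, t0 + ep]%classic); split.
- by apply: compact_setX => //; exact: segment_compact.
- move=> [y s] [_ /=]; rewrite !in_itv /= => /andP[s0 st]; split => //=.
  by rewrite s0 (le_lt_trans st).
- move=> [y s] [_ /=]; rewrite in_itv /= => /andP[s0 sT] nK.
  have [ys|ys] := leP `|y - x0| eta; last by rewrite rho0// mul0r.
  have [st|st] := leP s (t0 + ep); first by exfalso; apply: nK; split => //=; rewrite in_itv /= s0 st.
  by rewrite step_ge1 ?mulr0// ler_pdivlMr//; lra.
Qed.

Section one_mollifier.
Variables (eta : R) (rho : V -> R).
Hypothesis mrho : mollifier eta rho.
Let krho : kern lebN rho. Proof. by case: mrho. Qed.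
Let rho1 : L1 lebN rho. Proof. by case: krho. Qed.
Definition lrho := levy_op sigma mu rho.

(** A mollifier is the slice at time 0 of a test function on [0,1), here with t0 = 0 and ep = 1/2,
    so [test_slices] supplies its bounds. *)
Lemma moll_nice : exists A r, 0 < A /\ levy_nice sigma A r rho.
Proof.
have h2 : (0 : R) + 2^-1 < 1 by lra.
have h3 : (0 : R) < 2^-1 by lra.
have [A [r [A0 _ /(_ 0) h _]]] := test_slices sigma (test_moll 0 mrho h3 (lexx 0) h2).
exists A, r; split => //; rewrite (_ : rho = fun y => rho (y - 0) * step ((0 - 0) / 2^-1)).
  by apply: h; rewrite lexx ltr01.
by apply/funext => y; rewrite subr0 subrr mul0r step_le0// mulr1.
Qed.

Lemma moll_levy : exists A B C, [/\ bm A rho, bm B lrho, L1 lebN lrho, 0 <= C &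
  forall n, \int[lebN]_y `|lrho y - LV n rho y| <= C * `|e n|].
Proof.
have [A [r [A0 nA]]] := moll_nice.
have rb : bm A rho by split; [exact: L1_measurable rho1|case: nA].
have chi1 := ball_L1 (0 : V) (r + c).
have [||||||B l1 hl] := @unif_limit _ V R lebN (fun n => LV n rho) lrho (\1_(ball (0 : V) (r + c))) (fun n => A * e n).
- by move=> n; exists (rate n * A + `|rate n| * A); exact: LV_bm.
- by move=> n; exact: LV_L1.
- exact: chi1.
- by move=> x; rewrite indicE; case: (_ \in _) => /=; rewrite lexx ler01.
- by rewrite -(mulr0 A); apply: cvgM => //; exact: cvg_cst.
- by move=> n x; rewrite -(LVE n x rb); exact: levyE.
have [B' B'b] := B.
exists A, B', (A * \int[lebN]_x \1_(ball (0 : V) (r + c)) x); split => //.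
  by apply: mulr_ge0; [exact: ltW|apply: int_ge0 => x; rewrite indicE].
move=> n; apply: (le_trans (hl n)); rewrite mulrAC; apply: ler_wpM2l; last exact: ler_norm.
by apply: mulr_ge0; [exact: ltW|apply: int_ge0 => x; rewrite indicE].
Qed.

(** Linearity and translation invariance hold for the jump operators of [nu n] and pass to [levy_op]
    as n tends to infinity. *)
Lemma levy_tensor T x0 t0 ep s x : 0 < ep -> 0 <= t0 -> t0 + ep < T -> 0 <= s < T ->
  levy_op sigma mu (fun y => rho (y - x0) * step ((s - t0) / ep)) x =
  step ((s - t0) / ep) * lrho (x - x0).
Proof.
move=> ep0 t00 tT sT; set th := step _.
have [A [r [A0 _ /(_ s sT) hA _]]] := test_slices sigma (test_moll x0 mrho ep0 t00 tT).
have [A' [r' [A'0 nA']]] := moll_nice.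
have rb : bm A' rho by split; [exact: L1_measurable rho1|case: nA'].
have ind01 (B : set V) y : `|\1_B y : R| <= 1.
  by rewrite indicE; case: (_ \in _) => /=; rewrite ?normr1 ?normr0.
have th0 : 0 <= th by have /andP[] := step_bound ((s - t0) / ep).
apply/eqP; rewrite -subr_eq0 -normr_le0; apply/(le_cvg0 e0 (C := A + th * A')).
  by apply: addr_ge0; [exact: ltW|apply: mulr_ge0 => //; exact: ltW].
move=> n; have h1 := levyE n x hA; have h2 := levyE n (x - x0) nA'.
have eqI : \int[nu n]_z (rho (x + z - x0) * th - rho (x - x0) * th) =
    th * \int[nu n]_z (rho (x - x0 + z) - rho (x - x0)).
  rewrite -intZ.
    by apply: eq_Rintegral => z _; rewrite addrAC; ring.
  have [_ n1 _ _] := knu n.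
  have g1 : L1 (nu n) (fun z => 1 * rho (x - x0 + z)) by exact: (cv_L1y mV (knu n) _ rb).
  by apply: L1_eq (L1B g1 (L1Zr (rho (x - x0)) n1)) => z; rewrite !mul1r.
move: h1; rewrite eqI; move: h2.
set a := levy_op _ _ _ (x - x0); set b := levy_op _ _ _ x; set q := \int[_]_z _ => h2 h1.
rewrite (_ : b - th * lrho (x - x0) = (b - th * q) - th * (a - q)); last by rewrite /a /lrho; ring.
apply: (le_trans (ler_normB _ _)); rewrite mulrDl lerD//.
  apply: (le_trans h1); rewrite (le_trans (ler_norm _))// !normrM (gtr0_norm A0).
  by apply: ler_piMr => //; apply: mulr_ge0 => //; exact: ltW.
rewrite normrM (ger0_norm th0) -mulrA ler_wpM2l//.
apply: (le_trans h2); rewrite (le_trans (ler_norm _))// !normrM (gtr0_norm A'0).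
by apply: ler_piMr => //; apply: mulr_ge0 => //; exact: ltW.
Qed.

(** The operator moves onto the mollifier, where it acts on a smooth function and has a limit in L^1
    as n grows; z only needs to be bounded. *)
Lemma cvl_LV n A b z p : bm A rho -> bm b z ->
  cvl (LV n rho) z p = LX n (cvl rho z) p.
Proof.
move=> rA zb; pose zp y := z (shX y p).
have zpb : bm b zp.
  case: zb => mz zb; split; [exact: (measurable_shl mX p mz)|by move=> y; exact: zb].
have K1 : L1 lebN (cv (@shV R N) (nu n) (fun=> 1) rho) := cv_L1 mV pV (knu n) rho1.
rewrite /LX /cvl -(cv_comm mX (@shXC R N) p krho (knu n) zb).
have -> : cv (@shX R N) lebN rho (cv (@shX R N) (nu n) (fun=> 1) z) p =
    \int[lebN]_y (rho y * cv (@shV R N) (nu n) (fun=> 1) zp y).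
  apply: eq_Rintegral => y _; congr (_ * _); apply: eq_Rintegral => v _.
  by rewrite /zp /shX /shV /= addrA.
rewrite (cv_sym mV pV kV (knu n) rA zpb rho1).
have l2 : L1 lebN (fun y => rho y * zp y) by exact: (cvl_L1 p rho1 zb).
transitivity (\int[lebN]_y (cv (@shV R N) (nu n) (fun=> 1) rho y * zp y) -
  rate n * \int[lebN]_y (rho y * zp y)); last by [].
rewrite -intZ// -intB; [|exact: L1_bm K1 zpb|exact: L1Z].
by apply: eq_Rintegral => y _; rewrite /LV; move: (cv _ _ _ _ y) => k; rewrite /zp; ring.
Qed.

(* The finite jump measures nu n only enter through the error term, so that
   they can be sent to the limit in the estimate. *)
Lemma core_levy T Z0 kappa s eps z w W r :
  0 < T -> 0 < Z0 -> 0 < s -> 0 <= kappa -> bm Z0 z -> bm eps r ->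
  L1 (lebX R N) w -> L1 (lebX R N) W -> (forall p, 0 <= z p * w p) ->
  (forall p, `|z p| <= kappa \/ s * `|z p| <= z p * w p) ->
  W = J T (fun p => cvl lrho z p + r p) ->
  \int[lebX R N]_p (weight T p * (z p * w p)) <=
  2 * T * (Z0 * \int[lebX R N]_p `|cvl rho W p - w p| +
           (kappa + eps * T * Z0 / s) * \int[lebX R N]_p `|W p|).
Proof.
move=> T0 Z00 s0 ka0 zb rb w1 W1 zw zs WE.
have [A [B [C [rA lB l1 C0 hC]]]] := moll_levy.
have intrho : \int[lebN]_y rho y = 1 by case: mrho.
set I1 := \int[_]_p `|cvl rho W p - w p|; set I2 := \int[_]_p `|W p|.
have I20 : 0 <= I2 by exact: int_ge0.
rewrite -subr_le0; apply: (le_cvg0 (C := 2 * T * (Z0 * C * T * Z0 / s * I2)) e0).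
  by rewrite !mulr_ge0// ?invr_ge0 ltW.
move=> n.
have Lr1 : L1 lebN (LV n rho) by exact: LV_L1.
(* The difference between the operators on the mollifier is charged to the remainder, where it is
   small in sup norm because z is bounded. *)
pose r' p := r p + cvl (fun y => lrho y - LV n rho y) z p.
have r'b : bm (eps + Z0 * (C * `|e n|)) r'.
  apply: (@bm_le _ _ _ (eps + Z0 * \int[lebN]_y `|lrho y - LV n rho y|)).
    by rewrite lerD2l ler_wpM2l// ltW.
  by apply: bmD => //; apply: cvl_bm => //; exact: L1B.
have WE' : W = J T (fun p => cv (@shX R N) (nu n) (fun=> 1) (cv (@shX R N) lebN rho z) p -
    \int[nu n]_y 1 * cv (@shX R N) lebN rho z p + r' p).
  rewrite WE; congr (J T _); apply/funext => p.
  have := cvl_LV n p rA zb; rewrite /LX /rate /cvl => hLV.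
  by rewrite -[X in X + r' p]hLV /r' (cvlB p l1 Lr1 zb) /cvl; move: (cv _ _ lrho z p) (cv _ _ (LV n rho) z p) => a b; ring.
have h := core_estimate (knu n) krho intrho T0 Z00 s0 ka0 zb r'b w1 W1 zw zs WE'.
rewrite -/I2 -/(cvl rho W) in h; rewrite lerBlDr; apply: (le_trans h).
rewrite le_eqVlt; apply/orP; left; apply/eqP; rewrite /I1 /cvl; move: (\int[_]_p `|_|) => I; ring.
Qed.

End one_mollifier.
End levy_limit.

Lemma mpres_ereal d1 d2 (X : measurableType d1) (Y : measurableType d2) (R : realType)
    (m1 : {measure set X -> \bar R}) (m2 : {measure set Y -> \bar R}) (f : X -> Y)
    (F : Y -> \bar R) : mpres m1 m2 f -> measurable_fun [set: Y] F ->
  (\int[m1]_x F (f x) = \int[m2]_y F y)%E.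
Proof.
move=> fP mF; rewrite integralE [RHS]integralE; congr (_ - _)%E.
- rewrite -(mpres_ge0 fP); [|exact: measurable_funepos|by []].
  by apply: eq_integral => x _; rewrite !funeposE.
- rewrite -(mpres_ge0 fP); [|exact: measurable_funeneg|by []].
  by apply: eq_integral => x _; rewrite !funenegE.
Qed.

(** * The fundamental theorem of calculus for [prim] *)

Section fundamental_theorem.
Variable R : realType.

Lemma ftc_prim (f F : R -> R) t : continuous f ->
  (forall s, derivable F s 1 /\ derive1 F s = f s) -> 0 <= t -> prim f t = F t - F 0.
Proof.
move=> cf dF; rewrite le_eqVlt => /orP[/eqP <-|t0]; first by rewrite prim_le0// subrr.
have mf : measurable_fun [set: R] f by exact: continuous_measurable_fun.
have cF s : {for s, continuous F}.
  by apply: differentiable_continuous; apply/derivable1_diffP; case: (dF s).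
have h := @continuous_FTC2 R f F 0 t t0.
have {h} h : (\int[@lebesgue_measure R]_(x in `[0%R, t]) (f x)%:E = (F t)%:E - (F 0)%:E)%E.
  apply: h.
  - exact: continuous_subspaceT.
  - split; first by move=> x _; case: (dF x).
    + by apply: cvg_at_right_filter; exact: cF.
    + by apply: cvg_at_left_filter; exact: cF.
  - by move=> x _; case: (dF x).
rewrite /prim /Rintegral -(mpres_eint (@mpres_lebR R)); last first.
  by apply: measurable_funM => //; apply: measurable_boolR; exact: measurable_itvb.
transitivity (fine ((F t)%:E - (F 0)%:E)%E); last by [].
congr fine; rewrite -h -integral_itv_obnd_cbnd; last by apply: measurable_funTS; exact/measurable_EFinP.
rewrite -integral_itv_bndo_bndc; last by apply: measurable_funTS; exact/measurable_EFinP.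
rewrite [RHS]integral_mkcond; apply: eq_integral => x _; rewrite patchE mem_setE in_itv /=.
by case: (0 < x < t); rewrite ?mul1r ?mul0r.
Qed.

End fundamental_theorem.

(** * Integrals over the slab and pairing with test functions *)

Section space_time.
Variables (R : realType) (N : nat) (T : R).
Local Notation V := 'rV[R]_N.
Local Notation lebN := (lebesgue_rV R N).
Local Notation M := (lebX R N).
Local Notation leb1 := (@lebesgue_measure R).

Definition slab (p : V * R) : R := (0 < p.2 < T)%R%:R.

Lemma slab_bm : bm 1 slab.
Proof. by apply: boolR_bm; apply: measurable_itvb. Qed.

Lemma slab_QT p : slab p = \1_(QT T) p.
Proof.
rewrite indicE /slab; congr (_%:R); congr nat_of_bool; apply/idP/idP.
  by move=> h; rewrite inE; split => //=; rewrite in_itv.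
by rewrite inE => -[_] /=; rewrite in_itv.
Qed.

Lemma mpres_QX : mpres (lebN \x leb1)%E M id.
Proof.
have h := mpres_prod (mpres_id lebN) (mpres_lebR R).
by rewrite (_ : id = fun p : V * R => (id p.1, id p.2)); [exact: h|apply/funext => -[]].
Qed.

Lemma mpres_XQ : mpres M (lebN \x leb1)%E id.
Proof.
have h := mpres_prod (mpres_id lebN) (mpres_lebR_inv R).
by rewrite (_ : id = fun p : V * R => (id p.1, id p.2)); [exact: h|apply/funext => -[]].
Qed.

Lemma measurable_QT : measurable (QT T : set (V * R)).
Proof. exact: measurableX. Qed.

Lemma slab_patch (g : V * R -> R) :
  ((EFin \o g) \_ (QT T)) = EFin \o (fun p => slab p * g p).
Proof.
apply/funext => p; rewrite patchE /= slab_QT indicE.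
by case: (p \in QT T); rewrite ?mul1r ?mul0r.
Qed.

Lemma QT_L1 (g : V * R -> R) :
  (lebN \x leb1)%E.-integrable (QT T) (EFin \o g) <-> L1 M (fun p => slab p * g p).
Proof.
have h := integrable_mkcond (mu := (lebN \x leb1)%E) (EFin \o g) measurable_QT.
rewrite slab_patch in h; split.
  by move=> /h h2; exact: (mpres_L1 mpres_XQ h2).
by move=> h2; apply/h; exact: (mpres_L1 mpres_QX h2).
Qed.

Lemma slab_measurable (g : V * R -> R) : measurable_fun (QT T) g ->
  measurable_fun [set: V * R] (fun p => slab p * g p).
Proof.
move=> mg; apply/measurable_EFinP.
have := (measurable_restrictT (EFin \o g) measurable_QT).1.
rewrite slab_patch; apply; exact/measurable_EFinP.
Qed.

(** Converts the iterated extended integral of the definition of a solution into one real integral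
    over space-time. They can differ only at times whose slice is not integrable, which form a null
    set. *)
Lemma weakE (G F : V * R -> R) : L1 M F -> (forall p, F p = slab p * G p) ->
  (\int[leb1]_(t in `]0%R, T[) \int[lebN]_x (G (x, t))%:E = (\int[M]_p F p)%:E)%E.
Proof.
move=> F1 FG.
have mF := L1_measurable F1.
transitivity (\int[lebR R]_t (\int[lebN]_x F (x, t))%:E)%E; last first.
  by rewrite -EFin_int; [rewrite intX2|exact: L1X_int2].
rewrite integral_mkcond /=.
have mpatch : measurable_fun [set: R] ((fun t => (\int[lebN]_x (G (x, t))%:E)%E) \_ `]0%R, T[).
  rewrite (_ : _ \_ _ = fun t => (\int[lebN]_x (F (x, t))%:E)%E).
    exact: (measurable_eint2 _ mF).
  apply/funext => t; rewrite patchE mem_setE in_itv /=; case: ifPn => h.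
    by apply: eq_integral => x _; rewrite FG /slab /= h mul1r.
  by rewrite integral0_eq// => x _; rewrite FG /slab /= (negbTE h) mul0r.
transitivity (\int[lebR R]_t ((fun t => (\int[lebN]_x (G (x, t))%:E)%E) \_ `]0%R, T[) t)%E.
  apply: (mpres_ereal (@mpres_lebR R)); exact: mpatch.
apply: ae_eq_integral => //.
- apply/measurable_EFinP; exact: L1_measurable (L1X_int2 F1).
have := L1X_ae2 F1; apply: filterS => t Ft _.
rewrite patchE mem_setE in_itv /= EFin_int//; case: ifPn => h.
  by apply: eq_integral => x _; rewrite FG /slab /= h mul1r.
by rewrite integral0_eq// => x _; rewrite FG /slab /= (negbTE h) mul0r.
Qed.

Section test.
Variable psi : V * R -> R.
Hypotheses (T0 : 0 < T) (tpsi : test_function T psi).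
Definition dtest (p : V * R) : R := slab p * 'D_((0, 1) : V * R) psi p.

Let k1 : Ck 1 psi. Proof. by case: tpsi => h _; exact: (h 1%N). Qed.
Let cpsi : continuous psi. Proof. exact: Ck_continuous k1. Qed.

Lemma test_end x : psi (x, T) = 0.
Proof.
have [_ [K [cK KT vK]]] := tpsi.
by apply: (vanish_end cK KT) => // p pT; apply: vK; split => //; rewrite /= in_itv.
Qed.

Lemma dtest_bm : exists A r, [/\ 0 < A, 0 < r, bm A dtest & forall p, `|dtest p| <= A * (\1_(ball (0 : V) r) p.1 * slab p)].
Proof.
have [A [r [A0 r0 _ h]]] := test_slices (0 : 'M[R]_(N, 0)) tpsi.
have md : measurable_fun [set: V * R] dtest.
  apply: measurable_funM; first by case: slab_bm.
  exact: continuous_measurable_VR (Ck_continuous (k := 0) (Ck_derive _ k1)).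
have hb p : `|dtest p| <= A * (\1_(ball (0 : V) r) p.1 * slab p).
  case: p => x t; rewrite /dtest /slab /=; have [tT|_] := boolP (0 < t < T); last first.
    by rewrite mul0r !mulr0 normr0.
  have [h1 h2] := h x t tT; rewrite mul1r mulr1 indicE.
  have [|] := boolP (x \in (ball (0 : V) r : set V)); first by rewrite mulr1.
  rewrite notin_setE -ball_normE /= sub0r normrN => /negP; rewrite -leNgt => xr.
  by rewrite h2// normr0 mulr0.
exists A, r; split => //; split => // p; apply: (le_trans (hb p)).
rewrite ler_piMr ?(ltW A0)// indicE /slab.
by case: (_ \in _); case: (0 < _ < _); rewrite /= ?mulr1 ?mulr0 ?lexx ?ler01.
Qed.

Lemma dtest_L1 : L1 M dtest.
Proof.
have [A [r [_ _ [md _] h]]] := dtest_bm.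
apply: (L1_le md (L1Z A (L1X_tensor (ball_L1 (0 : V) r) (itvb_L1 0 T)))) => p; exact: h.
Qed.

Lemma test_prim x t : 0 <= t <= T -> prim (fun s => dtest (x, s)) t = psi (x, t) - psi (x, 0).
Proof.
move=> /andP[t0 tT].
have mD : measurable_fun [set: R] (fun s => 'D_((0, 1) : V * R) psi (x, s)).
  have := continuous_measurable_VR (Ck_continuous (k := 0) (Ck_derive ((0, 1) : V * R) k1)).
  exact: measurable_slice1.
rewrite /dtest /slab /=.
rewrite (@prim_is_L1 R (fun s => 'D_((0, 1) : V * R) psi (x, s)) T mD) //; last first.
  have [A [r [_ _ [md hA] _]]] := dtest_bm.
  apply: (L1_le _ (L1Z A (itvb_L1 0 T))) => [|s].
    exact: (measurable_slice1 (F := dtest) x md).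
  have := hA (x, s); rewrite /dtest /slab /=; case: (0 < s < T); rewrite ?mul1r ?mulr1 ?mul0r ?mulr0//.
  by rewrite normr0.
apply: (ftc_prim (F := fun s => psi (x, s))) => //.
  move=> s; have h2 := Ck_continuous (k := 0) (Ck_derive ((0, 1) : V * R) k1).
  exact: (cvg_comp _ _ (@pair_continuousr R N x s) (h2 (x, s))).
by move=> s; exact: D_time.
Qed.

Lemma test_bounded : exists B, forall p, 0 < p.2 < T -> `|psi p| <= B.
Proof.
have [_ [K [cK KT vK]]] := tpsi.
have vp : vanish T K psi by move=> p pT; apply: vK; split => //; rewrite /= in_itv.
have [B B0 hB] := vanish_bound cK cpsi vp.
by exists B => s /andP[s0 sT]; apply: hB; rewrite (ltW s0).
Qed.

Lemma test_slab_bm : exists B, bm B (fun p => slab p * psi p).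
Proof.
have [B hB] := test_bounded; exists `|B|; split.
  by apply: measurable_funM; [case: slab_bm|exact: continuous_measurable_VR].
move=> p; rewrite /slab; have [/hB h|_] := boolP (0 < p.2 < T).
  by rewrite mul1r (le_trans h)// ler_norm.
by rewrite mul0r normr0.
Qed.

(** Integration by parts in time. The boundary term at T vanishes with psi and the one at 0 with the
    primitive. *)
Lemma prim_pair1 (g : R -> R) x : L1 (lebR R) g ->
  \int[lebR R]_s (prim g s * dtest (x, s)) = - \int[lebR R]_s ((0 < s < T)%R%:R * (g s * psi (x, s))).
Proof.
move=> g1; have [A [r [_ _ [md hA] _]]] := dtest_bm.
have b1 : L1 (lebR R) (fun s => dtest (x, s)).
  apply: (L1_le _ (L1Z A (itvb_L1 0 T))) => [|s].
    exact: (measurable_slice1 (F := dtest) x md).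
  have := hA (x, s); rewrite /dtest /slab /=; case: (0 < s < T); rewrite ?mul1r ?mulr1 ?mul0r ?mulr0//.
  by rewrite normr0.
have := prim_mul T g1 b1; rewrite test_prim ?lexx ?andbT ?ltW// test_end sub0r.
move=> pm.
have gT : L1 (lebR R) (fun s => (0 < s < T)%R%:R * g s) by exact: prim_L1.
have mpsi : measurable_fun [set: R] (fun s => psi (x, s)).
  exact: (measurable_slice1 (F := psi) x (continuous_measurable_VR cpsi)).
have [B hB] := test_bounded.
have gp1 : L1 (lebR R) (fun s => (0 < s < T)%R%:R * (g s * psi (x, s))).
  apply: (L1_le _ (L1Z B (L1_norm gT))) => [|s].
    by apply: measurable_funM; [apply: measurable_boolR; exact: measurable_itvb|apply: measurable_funM => //; exact: L1_measurable g1].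
  have := hB (x, s); rewrite /=; case: (0 < s < T) => [/(_ isT) h|_]; last by rewrite !mul0r normr0 mulr0.
  by rewrite !mul1r normrM mulrC ler_wpM2r.
have pd1 : L1 (lebR R) (fun s => prim g s * dtest (x, s)).
  have pb : bm (\int[lebR R]_s `|g s|) (prim g).
    by split; [exact: measurable_prim (L1_measurable g1)|move=> t; exact: prim_abs].
  exact: bm_L1 pb b1.
have pE : prim (fun s => g s * prim (fun s => dtest (x, s)) s + prim g s * dtest (x, s)) T =
    \int[lebR R]_s ((0 < s < T)%R%:R * (g s * psi (x, s))) - psi (x, 0) * prim g T +
    \int[lebR R]_s (prim g s * dtest (x, s)).
  rewrite -[prim g T]/(\int[lebR R]_s ((0 < s < T)%R%:R * g s)).
  rewrite -intZ// -intB//; last exact: L1Z.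
  rewrite -intD//; last by apply: L1B => //; exact: L1Z.
  apply: eq_Rintegral => s _; have [sT|sT] := boolP (0 < s < T).
    rewrite test_prim; first by rewrite !mul1r; ring.
    by move: sT => /andP[/ltW -> /ltW ->].
  have d0 : dtest (x, s) = 0 by rewrite /dtest /slab /= (negbTE sT) mul0r.
  by rewrite d0 /= !mul0r !mulr0 subr0 addr0.
rewrite pE in pm; move: pm.
move: (\int[_]_s _) (\int[_]_s _) (prim g T) (psi (x, 0)) => a b c d.
by rewrite (mulrC c) mulNr; move: (d * c) => k h; lra.
Qed.

Lemma prim_pair (g : V * R -> R) : L1 M g -> (forall x, L1 (lebR R) (fun s => g (x, s))) ->
  [/\ L1 M (fun p => prim (fun s => g (p.1, s)) p.2 * dtest p),
     L1 M (fun p => g p * (slab p * psi p)) &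
     \int[M]_p (prim (fun s => g (p.1, s)) p.2 * dtest p) = - \int[M]_p (g p * (slab p * psi p))].
Proof.
move=> g1 gx; have mg := L1_measurable g1.
have [A [r [A0 _ [md hA] _]]] := dtest_bm.
have h1 : L1 M (fun p => prim (fun s => g (p.1, s)) p.2 * dtest p).
  have G1 := L1X_int1 (L1_norm g1).
  apply: (L1_le _ (L1Z A (L1X_tensor G1 (itvb_L1 0 T)))) => [|[x t]].
    by apply: measurable_funM => //; exact: measurable_primX.
  rewrite /= normrM; have hp := prim_abs t (gx x).
  have hd : `|dtest (x, t)| <= A * (0 < t < T)%R%:R.
    have := hA (x, t); rewrite /dtest /slab /=; case: (0 < t < T); rewrite ?mul1r ?mulr1 ?mul0r ?mulr0//.
    by rewrite normr0.
  by rewrite mulrCA; apply: ler_pM.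
have [B hB] := test_slab_bm.
have h2 : L1 M (fun p => g p * (slab p * psi p)) by exact: L1_bm g1 hB.
split => //; rewrite (intX1 h1) (intX1 h2) -intN; last exact: (L1X_int1 h2).
apply: eq_Rintegral => x _ /=; rewrite (prim_pair1 x (gx x)); congr (- _).
by apply: eq_Rintegral => s _; rewrite /slab /=; ring.
Qed.

End test.
End space_time.

(** * The operator applied to test functions *)

Section test_levy_limit.
Variables (R : realType) (N P : nat) (sigma : 'M[R]_(N, P)).
Local Notation V := 'rV[R]_N.
Local Notation lebN := (lebesgue_rV R N).
Local Notation M := (lebX R N).
Variable mu : {measure set V -> \bar R}.
Variables (nu : nat -> {sigma_finite_measure set V -> \bar R}) (e : nat -> R) (c : R).
Hypothesis e0 : e @ \oo --> (0 : R).
Hypothesis knu : forall n, kern (nu n) (fun=> 1).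
Hypothesis levyE : forall A r g n x, levy_nice sigma A r g ->
  `|levy_op sigma mu g x - \int[nu n]_z (g (x + z) - g x)| <=
  A * e n * \1_(ball (0 : V) (r + c)) x.
Variables (T : R) (psi : V * R -> R).
Hypotheses (T0 : 0 < T) (tpsi : test_function T psi).

Definition ltest (p : V * R) : R := slab T p * levy_op sigma mu (fun y => psi (y, p.2)) p.1.

Lemma test_levy : exists A B C, [/\ bm A (fun p => slab T p * psi p),
  L1 M (fun p => slab T p * psi p), bm B ltest, L1 M ltest & 0 <= C /\
  forall n, \int[M]_p `|ltest p - LX nu n (fun p => slab T p * psi p) p| <= C * `|e n|].
Proof.
have [A [r [A0 r0 hA _]]] := test_slices sigma tpsi.
pose sp (p : V * R) := slab T p * psi p.
have mpsi : measurable_fun [set: V * R] psi.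
  by apply: continuous_measurable_VR; case: tpsi => h _; exact: (Ck_continuous (h 1%N)).
have spb : bm A sp.
  split; first by apply: measurable_funM => //; case: (slab_bm N T).
  move=> [x t]; rewrite /sp /slab /=; have [/andP[t0 tT]|_] := boolP (0 < t < T).
    by rewrite mul1r; have [|_ _ h _ _] := hA t; [rewrite ltW|exact: h].
  by rewrite mul0r normr0 ltW.
have chi1 := L1X_tensor (ball_L1 (0 : V) (r + c)) (itvb_L1 0 T).
have sp1 : L1 M sp.
  have h1 := L1X_tensor (ball_L1 (0 : V) r) (itvb_L1 0 T).
  apply: (L1_le _ (L1Z A h1)) => [|[x t]]; first by case: spb.
  rewrite /sp /slab /=; have [/andP[t0 tT]|_] := boolP (0 < t < T); last first.
    by rewrite mul0r !mulr0 normr0.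
  rewrite mul1r mulr1 indicE; have [|_ h2 h _ _] := hA t; first by rewrite ltW.
  have [_|] := boolP (x \in (ball (0 : V) r : set V)); first by rewrite mulr1; exact: h.
  rewrite notin_setE -ball_normE /= sub0r normrN => /negP; rewrite -leNgt => xr.
  by rewrite h2// normr0 mulr0.
have [||||||[B Bb] l1 hl] := @unif_limit _ (V * R)%type R M (fun n => LX nu n sp) ltest
    (fun p => \1_(ball (0 : V) (r + c)) p.1 * (0 < p.2 < T)%R%:R) (fun n => A * e n).
- by move=> n; exists (rate nu n * A + `|rate nu n| * A); exact: LX_bm.
- by move=> n; exact: LX_L1.
- exact: chi1.
- by move=> p; rewrite indicE; case: (_ \in _); case: (_ < _ < _); rewrite /= ?mulr1 ?mulr0 ?lexx ?ler01.
- by rewrite -(mulr0 A); apply: cvgM => //; exact: cvg_cst.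
- move=> n [x t]; rewrite LX_slice /ltest /=.
  have [/andP[t0 tT]|nt] := boolP (0 < t < T).
    have t0T : 0 <= t < T by rewrite ltW.
    have [kg _ hb _ _] := hA t t0T.
    have gb : bm A (fun y => psi (y, t)).
      by split => //; exact: continuous_measurable_rV (Ck_continuous kg).
    rewrite (_ : (fun y => sp (y, t)) = fun y => psi (y, t)); last first.
      by apply/funext => y; rewrite /sp /slab /= t0 tT mul1r.
    rewrite /slab /= t0 tT mul1r mulr1 -(LVE knu n x gb); exact: (levyE n x (hA t t0T)).
  rewrite (_ : (fun y => sp (y, t)) = fun=> 0); last first.
    by apply/funext => y; rewrite /sp /slab /= (negbTE nt) mul0r.
  rewrite /slab /= (negbTE nt) mul0r !mulr0 /LV /cv.
  under eq_Rintegral do rewrite mulr0.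
  by rewrite int0 mulr0 !subrr normr0.
have I0 : 0 <= \int[M]_p (\1_(ball (0 : V) (r + c)) p.1 * (0 < p.2 < T)%R%:R : R).
  by apply: int_ge0 => p; rewrite indicE mulr_ge0.
exists A, B, (A * \int[M]_p (\1_(ball (0 : V) (r + c)) p.1 * (0 < p.2 < T)%R%:R)); split => //; split.
  by apply: mulr_ge0 => //; exact: ltW.
move=> n; apply: (le_trans (hl n)); rewrite mulrAC; apply: ler_wpM2l; last exact: ler_norm.
by apply: mulr_ge0 => //; exact: ltW.
Qed.

End test_levy_limit.

Section almost_everywhere.
Context d (T : measurableType d) (R : realType) (m : {measure set T -> \bar R}).
Implicit Types f g : T -> R.

Lemma eq_int_ae f g : measurable_fun [set: T] f -> measurable_fun [set: T] g ->
  {ae m, forall x, f x = g x} -> \int[m]_x f x = \int[m]_x g x.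
Proof.
move=> mf mg h; congr fine; apply: ae_eq_integral => //; try exact/measurable_EFinP.
by apply: filterS h => x /= -> .
Qed.

Lemma le_int_ae f g : L1 m f -> L1 m g -> {ae m, forall x, f x <= g x} ->
  \int[m]_x f x <= \int[m]_x g x.
Proof.
move=> f1 g1 h; have mf := L1_measurable f1; have mg := L1_measurable g1.
have mm : measurable_fun [set: T] (fun x => Num.min (f x) (g x)) by exact: measurable_minr.
have m1 : L1 m (fun x => Num.min (f x) (g x)).
  apply: (L1_le mm (L1D (L1_norm f1) (L1_norm g1))) => x.
  by rewrite minEle; case: ifP => _; rewrite ?lerDl ?lerDr.
rewrite (eq_int_ae mf mm).
  by apply: le_int => // x; rewrite ge_min lexx orbT.
by apply: filterS h => x /min_l ->.
Qed.

End almost_everywhere.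

(** * The time cut-off as an approximate Dirac mass *)

Section decreasing_step.
Variable R : realType.
Implicit Types x y : R.

Lemma flat1_le x y : x <= y -> flat1 x <= flat1 y.
Proof.
move=> xy; have [x0|x0] := leP x 0; first by rewrite (flat1_le0 x0) flat1_ge0.
have y0 : 0 < y by exact: lt_le_trans xy.
rewrite /flat1 /flat x0 y0 !hornerC !mul1r ler_expR lerN2.
by rewrite lef_pV2.
Qed.

Lemma step_le x y : x <= y -> step y <= step x.
Proof.
move=> xy; rewrite /step.
have h1 : flat1 (1 - y) <= flat1 (1 - x) by apply: flat1_le; lra.
have h2 := flat1_le xy.
have p (z : R) : 0 < flat1 (1 - z) + flat1 z.
  by rewrite lt_def step_den addr_ge0// flat1_ge0.
rewrite (ler_pdivrMr _ _ (p y)) mulrAC (ler_pdivlMr _ _ (p x)) !mulrDr mulrC lerD2l.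
by apply: ler_pM => //; exact: flat1_ge0.
Qed.

Variables (t0 ep : R).
Hypothesis ep0 : 0 < ep.
(** Nonpositive, supported in [t0, t0 + ep] and of integral -1: minus an approximate Dirac mass at
    t0, seen from the right. *)
Definition dstep (s : R) : R := derive1 (fun r => step ((r - t0) / ep)) s.

Let stepC k : Ck k (fun r : R => step ((r - t0) / ep)).
Proof.
apply: (@smooth_step R _ (fun r : R => (r - t0) / ep) (fun r => r / ep)).
  move=> s; have c1 : (fun r : R => r) @ s --> s by exact: cvg_id.
  have c2 : (fun r : R => t0) @ s --> t0 by exact: cvg_cst.
  have c3 : (fun r : R => ep^-1) @ s --> ep^-1 by exact: cvg_cst.
  exact: (cvgM (cvgB c1 c2) c3).
by move=> x v h /=; rewrite -[_ *: _]/(_ * _); ring.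
Qed.

Lemma dstep_derivable s : derivable (fun r => step ((r - t0) / ep)) s 1.
Proof. exact: Ck_derivable (stepC 1). Qed.

Lemma dstep_continuous : continuous dstep.
Proof.
have := Ck_continuous (k := 0) (Ck_derive (1 : R) (stepC 1)).
have -> : dstep = 'D_(1 : R) (fun r : R => step ((r - t0) / ep)).
  by apply/funext => s; rewrite /dstep derive1E.
by [].
Qed.

Lemma dstep_le0 s : dstep s <= 0.
Proof.
rewrite /dstep derive1E /derive; apply: limr_le; first exact: dstep_derivable.
apply: nearW => h; rewrite -[_ *: _]/(_ * _) /= -[h *: 1]/(h * 1) mulr1.
have le x y : x <= y -> step ((y - t0) / ep) <= step ((x - t0) / ep).
  by move=> xy; apply: step_le; rewrite ler_pM2r ?invr_gt0// lerD2r.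
have [h0|h0] := leP 0 h.
  by rewrite mulr_ge0_le0 ?invr_ge0// subr_le0 le// lerDr.
by rewrite mulr_le0_ge0 ?invr_le0 ?(ltW h0)// subr_ge0 le// gerDr ltW.
Qed.

Lemma dstep_out s : s < t0 \/ t0 + ep < s -> dstep s = 0.
Proof.
move=> h; rewrite /dstep derive1E; have cst0 (c : R) : 'D_1 (fun _ : R => c) s = 0 by exact: derive_cst.
case: h => h.
  rewrite (near_eq_derive _ (g := fun _ : R => 1 : R)) ?cst0//.
  have : \forall r \near s, r < t0 by exact: lt_nbhsl.
  apply: filterS => r rt; rewrite step_le0//.
  by rewrite ler_pdivrMr// mul0r subr_le0 ltW.
rewrite (near_eq_derive _ (g := fun _ : R => 0 : R)) ?cst0//.
have : \forall r \near s, t0 + ep < r by exact: lt_nbhsr.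
apply: filterS => r rt; rewrite step_ge1//.
by rewrite ler_pdivlMr// mul1r; lra.
Qed.

Variable T : R.
Hypotheses (t00 : 0 < t0) (tT : t0 + ep < T).

Lemma dstep_L1 : L1 (lebR R) dstep.
Proof.
have /compact_bounded[Q [_ hQ]] : compact (dstep @` `[0, T]).
  apply: continuous_compact; last exact: segment_compact.
  apply: continuous_subspaceT; exact: dstep_continuous.
have md : measurable_fun [set: R] dstep by exact: continuous_measurable_fun dstep_continuous.
apply: (L1_le md (L1Z (`|Q| + 1) (itvb_L1 0 T))) => s.
have [/andP[s0 sT]|nsT] := boolP (0 < s < T).
  rewrite mulr1; apply: hQ; first by rewrite ltr_pwDr// ler_norm.
  by exists s => //=; rewrite in_itv /= !ltW.
rewrite dstep_out ?normr0 ?mulr0//.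
have [st|st] := ltP s t0; [by left|right].
move: nsT; rewrite (lt_le_trans t00 st) /= -leNgt; exact: lt_le_trans.
Qed.

Lemma int_dstep : \int[lebR R]_s dstep s = -1.
Proof.
move: (ep0) (t00) (tT) => e0' t0' tT'; have T0 : 0 <= T by lra.
have hd s : derivable (fun r => step ((r - t0) / ep)) s 1 /\
    derive1 (fun r => step ((r - t0) / ep)) s = dstep s by split => //; exact: dstep_derivable.
have := ftc_prim dstep_continuous hd T0.
rewrite (step_ge1 (x := (T - t0) / ep)); last by rewrite ler_pdivlMr//; lra.
rewrite (step_le0 (x := (0 - t0) / ep)); last by rewrite ler_pdivrMr//; lra.
rewrite sub0r => <-; rewrite /prim; apply: eq_Rintegral => s _.
have [_|nsT] := boolP (0 < s < T); first by rewrite mul1r.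
rewrite mul0r dstep_out//.
have [st|st] := ltP s t0; [by left|right].
move: nsT; rewrite (lt_le_trans t00 st) /= -leNgt; exact: lt_le_trans.
Qed.

(** Integrating against [dstep] gives minus an average of [qt] over [t0, t0 + ep]. If this average
    is 0, then qt t0 is at most the oscillation of [qt] there. *)
Lemma dstep_eval B de (q qt : R -> R) : 0 <= de -> bm B q ->
  {ae lebR R, forall s, 0 < s < T -> q s = qt s} ->
  (forall s, t0 <= s <= t0 + ep -> `|qt s - qt t0| <= de) ->
  \int[lebR R]_s (q s * dstep s) = 0 -> `|qt t0| <= de.
Proof.
move=> de0 qB qqt hqt I0; move: (ep0) (t00) (tT) => e0' t0' tT'.
have d1 := dstep_L1.
have qd1 : L1 (lebR R) (fun s => q s * dstep s) by exact: bm_L1 qB d1.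
have Ie := int_dstep.
have main k : `|k| = 1 -> k * qt t0 <= de.
  move=> k1.
  have : \int[lebR R]_s (k * (q s * dstep s) - k * qt t0 * dstep s) <= \int[lebR R]_s (- de * dstep s + 0).
    apply: le_int_ae.
    - by apply: L1B; exact: L1Z.
    - by apply: L1D; [exact: L1Z|exact: L10].
    apply: filterS qqt => s hs; rewrite addr0.
    have [st|st] := boolP (t0 <= s <= t0 + ep); last first.
      rewrite dstep_out; first by rewrite !mulr0 subrr.
      by move: st; rewrite negb_and -!ltNge => /orP.
    have s0T : 0 < s < T by move: st => /andP[a b]; apply/andP; split; lra.
    rewrite (hs s0T) mulrA -mulrBl -mulrBr.
    apply: ler_wnM2r; first exact: dstep_le0.
    rewrite lerNl; apply: (@le_trans _ _ `|k * (qt s - qt t0)|).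
      by rewrite -normrN ler_norm.
    by rewrite normrM k1 mul1r; exact: hqt.
  under [X in _ <= X -> _]eq_Rintegral do rewrite addr0.
  rewrite intB; [|exact: L1Z|exact: L1Z].
  by rewrite !intZ// I0 Ie; lra.
rewrite ler_norml; have := main 1 (normr1 _); have := main (-1) (normrN1 _); lra.
Qed.

End decreasing_step.

(** * Moduli of continuity of primitives *)

Section primitives.
Variable R : realType.

Lemma prim_diff (a : R -> R) x y : L1 (lebR R) a -> 0 <= x <= y ->
  prim a y - prim a x = \int[lebR R]_s ((x < s < y)%R%:R * a s).
Proof.
move=> a1 /andP[x0]; rewrite le_eqVlt => /orP[/eqP <-|xy].
  rewrite subrr -[LHS](int0 (lebR R)); apply: eq_Rintegral => s _.
  by rewrite (_ : (x < s < x) = false) ?mul0r//; apply/negP => /andP[/lt_trans h /h]; rewrite ltxx.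
rewrite -(prim_closed x a1) -intB; last 2 first.
- exact: prim_L1.
- apply: (L1_le _ (L1_norm a1)) => [|s].
    apply: measurable_funM; last exact: L1_measurable a1.
    apply: measurable_boolR; apply: measurable_and; first exact: measurable_fun_ltr.
    exact: measurable_fun_ler.
  by case: (0 < s <= x); rewrite ?mul1r ?mul0r ?normr0.
apply: eq_Rintegral => s _; rewrite -mulrBl; congr (_ * _).
have [s0|s0] := ltP 0 s; have [sx|sx] := leP s x; have [sy|sy] := ltP s y => /=; rewrite ?subrr ?subr0//.
all: try by exfalso; lra.
Qed.

Lemma frac_le (a x : R) : 0 <= a -> 0 <= x -> a * (x / (a + 1)) <= x.
Proof.
move=> a0 x0; rewrite mulrCA; apply: ler_piMr => //.
by rewrite ler_pdivrMr ?mul1r ?lerDl// ltr_wpDl.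
Qed.

Lemma prim_lip (a : R -> R) C x y : L1 (lebR R) a -> (forall s, `|a s| <= C) -> 0 <= x <= y ->
  `|prim a y - prim a x| <= C * (y - x).
Proof.
move=> a1 aC xy; rewrite (prim_diff a1 xy); have /andP[x0 xy'] := xy.
rewrite -(int_itvb xy') -intZ; last exact: itvb_L1.
apply: le_norm_int_le.
- apply: (L1_le _ (L1_norm a1)) => [|s].
    by apply: measurable_funM; [apply: measurable_boolR; exact: measurable_itvb|exact: L1_measurable a1].
  by case: (x < s < y); rewrite ?mul1r ?mul0r ?normr0.
- by apply: L1Z; exact: itvb_L1.
move=> s; case: (x < s < y); first by rewrite mul1r mulr1.
by rewrite mul0r normr0 mulr0.
Qed.

Lemma dstep_prim (t0 ep T : R) (a : R -> R) : 0 < ep -> 0 < t0 -> t0 + ep < T -> L1 (lebR R) a ->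
  (exists C, forall s, `|prim a s| <= C) ->
  \int[lebR R]_s (prim a s * dstep t0 ep s) =
  - \int[lebR R]_s ((0 < s < T)%R%:R * (a s * step ((s - t0) / ep))).
Proof.
move=> ep0 t00 tT a1 [C hC].
have d1 := dstep_L1 ep0 t00 tT.
have pmul := prim_mul T a1 d1.
have hd s : derivable (fun r => step ((r - t0) / ep)) s 1 /\
    derive1 (fun r => step ((r - t0) / ep)) s = dstep t0 ep s.
  by split => //; exact: dstep_derivable.
have dp s : 0 <= s -> prim (dstep t0 ep) s = step ((s - t0) / ep) - 1.
  move=> s0; rewrite (ftc_prim (@dstep_continuous R t0 ep) hd s0) (step_le0 (x := (0 - t0) / ep))//.
  by rewrite ler_pdivrMr// mul0r sub0r oppr_le0 ltW.
have sT : step ((T - t0) / ep) = 0 by rewrite step_ge1// ler_pdivlMr// mul1r; lra.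
have T0 : 0 <= T by lra.
have mst : measurable_fun [set: R] (fun s => step ((s - t0) / ep)).
  rewrite (_ : (fun s => _) = fun s => (step ((s - t0) / ep))) //.
  apply: continuous_measurable_fun => s.
  by apply: differentiable_continuous; apply/derivable1_diffP; case: (hd s).
have sb s : `|step ((s - t0) / ep)| <= 1.
  by have /andP[h1 h2] := step_bound ((s - t0) / ep); rewrite ger0_norm.
have pa1 := prim_L1 T a1.
have as1 : L1 (lebR R) (fun s => (0 < s < T)%R%:R * (a s * step ((s - t0) / ep))).
  apply: (L1_eq _ (L1_bm pa1 (conj mst sb))) => s; by rewrite mulrA.
have pd1 : L1 (lebR R) (fun s => prim a s * dstep t0 ep s).
  by apply: (bm_L1 (a := C)) => //; split => //; exact: measurable_prim (L1_measurable a1).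
have pE : prim (fun s => a s * prim (dstep t0 ep) s + prim a s * dstep t0 ep s) T =
    \int[lebR R]_s ((0 < s < T)%R%:R * (a s * step ((s - t0) / ep))) - prim a T +
    \int[lebR R]_s (prim a s * dstep t0 ep s).
  rewrite -[prim a T]/(\int[lebR R]_s ((0 < s < T)%R%:R * a s)).
  rewrite -intB// -intD//; last exact: L1B.
  apply: eq_Rintegral => s _; have [sT'|nsT] := boolP (0 < s < T).
    rewrite dp; first by rewrite !mul1r; ring.
    by move: sT' => /andP[/ltW].
  rewrite dstep_out//; first by rewrite !mul0r mulr0 subrr addr0.
  have [st|st] := ltP s t0; [by left|right].
  by move: nsT; rewrite (lt_le_trans t00 st) /= -leNgt => h; exact: lt_le_trans h.
rewrite pE dp// sT in pmul; move: pmul.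
move: (\int[_]_s _) (\int[_]_s _) (prim a T) => u v k h; lra.
Qed.

End primitives.

(** * Uniqueness for the difference of two bounded solutions *)

Section uniqueness.
Variables (R : realType) (N P : nat) (sigma : 'M[R]_(N, P)).
Local Notation V := 'rV[R]_N.
Local Notation lebN := (lebesgue_rV R N).
Local Notation M := (lebX R N).
Variable mu : {measure set V -> \bar R}.
Variables (nu : nat -> {sigma_finite_measure set V -> \bar R}) (e : nat -> R) (c : R).
Hypothesis e0 : e @ \oo --> (0 : R).
Hypothesis knu : forall n, kern (nu n) (fun=> 1).
Hypothesis levyE : forall A r g n x, levy_nice sigma A r g ->
  `|levy_op sigma mu g x - \int[nu n]_z (g (x + z) - g x)| <=
  A * e n * \1_(ball (0 : V) (r + c)) x.
Variables (T Z0 B : R) (w z : V * R -> R) (v : R -> V -> R).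
Hypotheses (T0 : 0 < T) (Z00 : 0 < Z0) (wb : bm B w) (w1 : L1 M w) (zb : bm Z0 z).
Hypothesis zw0 : forall p, 0 <= z p * w p.
Hypothesis zs : forall k, 0 < k -> exists2 s, 0 < s & forall p, `|z p| <= k \/ s * `|z p| <= z p * w p.
Hypothesis wout : forall p, ~~ (0 < p.2 < T) -> w p = 0.
Hypothesis zout : forall p, ~~ (0 < p.2 < T) -> z p = 0.
Hypothesis weak : forall psi, test_function T psi ->
  \int[M]_p (w p * dtest T psi p) + \int[M]_p (z p * ltest sigma mu T psi p) = 0.
Hypothesis vae : {ae lebR R, forall t, 0 < t < T -> {ae lebN, forall x, w (x, t) = v t x}}.
Hypothesis vL1 : forall K t, compact K -> 0 < t < T -> L1 lebN (fun x => \1_K x * v t x).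
Hypothesis vcont : forall K t0 d, compact K -> 0 < t0 < T -> 0 < d -> exists2 h, 0 < h &
  forall t, 0 < t < T -> `|t - t0| < h -> \int[lebN]_x (\1_K x * `|v t x - v t0 x|) <= d.

Let mX := @measurable_shX R N.
Let pX := @mpres_shX R N.
Let kX := @shXK R N.

Section one_mollifier.
Variables (eta : R) (rho : V -> R).
Hypothesis mrho : mollifier eta rho.
Let krho : kern lebN rho. Proof. by case: mrho. Qed.
Let rho1 : L1 lebN rho. Proof. by case: krho. Qed.
Let irho : \int[lebN]_y rho y = 1. Proof. by case: mrho. Qed.
Local Notation l := (lrho sigma mu rho).

(** The weak equation is tested with rho(x - x0) step((t - t0) / ep). Continuity of the curve [v] in
    L^1_loc evaluates the mollified w at t0 exactly, for every t0 in ]0,T[. No initial term appears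
    because the test function does not vanish at time 0 and the weak equation for w has no such
    term. *)
Lemma smoothed_slice x0 : {ae lebR R, forall t, 0 < t < T ->
  cvl rho w (x0, t) = prim (fun s => cvl l z (x0, s)) t}.
Proof.
have [A [Bl [C [rA lB l1 C0 hC]]]] := moll_levy e0 knu levyE mrho.
have A0 : 0 <= A by exact: (bm_ge0 (0 : V) rA).
pose b t := cvl rho w (x0, t); pose cz s := cvl l z (x0, s).
have rwb := cvl_bm rho1 wb; have lzb := cvl_bm l1 zb.
set Cb := B * _ in rwb; set Cc := Z0 * _ in lzb.
have bb : bm Cb b.
  by split; [exact: (measurable_slice1 x0 (proj1 rwb))|move=> t; exact: (proj2 rwb)].
have czb : bm Cc cz.
  by split; [exact: (measurable_slice1 x0 (proj1 lzb))|move=> t; exact: (proj2 lzb)].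
have czout s : ~~ (0 < s < T) -> cz s = 0.
  move=> hs; rewrite /cz /cvl /cv -[RHS](int0 lebN); apply: eq_Rintegral => y _.
  by rewrite zout ?mulr0.
have cz1 : L1 (lebR R) cz.
  apply: (L1_le (proj1 czb) (L1Z Cc (itvb_L1 0 T))) => s.
  have [_|/czout ->] := boolP (0 < s < T); last by rewrite mulr0 normr0.
  by rewrite mulr1; case: czb.
have pcz s : `|prim cz s| <= \int[lebR R]_s `|cz s| by exact: prim_abs.
pose q t := b t - prim cz t.
have qb : bm (Cb + \int[lebR R]_s `|cz s|) q.
  by apply: bmB => //; split => //; apply: measurable_prim; case: czb.
pose K : set V := [set y | `|y - x0| <= eta].
have cK : compact K.
  apply: bounded_closed_compact.
    exists (eta + `|x0|); split; first exact: num_real.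
    move=> Q hQ y yB; apply: (le_trans _ (ltW hQ)).
    have := ler_normD (y - x0) x0; rewrite subrK => h.
    by apply: (le_trans h); rewrite lerD2r.
  rewrite (_ : K = (fun y : V => `|y - x0|) @^-1` [set r : R | r <= eta])//.
  apply: closed_comp; last exact: closed_le.
  move=> y _; have FF : Filter (nbhs y) by exact: nbhs_filter.
  have c1 : (fun y : V => y) @ y --> y by exact: cvg_id.
  have c2 : (fun y : V => x0) @ y --> x0 by exact: cvg_cst.
  exact: (cvg_norm (cvgB c1 c2)).
pose rx y := rho (y - x0).
have rxK y : rx y = rx y * \1_K y.
  rewrite indicE; have [_|] := boolP (y \in K); first by rewrite mulr1.
  rewrite notin_setE /K /= => /negP; rewrite -ltNge => h; rewrite mulr0.
  by case: mrho => _ _ _; apply.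
have mrx : measurable_fun [set: V] rx.
  apply: (measurableT_comp (proj1 rA)); apply: measurable_subv => //.
have rxA : bm A rx by split => // y; exact: (proj2 rA).
pose bt t := \int[lebN]_y (rx y * v t y).
have rv1 t : 0 < t < T -> L1 lebN (fun y => rx y * v t y).
  move=> tT; apply: (L1_eq _ (bm_L1 rxA (vL1 cK tT))) => y.
  by rewrite mulrA -rxK.
have bbt : {ae lebR R, forall t, 0 < t < T -> b t = bt t}.
  apply: filterS vae => t ht tT; rewrite /b /bt.
  have mw : measurable_fun [set: V] (fun y => w (y, t)) by exact: (measurable_slice2 t (proj1 wb)).
  transitivity (\int[lebN]_y (rx y * w (y, t))).
    rewrite -(int_shiftV x0); last exact: measurable_funM.
    by apply: eq_Rintegral => y _; rewrite /rx /shX /= addrK [y + _]addrC.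
  apply: eq_int_ae; [exact: measurable_funM|exact: L1_measurable (rv1 t tT)|].
  by apply: filterS (ht tT) => y ->.
pose qt t := bt t - prim cz t.
have qt0 t0 : 0 < t0 < T -> qt t0 = 0.
  move=> t0T; apply/eqP; rewrite -normr_le0; apply/ler_addgt0Pr => d d0; rewrite add0r.
  have d1 : 0 < d / 2 / (A + 1) by rewrite !divr_gt0// ltr_wpDl.
  have [h h0 hh] := vcont cK t0T d1.
  have Cc0 : 0 <= Cc by exact: (bm_ge0 (0 : R) czb).
  (* Three demands: the window stays within the distance h given by continuity, it stays inside
     ]0,T[, and the primitive of [cz] moves by at most d / 2 across it. *)
  pose ep := Num.min (h / 2) (Num.min ((T - t0) / 2) (d / 2 / (Cc + 1))).
  have /andP[t00 t0T'] := t0T.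
  have ep0 : 0 < ep by rewrite !lt_min !divr_gt0 ?subr_gt0// ltr_wpDl.
  have eph : ep <= h / 2 by rewrite ge_min lexx.
  have epT : ep <= (T - t0) / 2 by rewrite /ep !ge_min lexx !orbT.
  have epC : ep <= d / 2 / (Cc + 1) by rewrite /ep !ge_min lexx !orbT.
  have teT : t0 + ep < T by lra.
  have qqt : {ae lebR R, forall s, 0 < s < T -> q s = qt s}.
    by apply: filterS bbt => s hs sT; rewrite /q hs.
  apply: (dstep_eval ep0 t00 teT (ltW d0) qb qqt).
    move=> s /andP[ts st]; have sT : 0 < s < T by apply/andP; split; lra.
    have -> : qt s - qt t0 = (bt s - bt t0) - (prim cz s - prim cz t0) by rewrite /qt; ring.
    rewrite (le_trans (ler_normB _ _))// [leRHS](splitr d) lerD//.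
      rewrite /bt -intB; [|exact: rv1|exact: rv1].
      have dL : L1 lebN (fun y => \1_K y * `|v s y - v t0 y|).
        apply: (L1_eq _ (L1_norm (L1B (vL1 cK sT) (vL1 cK t0T)))) => y.
        by rewrite -mulrBr normrM (ger0_norm (x := \1_K y)) // indicE.
      apply: (@le_trans _ _ (\int[lebN]_y (A * (\1_K y * `|v s y - v t0 y|)))).
        apply: le_norm_int_le; [by apply: L1B; exact: rv1|exact: L1Z|].
        move=> y; rewrite -mulrBr rxK -mulrA normrM normrM (ger0_norm (x := \1_K y)) ?indicE//.
        by apply: ler_wpM2r; [rewrite mulr_ge0|case: rxA].
      rewrite intZ//; apply: (@le_trans _ _ (A * (d / 2 / (A + 1)))).
        apply: ler_wpM2l => //; apply: hh => //; rewrite ger0_norm ?subr_ge0// ltrBlDl.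
        by rewrite (le_lt_trans st)// ltrD2l (le_lt_trans eph)// ltr_pdivrMr// ltr_pMr// ltr1n.
      by apply: frac_le => //; rewrite divr_ge0// ltW.
    have hx : 0 <= t0 <= s by apply/andP; split; lra.
    apply: (le_trans (prim_lip cz1 (proj2 czb) hx)).
    apply: (@le_trans _ _ (Cc * (d / 2 / (Cc + 1)))).
      by apply: ler_wpM2l => //; rewrite (le_trans _ epC)// lerBlDl.
    by apply: frac_le => //; rewrite divr_ge0// ltW.
  pose psi (p : V * R) := rho (p.1 - x0) * step ((p.2 - t0) / ep).
  have tpsi : test_function T psi by exact: (test_moll x0 mrho ep0 (ltW t00) teT).
  have k1 : Ck 1 psi by case: tpsi => h' _; exact: (h' 1%N).
  have dE y s : dtest T psi (y, s) = slab T (y, s) * (rx y * dstep t0 ep s).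
    rewrite /dtest; congr (_ * _); have [_ <-] := D_time y s k1.
    rewrite derive1E /psi /= /dstep derive1E.
    have hd := @dstep_derivable R t0 ep s.
    transitivity ('D_1 (rho (y - x0) *: (fun r : R => step ((r - t0) / ep) : R^o)) s); first by [].
    by rewrite deriveZ.
  have lE y s : ltest sigma mu T psi (y, s) = slab T (y, s) * (step ((s - t0) / ep) * l (y - x0)).
    rewrite /ltest /slab /=; have [/andP[s0 sT]|_] := boolP (0 < s < T); last by rewrite !mul0r.
    rewrite !mul1r /psi /=.
    by apply: (levy_tensor e0 knu levyE mrho _ _ ep0 (ltW t00) teT); rewrite ltW.
  have := weak tpsi.
  have [A' [r' [_ _ dB _]]] := dtest_bm tpsi.
  have wd1 : L1 M (fun p => w p * dtest T psi p) by exact: L1_bm w1 dB.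
  have [A2 [B2 [C2 [_ _ _ lt1 _]]]] := test_levy e0 knu levyE tpsi.
  have zl1 : L1 M (fun p => z p * ltest sigma mu T psi p) by exact: bm_L1 zb lt1.
  rewrite (intX2 wd1) (intX2 zl1).
  have -> : \int[lebR R]_s \int[lebN]_y (w (y, s) * dtest T psi (y, s)) =
      \int[lebR R]_s (b s * dstep t0 ep s).
    apply: eq_Rintegral => s _; rewrite /b /cvl /cv -int_Zr; last exact: (cvl_L1 (x0, s) rho1 wb).
    rewrite -(int_shiftV x0); last first.
      apply: measurable_funM; first exact: (measurable_slice2 s (proj1 wb)).
      exact: (measurable_slice2 s (proj1 dB)).
    apply: eq_Rintegral => y _; rewrite dE /rx addrK /shX /= [x0 + y]addrC.
    have key : w (y + x0, s) * slab T (y + x0, s) = w (y + x0, s).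
      have := @wout (y + x0, s); rewrite /slab /=.
      by case: (0 < s < T) => [_|->]; rewrite ?mulr1 ?mul0r.
    by rewrite mulrA key; ring.
  have -> : \int[lebR R]_s \int[lebN]_y (z (y, s) * ltest sigma mu T psi (y, s)) =
      \int[lebR R]_s ((0 < s < T)%R%:R * (cz s * step ((s - t0) / ep))).
    apply: eq_Rintegral => s _; rewrite mulrC -mulrA /cz /cvl /cv -int_Zr; last exact: (cvl_L1 (x0, s) l1 zb).
    rewrite -(int_shiftV x0); last first.
      apply: measurable_funM; first exact: (measurable_slice2 s (proj1 zb)).
      exact: (measurable_slice2 s (L1_measurable lt1)).
    apply: eq_Rintegral => y _; rewrite lE addrK /shX /= [x0 + y]addrC /slab /=; ring.
  have dp := dstep_prim ep0 t00 teT cz1 (ex_intro _ _ pcz).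
  have db1 : L1 (lebR R) (fun s => b s * dstep t0 ep s) by exact: (bm_L1 bb (dstep_L1 ep0 t00 teT)).
  have dp1 : L1 (lebR R) (fun s => prim cz s * dstep t0 ep s).
    apply: (bm_L1 (a := \int[lebR R]_s `|cz s|)); last exact: (dstep_L1 ep0 t00 teT).
    by split => //; apply: measurable_prim; case: czb.
  move=> hw; transitivity (\int[lebR R]_s (b s * dstep t0 ep s - prim cz s * dstep t0 ep s)).
    by apply: eq_Rintegral => s _; rewrite /q mulrBl.
  by rewrite intB// dp opprK.
apply: filterS bbt => t ht tT; have := qt0 t tT; rewrite /qt -(ht tT) => /eqP.
by rewrite subr_eq0 => /eqP.
Qed.

Let W := J T (cvl l z).
Let W_bm : exists C, bm C W.
Proof.
have [A [Bl [C [rA lB l1 C0 hC]]]] := moll_levy e0 knu levyE mrho.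
by eexists; apply: (J_bm T0); exact: (cvl_bm l1 zb).
Qed.

(** For every x the two functions agree for almost every t, so by Tonelli they agree almost
    everywhere on space-time; integrability of W is inherited from the mollified w. *)
Lemma smoothed_limit : L1 M W /\ \int[M]_p `|W p - cvl rho w p| = 0.
Proof.
have [CW Wb] := W_bm.
have Sb := cvl_bm rho1 wb.
have S1 : L1 M (cvl rho w) := cv_L1 mX pX krho w1.
pose D p := W p - cvl rho w p.
have mD : measurable_fun [set: V * R] D by apply: measurable_funB; [case: Wb|case: Sb].
have Sout p : ~~ (0 < p.2 < T) -> cvl rho w p = 0.
  move=> hp; rewrite /cvl /cv -[RHS](int0 lebN); apply: eq_Rintegral => y _.
  by rewrite wout ?mulr0.
have D0 : (\int[M]_p `|D p|%:E = 0)%E.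
  rewrite tonelliX1//; last by apply: measurableT_comp.
  rewrite integral0_eq// => x _.
  have mDx : measurable_fun [set: R] (fun t => D (x, t)) by exact: measurable_slice1.
  have h : {ae lebR R, forall t, D (x, t) = 0}.
    apply: filterS (smoothed_slice x) => t ht.
    have [tT|ntT] := boolP (0 < t < T).
      by rewrite /D /W /J /= ht// (andP tT).2 mul1r subrr.
    rewrite /D Sout// subr0 /W /J /=; move: ntT; rewrite negb_and -!leNgt => /orP[t0|tT].
      by rewrite prim_le0// mulr0.
    by rewrite ltNge tT mul0r.
  transitivity (\int[lebR R]_t (0%:E : \bar R))%E; last by rewrite integral0.
  apply: ae_eq_integral => //.
    by apply/measurable_EFinP; apply: measurableT_comp.
  by apply: filterS h => t /= ->; rewrite normr0.
have D1 : L1 M D by apply: L1P => //; rewrite D0.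
split; first by apply: (L1_eq _ (L1D D1 S1)) => p; rewrite /D subrK.
by rewrite /Rintegral D0.
Qed.

(** W is the mollified w almost everywhere, so S W is w mollified twice, at L^1 distance at most 2
    ep from w. The remainder of the equation is 0, and kappa is at will. *)
Lemma smoothed_estimate ep : (forall y, rho y != 0 -> \int[M]_p `|w (shX y p) - w p| <= ep) ->
  \int[M]_p (weight T p * (z p * w p)) <= 2 * T * (Z0 * (ep + ep)).
Proof.
move=> hep; have [W1 D0] := smoothed_limit; have [CW Wb] := W_bm.
have Sb := cvl_bm rho1 wb.
have S1 : L1 M (cvl rho w) := cv_L1 mX pX krho w1.
have SS1 : L1 M (cvl rho (cvl rho w)) := cv_L1 mX pX krho S1.
have SW1 : L1 M (cvl rho W) := cv_L1 mX pX krho W1.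
have Db := bmB Wb Sb; have D1 := L1B W1 S1.
have moll : \int[M]_p `|cvl rho w p - w p| <= ep by exact: (mollify_L1 mX pX krho irho wb w1 hep).
have Eb := bmB Sb wb; have E1 := L1B S1 w1.
have hSW : \int[M]_p `|cvl rho W p - w p| <= ep + ep.
  have h1 : \int[M]_p `|cvl rho (fun p => W p - cvl rho w p) p| <= 0.
    by have := cv_L1_le mX pX kX krho Db D1; rewrite D0 mulr0.
  have h2 : \int[M]_p `|cvl rho (fun p => cvl rho w p - w p) p| <= ep.
    by have := cv_L1_le mX pX kX krho Eb E1; rewrite irho mul1r => h; exact: le_trans h moll.
  have n1 : L1 M (cvl rho (fun p => W p - cvl rho w p)) := cv_L1 mX pX krho D1.
  have n2 : L1 M (cvl rho (fun p => cvl rho w p - w p)) := cv_L1 mX pX krho E1.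
  apply: (@le_trans _ _ (\int[M]_p (`|cvl rho (fun p => W p - cvl rho w p) p| +
     (`|cvl rho (fun p => cvl rho w p - w p) p| + `|cvl rho w p - w p|)))).
    apply: le_int; [by apply: L1_norm; exact: L1B|by apply: L1D; [exact: L1_norm|apply: L1D; exact: L1_norm]|].
    move=> p; rewrite (cvl_subr p rho1 Wb Sb) (cvl_subr p rho1 Sb wb).
    move: (cvl rho W p) (cvl rho (cvl rho w) p) (cvl rho w p) (w p) => a1 a2 a3 a4.
    have -> : a1 - a4 = (a1 - a2) + ((a2 - a3) + (a3 - a4)) by ring.
    by apply: (le_trans (ler_normD _ _)); rewrite lerD2l; exact: ler_normD.
  rewrite intD; [|exact: L1_norm|by apply: L1D; exact: L1_norm].
  by rewrite intD; [|exact: L1_norm|exact: L1_norm]; lra.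
have I20 : 0 <= \int[M]_p `|W p| by exact: int_ge0.
apply/ler_addgt0Pr => d d0.
(* Makes the term of [core_levy] that is proportional to kappa at most d. *)
pose k := d / (2 * T * (\int[M]_p `|W p| + 1)).
have den : 0 < 2 * T * (\int[M]_p `|W p| + 1) by rewrite !mulr_gt0// ltr_wpDl.
have k0 : 0 < k by rewrite divr_gt0.
have [s s0 hs] := zs k0.
have r0 : bm 0 (fun _ : V * R => 0 : R) by split => // p; rewrite normr0.
have WE : W = J T (fun p => cvl l z p + 0).
  by rewrite /W; congr (J T _); apply/funext => p; rewrite addr0.
have := core_levy e0 knu levyE mrho T0 Z00 s0 (ltW k0) zb r0 w1 W1 zw0 hs WE.
move=> h; apply: (le_trans h); rewrite !mul0r addr0 mulrDr lerD//.
  by rewrite ler_wpM2l ?ler_wpM2l// ltW// mulr_gt0.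
rewrite (_ : d = k * (2 * T * (\int[M]_p `|W p| + 1))); last by rewrite /k divfK// gt_eqF.
rewrite mulrCA ler_wpM2l ?(ltW k0)// ler_wpM2l ?lerDl//.
by rewrite ltW// mulr_gt0.
Qed.

Lemma smoothed_vanish : {ae M, forall p, z p = 0} -> \int[M]_p `|cvl rho w p| = 0.
Proof.
move=> z0; have [W1 D0] := smoothed_limit.
have [A [Bl [C [rA lB l1 C0 hC]]]] := moll_levy e0 knu levyE mrho.
have [mz _] := zb.
have iz0 : (\int[M]_p `|z p|%:E = 0)%E.
  transitivity (\int[M]_p (0%:E : \bar R))%E; last by rewrite integral0.
  apply: ae_eq_integral => //; first by apply/measurable_EFinP; apply: measurableT_comp.
  by apply: filterS z0 => p /= ->; rewrite normr0.
have z1 : L1 M z by apply: L1P => //; rewrite iz0.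
have nz1 := L1_norm z1.
have zs0 : {ae lebR R, forall s, forall x, cvl l z (x, s) = 0}.
  have h1 : {ae lebR R, forall s, \int[lebN]_y `|z (y, s)| = 0}.
    apply: int0_ae; [exact: (L1X_int2 nz1)|by move=> s; exact: int_ge0|].
    by rewrite -(intX2 nz1) /Rintegral iz0.
  have h2 := L1X_ae2 nz1.
  apply: filterS2 h1 h2 => s hs hs1 x.
  have hy : {ae lebN, forall y, `|z (y, s)| = 0} by apply: int0_ae => //; rewrite hs.
  have hx := mpres_ae (mpres_shift x) hy.
  rewrite /cvl /cv -[RHS](int0 lebN); apply: eq_int_ae => //.
    exact: L1_measurable (cvl_L1 (x, s) l1 zb).
  apply: filterS hx => y /= /normr0_eq0; rewrite /shX /= addrC => ->; by rewrite mulr0.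
have W0 p : W p = 0.
  rewrite /W /J (_ : prim _ _ = 0) ?mulr0// /prim -[RHS](int0 (lebR R)); apply: eq_int_ae => //.
    apply: measurable_funM; first by apply: measurable_boolR; exact: measurable_itvb.
    exact: (measurable_slice1 p.1 (measurable_cvl (L1_measurable l1) mz)).
  by apply: filterS zs0 => s hs; rewrite hs mulr0.
rewrite -D0; apply: eq_Rintegral => p _; by rewrite W0 sub0r normrN.
Qed.

End one_mollifier.

Let translation_mollifier ep : 0 < ep -> exists eta rho, mollifier eta rho /\
  forall y, rho y != 0 -> \int[M]_p `|w (shX y p) - w p| <= ep.
Proof.
move=> ep0; have [h h0 hw] := L1_translation w1 ep0.
have [rho mrho] := mollifier_exists N h0; exists h, rho; split => // y ry; apply: hw.
rewrite leNgt; apply/negP => hy; move/eqP: ry; apply.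
by case: mrho => _ _ _; apply.
Qed.

Lemma unique_core : {ae M, forall p, w p = 0}.
Proof.
have zww1 : L1 M (fun p => weight T p * (z p * w p)).
  by apply: (bm_L1 (weight_bm N T0)); exact: bm_L1 zb w1.
have zwI : \int[M]_p (weight T p * (z p * w p)) <= 0.
  apply/ler_addgt0Pr => d d0; rewrite add0r.
  pose ep := d / (4 * T * Z0).
  have den : 0 < 4 * T * Z0 by rewrite !mulr_gt0.
  have ep0 : 0 < ep by rewrite divr_gt0.
  have [eta [rho [mrho hy]]] := translation_mollifier ep0.
  apply: (le_trans (smoothed_estimate mrho hy)).
  rewrite (_ : d = ep * (4 * T * Z0)); last by rewrite /ep divfK// gt_eqF.
  by rewrite le_eqVlt; apply/orP; left; apply/eqP; ring.
have z0 : {ae M, forall p, z p = 0}.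
  have ww0 p : 0 <= weight T p * (z p * w p) by rewrite mulr_ge0// weight_ge0.
  apply: filterS (int0_ae zww1 ww0 zwI) => p.
  have [pT|/zout //] := boolP (0 < p.2 < T).
  move=> /eqP; rewrite mulf_eq0 /weight pT mul1r subr_eq0 => /orP[/eqP h|/eqP h].
    by move: pT; rewrite h ltxx andbF.
  apply/eqP; rewrite -normr_le0; apply/ler_addgt0Pr => k k0; rewrite add0r.
  (* Where z w = 0, the alternative of [zs] leaves |z| <= k or |z| <= 0, for every k > 0. *)
  have [s s0 hs] := zs k0; have [//|] := hs p; rewrite h => hz.
  have : `|z p| <= 0 by rewrite -(pmulr_rle0 _ s0).
  by move=> /le_trans; apply; exact: ltW.
apply: filterS (int0_ae (L1_norm w1) _ _) => [p /normr0_eq0 //| |]; first by [].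
apply/ler_addgt0Pr => ep ep0; rewrite add0r.
have [eta [rho [mrho hy]]] := translation_mollifier ep0.
have krho : kern lebN rho by case: mrho.
have irho : \int[lebN]_y rho y = 1 by case: mrho.
have S1 : L1 M (cvl rho w) := cv_L1 mX pX krho w1.
have moll : \int[M]_p `|cvl rho w p - w p| <= ep by exact: (mollify_L1 mX pX krho irho wb w1 hy).
apply: (@le_trans _ _ (\int[M]_p (`|cvl rho w p| + `|cvl rho w p - w p|))).
  apply: le_int; [exact: L1_norm|by apply: L1D; apply: L1_norm => //; exact: L1B|].
  move=> p; rewrite -[X in `|X| <= _](subKr (cvl rho w p)); exact: ler_normB.
rewrite intD; [|exact: L1_norm|by apply: L1_norm; exact: L1B].
by rewrite (smoothed_vanish mrho z0) add0r.
Qed.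

End uniqueness.

Lemma same_sign (R : realType) (k d p : R) : 0 <= d /\ 0 <= p \/ d <= 0 /\ p <= 0 ->
  k * `|p| <= `|d| -> `|d - k * p| <= `|d| - k * `|p|.
Proof.
move=> [[d0 p0]|[d0 p0]].
  by rewrite (ger0_norm d0) (ger0_norm p0) => h; rewrite ger0_norm ?subr_ge0.
rewrite (ler0_norm d0) (ler0_norm p0) mulrN => h; rewrite ler0_norm; last by lra.
by lra.
Qed.

(** * The explicit Euler step: maximum principle and L^1 contraction *)

Section generator.
Variables (R : realType) (N : nat).
Local Notation V := 'rV[R]_N.
Local Notation lebN := (lebesgue_rV R N).
Local Notation M := (lebX R N).
Variables (nu : {sigma_finite_measure set V -> \bar R}) (phi : R -> R) (lip : R).
Hypothesis knu : kern nu (fun=> 1).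
Hypothesis phi_le : {homo phi : x y / x <= y}.
Hypothesis lip0 : 0 <= lip.
Hypothesis phi_lip : forall a b, `|phi a - phi b| <= lip * `|a - b|.
Hypothesis mphi : measurable_fun [set: R] phi.
Let la : R := \int[nu]_y 1.
Let mV := @measurable_shV R N.
Let pV := @mpres_shV R N.
Let kV := @shVK R N.
Let mX := @measurable_shX R N.
Let pX := @mpres_shX R N.
Let la0 : 0 <= la. Proof. exact: (mass_ge0 knu). Qed.

Lemma phi_bm d (X : measurableType d) C (u : X -> R) : bm C u ->
  bm (`|phi 0| + lip * C) (fun x => phi (u x)).
Proof.
move=> [mu uC]; split => [|x]; first exact: measurableT_comp.
have := ler_normD (phi (u x) - phi 0) (phi 0); rewrite subrK => h; apply: (le_trans h).
rewrite addrC lerD2l (le_trans (phi_lip _ _))// subr0; exact: (ler_wpM2l lip0).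
Qed.

Definition gen (g : V -> R) (x : V) : R := cv (@shV R N) nu (fun=> 1) g x - la * g x.
Definition genX (g : V * R -> R) (p : V * R) : R := cv (@shX R N) nu (fun=> 1) g p - la * g p.

Lemma gen_cst k x : gen (fun=> k) x = 0.
Proof. by rewrite /gen (cv_cst (@shV R N) knu) subrr. Qed.

Definition euler h (u : V -> R) (x : V) : R := u x + h * gen (fun y => phi (u y)) x.

Section step.
Variable h : R.
Hypotheses (h0 : 0 <= h) (cfl : h * la * lip <= 1).

Lemma cfl_le a b : h * la * `|phi a - phi b| <= `|a - b|.
Proof.
have hl : 0 <= h * la by rewrite mulr_ge0.
apply: (le_trans (ler_wpM2l hl (phi_lip a b))); rewrite mulrA; exact: ler_piMl.
Qed.

(** Maximum principle: constants are stationary, and under the step restriction what flows in from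
    values at most C, namely h la (phi C - phi u), is at most the gap C - u. *)
Lemma euler_bm C u : bm C u -> bm C (euler h u).
Proof.
move=> uC; have [mu uC'] := uC; have pb := phi_bm uC.
have hl : 0 <= h * la by rewrite mulr_ge0.
have cst_bm (k : R) : bm `|k| (fun _ : V => k) by exact: bm_cst.
split.
  apply: measurable_funD => //; apply: measurable_funM => //.
  apply: measurable_funB; first exact: (measurable_cv mV knu (proj1 pb)).
  by apply: measurable_funM => //; case: pb.
move=> x; have /andP[u1 u2] : - C <= u x <= C by rewrite -ler_norml.
have k1 : cv (@shV R N) nu (fun=> 1) (fun y => phi (u y)) x <= la * phi C.
  rewrite -(cv_cst (@shV R N) knu (phi C) x).
  apply: (cv_le mV knu x pb (cst_bm (phi C))) => y; apply: phi_le.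
  by have := uC' y; rewrite ler_norml => /andP[].
have k2 : la * phi (- C) <= cv (@shV R N) nu (fun=> 1) (fun y => phi (u y)) x.
  rewrite -(cv_cst (@shV R N) knu (phi (- C)) x).
  apply: (cv_le mV knu x (cst_bm (phi (- C))) pb) => y; apply: phi_le.
  by have := uC' y; rewrite ler_norml => /andP[].
have c1 := cfl_le C (u x); have c2 := cfl_le (u x) (- C).
rewrite ger0_norm ?subr_ge0 ?phi_le// ger0_norm ?subr_ge0// in c1.
rewrite ger0_norm ?subr_ge0 ?phi_le// ger0_norm ?subr_ge0// in c2.
have m1 := ler_wpM2l h0 k1; have m2 := ler_wpM2l h0 k2.
rewrite /euler /gen; move: (cv _ _ _ _ _) (phi _) (phi (u x)) (phi C) (u x) c1 c2 m1 m2 u1 u2 => q a b d y c1 c2 m1 m2 u1 u2.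
rewrite ler_norml; apply/andP; split; move: c1 c2 m1 m2; rewrite !mulrBr !mulrA; lra.
Qed.

(** Under the step restriction, subtracting h la (phi u - phi u') from u - u' does not change its
    sign, so absolute values subtract exactly; the convolution then gives back at most the amount
    taken away. *)
Lemma euler_contract C u u' : bm C u -> bm C u' -> L1 lebN (fun x => u x - u' x) ->
  L1 lebN (fun x => euler h u x - euler h u' x) /\
  \int[lebN]_x `|euler h u x - euler h u' x| <= \int[lebN]_x `|u x - u' x|.
Proof.
move=> uC uC' d1; have pb := phi_bm uC; have pb' := phi_bm uC'.
pose p x := phi (u x) - phi (u' x); have ppb := bmB pb pb'.
have hl : 0 <= h * la by rewrite mulr_ge0.
have p1 : L1 lebN p.
  apply: (L1_le (proj1 ppb) (L1Z lip (L1_norm d1))) => x; exact: phi_lip.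
have np1 := L1_norm p1; have npb := bm_norm ppb.
have Kp1 : L1 lebN (cv (@shV R N) nu (fun=> 1) p) := cv_L1 mV pV knu p1.
have Kn1 : L1 lebN (cv (@shV R N) nu (fun=> 1) (fun x => `|p x|)) := cv_L1 mV pV knu np1.
have dE x : euler h u x - euler h u' x =
    (u x - u' x - h * la * p x) + h * cv (@shV R N) nu (fun=> 1) p x.
  rewrite /euler /gen (cvB mV knu x pb pb') /p.
  move: (cv _ _ _ _ x) (cv _ _ _ (fun y => phi (u' y)) x) => a b; ring.
have e1 : L1 lebN (fun x => euler h u x - euler h u' x).
  apply: (L1_eq (fun x => esym (dE x))); apply: L1D; last exact: L1Z.
  by apply: L1B => //; exact: L1Z.
split => //.
apply: (@le_trans _ _ (\int[lebN]_x ((`|u x - u' x| - h * la * `|p x|) +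
    h * cv (@shV R N) nu (fun=> 1) (fun x => `|p x|) x))).
  apply: le_int; first exact: L1_norm.
    by apply: L1D; [apply: L1B; [exact: L1_norm|exact: L1Z]|exact: L1Z].
  move=> x; rewrite dE (le_trans (ler_normD _ _))// lerD//; last first.
    by rewrite normrM (ger0_norm h0) ler_wpM2l//; exact: (cv_abs mV knu x ppb).
  apply: same_sign; [|exact: cfl_le].
  have [uu|/ltW uu] := leP (u' x) (u x); [left|right]; rewrite /p ?subr_ge0 ?subr_le0.
    by split => //; exact: phi_le.
  by split => //; exact: phi_le.
have n1 : L1 lebN (fun x => `|u x - u' x|) by exact: L1_norm.
rewrite intD; [|by apply: L1B => //; exact: L1Z|exact: L1Z].
rewrite intB// ?intZ//; last exact: L1Z.
rewrite (int_cv mV pV kV knu npb np1) -/la mulrA.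
by rewrite subrK.
Qed.

Lemma euler_L1 C u : bm C u -> L1 lebN u ->
  L1 lebN (euler h u) /\ \int[lebN]_x `|euler h u x| <= \int[lebN]_x `|u x|.
Proof.
move=> uC u1; have C0 : 0 <= C by exact: (bm_ge0 (0 : V) uC).
have zb : bm C (fun _ : V => 0 : R) by split => // y; rewrite normr0.
have d1 : L1 lebN (fun x => u x - 0) by apply: L1_eq u1 => x; rewrite subr0.
have [e1 e2] := euler_contract uC zb d1.
have e0 x : euler h u x - euler h (fun=> 0) x = euler h u x.
  by rewrite [euler h (fun=> 0) x]/euler gen_cst mulr0 addr0 subr0.
split; first exact: L1_eq e1.
move: e2; congr (_ <= _); apply: eq_Rintegral => x _; by rewrite ?e0 ?subr0.
Qed.

(** The step commutes with translations, so contraction between u and its translate propagates the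
    translation modulus of the data. *)
Lemma euler_shift u b x : euler h (fun y => u (y + b)) x = euler h u (x + b).
Proof.
rewrite /euler /gen; congr (_ + h * (_ - _)); apply: eq_Rintegral => y _.
by rewrite /shV addrAC.
Qed.

End step.

(** phi(u) need not be integrable when phi 0 is not 0. The constant is subtracted first, which the
    operator does not notice. *)
Lemma genX_phi_L1 C u : bm C u -> L1 M u -> L1 M (genX (fun p => phi (u p))).
Proof.
move=> uC u1; have pb := phi_bm uC.
have kb : bm `|phi 0| (fun _ : V * R => phi 0) by exact: bm_cst.
pose g p := phi (u p) - phi 0; have gb := bmB pb kb.
have g1 : L1 M g.
  apply: (L1_le (proj1 gb) (L1Z lip (L1_norm u1))) => p; rewrite (le_trans (phi_lip _ _))//.
  by rewrite subr0.
have h : L1 M (genX g) by apply: L1B; [exact: (cv_L1 mX pX knu g1)|exact: L1Z].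
apply: L1_eq h => p; rewrite /genX (cvB mX knu p pb kb) (cv_cst (@shX R N) knu) -/la /g; ring.
Qed.

Lemma gen_phi_L1 C u : bm C u -> L1 lebN u ->
  L1 lebN (gen (fun x => phi (u x))) /\
  \int[lebN]_x `|gen (fun x => phi (u x)) x| <= 2 * la * lip * \int[lebN]_x `|u x|.
Proof.
move=> uC u1; have pb := phi_bm uC.
have kb : bm `|phi 0| (fun _ : V => phi 0) by exact: bm_cst.
pose g x := phi (u x) - phi 0; have gb := bmB pb kb.
have gu x : `|g x| <= lip * `|u x| by rewrite (le_trans (phi_lip _ _))// subr0.
have g1 : L1 lebN g by exact: (L1_le (proj1 gb) (L1Z lip (L1_norm u1)) gu).
have K1 : L1 lebN (cv (@shV R N) nu (fun=> 1) g) := cv_L1 mV pV knu g1.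
have ge x : gen (fun x => phi (u x)) x = gen g x.
  rewrite /gen (cvB mV knu x pb kb) (cv_cst (@shV R N) knu) -/la /g; ring.
have h : L1 lebN (gen g) by apply: L1B => //; exact: L1Z.
split; first by apply: L1_eq h => x; rewrite ge.
apply: (@le_trans _ _ (\int[lebN]_x (`|cv (@shV R N) nu (fun=> 1) g x| + la * `|g x|))).
  apply: le_int; [by apply: L1_norm; apply: L1_eq h => x; rewrite ge| |].
    by apply: L1D; [exact: L1_norm|apply: L1Z; exact: L1_norm].
  move=> x; rewrite ge /gen (le_trans (ler_normB _ _))//.
  by rewrite normrM (ger0_norm la0).
rewrite intD; [|exact: L1_norm|by apply: L1Z; exact: L1_norm].
rewrite intZ; last exact: L1_norm.
have h1 := cv_L1_le mV pV kV knu gb g1.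
have h2 : \int[lebN]_x `|g x| <= lip * \int[lebN]_x `|u x|.
  by rewrite -intZ; [apply: le_int => //; [exact: L1_norm|apply: L1Z; exact: L1_norm]|exact: L1_norm].
have h3 := ler_wpM2l la0 h2; rewrite -/la in h1.
apply: (le_trans (lerD h1 (lexx _))).
move: h3; move: (\int[_]_x _) (\int[_]_x `|u x|) => a b; rewrite mulrA; lra.
Qed.

End generator.

(** Truncation at height n: the bounded part contributes at most n times the length of the interval,
    the rest is small in L^1. *)
Lemma prim_ac (R : realType) (a : R -> R) : L1 (lebR R) a -> forall d, 0 < d ->
  exists2 h, 0 < h & forall x y, 0 <= x <= y -> y - x <= h ->
    \int[lebR R]_s ((x < s < y)%R%:R * `|a s|) <= d.
Proof.
move=> a1 d d0; have ma := L1_measurable a1.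
pose b (n : nat) (s : R) := a s * (`|a s| <= n%:R)%R%:R.
have mle n : measurable_fun [set: R] (fun s => (`|a s| <= n%:R)%R%:R : R).
  by apply: measurable_boolR; apply: measurable_fun_ler => //; exact: measurableT_comp.
have mb n : measurable_fun [set: R] (b n) by exact: measurable_funM.
have bs n s : `|b n s| <= `|a s|.
  by rewrite /b; case: (_ <= n%:R); rewrite ?mulr1 ?mulr0 ?normr0.
have cvb : {ae lebR R, forall s, b ^~ s @ \oo --> a s}.
  apply: aeW => s; apply: cvg_near_cst; exists (Num.truncn `|a s|).+1 => // n /= hn.
  rewrite /b (_ : `|a s| <= n%:R) ?mulr1//.
  by rewrite (le_trans (ltW (truncnS_gt _)))// ler_nat.
have d2 : 0 < d / 2 by rewrite divr_gt0.
have [n /(_ n (leqnn n)) hn] := cvg0_le (dct_L1 mb ma (L1_norm a1) bs cvb) d2.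
exists (d / 2 / (n%:R + 1)); first by rewrite divr_gt0// ltr_wpDl.
move=> x y /andP[x0 xy] yx.
have i1 := itvb_L1 x y.
have b1 : L1 (lebR R) (b n) by exact: (L1_le (mb n) (L1_norm a1) (bs n)).
have D1 : L1 (lebR R) (fun s => `|b n s - a s|) by apply: L1_norm; exact: L1B.
apply: (@le_trans _ _ (\int[lebR R]_s (n%:R * (x < s < y)%R%:R + `|b n s - a s|))).
  apply: le_int.
  - apply: (L1_le _ (L1_norm a1)) => [|s].
      apply: measurable_funM; last exact: measurableT_comp.
      by apply: measurable_boolR; exact: measurable_itvb.
    by case: (x < s < y); rewrite ?mul1r ?mul0r ?normr_id ?normr0.
  - by apply: L1D => //; exact: L1Z.
  move=> s; case: (x < s < y); last by rewrite mul0r mulr0 add0r.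
  rewrite mul1r mulr1; have h1 : `|b n s| <= n%:R.
    by rewrite /b; case: (leP `|a s| n%:R) => h; rewrite ?mulr1 ?mulr0 ?normr0.
  have := ler_normB (b n s) (b n s - a s); rewrite opprB addrC subrK; lra.
rewrite intD//; last exact: L1Z.
rewrite intZ// int_itvb// [leRHS](splitr d) lerD//; last first.
  by apply: le_trans hn; exact: ler_norm.
have n0 : 0 <= n%:R :> R by [].
by apply: (le_trans (ler_wpM2l n0 yx)); apply: frac_le => //; exact: ltW.
Qed.

(** * The explicit scheme and its interpolations *)

Section scheme.
Variables (R : realType) (N : nat).
Local Notation V := 'rV[R]_N.
Local Notation lebN := (lebesgue_rV R N).
Local Notation M := (lebX R N).
Variables (nu : {sigma_finite_measure set V -> \bar R}) (phi : R -> R) (lip : R).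
Hypothesis knu : kern nu (fun=> 1).
Hypothesis phi_le : {homo phi : x y / x <= y}.
Hypothesis lip0 : 0 <= lip.
Hypothesis phi_lip : forall a b, `|phi a - phi b| <= lip * `|a - b|.
Hypothesis mphi : measurable_fun [set: R] phi.
Let la : R := \int[nu]_y 1.
Let la0 : 0 <= la. Proof. exact: (mass_ge0 knu). Qed.
Let mX := @measurable_shX R N.

(** [Bs] holds the initial datum plus the source integrated in time. [Q] and [A] dominate its
    increments in sup norm and in L^1; because the step is nonexpansive, they become the bounds of
    the scheme itself. *)
Variables (S : R) (Bs : V * R -> R) (Q A : R -> R).
Hypothesis S0 : 0 < S.
Hypothesis mBs : measurable_fun [set: V * R] Bs.
Hypothesis BQ0 : forall x, `|Bs (x, 0)| <= Q 0.
Hypothesis BQ : forall x s t, 0 <= s <= t -> t <= S -> `|Bs (x, t) - Bs (x, s)| <= Q t - Q s.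
Hypothesis BA0 : L1 lebN (fun x => Bs (x, 0)) /\ \int[lebN]_x `|Bs (x, 0)| <= A 0.
Hypothesis BA : forall s t, 0 <= s <= t -> t <= S -> L1 lebN (fun x => Bs (x, t) - Bs (x, s)) /\
  \int[lebN]_x `|Bs (x, t) - Bs (x, s)| <= A t - A s.

(** The same kind of control for the increments of a translation difference, with D as the resulting
    modulus. *)
Definition shift_control b (D : R -> R) : Prop :=
  \int[lebN]_x `|Bs (x + b, 0) - Bs (x, 0)| <= D 0 /\
  forall s t, 0 <= s <= t -> t <= S ->
    \int[lebN]_x `|(Bs (x + b, t) - Bs (x + b, s)) - (Bs (x, t) - Bs (x, s))| <= D t - D s.

Variable n : nat.
Let tau : R := S / n.+1%:R.
Hypothesis cfl : tau * la * lip <= 1.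
Let tau0 : 0 < tau. Proof. by rewrite divr_gt0. Qed.
Let t_ (k : nat) : R := k%:R * tau.
Let tS k : t_ k.+1 = t_ k + tau. Proof. by rewrite /t_ -natr1 mulrDl mul1r. Qed.
Let t0 k : 0 <= t_ k. Proof. by rewrite mulr_ge0// ltW. Qed.
Let tn : t_ n.+1 = S. Proof. by rewrite /t_ /tau mulrC divfK// pnatr_eq0. Qed.
Let t_le j k : (t_ j <= t_ k) = (j <= k)%N. Proof. by rewrite /t_ ler_pM2r// ler_nat. Qed.
Let t_lt j k : (t_ j < t_ k) = (j < k)%N. Proof. by rewrite /t_ ltr_pM2r// ltr_nat. Qed.

Fixpoint es (k : nat) : V -> R :=
  if k is k'.+1 then fun x => euler nu phi tau (es k') x + (Bs (x, t_ k) - Bs (x, t_ k'))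
  else fun x => Bs (x, 0).

Definition eh k h x := euler nu phi h (es k) x + (Bs (x, t_ k + h) - Bs (x, t_ k)).

Let mBt t : measurable_fun [set: V] (fun x => Bs (x, t)).
Proof. exact: (measurable_slice2 t mBs). Qed.

Let cflh h : 0 <= h <= tau -> h * la * lip <= 1.
Proof.
move=> /andP[h0 ht]; apply: le_trans cfl.
by apply: ler_wpM2r => //; exact: ler_wpM2r.
Qed.

Let good k h (u : V -> R) : Prop := [/\ bm (Q (t_ k + h)) u, L1 lebN u &
  \int[lebN]_x `|u x| <= A (t_ k + h)].

Let th_le k h : (k <= n)%N -> 0 <= h <= tau -> t_ k + h <= S.
Proof. by move=> kn /andP[_ ht]; rewrite -tn (le_trans (lerD (lexx _) ht))// -tS t_le. Qed.

Lemma eh_good k h : (k <= n)%N -> 0 <= h <= tau -> good k 0 (es k) -> good k h (eh k h).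
Proof.
move=> kn hh [ub u1 uA]; have /andP[h0 ht] := hh; rewrite addr0 in ub uA.
have hS := th_le kn hh; have h3 : 0 <= t_ k <= t_ k + h by rewrite t0 lerDl.
have eb := euler_bm knu phi_le lip0 phi_lip mphi h0 (cflh hh) ub.
have [e1 eA] := euler_L1 knu phi_le lip0 phi_lip mphi h0 (cflh hh) ub u1.
have [d1 dA] := BA h3 hS.
split.
- split; first by apply: measurable_funD; [case: eb|exact: measurable_funB].
  move=> x; rewrite (le_trans (ler_normD _ _))//.
  by have := BQ x h3 hS; have := (proj2 eb) x; lra.
- exact: L1D.
apply: (@le_trans _ _ (\int[lebN]_x (`|euler nu phi h (es k) x| + `|Bs (x, t_ k + h) - Bs (x, t_ k)|))).
  apply: le_int; [by apply: L1_norm; exact: L1D|by apply: L1D; exact: L1_norm|].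
  by move=> x; exact: ler_normD.
by rewrite intD; [|exact: L1_norm|exact: L1_norm]; lra.
Qed.

Let es_eh k : es k.+1 = eh k tau.
Proof. by apply/funext => x; rewrite /= /eh tS. Qed.

Let tautau : 0 <= tau <= tau. Proof. by rewrite lexx ltW. Qed.

Lemma es_good k : (k <= n.+1)%N -> good k 0 (es k).
Proof.
elim: k => [_|k IH kn].
  rewrite /good /t_ mul0r addr0; case: BA0 => b1 b2; split => //.
  by split; [exact: mBt|exact: BQ0].
by rewrite es_eh /good addr0 tS; apply: eh_good => //; apply: IH; exact: ltnW.
Qed.

Lemma eh_shift b D k h : shift_control b D -> (k <= n)%N -> 0 <= h <= tau ->
  \int[lebN]_x `|es k (x + b) - es k x| <= D (t_ k) ->
  \int[lebN]_x `|eh k h (x + b) - eh k h x| <= D (t_ k + h).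
Proof.
move=> [_ hD] kn hh uD; have [ub u1 _] := es_good (leqW kn); have /andP[h0 ht] := hh.
rewrite addr0 in ub.
have hS := th_le kn hh; have h3 : 0 <= t_ k <= t_ k + h by rewrite t0 lerDl.
have [d1 _] := BA h3 hS; have d1b := L1_shiftV b d1.
have ub' : bm (Q (t_ k)) (fun y : V => es k (y + b)).
  split; first by apply: (measurableT_comp (proj1 ub)); apply: measurable_addv.
  by move=> x; exact: (proj2 ub).
have db1 : L1 lebN (fun x => es k (x + b) - es k x) by apply: L1B => //; exact: L1_shiftV.
have [e1 eA] := euler_contract knu phi_le lip0 phi_lip mphi h0 (cflh hh) ub' ub db1.
have f1 : L1 lebN (fun x => (Bs (x + b, t_ k + h) - Bs (x + b, t_ k)) - (Bs (x, t_ k + h) - Bs (x, t_ k))).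
  exact: L1B.
apply: (@le_trans _ _ (\int[lebN]_x (`|euler nu phi h (fun y => es k (y + b)) x - euler nu phi h (es k) x| +
   `|(Bs (x + b, t_ k + h) - Bs (x + b, t_ k)) - (Bs (x, t_ k + h) - Bs (x, t_ k))|))).
  have [_ g1 _] := eh_good kn hh (es_good (leqW kn)).
  apply: le_int; [by apply: L1_norm; apply: L1B => //; exact: L1_shiftV|by apply: L1D; exact: L1_norm|].
  move=> x; rewrite euler_shift /eh.
  move: (euler _ _ _ _ _) (euler _ _ _ _ x) (Bs (x + b, _ + _)) (Bs (x + b, _)) (Bs (x, _ + _)) (Bs (x, _)) => a1 a2 a3 a4 a5 a6.
  have -> : a1 + (a3 - a4) - (a2 + (a5 - a6)) = (a1 - a2) + ((a3 - a4) - (a5 - a6)) by ring.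
  exact: ler_normD.
have := hD _ _ h3 hS.
by rewrite intD; [|exact: L1_norm|exact: L1_norm]; lra.
Qed.

Lemma es_shift b D k : shift_control b D -> (k <= n.+1)%N ->
  \int[lebN]_x `|es k (x + b) - es k x| <= D (t_ k).
Proof.
move=> hD; elim: k => [_|k IH kn]; first by rewrite /t_ mul0r /=; case: hD.
by rewrite es_eh tS; apply: eh_shift => //; apply: IH; exact: ltnW.
Qed.

(** Constant on each cell [t_k, t_(k+1)[, at the value to which the operator is applied during that
    cell. *)
Definition util (p : V * R) : R := \sum_(k < n.+1) (t_ k <= p.2 < t_ k.+1)%R%:R * es k p.1.

Lemma util_cell k x s : (k <= n)%N -> t_ k <= s < t_ k.+1 -> util (x, s) = es k x.
Proof.
move=> kn /andP[ks sk]; rewrite /util (bigD1 (inord k : 'I_n.+1))//= inordK//.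
rewrite ks sk mul1r big1 ?addr0// => i ik.
suff -> : (t_ i <= s < t_ i.+1) = false by rewrite mul0r.
apply/negP => /andP[is_ si]; move/negP: ik; apply.
have h1 : (i < k.+1)%N := etrans (esym (t_lt i k.+1)) (le_lt_trans is_ sk).
have h2 : (k < i.+1)%N := etrans (esym (t_lt k i.+1)) (le_lt_trans ks si).
have e : nat_of_ord i = k by apply: anti_leq; rewrite -ltnS h1 -ltnS h2.
by apply/eqP/val_inj; exact: (etrans e (esym (inordK (kn : (k < n.+1)%N)))).
Qed.

Lemma util_out x s : ~~ (0 <= s < S) -> util (x, s) = 0.
Proof.
move=> hs; rewrite /util big1// => i _.
suff -> : (t_ i <= s < t_ i.+1) = false by rewrite mul0r.
apply/negP => /andP[is_ si]; move/negP: hs; apply; apply/andP; split.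
  exact: le_trans (t0 i) is_.
by apply: (lt_le_trans si); rewrite -tn t_le.
Qed.

Lemma cell_exists s : 0 <= s < S -> exists2 k, (k <= n)%N & t_ k <= s < t_ k.+1.
Proof.
move=> /andP[s0 sS]; have st : 0 <= s / tau by rewrite divr_ge0// ltW.
have /andP[h1 h2] := truncn_itv st; exists (Num.truncn (s / tau)).
  rewrite -ltnS -t_lt tn; apply: le_lt_trans sS.
  by rewrite /t_ -ler_pdivlMr.
by rewrite /t_ -ler_pdivlMr// h1 -ltr_pdivrMr.
Qed.

Lemma cell_exists_le s : 0 <= s <= S -> exists k h, [/\ (k <= n)%N, 0 <= h <= tau & s = t_ k + h].
Proof.
move=> /andP[s0]; rewrite le_eqVlt => /orP[/eqP ->|sS].
  by exists n, tau; split => //; rewrite -tS tn.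
have [|k kn /andP[h1 h2]] := @cell_exists s; first by rewrite s0.
exists k, (s - t_ k); split => //; last by rewrite addrC subrK.
by rewrite subr_ge0 h1 /= lerBlDl -tS ltW.
Qed.

Lemma Q_le s t : 0 <= s <= t -> t <= S -> Q s <= Q t.
Proof. by move=> st tS'; rewrite -subr_ge0; exact: le_trans (normr_ge0 _) (BQ 0 st tS'). Qed.

Lemma A_le s t : 0 <= s <= t -> t <= S -> A s <= A t.
Proof.
move=> st tS'; rewrite -subr_ge0; have [_ h] := BA st tS'.
by apply: le_trans h; exact: int_ge0.
Qed.

Let tkS k : (k <= n.+1)%N -> t_ k <= S. Proof. by move=> kn; rewrite -tn t_le. Qed.

Lemma util_bm : bm (Q S) util.
Proof.
split.
  apply: measurable_sum => k; apply: measurable_funM.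
    apply: measurable_boolR; apply: measurable_and; first exact: measurable_fun_ler.
    exact: measurable_fun_ltr.
  have [[mu _] _ _] := es_good (ltnW (ltn_ord k)).
  exact: (measurableT_comp mu measurable_fst).
have Q0 : 0 <= Q S.
  by apply: (@le_trans _ _ (Q 0)); [exact: le_trans (BQ0 0)|apply: Q_le; rewrite ?lexx// ltW].
move=> [x s]; have [sS|/util_out ->] := boolP (0 <= s < S); last by rewrite normr0.
have [k kn hk] := cell_exists sS; rewrite (util_cell x kn hk).
have [[_ h] _ _] := es_good (leqW kn); apply: (le_trans (h x)); rewrite addr0.
by apply: Q_le; rewrite ?t0 ?tkS// leqW.
Qed.

Lemma util_L1 : L1 M util.
Proof.
apply: L1_sum => k; have [_ u1 _] := es_good (ltnW (ltn_ord k)).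
have i1 : L1 (lebR R) (fun s : R => (t_ k <= s < t_ k.+1)%R%:R).
  apply: (L1_le _ (itvb_L1 (t_ k - 1) (t_ k.+1))) => [|s].
    apply: measurable_boolR; apply: measurable_and; first exact: measurable_fun_ler.
    exact: measurable_fun_ltr.
  have [/andP[h1 h2]|_] := boolP (t_ k <= s < t_ k.+1); last by rewrite normr0.
  by rewrite normr1 (_ : t_ k - 1 < s) ?h2//; lra.
by apply: L1_eq (L1X_tensor u1 i1) => p; rewrite mulrC.
Qed.

Definition rhs (p : V * R) : R := genX nu (fun q => phi (util q)) p.

Let phib := phi_bm lip0 phi_lip mphi util_bm.

Lemma rhs_bm : exists C, bm C rhs.
Proof. by eexists; apply: bmB; [exact: (cv_bm mX knu phib)|exact: (bmZ _ phib)]. Qed.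

Lemma rhs_L1 : L1 M rhs.
Proof. exact: (genX_phi_L1 knu lip0 phi_lip mphi util_bm util_L1). Qed.

Lemma rhs_cell k x s : (k <= n)%N -> t_ k <= s < t_ k.+1 ->
  rhs (x, s) = gen nu (fun y => phi (es k y)) x.
Proof.
move=> kn hk; rewrite -[LHS]/(gen nu (fun y => phi (util (y, s))) x).
by congr (gen nu _ x); apply/funext => y; rewrite (util_cell y kn hk).
Qed.

Lemma rhs_out x s : ~~ (0 <= s < S) -> rhs (x, s) = 0.
Proof.
move=> hs; rewrite -[LHS]/(gen nu (fun y => phi (util (y, s))) x).
rewrite (_ : (fun y => _) = fun=> phi 0) ?gen_cst//.
by apply/funext => y; rewrite util_out.
Qed.

Lemma rhs_L1x x : L1 (lebR R) (fun s => rhs (x, s)).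
Proof.
have [C [mr rC]] := rhs_bm.
(* The dominating open interval starts at -1 in order to contain the left end 0 of the first
   cell. *)
apply: (L1_le (measurable_slice1 x mr) (L1Z C (itvb_L1 (-1) S))) => s.
have [/andP[s0 sS]|/rhs_out ->] := boolP (0 <= s < S).
  by rewrite (_ : -1 < s < S) ?mulr1//; apply/andP; split => //; lra.
by rewrite normr0 mulr_ge0//; exact: le_trans (rC (x, s)).
Qed.

(** The interpolation that satisfies the integrated equation exactly, with the operator evaluated at
    [util]. Inside a cell it is a partial Euler step of length h <= tau, so it inherits the bounds
    of the scheme. *)
Definition uhat (p : V * R) : R := Bs p + prim (fun s => rhs (p.1, s)) p.2.

Let uhat_step k h x : (k <= n)%N -> 0 <= h <= tau -> uhat (x, t_ k) = es k x ->
  uhat (x, t_ k + h) = eh k h x.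
Proof.
move=> kn hh ek; have /andP[h0 ht] := hh.
have h3 : 0 <= t_ k <= t_ k + h by rewrite t0 lerDl.
have := prim_diff (rhs_L1x x) h3.
have -> : \int[lebR R]_s ((t_ k < s < t_ k + h)%R%:R * rhs (x, s)) =
    h * gen nu (fun y => phi (es k y)) x.
  transitivity (\int[lebR R]_s ((t_ k < s < t_ k + h)%R%:R * gen nu (fun y => phi (es k y)) x)).
    apply: eq_Rintegral => s _; have [/andP[s1 s2]|_] := boolP (t_ k < s < t_ k + h); last by rewrite !mul0r.
    by rewrite (@rhs_cell k)// (ltW s1) tS (lt_le_trans s2)// lerD2l.
  by rewrite int_Zr ?int_itvb ?lerDl// ?[t_ k + h]addrC ?addrK//; exact: itvb_L1.
move: ek; rewrite /uhat /eh /euler /=.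
move: (prim _ _) (prim _ (t_ k)) (gen _ _ _) => a b d; lra.
Qed.

Lemma uhat_es k x : (k <= n.+1)%N -> uhat (x, t_ k) = es k x.
Proof.
elim: k => [_|k IH kn]; first by rewrite /uhat /= /t_ mul0r prim_le0// addr0.
by rewrite tS (uhat_step kn tautau) ?es_eh//; apply: IH; exact: ltnW.
Qed.

Lemma uhat_eh k h x : (k <= n)%N -> 0 <= h <= tau -> uhat (x, t_ k + h) = eh k h x.
Proof. by move=> kn hh; apply: uhat_step => //; exact: uhat_es (leqW kn). Qed.

Lemma measurable_uhat : measurable_fun [set: V * R] uhat.
Proof.
have [C [mr _]] := rhs_bm.
by apply: measurable_funD => //; exact: (measurable_primX mr).
Qed.

Lemma uhat_good t : 0 <= t <= S -> [/\ forall x, `|uhat (x, t)| <= Q S,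
  L1 lebN (fun x => uhat (x, t)) & \int[lebN]_x `|uhat (x, t)| <= A S].
Proof.
move=> tS'; have /andP[t0' tS2] := tS'.
have [k [h [kn hh ->]]] := cell_exists_le tS'.
have [[_ b] l a] := eh_good kn hh (es_good (leqW kn)).
have hS := th_le kn hh; have /andP[h0 _] := hh.
have h3 : 0 <= t_ k + h <= S by rewrite addr_ge0.
split.
- by move=> x; rewrite uhat_eh//; apply: (le_trans (b x)); apply: Q_le.
- by apply: L1_eq l => x; rewrite uhat_eh.
- under eq_Rintegral do rewrite uhat_eh//.
  by apply: (le_trans a); apply: A_le.
Qed.

Lemma uhat_shift b D t : shift_control b D -> 0 <= t <= S ->
  \int[lebN]_x `|uhat (x + b, t) - uhat (x, t)| <= D S.
Proof.
move=> hD tS'; have [k [h [kn hh ->]]] := cell_exists_le tS'.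
under eq_Rintegral do rewrite !uhat_eh//.
apply: (le_trans (eh_shift hD kn hh (es_shift hD (leqW kn)))).
have /andP[h0 _] := hh; have h3 : 0 <= t_ k + h <= S by rewrite addr_ge0//= th_le.
have [_ hd] := hD; rewrite -subr_ge0; apply: le_trans (hd _ _ h3 (lexx _)); exact: int_ge0.
Qed.

Let C := 2 * la * lip * A S.

Lemma rhs_int s : L1 lebN (fun x => rhs (x, s)) /\ \int[lebN]_x `|rhs (x, s)| <= C.
Proof.
have AS0 : 0 <= A S.
  have [_ h] := BA0; apply: (@le_trans _ _ (A 0)); first by apply: le_trans h; exact: int_ge0.
  by apply: A_le; rewrite ?lexx// ltW.
have C0 : 0 <= C by rewrite !mulr_ge0.
have [sS|hs] := boolP (0 <= s < S); last first.
  split; first by apply: L1_eq (L10 lebN) => x; rewrite rhs_out.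
  under eq_Rintegral do rewrite rhs_out// normr0.
  by rewrite int0.
have [k kn hk] := cell_exists sS; have [ub u1 uA] := es_good (leqW kn).
have [g1 g2] := gen_phi_L1 knu lip0 phi_lip mphi ub u1.
split; first by apply: L1_eq g1 => x; rewrite (rhs_cell x kn hk).
under eq_Rintegral do rewrite (rhs_cell _ kn hk).
apply: (le_trans g2); apply: ler_wpM2l; first by rewrite !mulr_ge0.
by apply: (le_trans uA); rewrite addr0; apply: A_le; rewrite ?t0 ?tkS// leqW.
Qed.

Lemma uhat_util t : 0 <= t < S -> exists2 s, 0 <= s <= t /\ t - s <= tau &
  L1 lebN (fun x => uhat (x, t) - util (x, t)) /\
  \int[lebN]_x `|uhat (x, t) - util (x, t)| <= tau * C + (A t - A s).
Proof.
move=> tS'; have [k kn hk] := cell_exists tS'; have /andP[k1 k2] := hk.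
have /andP[_ tS2] := tS'.
have hh : 0 <= t - t_ k <= tau by rewrite subr_ge0 k1 lerBlDl -tS ltW.
have h3 : 0 <= t_ k <= t by rewrite t0.
have [d1 dA] := BA h3 (ltW tS2).
exists (t_ k); first by split => //; case/andP: hh.
have [g1 g2] := rhs_int t.
have e x : uhat (x, t) - util (x, t) = (t - t_ k) * rhs (x, t) + (Bs (x, t) - Bs (x, t_ k)).
  rewrite (util_cell x kn hk) (rhs_cell x kn hk).
  have {1}-> : t = t_ k + (t - t_ k) by ring.
  by rewrite (uhat_eh x kn hh) /eh /euler (_ : t_ k + (t - t_ k) = t); ring.
have le1 : L1 lebN (fun x => (t - t_ k) * rhs (x, t) + (Bs (x, t) - Bs (x, t_ k))).
  by apply: L1D => //; exact: L1Z.
split; first by apply: L1_eq le1 => x; rewrite e.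
under eq_Rintegral do rewrite e.
have /andP[h0 ht] := hh.
apply: (@le_trans _ _ (\int[lebN]_x ((t - t_ k) * `|rhs (x, t)| + `|Bs (x, t) - Bs (x, t_ k)|))).
  apply: le_int; [by apply: L1_norm; apply: L1D => //; exact: L1Z|by apply: L1D; [apply: L1Z|]; exact: L1_norm|].
  by move=> x; rewrite (le_trans (ler_normD _ _))// lerD2r normrM (ger0_norm h0).
rewrite intD; [|by apply: L1Z; exact: L1_norm|exact: L1_norm].
rewrite intZ; last exact: L1_norm.
by rewrite lerD// ler_pM//; exact: int_ge0.
Qed.

Lemma uhat_time s t : 0 <= s <= t -> t <= S ->
  \int[lebN]_x `|uhat (x, t) - uhat (x, s)| <= C * (t - s) + (A t - A s).
Proof.
move=> st tS'; have [d1 dA] := BA st tS'; have /andP[s0 st'] := st.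
pose H (p : V * R) := (s < p.2 < t)%R%:R * `|rhs p|.
have H1 : L1 M H.
  apply: (bm_L1 (a := 1)); last by apply: L1_norm; exact: rhs_L1.
  by apply: boolR_bm; exact: measurable_itvb.
have I1 : \int[lebN]_x \int[lebR R]_r H (x, r) <= C * (t - s).
  rewrite -(intX1 H1) (intX2 H1) -(int_itvb st') -intZ; last exact: itvb_L1.
  apply: le_int; [exact: (L1X_int2 H1)|by apply: L1Z; exact: itvb_L1|].
  move=> r; have [g1 g2] := rhs_int r; rewrite /H /= intZ; last exact: L1_norm.
  by rewrite mulrC ler_wpM2r.
have sS : 0 <= s <= S by rewrite s0 (le_trans st').
have ttS : 0 <= t <= S by rewrite (le_trans s0).
have [_ us _] := uhat_good sS; have [_ ut _] := uhat_good ttS.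
have HI := L1X_int1 H1.
apply: (@le_trans _ _ (\int[lebN]_x (\int[lebR R]_r H (x, r) + `|Bs (x, t) - Bs (x, s)|))).
  apply: le_int; [by apply: L1_norm; exact: L1B|by apply: L1D => //; exact: L1_norm|].
  move=> x; rewrite /uhat /= addrC.
  have -> : - (Bs (x, s) + prim (fun r => rhs (x, r)) s) + (Bs (x, t) + prim (fun r => rhs (x, r)) t) =
    (prim (fun r => rhs (x, r)) t - prim (fun r => rhs (x, r)) s) + (Bs (x, t) - Bs (x, s)) by ring.
  rewrite (le_trans (ler_normD _ _))// lerD2r (prim_diff (rhs_L1x x) st) /H /=.
  have l1 : L1 (lebR R) (fun r => (s < r < t)%R%:R * rhs (x, r)).
    by apply: bm_L1 (rhs_L1x x); apply: boolR_bm; exact: measurable_itvb.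
  rewrite (le_trans (le_norm_int l1))// le_eqVlt; apply/orP; left; apply/eqP.
  by apply: eq_Rintegral => r _; case: (s < r < t); rewrite ?mul1r ?mul0r ?normr0.
by rewrite intD//; [lra|exact: L1_norm].
Qed.

End scheme.

(** * Uniform continuity and Lipschitz approximation of phi *)

Section monotone_nonlinearity.
Variables (R : realType) (phi : R -> R).
Hypothesis phi_le : {homo phi : x y / x <= y}.
Hypothesis cphi : continuous phi.

(** Heine's theorem in a slightly stronger form: only a is confined to [-M, M], while b may leave
    the interval. *)
Lemma unif_cont (M d : R) : 0 < d -> exists2 h, 0 < h &
  forall a b, `|a| <= M -> `|b - a| < h -> `|phi b - phi a| <= d.
Proof.
move=> d0; have d2 : 0 < d / 2 by rewrite divr_gt0.
pose P (h x : R) := forall y, `|y - x| < h -> `|phi y - phi x| <= d.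
have /compact_near_coveringP := @segment_compact R (- M) M.
move=> /(_ R (0 : R)^'+ P _) cov.
have near1 : forall x, `[- M, M]%classic x -> \forall x' \near x & h \near (0 : R)^'+, P h x'.
  move=> x _; have : phi @ x --> phi x by exact: cphi.
  move=> /cvgrPdist_lt /(_ _ d2) /nbhs_ballP[r /= r0 hr].
  have r2 : 0 < r / 2 by rewrite divr_gt0.
  exists (ball x (r / 2), [set h | h < r / 2]).
    by split; [exact: nbhsx_ballx|exact: nbhs_right_lt].
  move=> [x' h] /= [xx' hr2] y yx'.
  have b1 : `|phi x - phi x'| < d / 2.
    by apply: hr; apply: le_ball xx'; rewrite ler_pdivrMr// ler_pMr// ler1n.
  have b2 : `|phi x - phi y| < d / 2.
    apply: hr; rewrite /ball /=; have := ler_distD x' x y.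
    move: xx' yx'; rewrite /ball /= (distrC y x') => ??; lra.
  have := ler_distD (phi x) (phi y) (phi x'); rewrite (distrC (phi y) (phi x)); lra.
have FF : Filter (0 : R)^'+ by exact: at_right_proper_filter.
have h1 := cov near1.
have h2 : \forall h \near (0 : R)^'+, 0 < h by exact: nbhs_right_gt.
have FP : ProperFilter (0 : R)^'+ by exact: at_right_proper_filter.
have h12 := filterI h1 h2.
have [h [/= hK h0]] := @filter_ex _ (0 : R)^'+ FP _ (h12 FF).
exists h => // a b aM ab; apply: (hK a) => //=.
by rewrite in_itv /= -ler_norml.
Qed.

(** The inf-convolution y -> f(y) + L |x - y| of the clipped function. An infimum of L-Lipschitz
    functions is L-Lipschitz, and it lies below f by the choice y = x. *)
Lemma lip_approx (M d : R) : 0 < M -> 0 < d -> exists psi L, [/\ 0 <= L,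
  {homo psi : x y / x <= y}, forall a b, `|psi a - psi b| <= L * `|a - b| &
  forall x, `|x| <= M -> `|psi x - phi x| <= d].
Proof.
move=> M0 d0; have [h h0 hh] := unif_cont M d0.
(* Clipping makes f bounded, hence the infimum finite, without changing phi on [-M, M]. *)
pose clip (x : R) := Num.max (- M) (Num.min M x).
have clip_in x : `|clip x| <= M.
  by rewrite ler_norml /clip le_max lexx /= ge_max ge_min lexx andbT /= ; lra.
have clip_id x : `|x| <= M -> clip x = x.
  by rewrite ler_norml => /andP[h1 h2]; rewrite /clip (min_r h2) (max_r h1).
have clip_le x y : x <= y -> clip x <= clip y.
  move=> xy; rewrite /clip ge_max; apply/andP; split; rewrite le_max ?lexx//.
  by apply/orP; right; rewrite le_min !ge_min lexx xy orbT.
have clip_dist x y : `|clip x - clip y| <= `|x - y|.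
  rewrite /clip /Num.max /Num.min.
  case: (ltP M x) => ?; case: (ltP M y) => ?; repeat case: ifPn; rewrite -?leNgt => *;
  have := ler_norm (x - y); have := ler_norm (y - x); rewrite (distrC y x) ler_norml => ??; apply/andP; split; lra.
pose f x := phi (clip x).
pose B := `|phi M| + `|phi (- M)|.
have fB x : `|f x| <= B.
  have := clip_in x; rewrite ler_norml => /andP[/phi_le h1 /phi_le h2].
  rewrite ler_norml /B; apply/andP; split.
    have := ler_norm (- phi (- M)); rewrite normrN; have := normr_ge0 (phi M); rewrite /f; lra.
  by have := ler_norm (phi M); have := normr_ge0 (phi (- M)); rewrite /f; lra.
have f_le x y : x <= y -> f x <= f y by move=> xy; apply/phi_le/clip_le.
have B0 : 0 <= B by rewrite addr_ge0.
(* For this slope a competitor y at distance at least h pays 2 B or more, the largest possible gain;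
   nearer ones gain at most d. *)
pose L := 2 * B / h.
have L0 : 0 <= L by rewrite divr_ge0 ?mulr_ge0// ltW.
pose E x := [set f y + L * `|x - y| | y in [set: R]].
have lbE x : lbound (E x) (- B).
  move=> _ [y _ <-]; have := fB y; rewrite ler_norml => /andP[h1 _].
  have h2 : 0 <= L * `|x - y| by rewrite mulr_ge0.
  lra.
have hE x : has_inf (E x) by split; [exists (f x + L * `|x - x|), x|exists (- B)].
pose psi x := inf (E x).
have psi_le x y : psi x <= f y + L * `|x - y|.
  by apply: (ge_inf (proj2 (hE x))); exists y.
have psi_ge x k : (forall y, k <= f y + L * `|x - y|) -> k <= psi x.
  by move=> hk; apply: lb_le_inf; [exact: proj1 (hE x)|move=> _ [y _ <-]].
have lipE a b : psi a - psi b <= L * `|a - b|.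
  rewrite lerBlDr -lerBlDl; apply: psi_ge => y; rewrite lerBlDl (le_trans (psi_le a y))//.
  rewrite addrCA lerD2l -mulrDr ler_wpM2l//; exact: ler_distD.
exists psi, L; split => //.
(* Monotonicity: the competitor y for x' is matched with y - (x' - x) for x, at the same distance
   and with a smaller value of f. *)
- move=> x x' xx'; apply: psi_ge => y; apply: (le_trans (psi_le x (y - (x' - x)))).
  rewrite (_ : x - _ = x' - y); last by ring.
  by rewrite lerD2r f_le// lerBlDr lerDl subr_ge0.
- move=> a b; rewrite ler_norml lipE andbT lerNl opprB distrC; exact: lipE.
move=> x xM; rewrite ler_norml; apply/andP; split; last first.
  have := psi_le x x; rewrite subrr normr0 mulr0 addr0 /f clip_id//; lra.
rewrite lerNl opprB lerBlDr -lerBlDl; apply: psi_ge => y.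
rewrite -{1}(clip_id x xM) -/(f x).
have [xy|xy] := ltP `|x - y| h.
  have h3 : `|f x - f y| <= d.
    rewrite distrC; apply: hh; first exact: clip_in.
    by rewrite distrC (le_lt_trans (clip_dist x y)).
  have h4 : 0 <= L * `|x - y| by rewrite mulr_ge0.
  by move: h3; rewrite ler_norml => /andP[_ h3]; lra.
have h4 : 2 * B <= L * `|x - y|.
  apply: (@le_trans _ _ (L * h)); first by rewrite /L divfK// gt_eqF.
  exact: ler_wpM2l.
have := fB x; have := fB y; rewrite !ler_norml => /andP[h5 _] /andP[_ h6]; lra.
Qed.

End monotone_nonlinearity.

(** * Controls for the initial datum and the source *)

Section base.
Variables (R : realType) (N : nat).
Local Notation V := 'rV[R]_N.
Local Notation lebN := (lebesgue_rV R N).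
Local Notation M := (lebX R N).

Lemma prim_L1_control (g : V * R -> R) s t : L1 M g -> (forall x, L1 (lebR R) (fun r => g (x, r))) ->
  0 <= s <= t ->
  L1 lebN (fun x => prim (fun r => g (x, r)) t - prim (fun r => g (x, r)) s) /\
  \int[lebN]_x `|prim (fun r => g (x, r)) t - prim (fun r => g (x, r)) s| <=
  prim (fun r => \int[lebN]_x `|g (x, r)|) t - prim (fun r => \int[lebN]_x `|g (x, r)|) s.
Proof.
move=> g1 gx st; have mg := L1_measurable g1.
pose H (p : V * R) := (s < p.2 < t)%R%:R * g p.
have cb : bm 1 (fun p : V * R => (s < p.2 < t)%R%:R : R).
  by apply: boolR_bm; exact: measurable_itvb.
have H1 : L1 M H by exact: bm_L1 cb g1.
have nH1 := L1_norm H1; have ng1 := L1_norm g1.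
have HI := L1X_int1 H1; have nHI := L1X_int1 nH1.
have pE x : prim (fun r => g (x, r)) t - prim (fun r => g (x, r)) s = \int[lebR R]_r H (x, r).
  exact: prim_diff.
split; first by apply: L1_eq HI => x; rewrite pE.
rewrite (prim_diff (L1X_int2 ng1) st).
apply: (@le_trans _ _ (\int[lebN]_x \int[lebR R]_r `|H (x, r)|)).
  apply: le_int => //; first by apply: L1_norm; apply: L1_eq HI => x; rewrite pE.
  move=> x; rewrite pE; apply: le_norm_int.
  have cb1 : bm 1 (fun r : R => (s < r < t)%R%:R : R) by apply: boolR_bm; exact: measurable_itvb.
  exact: (bm_L1 cb1 (gx x)).
rewrite -(intX1 nH1) (intX2 nH1) le_eqVlt; apply/orP; left; apply/eqP.
apply: eq_Rintegral => r _; rewrite /H /=; case: (s < r < t).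
  by rewrite mul1r; under eq_Rintegral do rewrite mul1r.
by rewrite mul0r; under eq_Rintegral do rewrite mul0r normr0; rewrite int0.
Qed.

Variables (T M0 : R) (U0 : V -> R) (F : V * R -> R) (m : R -> R).
Hypotheses (T0 : 0 < T) (Ub : bm M0 U0) (U1 : L1 lebN U0).
Hypotheses (F1 : L1 M F) (m1 : L1 (lebR R) m) (Fm : forall x s, `|F (x, s)| <= m s).
(** The extra unit of time makes the weight S - t at least 1 on [0,T], so that weighted bounds
    control the unweighted ones there. *)
Let S := T + 1.

Definition base (p : V * R) : R := U0 p.1 + prim (fun s => F (p.1, s)) p.2.
Definition baseQ (t : R) : R := M0 + prim m t.
Definition baseA (t : R) : R := \int[lebN]_x `|U0 x| + prim (fun s => \int[lebN]_x `|F (x, s)|) t.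
Definition baseD (b : V) (t : R) : R := \int[lebN]_x `|U0 (x + b) - U0 x| +
  prim (fun s => \int[lebN]_x `|F (x + b, s) - F (x, s)|) t.

Let mF := L1_measurable F1.

Lemma F_L1x x : L1 (lebR R) (fun s => F (x, s)).
Proof.
apply: (L1_le (measurable_slice1 x mF) m1) => s; exact: Fm.
Qed.

Lemma measurable_base : measurable_fun [set: V * R] base.
Proof.
apply: measurable_funD; last exact: measurable_primX.
exact: (measurableT_comp (proj1 Ub) measurable_fst).
Qed.

Lemma baseQ0 x : `|base (x, 0)| <= baseQ 0.
Proof. by rewrite /base /baseQ /= !prim_le0// !addr0; exact: (proj2 Ub). Qed.

Lemma base_diff x s t : base (x, t) - base (x, s) = prim (fun r => F (x, r)) t - prim (fun r => F (x, r)) s.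
Proof. rewrite /base /=; ring. Qed.

Lemma baseQ_le x s t : 0 <= s <= t -> `|base (x, t) - base (x, s)| <= baseQ t - baseQ s.
Proof.
move=> st; rewrite base_diff (prim_diff (F_L1x x) st) /baseQ.
have -> : M0 + prim m t - (M0 + prim m s) = prim m t - prim m s by ring.
have cb : bm 1 (fun r : R => (s < r < t)%R%:R : R) by apply: boolR_bm; exact: measurable_itvb.
rewrite (prim_diff m1 st); apply: le_norm_int_le; [exact: bm_L1 cb (F_L1x x)|exact: bm_L1 cb m1|].
by move=> r; case: (s < r < t); rewrite ?mul1r ?mul0r ?normr0//; exact: Fm.
Qed.

Lemma baseA0 : L1 lebN (fun x => base (x, 0)) /\ \int[lebN]_x `|base (x, 0)| <= baseA 0.
Proof.
have e x : base (x, 0) = U0 x by rewrite /base /= prim_le0// addr0.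
split; first by apply: L1_eq U1 => x; rewrite e.
by under eq_Rintegral do rewrite e; rewrite /baseA prim_le0// addr0.
Qed.

Lemma baseA_le s t : 0 <= s <= t -> L1 lebN (fun x => base (x, t) - base (x, s)) /\
  \int[lebN]_x `|base (x, t) - base (x, s)| <= baseA t - baseA s.
Proof.
move=> st; have [h1 h2] := prim_L1_control F1 F_L1x st.
split; first by apply: L1_eq h1 => x; rewrite base_diff.
under eq_Rintegral do rewrite base_diff.
by apply: (le_trans h2); rewrite /baseA; lra.
Qed.

Lemma baseA_unif d : 0 < d -> exists2 h, 0 < h & forall s t, 0 <= s <= t -> t - s <= h ->
  baseA t - baseA s <= d.
Proof.
move=> d0; have a1 := L1X_int2 (L1_norm F1).
have [h h0 hh] := prim_ac a1 d0; exists h => // s t st ts.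
have -> : baseA t - baseA s = prim (fun s => \int[lebN]_x `|F (x, s)|) t - prim (fun s => \int[lebN]_x `|F (x, s)|) s.
  by rewrite /baseA; ring.
rewrite (prim_diff a1 st); apply: le_trans (hh s t st ts).
rewrite le_eqVlt; apply/orP; left; apply/eqP; apply: eq_Rintegral => r _ /=.
by rewrite ger0_norm// int_ge0.
Qed.

Lemma base_shift b : shift_control S base b (baseD b).
Proof.
pose g (p : V * R) := F (p.1 + b, p.2) - F p.
have Fb1 : L1 M (fun p => F (p.1 + b, p.2)) by exact: (mpres_L1 (mpres_shX b) F1).
have g1 : L1 M g by exact: L1B.
have gx x : L1 (lebR R) (fun r => g (x, r)) by exact: (L1B (F_L1x (x + b)) (F_L1x x)).
split.
  by rewrite /base /baseD /= [prim _ 0]prim_le0// addr0; under eq_Rintegral do rewrite !prim_le0// !addr0.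
move=> s t st _; have [_ h2] := prim_L1_control g1 gx st.
have pg x r : prim (fun r => g (x, r)) r = prim (fun r => F (x + b, r)) r - prim (fun r => F (x, r)) r.
  rewrite /prim -intB; [|exact: prim_L1 (F_L1x _)|exact: prim_L1 (F_L1x _)].
  by apply: eq_Rintegral => q _; rewrite /g /= mulrBr.
have -> : baseD b t - baseD b s = prim (fun s => \int[lebN]_x `|g (x, s)|) t - prim (fun s => \int[lebN]_x `|g (x, s)|) s.
  by rewrite /baseD /g /=; ring.
apply: le_trans h2; rewrite le_eqVlt; apply/orP; left; apply/eqP; apply: eq_Rintegral => x _.
by rewrite !base_diff !pg; congr `|_|; ring.
Qed.

Lemma baseD_small d : 0 < d -> exists2 h, 0 < h & forall b : V, `|b| <= h -> baseD b S <= d.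
Proof.
move=> d0; have d2 : 0 < d / 2 by rewrite divr_gt0.
have [_ /(_ _ d2)[h1 h10 hh1]] := L1_tc U1.
have [h2 h20 hh2] := L1_translation F1 d2.
exists (Num.min h1 h2); first by rewrite lt_min h10.
move=> b; rewrite le_min => /andP[b1 b2]; rewrite (splitr d) /baseD lerD ?hh1//.
have g1 : L1 M (fun p => `|F (p.1 + b, p.2) - F p|).
  by apply: L1_norm; apply: L1B => //; exact: (mpres_L1 (mpres_shX b) F1).
apply: le_trans (hh2 b b2); rewrite (intX2 g1) /prim.
have gi := L1X_int2 g1.
apply: le_int => //; first exact: prim_L1.
by move=> s; case: (0 < s < S); rewrite ?mul1r// mul0r int_ge0.
Qed.

End base.

Lemma slab_int (R : realType) (N : nat) (S B : R) (g : 'rV[R]_N * R -> R) : 0 < S ->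
  measurable_fun [set: 'rV[R]_N * R] g ->
  (forall t, 0 < t < S -> L1 (lebesgue_rV R N) (fun x => g (x, t)) /\
     \int[lebesgue_rV R N]_x `|g (x, t)| <= B) ->
  L1 (lebX R N) (fun p => slab S p * g p) /\
  \int[lebX R N]_p `|slab S p * g p| <= S * B.
Proof.
move=> S0 mg hg.
have ms : measurable_fun [set: 'rV[R]_N * R] (fun p => slab S p * g p).
  by apply: measurable_funM => //; case: (slab_bm N S).
have B0 : 0 <= B.
  have h2 : 0 < S / 2 < S by apply/andP; split; lra.
  by have [_ h] := hg _ h2; apply: le_trans h; exact: int_ge0.
have bnd t : (\int[lebesgue_rV R N]_x `|slab S (x, t) * g (x, t)|%:E <= ((0 < t < S)%R%:R * B)%:E)%E.
  rewrite /slab /=; have [tS|ntS] := boolP (0 < t < S); last first.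
    by rewrite integral0_eq ?mul0r// => x _; rewrite mul0r normr0.
  have [g1 gB] := hg t tS; rewrite mul1r.
  under eq_integral do rewrite mul1r.
  by rewrite -EFin_int; [rewrite lee_fin|exact: L1_norm].
have i1 : L1 (lebR R) (fun t => (0 < t < S)%R%:R * B).
  by apply: L1Zr; exact: itvb_L1.
have h1 : L1 (lebX R N) (fun p => slab S p * g p).
  apply: (L1X_prod2 ms); apply: (@le_lt_trans _ _ (\int[lebR R]_t `|(0 < t < S)%R%:R * B|%:E)%E); last exact: L1_lty.
  apply: ge0_le_integral => //.
  - by move=> t _; exact: integral_ge0.
  - have mn : measurable_fun [set: 'rV[R]_N * R] (fun p => `|slab S p * g p|) by exact: measurableT_comp.
    exact: (measurable_eint2 _ mn).
  - by apply/measurable_EFinP; apply: measurableT_comp => //; exact: L1_measurable i1.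
  by move=> t _; apply: (le_trans (bnd t)); rewrite lee_fin ler_norm.
split => //; have n1 := L1_norm h1; rewrite (intX2 n1).
rewrite (_ : S * B = \int[lebR R]_t ((0 < t < S)%R%:R * B)); last first.
  by rewrite int_Zr ?int_itvb ?subr0 ?(ltW S0)//; exact: itvb_L1.
apply: le_int => //; first exact: (L1X_int2 n1).
move=> t; rewrite /slab /=; have [tS|_] := boolP (0 < t < S); last first.
  by under eq_Rintegral do rewrite mul0r normr0; rewrite int0 mul0r.
by under eq_Rintegral do rewrite mul1r; rewrite mul1r; case: (hg t tS).
Qed.

Lemma tri3 (R : realType) (a1 a2 a3 a4 : R) :
  `|a1 - a4| <= `|a1 - a2| + (`|a2 - a3| + `|a3 - a4|).
Proof.
have -> : a1 - a4 = (a1 - a2) + ((a2 - a3) + (a3 - a4)) by ring.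
by apply: (le_trans (ler_normD _ _)); rewrite lerD2l; exact: ler_normD.
Qed.

Lemma J_ext (R : realType) (N : nat) (S : R) (g h : 'rV[R]_N * R -> R) :
  (forall p, 0 < p.2 < S -> g p = h p) -> J S g = J S h.
Proof.
move=> gh; apply/funext => -[x t]; rewrite /J /=; have [tS|_] := ltP t S; last by rewrite !mul0r.
congr (_ * _); apply: eq_Rintegral => s _.
have [/andP[s0 st]|_] := boolP (0 < s < t); last by rewrite !mul0r.
by rewrite gh//= s0 (lt_trans st).
Qed.

(** * The approximations form a Cauchy sequence *)

Section existence.
Variables (R : realType) (N P : nat) (sigma : 'M[R]_(N, P)).
Local Notation V := 'rV[R]_N.
Local Notation lebN := (lebesgue_rV R N).
Local Notation M := (lebX R N).
Variable mu : {measure set V -> \bar R}.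
Variables (nu : nat -> {sigma_finite_measure set V -> \bar R}) (e : nat -> R) (c : R).
Hypothesis e0 : e @ \oo --> (0 : R).
Hypothesis knu : forall n, kern (nu n) (fun=> 1).
Hypothesis levyE : forall A r g n x, levy_nice sigma A r g ->
  `|levy_op sigma mu g x - \int[nu n]_z (g (x + z) - g x)| <=
  A * e n * \1_(ball (0 : V) (r + c)) x.
Variable phi : R -> R.
Hypothesis phi_le : {homo phi : x y / x <= y}.
Hypothesis cphi : continuous phi.
Variables (T M0 : R) (U0 : V -> R) (F : V * R -> R) (m : R -> R).
Hypotheses (T0 : 0 < T) (Ub : bm M0 U0) (U1 : L1 lebN U0).
Hypotheses (F1 : L1 M F) (m1 : L1 (lebR R) m) (Fm : forall x s, `|F (x, s)| <= m s).
Let S := T + 1.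
Let S0 : 0 < S. Proof. by rewrite /S addr_gt0. Qed.
Let Q := baseQ M0 m.
Let A := baseA U0 F.
Let D b := baseD U0 F b S.
(** The added 1 keeps the bound positive even for zero data. *)
Definition Mb := Q S + 1.
Let mX := @measurable_shX R N.
Let pX := @mpres_shX R N.
Let kX := @shXK R N.
Let mV := @measurable_shV R N.
Let pV := @mpres_shV R N.

Let M00 : 0 <= M0. Proof. exact: (bm_ge0 (0 : V) Ub). Qed.
Let QS0 : 0 <= Q S.
Proof.
have h0S : 0 <= (0 : R) <= S by rewrite lexx ltW.
have h := baseQ_le M0 U0 F1 m1 Fm (0 : V) h0S.
have h2 := le_trans (normr_ge0 _) h; rewrite subr_ge0 in h2; apply: le_trans h2.
by rewrite /baseQ prim_le0// addr0.
Qed.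
Lemma Mb_gt0 : 0 < Mb. Proof. exact: (ltr_wpDl QS0 ltr01). Qed.

Definition rj (j : nat) (ut : V * R -> R) (ph : R -> R) := genX (nu j) (fun p => ph (ut p)).
Definition uh (j : nat) ut ph (p : V * R) : R := base U0 F p + prim (fun s => rj j ut ph (p.1, s)) p.2.

(** All that is retained from one run of the scheme. The bounds [Mb], [A S] and [D] depend on the
    data only; the constants quantified inside may depend on j. *)
Definition approx_sol (j : nat) (ut : V * R -> R) (ph : R -> R) : Prop :=
  [/\ [/\ bm Mb ut, L1 M ut & forall x s, ~~ (0 <= s < S) -> ut (x, s) = 0],
      measurable_fun [set: R] ph /\ forall x, `|x| <= Mb -> `|ph x - phi x| <= j.+1%:R^-1,
      [/\ exists C, bm C (rj j ut ph), L1 M (rj j ut ph),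
        forall x, L1 (lebR R) (fun s => rj j ut ph (x, s)) &
        measurable_fun [set: V * R] (uh j ut ph)],
      forall t, 0 <= t <= S -> [/\ forall x, `|uh j ut ph (x, t)| <= Mb,
        L1 lebN (fun x => uh j ut ph (x, t)), \int[lebN]_x `|uh j ut ph (x, t)| <= A S &
        forall b, \int[lebN]_x `|uh j ut ph (x + b, t) - uh j ut ph (x, t)| <= D b] &
      (forall t, 0 <= t < S -> L1 lebN (fun x => uh j ut ph (x, t) - ut (x, t)) /\
        \int[lebN]_x `|uh j ut ph (x, t) - ut (x, t)| <= j.+1%:R^-1) /\
      exists C, forall s t, 0 <= s <= t -> t <= S ->
        \int[lebN]_x `|uh j ut ph (x, t) - uh j ut ph (x, s)| <= C * (t - s) + (A t - A s)].

Lemma approx_exists j : exists ut ph, approx_sol j ut ph.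
Proof.
have d0 : 0 < j.+1%:R^-1 :> R by rewrite invr_gt0.
set d : R := j.+1%:R^-1 in d0.
have [ph [L [L0 ph_le ph_lip ph_close]]] := lip_approx phi_le cphi Mb_gt0 d0.
have mph : measurable_fun [set: R] ph by apply: nondecreasing_measurable => // x y _ _; exact: ph_le.
pose la := \int[nu j]_y 1.
have la0 : 0 <= la := mass_ge0 (knu j).
have mB : measurable_fun [set: V * R] (base U0 F) by exact: (measurable_base Ub F1).
have BQ0 x : `|base U0 F (x, 0)| <= Q 0 by exact: baseQ0.
have BQ x s t : 0 <= s <= t -> t <= S -> `|base U0 F (x, t) - base U0 F (x, s)| <= Q t - Q s.
  by move=> st _; exact: baseQ_le.
have BA s t : 0 <= s <= t -> t <= S -> L1 lebN (fun x => base U0 F (x, t) - base U0 F (x, s)) /\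
    \int[lebN]_x `|base U0 F (x, t) - base U0 F (x, s)| <= A t - A s.
  by move=> st _; exact: (baseA_le U0 F1 m1 Fm st).
have BA0 : L1 lebN (fun x => base U0 F (x, 0)) /\ \int[lebN]_x `|base U0 F (x, 0)| <= A 0 by exact: baseA0.
have AS0 : 0 <= A S.
  have h0S : 0 <= (0 : R) <= S by rewrite lexx ltW.
  have [_ h] := BA _ _ h0S (lexx _); have [_ h'] := BA0.
  have i1 : 0 <= A 0 by apply: le_trans h'; exact: int_ge0.
  have i2 : 0 <= A S - A 0 by apply: le_trans h; exact: int_ge0.
  by move: i2; rewrite subr_ge0; exact: le_trans.
have d2 : 0 < d / 2 by rewrite divr_gt0.
have [h h0 hh] := baseA_unif U0 F1 d2.
pose C := 2 * la * L * A S.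
have C0 : 0 <= C by rewrite !mulr_ge0.
(* The three summands are three demands on 1 / tau: the step restriction, tau * C <= d / 2, and tau
   <= h for the modulus of the source. *)
pose K := la * L + C * 2 / d + h^-1.
have k1 : 0 <= la * L by rewrite mulr_ge0.
have k2 : 0 <= C * 2 / d by rewrite divr_ge0 ?mulr_ge0// ltW.
have k3 : 0 < h^-1 by rewrite invr_gt0.
have K0 : 0 < K by rewrite ltr_wpDl// addr_ge0.
pose n := Num.truncn (S * K).
have tau0 : 0 < S / n.+1%:R by rewrite divr_gt0.
set tau := S / n.+1%:R in tau0.
have tK : tau * K <= 1.
  rewrite /tau mulrAC ler_pdivrMr// mul1r; apply: ltW; exact: truncnS_gt.
have tle k : 0 <= k -> k <= K -> tau * k <= 1.
  by move=> kk kK; apply: le_trans tK; apply: ler_wpM2l => //; exact: ltW.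
have cfl : tau * la * L <= 1 by rewrite -mulrA tle// /K -addrA lerDl addr_ge0// ltW.
have tC : tau * C <= d / 2.
  have := tle _ k2 _; rewrite /K [la * L + _]addrC -addrA lerDl addr_ge0 ?(ltW k3)// => /(_ isT).
  rewrite (_ : tau * _ = tau * C / (d / 2)); last by field; rewrite gt_eqF.
  by rewrite ler_pdivrMr// mul1r.
have th : tau <= h.
  have := tle _ (ltW k3) _; rewrite /K lerDr addr_ge0// => /(_ isT).
  by rewrite -ler_pdivlMr// mul1r invrK.
exists (util (nu j) ph S (base U0 F) n), ph; split.
- split; last by move=> x s; exact: util_out.
    apply: bm_le (util_bm (knu j) ph_le L0 ph_lip mph S0 mB BQ0 BQ BA0 BA cfl).
    by rewrite lerDl.
  exact: (util_L1 (knu j) ph_le L0 ph_lip mph S0 mB BQ0 BQ BA0 BA cfl).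
- by split.
- split.
  + exact: (rhs_bm (knu j) ph_le L0 ph_lip mph S0 mB BQ0 BQ BA0 BA cfl).
  + exact: (rhs_L1 (knu j) ph_le L0 ph_lip mph S0 mB BQ0 BQ BA0 BA cfl).
  + exact: (rhs_L1x (knu j) ph_le L0 ph_lip mph S0 mB BQ0 BQ BA0 BA cfl).
  + exact: (measurable_uhat (knu j) ph_le L0 ph_lip mph S0 mB BQ0 BQ BA0 BA cfl).
- move=> t tS.
  have [h1 h2 h3] := uhat_good (knu j) ph_le L0 ph_lip mph S0 mB BQ0 BQ BA0 BA cfl tS.
  split => //.
    by move=> x; apply: (le_trans (h1 x)); rewrite lerDl.
  move=> b; have hD : shift_control S (base U0 F) b (baseD U0 F b) by exact: (base_shift T U0 F1 m1 Fm b).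
  exact: (uhat_shift (knu j) ph_le L0 ph_lip mph S0 mB BQ0 BQ BA0 BA cfl hD tS).
- split.
    move=> t tS.
    have [s [st ts] [hu1 hu]] := uhat_util (knu j) ph_le L0 ph_lip mph S0 mB BQ0 BQ BA0 BA cfl tS.
    split; first exact: hu1.
    apply: (le_trans hu); rewrite [leRHS](splitr d) lerD//.
    by apply: hh => //; exact: le_trans ts th.
  exists C => s t st tS.
  exact: (uhat_time (knu j) ph_le L0 ph_lip mph S0 mB BQ0 BQ BA0 BA cfl st tS).
Qed.

Section pairs.
Variables (ut : nat -> V * R -> R) (ph : nat -> R -> R).
Hypothesis ap : forall j, approx_sol j (ut j) (ph j).
Local Notation u_ j := (uh j (ut j) (ph j)).
Local Notation r_ j := (rj j (ut j) (ph j)).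

Let Cp := `|phi Mb| + `|phi (- Mb)|.
Lemma phi_bound x : `|x| <= Mb -> `|phi x| <= Cp.
Proof.
rewrite ler_norml => /andP[/phi_le h1 /phi_le h2]; rewrite ler_norml; apply/andP; split.
  have := ler_norm (- phi (- Mb)); rewrite normrN; have := normr_ge0 (phi Mb); rewrite /Cp; lra.
by have := ler_norm (phi Mb); have := normr_ge0 (phi (- Mb)); rewrite /Cp; lra.
Qed.

Let Cp0 : 0 <= Cp. Proof. by rewrite addr_ge0. Qed.
Let mphi : measurable_fun [set: R] phi. Proof. exact: continuous_measurable_fun. Qed.

Lemma phi_ut_bm j : bm Cp (fun p => phi (ut j p)).
Proof.
have [[[mu_ ub] _ _] _ _ _ _] := ap j.
by split; [exact: measurableT_comp|move=> p; apply: phi_bound].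
Qed.

Lemma ph_close j : bm j.+1%:R^-1 (fun p => ph j (ut j p) - phi (ut j p)).
Proof.
have [[[mu_ ub] _ _] [mph hph] _ _ _] := ap j.
split; last by move=> p; exact: hph.
by apply: measurable_funB; exact: measurableT_comp.
Qed.

Lemma ph_ut_bm j : bm (Cp + 1) (fun p => ph j (ut j p)).
Proof.
have [[[mu_ ub] _ _] [mph hph] _ _ _] := ap j.
split; first exact: measurableT_comp.
move=> p; have := ler_normD (ph j (ut j p) - phi (ut j p)) (phi (ut j p)); rewrite subrK.
have := hph _ (ub p); have := phi_bound (ub p).
have : j.+1%:R^-1 <= 1 :> R by rewrite invf_le1// ler1n.
by move: (_^-1) => q; lra.
Qed.

(** [zz] and [ww] use the step functions at which the nonlinearity is evaluated, which gives zz * ww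
    >= 0; [wh] uses the interpolations, for which the equation is exact. [wh_ww] bounds the
    discrepancy. *)
Definition zz i j (p : V * R) : R := slab S p * (phi (ut i p) - phi (ut j p)).
Definition ww i j (p : V * R) : R := slab S p * (ut i p - ut j p).
Definition wh i j (p : V * R) : R := slab S p * (u_ i p - u_ j p).

Let slab01 (p : V * R) : slab S p = 0 \/ slab S p = 1.
Proof. by rewrite /slab; case: (_ < _ < _); [right|left]. Qed.

Lemma zz_bm i j : bm (Cp + Cp) (zz i j).
Proof. by have := bmM (slab_bm N S) (bmB (phi_ut_bm i) (phi_ut_bm j)); rewrite mul1r. Qed.

Lemma ww_L1 i j : L1 M (ww i j).
Proof.
have [[_ l1 _] _ _ _ _] := ap i; have [[_ l1' _] _ _ _ _] := ap j.
by apply: (bm_L1 (slab_bm N S)); exact: L1B.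
Qed.

Lemma zzww_ge0 i j p : 0 <= zz i j p * ww i j p.
Proof.
rewrite /zz /ww; have [->|->] := slab01 p; first by rewrite !mul0r.
rewrite !mul1r; have [h|/ltW h] := leP (ut j p) (ut i p).
  by rewrite mulr_ge0// subr_ge0// phi_le.
by rewrite mulr_le0// subr_le0// phi_le.
Qed.

(** One s serves all pairs (i, j): it is the modulus of uniform continuity of phi on the common
    range [-Mb, Mb]. *)
Lemma zz_modulus k : 0 < k -> exists2 s, 0 < s & forall i j p,
  `|zz i j p| <= k \/ s * `|zz i j p| <= zz i j p * ww i j p.
Proof.
move=> k0; have [h h0 hh] := unif_cont cphi Mb k0; exists h => // i j p.
have [[[_ ui] _ _] _ _ _ _] := ap i; have [[[_ uj] _ _] _ _ _ _] := ap j.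
have [hij|hij] := ltP `|ut i p - ut j p| h.
  left; rewrite /zz; have [->|->] := slab01 p; first by rewrite mul0r normr0 ltW.
  by rewrite mul1r; exact: hh.
right; have -> : zz i j p * ww i j p = `|zz i j p| * `|ww i j p|.
  by rewrite -normrM ger0_norm// zzww_ge0.
rewrite mulrC /zz /ww; have [->|->] := slab01 p; first by rewrite !mul0r normr0 !mul0r.
by rewrite !mul1r; exact: ler_wpM2l.
Qed.

Let wh_slices i j t : 0 < t < S -> L1 lebN (fun x => u_ i (x, t) - u_ j (x, t)) /\
  \int[lebN]_x `|u_ i (x, t) - u_ j (x, t)| <= A S + A S.
Proof.
move=> /andP[t0 tS]; have tS' : 0 <= t <= S by rewrite !ltW.
have [_ _ _ hi _] := ap i; have [_ _ _ hj _] := ap j.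
have [_ l1 a1 _] := hi t tS'; have [_ l2 a2 _] := hj t tS'.
split; first exact: L1B.
apply: (@le_trans _ _ (\int[lebN]_x (`|u_ i (x, t)| + `|u_ j (x, t)|))).
  apply: le_int; [by apply: L1_norm; exact: L1B|by apply: L1D; exact: L1_norm|].
  by move=> x; exact: ler_normB.
by rewrite intD; [rewrite lerD|exact: L1_norm|exact: L1_norm].
Qed.

Let mu_j j : measurable_fun [set: V * R] (u_ j). Proof. by have [_ _ [_ _ _ h] _ _] := ap j. Qed.

Lemma wh_L1 i j : L1 M (wh i j) /\ \int[M]_p `|wh i j p| <= S * (A S + A S).
Proof. by apply: slab_int => //; [exact: measurable_funB|exact: wh_slices]. Qed.

Lemma wh_bm i j : bm (Mb + Mb) (wh i j).
Proof.
split.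
  apply: measurable_funM; first by case: (slab_bm N S).
  exact: measurable_funB.
move=> [x t]; rewrite /wh /slab /=; have [/andP[t0 tS]|_] := boolP (0 < t < S); last first.
  by rewrite mul0r normr0 addr_ge0// ltW// Mb_gt0.
have tS' : 0 <= t <= S by rewrite !ltW.
have [_ _ _ hi _] := ap i; have [_ _ _ hj _] := ap j.
have [b1 _ _ _] := hi t tS'; have [b2 _ _ _] := hj t tS'.
by rewrite mul1r (le_trans (ler_normB _ _))// lerD.
Qed.

Lemma wh_ww i j : \int[M]_p `|wh i j p - ww i j p| <= S * (i.+1%:R^-1 + j.+1%:R^-1).
Proof.
have [[[mi _] _ _] _ _ _ [ci _]] := ap i; have [[[mj _] _ _] _ _ _ [cj _]] := ap j.
pose g p := (u_ i p - ut i p) - (u_ j p - ut j p).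
have [l1 _] := wh_L1 i j.
have wl := ww_L1 i j.
have mg : measurable_fun [set: V * R] g by apply: measurable_funB; exact: measurable_funB.
have eqp p : wh i j p - ww i j p = slab S p * g p by rewrite /wh /ww /g; ring.
under eq_Rintegral do rewrite eqp.
have hg t : 0 < t < S -> L1 lebN (fun x => g (x, t)) /\ \int[lebN]_x `|g (x, t)| <= i.+1%:R^-1 + j.+1%:R^-1.
  move=> /andP[t0 tS]; have tS' : 0 <= t < S by rewrite ltW.
  have [a1 a2] := ci t tS'; have [b1 b2] := cj t tS'.
  split; first exact: L1B.
  apply: (@le_trans _ _ (\int[lebN]_x (`|u_ i (x, t) - ut i (x, t)| + `|u_ j (x, t) - ut j (x, t)|))).
    apply: le_int; [by apply: L1_norm; exact: L1B|by apply: L1D; exact: L1_norm|].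
    by move=> x; exact: ler_normB.
  by rewrite intD; [rewrite lerD|exact: L1_norm|exact: L1_norm].
exact: (proj2 (slab_int S0 mg hg)).
Qed.

Lemma cvl_LX n rho b (z : V * R -> R) p : kern lebN rho -> bm b z ->
  cvl rho (LX nu n z) p = LX nu n (cvl rho z) p.
Proof.
move=> krho zb; have [_ rho1 _ _] := krho.
have Kb := cv_bm mX (knu n) zb; have Lb := bmZ (rate nu n) zb.
have -> : cvl rho (LX nu n z) p = cvl rho (cv (@shX R N) (nu n) (fun=> 1) z) p -
    cvl rho (fun q => rate nu n * z q) p by exact: (cvl_subr p rho1 Kb Lb).
have -> : cvl rho (fun q => rate nu n * z q) p = rate nu n * cvl rho z p.
  exact: (cvZ mX krho (rate nu n) p zb).
by rewrite /LX /cvl (cv_comm mX (@shXC R N) p krho (knu n) zb).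
Qed.

(** Initial datum and source cancel in the difference; what remains is the primitive of the
    difference of the operators. *)
Lemma whE i j : wh i j = J S (fun p => r_ i p - r_ j p).
Proof.
have [_ _ [_ _ li _] _ _] := ap i; have [_ _ [_ _ lj _] _ _] := ap j.
apply/funext => -[x t]; rewrite /wh /J /slab /uh /=.
have eqp q : base U0 F (x, t) + prim (fun s => r_ i (x, s)) t - (base U0 F (x, t) + q) =
    prim (fun s => r_ i (x, s)) t - q by ring.
rewrite eqp; have [tS|tS] := ltP t S; last by rewrite andbF !mul0r.
rewrite andbT mul1r; have [t0|t0] := ltP 0 t; last by rewrite mul0r prim_le0.
rewrite mul1r /prim -intB; [|exact: prim_L1|exact: prim_L1].
by apply: eq_Rintegral => s _; exact: (esym (mulrBr _ _ _)).
Qed.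

Lemma wh_shift i j y : \int[M]_p `|wh i j (shX y p) - wh i j p| <= S * (D y + D y).
Proof.
pose g p := (u_ i (shX y p) - u_ j (shX y p)) - (u_ i p - u_ j p).
have msh : measurable_fun [set: V * R] (fun p => shX y p) by case: (pX y).
have mg : measurable_fun [set: V * R] g.
  apply: measurable_funB; apply: measurable_funB => //.
    exact: (measurableT_comp (mu_j i) msh).
  exact: (measurableT_comp (mu_j j) msh).
have eqp p : wh i j (shX y p) - wh i j p = slab S p * g p.
  by rewrite /wh /g -[slab S (shX y p)]/(slab S p); ring.
under eq_Rintegral do rewrite eqp.
have hg t : 0 < t < S -> L1 lebN (fun x => g (x, t)) /\ \int[lebN]_x `|g (x, t)| <= D y + D y.
  move=> /andP[t0 tS]; have tS' : 0 <= t <= S by rewrite !ltW.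
  have [_ _ _ hi _] := ap i; have [_ _ _ hj _] := ap j.
  have [_ l1 _ s1] := hi t tS'; have [_ l2 _ s2] := hj t tS'.
  have l1' := L1_shiftV y l1; have l2' := L1_shiftV y l2.
  have d1 := L1B l1' l1; have d2 := L1B l2' l2.
  split; first by apply: L1B; exact: L1B.
  apply: (@le_trans _ _ (\int[lebN]_x (`|u_ i (x + y, t) - u_ i (x, t)| + `|u_ j (x + y, t) - u_ j (x, t)|))).
    apply: le_int; [by apply: L1_norm; apply: L1B; exact: L1B|by apply: L1D; exact: L1_norm|].
    move=> x; rewrite /g /shX /=.
    have -> : u_ i (x + y, t) - u_ j (x + y, t) - (u_ i (x, t) - u_ j (x, t)) =
      (u_ i (x + y, t) - u_ i (x, t)) - (u_ j (x + y, t) - u_ j (x, t)) by ring.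
    exact: ler_normB.
  by rewrite intD; [rewrite lerD|exact: L1_norm|exact: L1_norm].
exact: (proj2 (slab_int S0 mg hg)).
Qed.

Section smoothing.
Variables (eta : R) (rho : V -> R) (Ar Bl Cl : R).
Hypothesis mrho : mollifier eta rho.
Local Notation l := (lrho sigma mu rho).
Hypotheses (rA : bm Ar rho) (lB : bm Bl l) (l1 : L1 lebN l) (Cl0 : 0 <= Cl).
Hypothesis hC : forall n, \int[lebN]_y `|l y - LV nu n rho y| <= Cl * `|e n|.
Let krho : kern lebN rho. Proof. by case: mrho. Qed.
Let rho1 : L1 lebN rho. Proof. by case: krho. Qed.
Let irho : \int[lebN]_y rho y = 1. Proof. by case: mrho. Qed.
Let I := \int[lebN]_y `|l y|.
Let I0 : 0 <= I. Proof. exact: int_ge0. Qed.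

(** First term: the price of replacing [nu j] by the limit operator on the mollifier. Second term:
    the price of replacing [ph j] by phi. *)
Definition err j := (Cp + 1) * (Cl * `|e j|) + j.+1%:R^-1 * I.

Definition rr i j (p : V * R) : R := slab S p *
  ((cvl (fun y => LV nu i rho y - l y) (fun p => ph i (ut i p)) p +
    cvl l (fun p => ph i (ut i p) - phi (ut i p)) p) -
   (cvl (fun y => LV nu j rho y - l y) (fun p => ph j (ut j p)) p +
    cvl l (fun p => ph j (ut j p) - phi (ut j p)) p)).

Let Ll1 n : L1 lebN (LV nu n rho). Proof. exact: (LV_L1 knu n rho1). Qed.

Lemma rr_bm i j : bm (err i + err j) (rr i j).
Proof.
have h n : bm (err n) (fun p => cvl (fun y => LV nu n rho y - l y) (fun p => ph n (ut n p)) p +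
    cvl l (fun p => ph n (ut n p) - phi (ut n p)) p).
  apply: bmD; last exact: (cvl_bm l1 (ph_close n)).
  apply: bm_le (cvl_bm (L1B (Ll1 n) l1) (ph_ut_bm n)).
  apply: ler_wpM2l; first by rewrite addr_ge0.
  by under eq_Rintegral do rewrite distrC.
by have := bmM (slab_bm N S) (bmB (h i) (h j)); rewrite mul1r.
Qed.

(** After mollification each operator acts on [rho], where it can be exchanged for the common limit
    [l], and each [ph] can be exchanged for phi; the exchanged terms make up [rr]. *)
Lemma W_eq i j : cvl rho (wh i j) = J S (fun p => cvl l (zz i j) p + rr i j p).
Proof.
have [_ _ [[Ci rbi] _ _ _] _ _] := ap i; have [_ _ [[Cj rbj] _ _ _] _ _] := ap j.
have gb := bmB rbi rbj.
transitivity (J S (cvl rho (fun p => r_ i p - r_ j p))).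
  by apply/funext => p; rewrite whE; exact: (cv_J S krho p gb).
apply: J_ext => -[x t] tS; rewrite (cvl_subr _ rho1 rbi rbj).
have hr n b' : bm b' (r_ n) -> cvl rho (r_ n) (x, t) = cvl (LV nu n rho) (fun p => ph n (ut n p)) (x, t).
  move=> _; rewrite (cvl_LV knu mrho n (x, t) rA (ph_ut_bm n)).
  exact: (cvl_LX n (x, t) krho (ph_ut_bm n)).
rewrite (hr i _ rbi) (hr j _ rbj).
have hz : cvl l (zz i j) (x, t) = cvl l (fun p => phi (ut i p)) (x, t) - cvl l (fun p => phi (ut j p)) (x, t).
  rewrite -(cvl_subr _ l1 (phi_ut_bm i) (phi_ut_bm j)); apply: eq_Rintegral => y _.
  by rewrite /zz /slab /shX /=; move: tS => /= ->; rewrite mul1r.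
rewrite hz /rr (_ : slab S (x, t) = 1); last by rewrite /slab /=; move: tS => /= ->.
rewrite mul1r !(cvlB _ (Ll1 _) l1 (ph_ut_bm _)) !(cvl_subr _ l1 (ph_ut_bm _) (phi_ut_bm _)).
move: (cvl _ _ _) (cvl _ _ _) (cvl _ _ _) (cvl _ _ _) (cvl _ _ _) (cvl _ _ _) => a1 a2 a3 a4 a5 a6.
ring.
Qed.

Let Z0 := Cp + Cp + 1.
Let Z00 : 0 < Z0. Proof. by rewrite /Z0 ltr_wpDl// addr_ge0. Qed.

(** The energy estimate with w = ww and W the mollified [wh]. The distance from S W to w is two
    mollification errors, each bounded by the translation modulus, plus the interpolation error. *)
Lemma zw_est dd i j k s : (forall b, `|b| <= eta -> D b <= dd) -> 0 <= k -> 0 < s ->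
  (forall p, `|zz i j p| <= k \/ s * `|zz i j p| <= zz i j p * ww i j p) ->
  \int[M]_p (weight S p * (zz i j p * ww i j p)) <=
  2 * S * (Z0 * (2 * (S * (dd + dd)) + S * (i.+1%:R^-1 + j.+1%:R^-1)) +
     (k + (err i + err j) * S * Z0 / s) * (S * (A S + A S))).
Proof.
move=> hD k0 s0 hs.
have [w1 wI] := wh_L1 i j; have wb := wh_bm i j.
have Sb := cvl_bm rho1 wb.
have S1 : L1 M (cvl rho (wh i j)) := cv_L1 mX pX krho w1.
have SS1 : L1 M (cvl rho (cvl rho (wh i j))) := cv_L1 mX pX krho S1.
have hmol y : rho y != 0 -> \int[M]_p `|wh i j (shX y p) - wh i j p| <= S * (dd + dd).
  move=> ry; apply: (le_trans (wh_shift i j y)); rewrite ler_wpM2l ?(ltW S0)//.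
  have hy : `|y| <= eta.
    by rewrite leNgt; apply/negP => hy; move/eqP: ry; apply; case: mrho => _ _ _; apply.
  by rewrite lerD// hD.
have moll : \int[M]_p `|cvl rho (wh i j) p - wh i j p| <= S * (dd + dd).
  exact: (mollify_L1 mX pX krho irho wb w1 hmol).
have Eb := bmB Sb wb; have E1 := L1B S1 w1.
have h2 : \int[M]_p `|cvl rho (fun p => cvl rho (wh i j) p - wh i j p) p| <= S * (dd + dd).
  by have := cv_L1_le mX pX kX krho Eb E1; rewrite irho mul1r => h; exact: le_trans h moll.
have n2 : L1 M (cvl rho (fun p => cvl rho (wh i j) p - wh i j p)) := cv_L1 mX pX krho E1.
have wwl := ww_L1 i j.
have hSW : \int[M]_p `|cvl rho (cvl rho (wh i j)) p - ww i j p| <= 2 * (S * (dd + dd)) + S * (i.+1%:R^-1 + j.+1%:R^-1).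
  apply: (@le_trans _ _ (\int[M]_p (`|cvl rho (fun p => cvl rho (wh i j) p - wh i j p) p| +
     (`|cvl rho (wh i j) p - wh i j p| + `|wh i j p - ww i j p|)))).
    apply: le_int; [by apply: L1_norm; exact: L1B| |].
      by apply: L1D; [exact: L1_norm|apply: L1D; apply: L1_norm; exact: L1B].
    move=> p; rewrite (cvl_subr p rho1 Sb wb).
    exact: tri3.
  rewrite intD; [|exact: L1_norm|by apply: L1D; apply: L1_norm; exact: L1B].
  rewrite intD; [|by apply: L1_norm; exact: L1B|by apply: L1_norm; exact: L1B].
  rewrite addrA lerD ?wh_ww// (_ : 2 * _ = S * (dd + dd) + S * (dd + dd)); last by ring.
  exact: lerD.
have hW : \int[M]_p `|cvl rho (wh i j) p| <= S * (A S + A S).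
  by have := cv_L1_le mX pX kX krho wb w1; rewrite irho mul1r => h; exact: le_trans h wI.
have zb : bm Z0 (zz i j) by apply: bm_le (zz_bm i j); rewrite lerDl.
have rb := rr_bm i j.
have er0 : 0 <= err i + err j by exact: (bm_ge0 ((0 : V), (0 : R)) rb).
have := core_levy e0 knu levyE mrho S0 Z00 s0 k0 zb rb wwl S1 (zzww_ge0 i j) hs (W_eq i j).
move=> h; apply: (le_trans h); rewrite ler_wpM2l ?mulr_ge0 ?(ltW S0)//.
rewrite lerD// ?ler_wpM2l ?(ltW Z00)//.
apply: addr_ge0 => //; apply: divr_ge0; last exact: ltW.
by rewrite !mulr_ge0// ltW.
Qed.

(** Where |z| exceeds k it is at most z w / s; since [l] is bounded, the weighted energy controls
    the mollified difference uniformly in x and t. *)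
Lemma W_est i j k s x t : 0 <= k -> 0 < s -> 0 <= t <= T ->
  (forall p, `|zz i j p| <= k \/ s * `|zz i j p| <= zz i j p * ww i j p) ->
  `|cvl rho (wh i j) (x, t)| <= S * (k * I + (err i + err j)) +
     Bl / s * \int[M]_p (weight S p * (zz i j p * ww i j p)).
Proof.
move=> k0 s0 /andP[t0 tT] hs.
have tS : t < S by rewrite /S; lra.
have zb := zz_bm i j; have rb := rr_bm i j; have wwl := ww_L1 i j.
have er0 : 0 <= err i + err j by exact: (bm_ge0 ((0 : V), (0 : R)) rb).
have zw1 : L1 M (fun p => zz i j p * ww i j p) by exact: bm_L1 zb wwl.
have wzw1 : L1 M (fun p => weight S p * (zz i j p * ww i j p)) by exact: (bm_L1 (weight_bm N S0) zw1).
have Bl0 : 0 <= Bl by exact: (bm_ge0 (0 : V) lB).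
rewrite W_eq /J /= tS mul1r /prim.
pose a r := cvl l (zz i j) (x, r) + rr i j (x, r).
pose Zs r := \int[lebN]_y (zz i j (y, r) * ww i j (y, r)).
pose Ws r := \int[lebN]_y (weight S (y, r) * (zz i j (y, r) * ww i j (y, r))).
have Ws1 : L1 (lebR R) Ws by exact: (L1X_int2 wzw1).
have ab := bmD (cvl_bm l1 zb) rb.
have at1 : L1 (lebR R) (fun r => (0 < r < t)%R%:R * a r).
  have ab' : bm ((Cp + Cp) * \int[lebN]_y `|l y| + (err i + err j)) a.
    by split; [exact: (measurable_slice1 x (proj1 ab))|move=> r; exact: (proj2 ab)].
  exact: (L1_bm (itvb_L1 0 t) ab').
have b1 : L1 (lebR R) (fun r => (k * I + (err i + err j)) * (0 < r < t)%R%:R + Bl / s * Ws r).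
  by apply: L1D; apply: L1Z => //; exact: itvb_L1.
apply: (le_trans (le_norm_int at1)).
apply: (@le_trans _ _ (\int[lebR R]_r ((k * I + (err i + err j)) * (0 < r < t)%R%:R + Bl / s * Ws r))).
  apply: le_int_ae => //; first exact: L1_norm.
  apply: filterS (L1X_ae2 zw1) => r zr.
  have Ws0 : 0 <= Bl / s * Ws r.
    rewrite mulr_ge0 ?divr_ge0 ?(ltW s0)// int_ge0// => y.
    by rewrite mulr_ge0 ?weight_ge0// zzww_ge0.
  have [/andP[r0 rt]|_] := boolP (0 < r < t); last by rewrite mul0r normr0 mulr0 add0r.
  rewrite mul1r mulr1.
  (* The weight is at least 1 at times r < t <= T, thanks to S = T + 1. *)
  have ZW : Zs r <= Ws r.
    have wr : 1 <= weight S ((0 : V), r) 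
      by rewrite /weight /= r0 (lt_trans rt tS) mul1r /S addrAC lerDr subr_ge0 (le_trans (ltW rt)).
    apply: le_int => //.
      by apply: (L1_eq _ (L1Z (weight S ((0 : V), r)) zr)) => y.
    by move=> y; apply: ler_peMl; [exact: zzww_ge0|exact: wr].
  have hl : `|cvl l (zz i j) (x, r)| <= k * I + Bl / s * Zs r.
    have sr := L1_shiftV x zr.
    have lz1 : L1 lebN (fun y => l y * zz i j (shX y (x, r))) := cvl_L1 (x, r) l1 zb.
    apply: (le_trans (le_norm_int lz1)).
    rewrite /Zs -(int_shiftV x (g := fun y => zz i j (y, r) * ww i j (y, r))); last exact: L1_measurable zr.
    have -> : k * I = \int[lebN]_y (k * `|l y|) by rewrite intZ//; exact: L1_norm.
    rewrite -(intZ (Bl / s) sr) -intD; [|by apply: L1Z; exact: L1_norm|exact: L1Z].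
    apply: le_int; [exact: L1_norm|by apply: L1D; [apply: L1Z; exact: L1_norm|exact: L1Z]|].
    move=> y; rewrite normrM /shX /= [x + y]addrC.
    have ly := (proj2 lB) y; have zw0 := zzww_ge0 i j (y + x, r).
    have p0 : 0 <= Bl / s * (zz i j (y + x, r) * ww i j (y + x, r)) by rewrite mulr_ge0 ?divr_ge0 ?(ltW s0).
    have p1 : 0 <= k * `|l y| by rewrite mulr_ge0.
    have [h|h] := hs (y + x, r).
      by rewrite mulrC (le_trans (ler_wpM2r (normr_ge0 _) h))// lerDl.
    apply: (@le_trans _ _ (Bl / s * (zz i j (y + x, r) * ww i j (y + x, r)))); last by rewrite lerDr.
    rewrite -mulrA; apply: ler_pM => //.
    by rewrite mulrC ler_pdivlMr// mulrC.
  have h2 : Bl / s * Zs r <= Bl / s * Ws r by apply: ler_wpM2l => //; rewrite divr_ge0// ltW.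
  apply: (le_trans (ler_normD _ _)); apply: (le_trans (lerD hl ((proj2 rb) (x, r)))).
  by rewrite addrAC lerD2l.
rewrite intD; [|by apply: L1Z; exact: itvb_L1|exact: L1Z].
rewrite (intZ _ (itvb_L1 0 t)) int_itvb//.
rewrite intZ// (intX2 wzw1) lerD// subr0 mulrC ler_wpM2r ?(ltW tS)//.
by rewrite addr_ge0// mulr_ge0.
Qed.

Lemma err_small x : 0 < x -> exists n0, forall j, (n0 <= j)%N -> err j <= x.
Proof.
move=> x0; have h : err @ \oo --> (0 : R).
  have hz : (Cp + 1) * (Cl * `|0 : R|) + 0 * I = 0 by rewrite normr0 !mulr0 mul0r addr0.
  have h1 : (fun j => (Cp + 1) * (Cl * `|e j|)) @ \oo --> (Cp + 1) * (Cl * `|0 : R|).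
    by apply: cvgM; [exact: cvg_cst|apply: cvgM; [exact: cvg_cst|exact: (cvg_norm e0)]].
  have h2 : (fun j => j.+1%:R^-1 * I) @ \oo --> (0 * I : R).
    apply: cvgM; last exact: cvg_cst.
    apply/cvgrPdist_le => q q0; have [n _ hn] := near_infty_natSinv_lt (PosNum q0).
    by exists n => // k nk; rewrite sub0r normrN ger0_norm// ltW// hn.
  by have h3 := cvgD h1 h2; rewrite hz in h3; exact: h3.
have [n hn] := cvg0_le h x0; exists n => j nj; exact: le_trans (ler_norm _) (hn j nj).
Qed.

Lemma inv_small x : 0 < x -> exists n0, forall j, (n0 <= j)%N -> j.+1%:R^-1 <= x :> R.
Proof.
move=> x0; have [n _ hn] := near_infty_natSinv_lt (PosNum x0).
by exists n => j nj; rewrite ltW// hn.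
Qed.

Let AS0 : 0 <= A S.
Proof.
have h0S : 0 <= (0 : R) <= S by rewrite lexx ltW.
have [_ _ _ h _] := ap 0%N; have [_ _ hA _] := h 0 h0S.
by apply: le_trans hA; exact: int_ge0.
Qed.

(** For a fixed mollifier the error proportional to dd remains, with 8 = 2 * 2 * 2 from the
    prefactor, the two mollifications and dd + dd. The level k is fixed first, then s, then the
    indices. *)
Lemma zw_lim dd x : (forall b, `|b| <= eta -> D b <= dd) -> 0 < x ->
  exists n0, forall i j, (n0 <= i)%N -> (n0 <= j)%N ->
  \int[M]_p (weight S p * (zz i j p * ww i j p)) <= 8 * S * S * Z0 * dd + x.
Proof.
move=> hD x0; have S0' := ltW S0; have Z0' := ltW Z00.
have x3 : 0 < x / 3 by rewrite divr_gt0.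
have x6 : 0 < x / 3 / 2 by rewrite !divr_gt0.
pose c2 := 2 * S * Z0 * S; pose c3 := 2 * S * S * (A S + A S).
have c20 : 0 <= c2 by rewrite !mulr_ge0.
have c30 : 0 <= c3 by rewrite !mulr_ge0// addr_ge0.
have k0 : 0 < x / 3 / (c3 + 1) by rewrite divr_gt0// ltr_wpDl.
have [s s0 hs] := zz_modulus k0.
pose c4 := 2 * S * S * Z0 / s * (S * (A S + A S)).
have c40 : 0 <= c4.
  apply: mulr_ge0; last by apply: mulr_ge0 => //; exact: addr_ge0.
  by apply: divr_ge0; [rewrite !mulr_ge0|exact: ltW].
have y2 : 0 < x / 3 / 2 / (c2 + 1) by rewrite divr_gt0// ltr_wpDl.
have y4 : 0 < x / 3 / 2 / (c4 + 1) by rewrite divr_gt0// ltr_wpDl.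
have [na hna] := inv_small y2; have [nb hnb] := err_small y4.
exists (maxn na nb) => i j; rewrite !geq_max => /andP[ia ib] /andP[ja jb].
apply: (le_trans (zw_est hD (ltW k0) s0 (hs i j))).
have h1 := ler_wpM2l c20 (lerD (hna i ia) (hna j ja)).
have h2 := ler_wpM2l c40 (lerD (hnb i ib) (hnb j jb)).
have f3 := frac_le c30 (ltW x3); have f2 := frac_le c20 (ltW x6); have f4 := frac_le c40 (ltW x6).
set k := x / 3 / (c3 + 1) in f3 *.
set q2 := x / 3 / 2 / (c2 + 1) in h1 f2; set q4 := x / 3 / 2 / (c4 + 1) in h2 f4.
rewrite (_ : 2 * S * _ = 8 * S * S * Z0 * dd + (c2 * (i.+1%:R^-1 + j.+1%:R^-1) + c3 * k + c4 * (err i + err j))); last first.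
  by rewrite /c2 /c3 /c4; ring.
rewrite lerD2l.
have g1 : c2 * (i.+1%:R^-1 + j.+1%:R^-1) <= x / 3 / 2 + x / 3 / 2.
  by apply: (le_trans h1); rewrite [leLHS]mulrDr; exact: lerD.
have g2 : c4 * (err i + err j) <= x / 3 / 2 + x / 3 / 2.
  by apply: (le_trans h2); rewrite [leLHS]mulrDr; exact: lerD.
apply: (le_trans (lerD (lerD g1 f3) g2)).
by rewrite le_eqVlt; apply/orP; left; apply/eqP; field.
Qed.

(** Each d requires its own mollifier to make the energy small, whereas the mollifier is fixed in
    this section. The smallness is therefore assumed here; the lemma of the same name below supplies
    it. *)
Hypothesis zw_small : forall d, 0 < d -> exists n0, forall i j, (n0 <= i)%N -> (n0 <= j)%N ->
  \int[M]_p (weight S p * (zz i j p * ww i j p)) <= d.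

Lemma W_small d : 0 < d -> exists n0, forall i j, (n0 <= i)%N -> (n0 <= j)%N ->
  forall x t, 0 <= t <= T -> `|cvl rho (wh i j) (x, t)| <= d.
Proof.
move=> d0; have d3 : 0 < d / 3 by rewrite divr_gt0.
have d6 : 0 < d / 3 / 2 by rewrite divr_gt0.
have SI0 : 0 <= S * I by rewrite mulr_ge0// ltW.
have k0 : 0 < d / 3 / (S * I + 1) by rewrite divr_gt0// ltr_wpDl.
have [s s0 hs] := zz_modulus k0.
have Bl0 : 0 <= Bl by exact: (bm_ge0 (0 : V) lB).
have Bs0 : 0 <= Bl / s by rewrite divr_ge0// ltW.
have q0 : 0 < d / 3 / (Bl / s + 1) by rewrite divr_gt0// ltr_wpDl.
have r0 : 0 < d / 3 / 2 / (S + 1) by rewrite divr_gt0// ltr_wpDl// ltW.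
have [na hna] := zw_small q0; have [nb hnb] := err_small r0.
exists (maxn na nb) => i j; rewrite !geq_max => /andP[ia ib] /andP[ja jb] x t tT.
apply: (le_trans (W_est x (ltW k0) s0 tT (hs i j))).
have h1 := ler_wpM2l Bs0 (hna i j ia ja).
have S0' := ltW S0.
have h2 := ler_wpM2l S0' (lerD (hnb i ib) (hnb j jb)).
have f1 := frac_le Bs0 (ltW d3); have f2 := frac_le SI0 (ltW d3); have f3 := frac_le S0' (ltW d6).
set k := d / 3 / (S * I + 1) in f2 *.
rewrite (_ : S * (k * I + _) = S * I * k + S * (err i + err j)); last by ring.
have g2 : S * (err i + err j) <= d / 3 / 2 + d / 3 / 2.
  by apply: (le_trans h2); rewrite [leLHS]mulrDr; exact: lerD.
apply: (le_trans (lerD (lerD f2 g2) (le_trans h1 f1))).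
by rewrite le_eqVlt; apply/orP; left; apply/eqP; field.
Qed.

End smoothing.

(** The radius of the mollifier is chosen first, so that the translation modulus takes at most d /
    2; [zw_lim] takes the rest. *)
Lemma zw_small d : 0 < d -> exists n0, forall i j, (n0 <= i)%N -> (n0 <= j)%N ->
  \int[M]_p (weight S p * (zz i j p * ww i j p)) <= d.
Proof.
move=> d0; have S0' := ltW S0.
pose c1 := 8 * S * S * (Cp + Cp + 1).
have c10 : 0 <= c1 by rewrite !mulr_ge0// !addr_ge0.
have d2 : 0 < d / 2 by rewrite divr_gt0.
have q0 : 0 < d / 2 / (c1 + 1) by rewrite divr_gt0// ltr_wpDl.
have [h h0 hD] := baseD_small T U1 F1 q0.
have [rho mrho] := mollifier_exists N h0.
have [Ar [Bl [Cl [rA lB l1 Cl0 hC]]]] := moll_levy e0 knu levyE mrho.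
have [n0 hn] := zw_lim mrho rA l1 hC hD d2.
exists n0 => i j ni nj; apply: (le_trans (hn i j ni nj)); rewrite [leRHS](splitr d) lerD2r.
exact: (frac_le c10 (ltW d2)).
Qed.

(** A difference is compared with its mollification. The error is small in L^1 uniformly in i, j and
    t by the translation modulus, and the mollification is uniformly small by [W_small], which on a
    ball costs only the volume. *)
Lemma uh_cauchy r0 d : 0 < d -> exists n0, forall i j, (n0 <= i)%N -> (n0 <= j)%N ->
  forall t, 0 <= t <= T ->
  \int[lebN]_x (\1_(ball (0 : V) r0) x * `|u_ i (x, t) - u_ j (x, t)|) <= d.
Proof.
move=> d0; have d4 : 0 < d / 4 by rewrite divr_gt0.
have d2 : 0 < d / 2 by rewrite divr_gt0.
have [h h0 hD] := baseD_small T U1 F1 d4.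
have [rho mrho] := mollifier_exists N h0.
have [Ar [Bl [Cl [rA lB l1 Cl0 hC]]]] := moll_levy e0 knu levyE mrho.
have krho : kern lebN rho by case: mrho.
have irho : \int[lebN]_y rho y = 1 by case: mrho.
have B1 := ball_L1 (0 : V) r0.
have B01 x : 0 <= (\1_(ball (0 : V) r0) x : R) <= 1.
  by rewrite indicE; case: (_ \in _); rewrite /= ?lexx ?ler01.
pose vol : R := \int[lebN]_x \1_(ball (0 : V) r0) x.
have vol0 : 0 <= vol by apply: int_ge0 => x; case/andP: (B01 x).
have q0 : 0 < d / 2 / (vol + 1) by rewrite divr_gt0// ltr_wpDl.
have [n0 hn] : exists n0, forall i j, (n0 <= i)%N -> (n0 <= j)%N ->
  forall x t, 0 <= t <= T -> `|cvl rho (wh i j) (x, t)| <= d / 2 / (vol + 1).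
  first [exact: (W_small mrho rA lB l1 Cl0 hC zw_small q0) | exact: (W_small mrho rA lB l1 hC zw_small q0) | exact: (W_small mrho lB l1 hC zw_small q0) | exact: (W_small mrho lB l1 Cl0 hC zw_small q0)].
exists n0 => i j ni nj t /andP[]; rewrite le_eqVlt => /orP[/eqP <- _|t0 tT].
  rewrite (_ : \int[lebN]_x _ = 0) ?ltW// -[RHS](int0 lebN); apply: eq_Rintegral => x _.
  by rewrite /uh /= !prim_le0// subrr normr0 mulr0.
have tS : 0 <= t <= S by rewrite ltW// /S ler_wpDr.
have tS' : t < S by rewrite /S ltr_pwDr.
have [_ _ _ hi _] := ap i; have [_ _ _ hj _] := ap j.
have [b1 li _ si] := hi t tS; have [b2 lj _ sj] := hj t tS.
pose dd x := u_ i (x, t) - u_ j (x, t).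
have dd1 : L1 lebN dd by exact: L1B.
have ddb : bm (Mb + Mb) dd.
  by split; [exact: L1_measurable dd1|move=> x; rewrite (le_trans (ler_normB _ _))// lerD].
have shift y : rho y != 0 -> \int[lebN]_x `|dd (shV y x) - dd x| <= d / 2.
  move=> ry; have hy : `|y| <= h.
    by rewrite leNgt; apply/negP => hy; move/eqP: ry; apply; case: mrho => _ _ _; apply.
  have li' := L1B (L1_shiftV y li) li; have lj' := L1B (L1_shiftV y lj) lj.
  have Dy := hD y hy.
  apply: (@le_trans _ _ (\int[lebN]_x (`|u_ i (x + y, t) - u_ i (x, t)| + `|u_ j (x + y, t) - u_ j (x, t)|))).
    apply: le_int; [|by apply: L1D; exact: L1_norm|].
      by apply: L1_norm; apply: L1B => //; exact: L1_shiftV.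
    move=> x; rewrite /dd /shV.
    have -> : u_ i (x + y, t) - u_ j (x + y, t) - (u_ i (x, t) - u_ j (x, t)) =
      (u_ i (x + y, t) - u_ i (x, t)) - (u_ j (x + y, t) - u_ j (x, t)) by ring.
    exact: ler_normB.
  rewrite intD; [|exact: L1_norm|exact: L1_norm].
  have := lerD (le_trans (si y) Dy) (le_trans (sj y) Dy).
  by rewrite (_ : d / 4 + d / 4 = d / 2); last by field.
have moll := mollify_L1 mV pV krho irho ddb dd1 shift.
have cE x : cv (@shV R N) lebN rho dd x = cvl rho (wh i j) (x, t).
  apply: eq_Rintegral => y _; rewrite /wh /slab /shX /shV /= t0 tS' mul1r.
  by [].
have c1 : L1 lebN (cv (@shV R N) lebN rho dd) := cv_L1 mV pV krho dd1.
have m1' := L1B c1 dd1.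
apply: (@le_trans _ _ (\int[lebN]_x (`|cv (@shV R N) lebN rho dd x - dd x| + d / 2 / (vol + 1) * \1_(ball (0 : V) r0) x))).
  apply: le_int; [|by apply: L1D; [exact: L1_norm|exact: L1Z]|].
    apply: (bm_L1 (a := 1)); last exact: L1_norm.
    split; first exact: L1_measurable B1.
    by move=> x; have /andP[h1 h2] := B01 x; rewrite ger0_norm.
  move=> x; have /andP[h1 h2] := B01 x; rewrite -/(dd x).
  have hx : `|cv (@shV R N) lebN rho dd x| <= d / 2 / (vol + 1).
    by rewrite cE; apply: hn => //; rewrite ltW.
  have h3 : `|dd x| <= `|cv (@shV R N) lebN rho dd x - dd x| + `|cv (@shV R N) lebN rho dd x|.
    have := ler_normB (cv (@shV R N) lebN rho dd x) (cv (@shV R N) lebN rho dd x - dd x).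
    by rewrite opprB addrC subrK addrC.
  apply: (le_trans (ler_wpM2l h1 h3)); rewrite mulrDr lerD//; first exact: ler_piMl.
  by rewrite mulrC; exact: ler_wpM2r.
rewrite intD; [|exact: L1_norm|exact: L1Z].
rewrite intZ// -/vol [leRHS](splitr d) lerD//.
by rewrite mulrC; exact: (frac_le vol0 (ltW d2)).
Qed.
End pairs.
End existence.

(** * Almost everywhere convergence of fast sequences *)

Section fast_convergence.
Context d (X : measurableType d) (R : realType) (m : {measure set X -> \bar R}).

(** The sum of the series has finite integral by monotone convergence, hence is finite almost
    everywhere. *)
Lemma fast_series (a : nat -> X -> R) :
  (forall k, L1 m (a k)) -> (forall k x, 0 <= a k x) ->
  (forall k, \int[m]_x a k x <= 2^-1 ^+ k) ->
  {ae m, forall x, cvgn (series (fun k => a k x))}.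
Proof.
move=> a1 a0 ha.
have E0 k x : (0 <= (a k x)%:E)%E by rewrite lee_fin.
have Em k : measurable_fun [set: X] (fun x => (a k x)%:E).
  by apply/measurable_EFinP; exact: L1_measurable (a1 k).
have fin : (\int[m]_x (\sum_(k <oo) (a k x)%:E) < +oo)%E.
  rewrite integral_nneseries//.
  apply: (@le_lt_trans _ _ (1 * (1 - 2^-1)^-1 : R)%:E); last exact: ltry.
  apply: lime_le; first by apply: is_cvg_nneseries => n _ _; exact: integral_ge0.
  apply: nearW => n; apply: (@le_trans _ _ (series (geometric 1 2^-1) n)%:E).
    rewrite /series /= -sumEFin; apply: lee_sum => k _.
    by rewrite -EFin_int// lee_fin /geometric /= mul1r.
  by rewrite lee_fin; apply: geometric_le_lim => //; rewrite ger0_norm// invf_lt1// ltr1n.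
have mS : measurable_fun [set: X] (fun x => \sum_(k <oo) (a k x)%:E)%E.
  by apply: ge0_emeasurable_sum.
have I : m.-integrable [set: X] (fun x => \sum_(k <oo) (a k x)%:E)%E.
  apply/integrableP; split => //; under eq_integral do rewrite gee0_abs ?nneseries_ge0//.
  exact: fin.
have := integrable_ae measurableT I; apply: filterS => x /(_ Logic.I) hx.
apply: nondecreasing_is_cvgn; first by apply: nondecreasing_series => k _ _.
exists (fine (\sum_(k <oo) (a k x)%:E)%E) => _ [n _ <-].
rewrite -lee_fin fineK// /series /= -sumEFin; exact: nneseries_lim_ge.
Qed.

Lemma series_cauchy_cvg (w a : nat -> R) k0 : cvgn (series a) -> (forall k, 0 <= a k) ->
  (forall k, (k0 <= k)%N -> `|w k - w k.+1| <= a k) -> exists l : R, w @ \oo --> l.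
Proof.
move=> ca a0 h; pose dd k := (k0 <= k)%N%:R * (w k.+1 - w k).
have dda k : `|dd k| <= a k.
  rewrite /dd; have [hk|_] := leqP k0 k; last by rewrite mul0r normr0.
  by rewrite mul1r distrC h.
have cd : cvgn (series dd).
  apply: normed_cvg; apply: (series_le_cvg _ a0 dda ca) => k; exact: normr_ge0.
have dE i : w (i + k0)%N = w k0 + series dd (i + k0)%N.
  elim: i => [|i IH].
    rewrite add0n /series /= big_nat_cond big1 ?addr0// => j /andP[/andP[_ jk] _].
    by rewrite /dd leqNgt jk mul0r.
  rewrite addSn /series /= big_nat_recr//= -/(series dd (i + k0)) addrA -IH /dd leq_addl mul1r.
  by rewrite addrC subrK.
move/cvg_ex : cd => [l hl]; exists (w k0 + l).
rewrite -(cvg_shiftn k0); rewrite (_ : (fun n => w (n + k0)%N) = (fun n => w k0 + series dd (n + k0)%N)); last exact/funext.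
apply: cvgD; first exact: cvg_cst.
have := hl; rewrite -(cvg_shiftn k0); exact.
Qed.
End fast_convergence.

Section indicator_ball.
Variables (R : realType) (N : nat).
Local Notation V := 'rV[R]_N.

Lemma ball0E r (x : V) : \1_(ball (0 : V) r) x = (`|x| < r)%R%:R :> R.
Proof.
rewrite indicE; congr (_%:R); congr (nat_of_bool _); apply/idP/idP => [/set_mem|h].
  by rewrite -ball_normE /ball_ /= sub0r normrN.
by apply/mem_set; rewrite -ball_normE /ball_ /= sub0r normrN.
Qed.

Lemma ball0_bm r : bm 1 (\1_(ball (0 : V) r) : V -> R).
Proof.
split; first exact: (L1_measurable (ball_L1 (0 : V) r)).
by move=> x; rewrite ball0E; case: (_ < _); rewrite ?normr1 ?normr0.
Qed.

Lemma ball0_ge0 r (x : V) : 0 <= (\1_(ball (0 : V) r) x : R).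
Proof. by rewrite ball0E. Qed.

Lemma ball0_ge1 r (x : V) : (\1_(ball (0 : V) r) x : R) <= 1.
Proof. by rewrite ball0E; case: (_ < _). Qed.
End indicator_ball.

(** * The limit curve in C([0,T]; L^1_loc) *)

Section curve_limit.
Variables (R : realType) (N : nat).
Local Notation V := 'rV[R]_N.
Local Notation lebN := (lebesgue_rV R N).
Local Notation M := (lebX R N).
Variables (T B A : R) (u_ : nat -> V * R -> R).
Hypothesis T0 : 0 < T.
Hypothesis mu_ : forall j, measurable_fun [set: V * R] (u_ j).
Hypothesis ub : forall j x t, 0 <= t <= T -> `|u_ j (x, t)| <= B.
Hypothesis uL1 : forall j t, 0 <= t <= T -> L1 lebN (fun x => u_ j (x, t)) /\
  \int[lebN]_x `|u_ j (x, t)| <= A.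
Hypothesis cauchy : forall r d, 0 < d -> exists n0, forall i j, (n0 <= i)%N -> (n0 <= j)%N ->
  forall t, 0 <= t <= T ->
  \int[lebN]_x (\1_(ball (0 : V) r) x * `|u_ i (x, t) - u_ j (x, t)|) <= d.

Let b r (x : V) : R := \1_(ball (0 : V) r) x.
Let b0 r x : 0 <= b r x. Proof. exact: ball0_ge0. Qed.
Let b1 r x : b r x <= 1. Proof. exact: ball0_ge1. Qed.

(* A fast subsequence converges a.e. on each time slice; the upper limit makes
   the limit jointly measurable. *)
Lemma curve_limit : exists u : V * R -> R, [/\ measurable_fun [set: V * R] u, forall p, `|u p| <= B,
  forall t, 0 <= t <= T -> L1 lebN (fun x => u (x, t)) /\ \int[lebN]_x `|u (x, t)| <= A &
  forall r d, 0 < d -> exists n0, forall j, (n0 <= j)%N -> forall t, 0 <= t <= T ->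
    \int[lebN]_x (\1_(ball (0 : V) r) x * `|u_ j (x, t) - u (x, t)|) <= d].
Proof.
have h0T : 0 <= (0 : R) <= T by rewrite lexx ltW.
have B0 : 0 <= B := le_trans (normr_ge0 _) (ub 0%N (0 : V) h0T).
have /choice[n0 hn0] : forall k, exists n, forall i j, (n <= i)%N -> (n <= j)%N ->
    forall t, 0 <= t <= T -> \int[lebN]_x (b k%:R x * `|u_ i (x, t) - u_ j (x, t)|) <= 2^-1 ^+ k.
  by move=> k; apply: cauchy; exact: exprn_gt0.
(* The sum dominates every threshold up to index k, and the summand k makes n k at least k. *)
pose n k := (\sum_(i < k.+1) n0 i + k)%N.
have nn k l : (k <= l)%N -> (n0 k <= n l)%N.
  move=> kl; have kl' : (k < l.+1)%N by [].
  by rewrite /n (bigD1 (Ordinal kl'))//= -!addnA leq_addr.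
pose w k p := (0 <= p.2 <= T)%R%:R * u_ (n k) p.
have wE k x t : 0 <= t <= T -> w k (x, t) = u_ (n k) (x, t) by rewrite /w /= => ->; rewrite mul1r.
have wb k p : `|w k p| <= B.
  case: p => x t; rewrite /w /=; have [tT|_] := boolP (0 <= t <= T); last by rewrite mul0r normr0.
  by rewrite mul1r ub.
have mw k : measurable_fun [set: V * R] (w k).
  apply: measurable_funM => //; apply: measurable_boolR; apply: measurable_and.
    by apply: measurable_fun_ler => //; exact: measurable_snd.
  by apply: measurable_fun_ler => //; exact: measurable_snd.
(* The upper limit exists at every point and is measurable in (x, t) jointly; the cut-off in [u]
   below restores the bound B where the sequence does not converge. *)
pose h p := fine (limn_esup (fun k => (w k p)%:E)).
have mh : measurable_fun [set: V * R] h.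
  apply: measurable_fine; apply: measurable_fun_limn_esup => k.
  by apply/measurable_EFinP.
pose u p := (`|h p| <= B)%R%:R * h p.
have mu' : measurable_fun [set: V * R] u.
  apply: measurable_funM => //; apply: measurable_boolR.
  by apply: measurable_fun_ler => //; exact: measurableT_comp.
have uB p : `|u p| <= B.
  by rewrite /u; have [hp|_] := boolP (`|h p| <= B); rewrite ?mul1r// mul0r normr0.
have lim p l : w ^~ p @ \oo --> l -> u p = l.
  move=> wl; have hl : (fun k => (w k p)%:E) @ \oo --> l%:E by apply: (cvg_comp _ _ wl).
  have [_ hs] := cvg_limn_einf_sup hl.
  have lB : `|l| <= B.
    rewrite -(cvg_lim (@Rhausdorff R) (cvg_norm wl)); apply: limr_le.
      by apply/cvg_ex; exists `|l|; exact: cvg_norm.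
    by apply: nearW => k; exact: wb.
  by rewrite /u /h hs /= lB mul1r.
have wL1 k t : 0 <= t <= T -> L1 lebN (fun x => w k (x, t)).
  by move=> tT; apply: (L1_eq _ (proj1 (uL1 (n k) tT))) => x; rewrite wE.
have aecv t : 0 <= t <= T -> {ae lebN, forall x, (fun k => w k (x, t)) @ \oo --> u (x, t)}.
  move=> tT; pose a k x := b k%:R x * `|w k (x, t) - w k.+1 (x, t)|.
  have a1 k : L1 lebN (a k).
    by apply: (bm_L1 (ball0_bm _ _)); apply: L1_norm; apply: L1B; exact: wL1.
  have a0 k x : 0 <= a k x by rewrite mulr_ge0.
  have ai k : \int[lebN]_x a k x <= 2^-1 ^+ k.
    apply: le_trans (hn0 k (n k) (n k.+1) _ _ t tT); [|exact: nn|exact: nn].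
    by apply: le_int => //; [apply: (bm_L1 (ball0_bm _ _)); apply: L1_norm; apply: L1B; exact: (proj1 (uL1 _ tT))|move=> x; rewrite /a !wE].
  apply: filterS (fast_series a1 a0 ai) => x cx.
  have xk : `|x| < (Num.bound `|x|)%:R by exact: archi_boundP.
  have [l hl] : exists l : R, (fun k => w k (x, t)) @ \oo --> l.
    apply: (series_cauchy_cvg (k0 := Num.bound `|x|) cx) => // k hk.
    by rewrite /a /b ball0E (lt_le_trans xk) ?ler_nat// mul1r.
  by rewrite (lim _ _ hl).
have loc t r d : 0 <= t <= T -> 0 < d -> exists k0, forall k, (k0 <= k)%N ->
    \int[lebN]_x (b r x * `|w k (x, t) - u (x, t)|) <= d.
  move=> tT d0.
  have mb : measurable_fun [set: V] (b r) := proj1 (ball0_bm N r).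
  have mwt k : measurable_fun [set: V] (fun x => b r x * w k (x, t)).
    by apply: measurable_funM => //; exact: L1_measurable (wL1 k t tT).
  have mut : measurable_fun [set: V] (fun x => b r x * u (x, t)).
    by apply: measurable_funM => //; exact: (measurable_slice2 t mu').
  have gL : L1 lebN (fun x => B * b r x) by apply: L1Z; exact: ball_L1.
  have dom k x : `|b r x * w k (x, t)| <= B * b r x.
    by rewrite normrM (ger0_norm (b0 r x)) mulrC ler_wpM2r.
  have cva : {ae lebN, forall x, (fun k => b r x * w k (x, t)) @ \oo --> b r x * u (x, t)}.
    apply: filterS (aecv t tT) => x hx; apply: cvgM => //; exact: cvg_cst.
  have [k0 hk] := cvg0_le (dct_L1 mwt mut gL dom cva) d0.
  exists k0 => k kk; apply: le_trans (le_trans (ler_norm _) (hk k kk)).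
  rewrite le_eqVlt; apply/orP; left; apply/eqP; apply: eq_Rintegral => x _.
  by rewrite -mulrBr normrM (ger0_norm (b0 r x)).
have ut1 t : 0 <= t <= T -> measurable_fun [set: V] (fun x => u (x, t)).
  by move=> _; exact: (measurable_slice2 t mu').
have bL1 t r k : 0 <= t <= T -> L1 lebN (fun x => b r x * `|w k (x, t) - u (x, t)|).
  move=> tT; apply: (@L1_bm _ _ _ lebN (B + B) (b r)); first exact: ball_L1.
  by apply: bm_norm; apply: bmB; split => //; [exact: L1_measurable (wL1 k t tT)|exact: ut1].
have buL1 t r : 0 <= t <= T -> L1 lebN (fun x => b r x * `|u (x, t)|).
  move=> tT; apply: (@L1_bm _ _ _ lebN B (b r)); first exact: ball_L1.
  by apply: bm_norm; split => //; exact: ut1.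
have bnd t r : 0 <= t <= T -> \int[lebN]_x (b r x * `|u (x, t)|) <= A.
  move=> tT; apply/ler_addgt0Pr => d d0; have [k0 hk] := loc t r d tT d0.
  have [w1 wA] := uL1 (n k0) tT.
  apply: (@le_trans _ _ (\int[lebN]_x (`|u_ (n k0) (x, t)| + b r x * `|w k0 (x, t) - u (x, t)|))).
    apply: le_int; [exact: buL1|by apply: L1D; [exact: L1_norm|exact: bL1]|].
    move=> x; rewrite -(wE _ _ _ tT).
    have h3 : `|u (x, t)| <= `|w k0 (x, t)| + `|w k0 (x, t) - u (x, t)|.
      by have := ler_normB (w k0 (x, t)) (w k0 (x, t) - u (x, t)); rewrite opprB addrC subrK.
    apply: (le_trans (ler_wpM2l (b0 r x) h3)); rewrite mulrDr lerD2r.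
    by apply: ler_piMl.
  rewrite intD; [|exact: L1_norm|exact: bL1].
  by rewrite lerD// hk.
exists u; split => //.
  move=> t tT; have mut := ut1 t tT.
  have le : (\int[lebN]_x `|u (x, t)|%:E <= A%:E)%E.
    (* Convergence is only local, so the L^1 bound is first obtained on balls and then extended by
       monotone convergence. *)
    pose g k x := (b k%:R x * `|u (x, t)|)%:E.
    have mg k : measurable_fun [set: V] (g k) by apply/measurable_EFinP; exact: L1_measurable (buL1 t k%:R tT).
    have g0 k x : [set: V] x -> (0 <= g k x)%E by move=> _; rewrite lee_fin mulr_ge0.
    have gnd x : [set: V] x -> {homo g^~ x : k l / (k <= l)%N >-> (k <= l)%E}.
      move=> _ k l kl; rewrite lee_fin ler_wpM2r// /b !ball0E.
      have [hx|_] := ltP `|x| k%:R => //.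
      by rewrite (lt_le_trans hx) ?ler_nat.
    rewrite (_ : (\int[lebN]_x _ = \int[lebN]_x limn (g^~ x))%E); last first.
      apply: eq_integral => x _; apply/esym; apply: cvg_lim => //; apply: cvg_near_cst.
      exists (Num.bound `|x|) => // k /= hk; rewrite /g /b ball0E (lt_le_trans (archi_boundP (normr_ge0 x))) ?ler_nat// mul1r.
      by [].
    rewrite (monotone_convergence lebN measurableT mg g0 gnd); apply: lime_le.
      by apply/cvg_ex; eexists; exact: (cvg_monotone_convergence measurableT mg g0 gnd).
    by apply: nearW => k; rewrite -EFin_int ?lee_fin; [exact: bnd|exact: buL1].
  have u1 : L1 lebN (fun x => u (x, t)) by apply: L1P => //; exact: le_lt_trans le (ltry _).
  by split => //; rewrite -lee_fin EFin_int//; exact: L1_norm.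
move=> r d d0; have d2 : 0 < d / 2 by rewrite divr_gt0.
have [j0 hj0] := cauchy r d2; exists j0 => j jj t tT.
have [k0 hk] := loc t r (d / 2) tT d2.
pose k := maxn k0 j0; have hk' := hk k (leq_maxl _ _).
have [uj _] := uL1 j tT.
have jn : (j0 <= n k)%N by rewrite (leq_trans (leq_maxr k0 j0))// /n leq_addl.
have [un _] := uL1 (n k) tT.
have q1 : L1 lebN (fun x => b r x * `|u_ j (x, t) - u_ (n k) (x, t)|).
  by apply: (bm_L1 (ball0_bm _ _)); apply: L1_norm; exact: L1B.
have q2 : L1 lebN (fun x => b r x * `|u_ j (x, t) - u (x, t)|).
  apply: (@L1_bm _ _ _ lebN (B + B) (b r)); first exact: ball_L1.
  apply: bm_norm; apply: bmB; split => //; [exact: L1_measurable uj|by move=> x; exact: ub|exact: ut1].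
rewrite [leRHS](splitr d).
apply: (@le_trans _ _ (\int[lebN]_x (b r x * `|u_ j (x, t) - u_ (n k) (x, t)| + b r x * `|w k (x, t) - u (x, t)|))).
  apply: le_int => //; first by apply: L1D => //; exact: bL1.
  by move=> x; rewrite -mulrDr wE// ler_wpM2l// ler_distD.
rewrite intD//; last exact: bL1.
by apply: lerD => //; exact: hj0.
Qed.
End curve_limit.

(** Local convergence with a uniform bound suffices against an integrable bounded g: outside a large
    ball the mass of g is small, inside it the local convergence acts. *)
Lemma pair_lim (R : realType) (N : nat) (T B Bg : R) (u_ : nat -> 'rV[R]_N * R -> R)
    (u g : 'rV[R]_N * R -> R) : 0 < T -> 0 <= B ->
  (forall j, measurable_fun [set: 'rV[R]_N * R] (u_ j)) -> measurable_fun [set: 'rV[R]_N * R] u ->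
  (forall j x t, 0 < t < T -> `|u_ j (x, t)| <= B) -> (forall p, `|u p| <= B) ->
  bm Bg g -> L1 (lebX R N) g -> (forall p, ~~ (0 < p.2 < T) -> g p = 0) ->
  (forall r d, 0 < d -> exists n0, forall j, (n0 <= j)%N -> forall t, 0 < t < T ->
    \int[lebesgue_rV R N]_x (\1_(ball (0 : 'rV[R]_N) r) x * `|u_ j (x, t) - u (x, t)|) <= d) ->
  forall d, 0 < d -> exists n0, forall j, (n0 <= j)%N ->
    L1 (lebX R N) (fun p => (u_ j p - u p) * g p) /\
    \int[lebX R N]_p `|(u_ j p - u p) * g p| <= d.
Proof.
move=> T0 B0 muj mu' ub uB gb g1 gout loc d d0.
pose b r (x : 'rV[R]_N) : R := \1_(ball (0 : 'rV[R]_N) r) x.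
have b0 r x : 0 <= b r x by exact: ball0_ge0.
have b1 r x : b r x <= 1 by exact: ball0_ge1.
have Bg0 : 0 <= Bg by exact: (bm_ge0 ((0 : 'rV[R]_N), (0 : R)) gb).
have d2 : 0 < d / 2 by rewrite divr_gt0.
have BB0 : 0 <= B + B by rewrite addr_ge0.
have y1 : 0 < d / 2 / (B + B + 1) by rewrite divr_gt0// ltr_wpDl.
have BT0 : 0 <= Bg * T by rewrite mulr_ge0// ltW.
have y2 : 0 < d / 2 / (Bg * T + 1) by rewrite divr_gt0// ltr_wpDl.
have mb r : measurable_fun [set: 'rV[R]_N * R] (fun p => b r p.1).
  by apply: (measurableT_comp (proj1 (ball0_bm N r))); exact: measurable_fst.
have cb r : bm 1 (fun p : 'rV[R]_N * R => 1 - b r p.1).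
  split; first by apply: measurable_funB => //; exact: mb.
  by move=> p; rewrite ger0_norm ?subr_ge0// gerBl.
have [r hr] : exists r, \int[lebX R N]_p `|(1 - b r p.1) * g p| <= d / 2 / (B + B + 1).
  have mf k : measurable_fun [set: 'rV[R]_N * R] (fun p => (1 - b k%:R p.1) * g p).
    by apply: measurable_funM; [exact: (proj1 (cb _))|exact: (proj1 gb)].
  have m0 : measurable_fun [set: 'rV[R]_N * R] (fun=> 0 : R) by exact: measurable_cst.
  have dom k p : `|(1 - b k%:R p.1) * g p| <= `|g p|.
    by rewrite normrM ler_piMl// (proj2 (cb k%:R) p).
  have cva : {ae lebX R N, forall p, (fun k => (1 - b k%:R p.1) * g p) @ \oo --> (0 : R)}.
    apply: nearW => p; apply: cvg_near_cst; exists (Num.bound `|p.1|) => // k /= hk.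
    by rewrite /b ball0E (lt_le_trans (archi_boundP (normr_ge0 p.1))) ?ler_nat// subrr mul0r.
  have [k0 hk] := cvg0_le (dct_L1 mf m0 (L1_norm g1) dom cva) y1.
  exists k0%:R; apply: le_trans (le_trans (ler_norm _) (hk k0 (leqnn _))).
  rewrite le_eqVlt; apply/orP; left; apply/eqP; apply: eq_Rintegral => p _.
  by rewrite subr0.
have [n0 hn] := loc r _ y2; exists n0 => j jn.
pose D p := slab T p * (u_ j p - u p).
have Db : bm (B + B) D.
  split; first by apply: measurable_funM; [exact: (proj1 (slab_bm N T))|exact: measurable_funB].
  case=> x t; rewrite /D /slab /=; have [tT|_] := boolP (0 < t < T); last by rewrite mul0r normr0.
  by rewrite mul1r (le_trans (ler_normB _ _))// lerD// ub.
have DE p : (u_ j p - u p) * g p = D p * g p.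
  rewrite /D /slab; have [tT|tT] := boolP (0 < p.2 < T); first by rewrite mul1r.
  by rewrite gout// !mulr0.
have Dg1 : L1 (lebX R N) (fun p => D p * g p) := bm_L1 Db g1.
have e1 : L1 (lebX R N) (fun p => (u_ j p - u p) * g p).
  by apply: (L1_eq _ Dg1) => p; rewrite DE.
split => //.
have mG : measurable_fun [set: 'rV[R]_N * R] (fun p => b r p.1 * `|u_ j p - u p|).
  by apply: measurable_funM => //; apply: measurableT_comp => //; exact: measurable_funB.
have [G1 GI] : L1 (lebX R N) (fun p => slab T p * (b r p.1 * `|u_ j p - u p|)) /\
  \int[lebX R N]_p `|slab T p * (b r p.1 * `|u_ j p - u p|)| <= T * (d / 2 / (Bg * T + 1)).
  apply: slab_int => // t tT; split.
    apply: (@L1_bm _ _ _ (lebesgue_rV R N) (B + B) (b r)); first exact: ball_L1.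
    apply: bm_norm; apply: bmB; split => //.
    - exact: (measurable_slice2 t (muj j)).
    - by move=> x; exact: ub.
    - exact: (measurable_slice2 t mu').
  apply: le_trans (hn j jn t tT); rewrite le_eqVlt; apply/orP; left; apply/eqP.
  by apply: eq_Rintegral => x _; rewrite ger0_norm// mulr_ge0.
have cg1 : L1 (lebX R N) (fun p => `|(1 - b r p.1) * g p|) by apply: L1_norm; exact: (bm_L1 (cb r) g1).
have G1' := L1_norm G1.
apply: (@le_trans _ _ (\int[lebX R N]_p ((B + B) * `|(1 - b r p.1) * g p| + Bg * `|slab T p * (b r p.1 * `|u_ j p - u p|)|))).
  apply: le_int; [exact: L1_norm|by apply: L1D; exact: L1Z|].
  move=> p; rewrite DE normrM.
  have -> : `|D p| * `|g p| = `|D p| * `|(1 - b r p.1) * g p| + `|g p| * `|slab T p * (b r p.1 * `|u_ j p - u p|)|.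
    rewrite /D !normrM normr_id (ger0_norm (b0 r p.1)) (@ger0_norm _ (1 - b r p.1)) ?subr_ge0//.
    ring.
  by apply: lerD; [apply: ler_wpM2r => //; exact: (proj2 Db)|apply: ler_wpM2r => //; exact: (proj2 gb)].
rewrite intD ?intZ//; [|exact: L1Z|exact: L1Z].
rewrite [leRHS](splitr d); apply: lerD.
  by apply: (le_trans (ler_wpM2l BB0 hr)); exact: (frac_le BB0 (ltW d2)).
apply: (le_trans (ler_wpM2l Bg0 GI)); rewrite mulrA; exact: (frac_le BT0 (ltW d2)).
Qed.

(** * Bounds for phi on bounded sets *)

Section modulus.
Variables (R : realType) (phi : R -> R).
Hypothesis phi_le : {homo phi : x y / x <= y}.
Hypothesis cphi : continuous phi.

Lemma phi_bounded (m : R) : exists2 Cp, 0 <= Cp & forall x, `|x| <= m -> `|phi x| <= Cp.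
Proof.
exists (`|phi m| + `|phi (- m)|); first by rewrite addr_ge0.
move=> x; rewrite ler_norml => /andP[x1 x2]; rewrite ler_norml; apply/andP; split.
  rewrite opprD addrC; apply: le_trans (phi_le x1).
  have h := ler_norm (- phi (- m)); rewrite normrN in h; have h0 := normr_ge0 (phi m); lra.
apply: (le_trans (phi_le x2)); apply: (le_trans (ler_norm _)); by rewrite lerDl.
Qed.

(** Turns uniform continuity into an affine bound, which can be integrated against an L^1 difference
    of the arguments. *)
Lemma phi_modulus (m k : R) : 0 < k -> exists2 C, 0 <= C & forall a b, `|a| <= m -> `|b| <= m ->
  `|phi a - phi b| <= k + C * `|a - b|.
Proof.
move=> k0; have [h h0 hh] := unif_cont cphi m k0; have [Cp Cp0 hC] := phi_bounded m.
exists ((Cp + Cp) / h); first by rewrite divr_ge0 ?addr_ge0// ltW.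
move=> a b am bm'; have [ab|ab] := ltP `|a - b| h.
  by rewrite (le_trans (hh b a bm' ab))// lerDl mulr_ge0// divr_ge0 ?addr_ge0// ltW.
apply: (@le_trans _ _ (Cp + Cp)); first by rewrite (le_trans (ler_normB _ _))// lerD// hC.
apply: (@le_trans _ _ ((Cp + Cp) / h * `|a - b|)); last by rewrite lerDr ltW.
by rewrite -mulrA ler_peMr ?addr_ge0// mulrC ler_pdivlMr// mul1r.
Qed.
End modulus.

Lemma small_eq0 (R : realType) (x K : R) : 0 < K -> (forall d, 0 < d -> `|x| <= K * d) -> x = 0.
Proof.
move=> K0 h; apply/eqP; rewrite -normr_le0; apply/ler_addgt0Pr => d d0.
by rewrite add0r (le_trans (h (d / K) _)) ?divr_gt0// mulrC divfK// gt_eqF.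
Qed.

(** * Passage to the limit in the weak formulation *)

Section construction.
Variables (R : realType) (N P : nat) (sigma : 'M[R]_(N, P)).
Local Notation V := 'rV[R]_N.
Local Notation lebN := (lebesgue_rV R N).
Local Notation M := (lebX R N).
Variable mu : {measure set V -> \bar R}.
Variables (nu : nat -> {sigma_finite_measure set V -> \bar R}) (e : nat -> R) (c : R).
Hypothesis e0 : e @ \oo --> (0 : R).
Hypothesis knu : forall n, kern (nu n) (fun=> 1).
Hypothesis levyE : forall A r g n x, levy_nice sigma A r g ->
  `|levy_op sigma mu g x - \int[nu n]_z (g (x + z) - g x)| <=
  A * e n * \1_(ball (0 : V) (r + c)) x.
Variable phi : R -> R.
Hypothesis phi_le : {homo phi : x y / x <= y}.
Hypothesis cphi : continuous phi.
Variables (T M0 : R) (U0 : V -> R) (F : V * R -> R) (m : R -> R).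
Hypotheses (T0 : 0 < T) (Ub : bm M0 U0) (U1 : L1 lebN U0).
Hypotheses (F1 : L1 M F) (m1 : L1 (lebR R) m) (Fm : forall x s, `|F (x, s)| <= m s).
Let S := T + 1.
Let A := baseA U0 F.
Let mX := @measurable_shX R N.
Let pX := @mpres_shX R N.
Let kX := @shXK R N.
Let mphi : measurable_fun [set: R] phi.
Proof. by apply: nondecreasing_measurable => // x y _ _; exact: phi_le. Qed.

Section weak.
Variable psi : V * R -> R.
Hypothesis tpsi : test_function T psi.
Let Psi p := slab T p * psi p.
Let D := dtest T psi.
Let L := ltest sigma mu T psi.

Lemma weak_initial : [/\ L1 M (fun p => U0 p.1 * D p), L1 lebN (fun x => U0 x * psi (x, 0)) &
  \int[M]_p (U0 p.1 * D p) = - \int[lebN]_x (U0 x * psi (x, 0))].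
Proof.
have [a [r [a0 r0 db dle]]] := dtest_bm tpsi.
have d1 : L1 M D := dtest_L1 tpsi.
have Ufst : bm M0 (fun p : V * R => U0 p.1).
  by split; [apply: (measurableT_comp (proj1 Ub)); exact: measurable_fst|move=> p; exact: (proj2 Ub)].
have h1 := bm_L1 Ufst d1.
have Dt x : \int[lebR R]_t (U0 x * D (x, t)) = - (U0 x * psi (x, 0)).
  have l1 : L1 (lebR R) (fun t => D (x, t)).
    apply: (L1_le (measurable_slice1 x (proj1 db)) (L1Z a (itvb_L1 0 T))) => t.
    apply: (le_trans (dle (x, t))); rewrite ler_wpM2l ?(ltW a0)//= /slab /=.
    by rewrite ler_piMl ?ler0n// ball0_ge1.
  rewrite intZ//.
  have -> : \int[lebR R]_t D (x, t) = prim (fun s => D (x, s)) T.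
    apply: eq_Rintegral => s _; rewrite /D /dtest /slab /=.
    by have [_|_] := boolP (0 < s < T); rewrite ?mul1r// !mul0r.
  have hT : 0 <= T <= T by rewrite lexx (ltW T0).
  by rewrite (test_prim tpsi x hT) (test_end T0 tpsi) sub0r mulrN.
have UL : L1 lebN (fun x => U0 x * psi (x, 0)).
  apply: (L1_eq _ (L1N (L1X_int1 h1))) => x; rewrite /= -[RHS]opprK -Dt //.
split => //; rewrite (intX1 h1).
by under eq_Rintegral do rewrite Dt; rewrite intN.
Qed.

Section one_step.
Variables (j : nat) (ut : V * R -> R) (ph : R -> R) (Cq : R).
Hypothesis ap : approx_sol nu phi T M0 U0 F m j ut ph.
Local Notation q := (fun p => ph (ut p)).
Hypothesis qb : bm Cq q.

Lemma weak_approx : L1 M (fun p => uh nu U0 F j ut ph p * D p) /\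
  \int[M]_p (uh nu U0 F j ut ph p * D p) + \int[M]_p (ph (ut p) * LX nu j Psi p) +
  \int[M]_p (F p * Psi p) + \int[lebN]_x (U0 x * psi (x, 0)) = 0.
Proof.
case: ap => [[ub u1 _] _ [_ r1 rx _] _ _].
have [w1 _ w2] := weak_initial.
have [p1 p2 p3] := prim_pair T0 tpsi F1 (F_L1x F1 m1 Fm).
have [s1 s2 s3] := prim_pair T0 tpsi r1 rx.
have E : (fun p => uh nu U0 F j ut ph p * D p) = (fun p => U0 p.1 * D p +
    (prim (fun s => F (p.1, s)) p.2 * D p + prim (fun s => rj nu j ut ph (p.1, s)) p.2 * D p)).
  by apply/funext => p; rewrite /uh /base -!mulrDl addrA.
rewrite E; split; first by apply: L1D => //; exact: L1D.
rewrite intD//; last exact: L1D.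
rewrite intD// w2 p3 s3.
have [B [B' [Cl [Pb P1 _ _ _]]]] := test_levy e0 knu levyE tpsi.
pose K g := cv (@shX R N) (nu j) (fun=> 1) g.
pose la := \int[nu j]_y 1.
have [Ck Kb] : exists C, bm C (K q).
  by eexists; apply: cv_bm; first [exact: mX | exact: pX | exact: kX | exact: (knu j) | exact: qb].
have [Ck' Kb'] : exists C, bm C (K Psi).
  by eexists; apply: cv_bm; first [exact: mX | exact: pX | exact: kX | exact: (knu j) | exact: Pb].
have KP1 : L1 M (K Psi) by exact: (cv_L1 mX pX (knu j) P1).
have sym : \int[M]_p (Psi p * K q p) = \int[M]_p (K Psi p * ph (ut p)).
  apply: cv_sym; first [exact: mX | exact: pX | exact: kX | exact: (knu j) | exact: qb | exact: Pb | exact: P1].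
have qP : L1 M (fun p => la * (ph (ut p) * Psi p)) by apply: L1Z; exact: (bm_L1 qb P1).
have S1 : \int[M]_p (rj nu j ut ph p * Psi p) = \int[M]_p (Psi p * K q p) - \int[M]_p (la * (ph (ut p) * Psi p)).
  rewrite -intB//; last exact: (L1_bm P1 Kb).
  apply: eq_Rintegral => p _; rewrite /rj /genX /K /la; ring.
have S2 : \int[M]_p (ph (ut p) * LX nu j Psi p) = \int[M]_p (K Psi p * ph (ut p)) - \int[M]_p (la * (ph (ut p) * Psi p)).
  rewrite -intB//; last exact: (L1_bm KP1 qb).
  apply: eq_Rintegral => p _; rewrite /LX /rate /K /la; ring.
rewrite S2 -sym -S1.
set x1 := \int[lebN]_x _; set x2 := \int[M]_p _; set x3 := \int[M]_p _; ring.
Qed.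
End one_step.

Section limit.
Variables (ut : nat -> V * R -> R) (ph : nat -> R -> R) (u : V * R -> R).
Hypothesis ap : forall j, approx_sol nu phi T M0 U0 F m j (ut j) (ph j).
Local Notation u_ j := (uh nu U0 F j (ut j) (ph j)).
Let B := Mb T M0 m.
Hypothesis mu' : measurable_fun [set: V * R] u.
Hypothesis uB : forall p, `|u p| <= B.
Hypothesis loc : forall r d, 0 < d -> exists n0, forall j, (n0 <= j)%N -> forall t, 0 <= t <= T ->
    \int[lebN]_x (\1_(ball (0 : V) r) x * `|u_ j (x, t) - u (x, t)|) <= d.

Let B0 : 0 <= B. Proof. exact: le_trans (normr_ge0 _) (uB ((0 : V), (0 : R))). Qed.
Let TS t : 0 < t < T -> 0 <= t <= S.
Proof. by move=> /andP[t0 tT]; rewrite (ltW t0) /S ltW// ltr_wpDr. Qed.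

Lemma loc_ut r d : 0 < d -> exists n0, forall j, (n0 <= j)%N -> forall t, 0 < t < T ->
    \int[lebN]_x (\1_(ball (0 : V) r) x * `|ut j (x, t) - u (x, t)|) <= d.
Proof.
move=> d0; have d2 : 0 < d / 2 by rewrite divr_gt0.
have [n1 h1] := loc r d2; have [n2 _ h2] := near_infty_natSinv_lt (PosNum d2).
exists (maxn n1 n2) => j; rewrite geq_max => /andP[j1 j2] t tT.
have tT' : 0 <= t <= T by case/andP: tT => /ltW -> /ltW ->.
have tS' : 0 <= t < S by case/andP: tT => /ltW -> tT; rewrite /S (lt_trans tT)// ltrDl.
case: (ap j) => [[ub u1 _] _ _ h4 [h5 _]].
have [l1 l2] := h5 t tS'; have [g1 g2 _ _] := h4 t (TS tT).
pose b x : R := \1_(ball (0 : V) r) x.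
have mut : measurable_fun [set: V] (fun x => u (x, t)) by exact: (measurable_slice2 t mu').
have mtt : measurable_fun [set: V] (fun x => ut j (x, t)) by exact: (measurable_slice2 t (proj1 ub)).
have q1 : L1 lebN (fun x => b x * `|u_ j (x, t) - u (x, t)|).
  apply: (@L1_bm _ _ _ lebN (B + B) b); first exact: ball_L1.
  by apply: bm_norm; apply: bmB; split => //; exact: L1_measurable g2.
have q2 : L1 lebN (fun x => b x * `|ut j (x, t) - u (x, t)|).
  apply: (@L1_bm _ _ _ lebN (B + B) b); first exact: ball_L1.
  by apply: bm_norm; apply: bmB; split => // x; exact: (proj2 ub).
apply: (@le_trans _ _ (\int[lebN]_x (`|u_ j (x, t) - ut j (x, t)| + b x * `|u_ j (x, t) - u (x, t)|))).
  apply: le_int => //; first by apply: L1D => //; exact: L1_norm.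
  move=> x; have bx0 : 0 <= b x by exact: ball0_ge0.
  have h : `|ut j (x, t) - u (x, t)| <= `|u_ j (x, t) - ut j (x, t)| + `|u_ j (x, t) - u (x, t)|.
    by rewrite (le_trans (ler_distD (u_ j (x, t)) _ _))// lerD2r distrC.
  apply: (le_trans (ler_wpM2l bx0 h)); rewrite mulrDr lerD2r ler_piMl//.
  exact: ball0_ge1.
rewrite intD//; last exact: L1_norm.
rewrite [leRHS](splitr d) lerD//; last exact: h1.
by apply: (le_trans l2); rewrite ltW// h2.
Qed.

Lemma weak_limit : \int[M]_p (u p * D p) + \int[M]_p (phi (u p) * L p) +
  \int[M]_p (F p * Psi p) + \int[lebN]_x (U0 x * psi (x, 0)) = 0.
Proof.
have [Cp Cp0 hCp] := phi_bounded phi_le B.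
have [A' [Bl [Cl [Pb P1 Lb L1' [Cl0 hCl]]]]] := test_levy e0 knu levyE tpsi.
have [a [r [a0 _ Db _]]] := dtest_bm tpsi.
have D1 : L1 M D := dtest_L1 tpsi.
have qb j : bm (Cp + 1) (fun p => ph j (ut j p)).
  case: (ap j) => [[ub _ _] [mph hph] _ _ _]; split.
    by apply: (measurableT_comp mph); exact: (proj1 ub).
  move=> p; have h1 := hph _ ((proj2 ub) p); have h2 := hCp _ ((proj2 ub) p).
  have h3 : j.+1%:R^-1 <= 1 :> R by rewrite invf_le1// ler1n.
  have := ler_normD (phi (ut j p)) (ph j (ut j p) - phi (ut j p)).
  rewrite addrC subrK => h; apply: (le_trans h); exact: (lerD h2 (le_trans h1 h3)).
pose I := \int[M]_p `|L p|.
have I0 : 0 <= I by exact: int_ge0.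
have cc0 : 0 <= (Cp + 1) * Cl by rewrite mulr_ge0// addr_ge0.
have pub : bm B u by split.
have phib : bm Cp (fun p => phi (u p)).
  by split; [exact: (measurableT_comp mphi)|move=> p; exact: hCp].
have Dout p : ~~ (0 < p.2 < T) -> D p = 0.
  by move=> hp; rewrite /D /dtest /slab (negbTE hp) mul0r.
have Lout p : ~~ (0 < p.2 < T) -> L p = 0.
  by move=> hp; rewrite /L /ltest /slab (negbTE hp) mul0r.
have muj j : measurable_fun [set: V * R] (u_ j) by case: (ap j) => [_ _ [_ _ _ h] _ _].
have muu j : measurable_fun [set: V * R] (ut j) by case: (ap j) => [[[h _] _ _] _ _ _ _].
have ujb j x t : 0 < t < T -> `|u_ j (x, t)| <= B.
  by move=> tT; case: (ap j) => [_ _ _ h _]; have [h1 _ _ _] := h t (TS tT); exact: h1.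
have utb j x t : 0 < t < T -> `|ut j (x, t)| <= B.
  by move=> _; case: (ap j) => [[[_ h] _ _] _ _ _ _].
have loc' r' d : 0 < d -> exists n0, forall j, (n0 <= j)%N -> forall t, 0 < t < T ->
    \int[lebN]_x (\1_(ball (0 : V) r') x * `|u_ j (x, t) - u (x, t)|) <= d.
  move=> d0; have [n0 h] := loc r' d0; exists n0 => j jn t /andP[t0 tT]; apply: h => //.
  by rewrite !ltW.
(* One d from the time derivative, three from the nonlinearity and one from the operator on the test
   function. *)
apply: (@small_eq0 _ _ 5) => // d d0.
have k0 : 0 < d / (I + 1) by rewrite divr_gt0// ltr_wpDl.
have [C C0 hC] := phi_modulus phi_le cphi B k0.
have y2 : 0 < d / (C + 1) by rewrite divr_gt0// ltr_wpDl.
have y4 : 0 < d / ((Cp + 1) * Cl + 1) by rewrite divr_gt0// ltr_wpDl.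
have [n1 h1] := pair_lim T0 B0 muj mu' ujb uB Db D1 Dout loc' d0.
have [n2 h2] := pair_lim T0 B0 muu mu' utb uB Lb L1' Lout loc_ut y2.
have [n3 _ h3] := near_infty_natSinv_lt (PosNum k0).
have [n4 h4] := cvg0_le e0 y4.
pose j := maxn (maxn n1 n2) (maxn n3 n4).
have j1 : (n1 <= j)%N by rewrite /j !leq_max leqnn.
have j2 : (n2 <= j)%N by rewrite /j !leq_max leqnn orbT.
have j3 : (n3 <= j)%N by rewrite /j !leq_max leqnn !orbT.
have j4 : (n4 <= j)%N by rewrite /j !leq_max leqnn !orbT.
have [uD1 W] := weak_approx (ap j) (qb j).
have [e1 e1'] := h1 j j1; have [e2 e2'] := h2 j j2.
have uD : L1 M (fun p => u p * D p) := bm_L1 pub D1.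
have pL : L1 M (fun p => phi (u p) * L p) := bm_L1 phib L1'.
have qL : L1 M (fun p => ph j (ut j p) * L p) := bm_L1 (qb j) L1'.
have LX1 : L1 M (LX nu j Psi) by apply: LX_L1 => //.
have qX : L1 M (fun p => ph j (ut j p) * LX nu j Psi p) := bm_L1 (qb j) LX1.
set X := (X in `|X|).
have XE : X = (\int[M]_p (u p * D p) - \int[M]_p (u_ j p * D p)) +
   ((\int[M]_p (phi (u p) * L p) - \int[M]_p (ph j (ut j p) * L p)) +
    (\int[M]_p (ph j (ut j p) * L p) - \int[M]_p (ph j (ut j p) * LX nu j Psi p))).
  apply/eqP; rewrite -subr_eq0; apply/eqP; rewrite -[RHS]W /X.
  set z1 := \int[M]_p (u p * D p); set z2 := \int[M]_p (u_ j p * D p).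
  set z3 := \int[M]_p (phi (u p) * L p); set z4 := \int[M]_p (ph j (ut j p) * L p).
  set z5 := \int[M]_p (ph j (ut j p) * LX nu j Psi p).
  set z6 := \int[M]_p (F p * Psi p); set z7 := \int[lebN]_x _; ring.
have T1 : `|\int[M]_p (u p * D p) - \int[M]_p (u_ j p * D p)| <= d.
  rewrite distrC -intB//; apply: (le_trans (le_norm_int (L1B uD1 uD))); apply: le_trans e1'.
  rewrite le_eqVlt; apply/orP; left; apply/eqP; apply: eq_Rintegral => p _.
  by rewrite mulrBl.
have nL := L1_norm L1'.
have T2 : `|\int[M]_p (phi (u p) * L p) - \int[M]_p (ph j (ut j p) * L p)| <= d + d + d.
  rewrite distrC -intB//; apply: (le_trans (le_norm_int (L1B qL pL))).
  apply: (@le_trans _ _ (\int[M]_p ((d / (I + 1) + d / (I + 1)) * `|L p| + C * `|(ut j p - u p) * L p|))).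
    apply: le_int; [by apply: L1_norm; exact: L1B|by apply: L1D; [exact: L1Z|apply: L1Z; exact: L1_norm]|].
    move=> p; rewrite [leRHS](_ : _ = (d / (I + 1) + (d / (I + 1) + C * `|ut j p - u p|)) * `|L p|); last by rewrite (normrM (ut j p - u p) (L p)); ring.
    rewrite -mulrBl normrM ler_wpM2r//.
    case: (ap j) => [[ub _ _] [_ hph] _ _ _].
    have g1 := hph _ ((proj2 ub) p); have g2 := hC _ _ ((proj2 ub) p) (uB p).
    have g3 : j.+1%:R^-1 <= d / (I + 1) by rewrite ltW// h3.
    apply: (le_trans (ler_distD (phi (ut j p)) _ _)).
    exact: (lerD (le_trans g1 g3) g2).
  rewrite intD ?intZ//; [|exact: L1_norm|exact: L1Z|by apply: L1Z; exact: L1_norm].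
  have f1 := frac_le I0 (ltW d0); have f2 := frac_le C0 (ltW d0).
  rewrite mulrDl; apply: lerD; last by apply: le_trans f2; exact: ler_wpM2l.
  by apply: lerD; rewrite mulrC.
have T3 : `|\int[M]_p (ph j (ut j p) * L p) - \int[M]_p (ph j (ut j p) * LX nu j Psi p)| <= d.
  rewrite -intB//; apply: (le_trans (le_norm_int (L1B qL qX))).
  have dL := L1_norm (L1B L1' LX1).
  apply: (@le_trans _ _ (\int[M]_p ((Cp + 1) * `|L p - LX nu j Psi p|))).
    apply: le_int; [by apply: L1_norm; exact: L1B|exact: L1Z|].
    by move=> p; rewrite -mulrBr normrM ler_wpM2r//; exact: (proj2 (qb j)).
  have cp1 : 0 <= Cp + 1 by rewrite addr_ge0.
  rewrite intZ//; apply: (le_trans (ler_wpM2l cp1 (hCl j))); rewrite mulrA.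
  apply: (le_trans (ler_wpM2l cc0 (h4 j j4))); exact: (frac_le cc0 (ltW d0)).
rewrite XE; apply: (le_trans (ler_normD _ _)).
apply: (le_trans (lerD T1 (le_trans (ler_normD _ _) (lerD T2 T3)))).
by rewrite le_eqVlt; apply/orP; left; apply/eqP; ring.
Qed.
End limit.
End weak.

Lemma solution_exists : exists u : V * R -> R, [/\ measurable_fun [set: V * R] u,
  exists B, forall p, `|u p| <= B,
  L1 M (fun p => slab T p * u p) /\ (forall t, 0 <= t <= T -> L1 lebN (fun x => u (x, t))),
  forall r t0 d, 0 <= t0 <= T -> 0 < d -> exists2 h, 0 < h & forall t, 0 <= t <= T ->
    `|t - t0| < h -> \int[lebN]_x (\1_(ball (0 : V) r) x * `|u (x, t) - u (x, t0)|) <= d &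
  forall psi, test_function T psi -> \int[M]_p (u p * dtest T psi p) +
    \int[M]_p (phi (u p) * ltest sigma mu T psi p) +
    \int[M]_p (F p * (slab T p * psi p)) + \int[lebN]_x (U0 x * psi (x, 0)) = 0].
Proof.
have /choice[ut hut] : forall j, exists ut, exists ph, approx_sol nu phi T M0 U0 F m j ut ph.
  by move=> j; exact: (approx_exists knu phi_le cphi T0 Ub U1 F1 m1 Fm j).
have /choice[ph ap] := hut.
pose u_ j := uh nu U0 F j (ut j) (ph j).
have TS t : 0 <= t <= T -> 0 <= t <= S.
  by move=> /andP[-> tT]; rewrite /S (le_trans tT)// lerDl.
have muj j : measurable_fun [set: V * R] (u_ j) by case: (ap j) => [_ _ [_ _ _ h] _ _].
have ujb j x t : 0 <= t <= T -> `|u_ j (x, t)| <= Mb T M0 m.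
  by move=> tT; case: (ap j) => [_ _ _ h _]; have [h1 _ _ _] := h t (TS t tT); exact: h1.
have ujL j t : 0 <= t <= T -> L1 lebN (fun x => u_ j (x, t)) /\ \int[lebN]_x `|u_ j (x, t)| <= A S.
  by move=> tT; case: (ap j) => [_ _ _ h _]; have [_ h1 h2 _] := h t (TS t tT); split; [exact: h1|exact: h2].
have cau r d : 0 < d -> exists n0, forall i j, (n0 <= i)%N -> (n0 <= j)%N -> forall t, 0 <= t <= T ->
    \int[lebN]_x (\1_(ball (0 : V) r) x * `|u_ i (x, t) - u_ j (x, t)|) <= d.
  by move=> d0; exact: (uh_cauchy e0 knu levyE phi_le cphi T0 Ub U1 F1 m1 Fm ap r d0).
have [u [mu' uB uL loc]] := curve_limit T0 muj ujb ujL cau.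
exists u; split => //; first by exists (Mb T M0 m).
- split; last by move=> t tT; have [] := uL t tT.
  have h t : 0 < t < T -> L1 lebN (fun x => u (x, t)) /\ \int[lebN]_x `|u (x, t)| <= A S.
    by move=> /andP[t0 tT]; apply: uL; rewrite !ltW.
  by have [] := slab_int T0 mu' h.
- move=> r t0 d t0T d0; have d3 : 0 < d / 3 by rewrite divr_gt0.
  have d6 : 0 < d / 3 / 2 by rewrite divr_gt0.
  (* The index is fixed before the time step h is chosen, so the Lipschitz constant C of this one
     approximation may depend on it. *)
  have [n0 hn] := loc r _ d3; have [_ _ _ _ [_ [C hC]]] := ap n0.
  have [h1 h10 hA] := baseA_unif U0 F1 d6.
  have y0 : 0 < d / 3 / 2 / (`|C| + 1) by rewrite divr_gt0// ltr_wpDl.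
  exists (Num.min h1 (d / 3 / 2 / (`|C| + 1))); first by rewrite lt_min h10.
  move=> t tT; rewrite lt_min => /andP[ht1 ht2].
  have inc s s' : 0 <= s <= s' -> s' <= T -> s' - s <= h1 -> s' - s <= d / 3 / 2 / (`|C| + 1) ->
      \int[lebN]_x `|u_ n0 (x, s') - u_ n0 (x, s)| <= d / 3.
    move=> ss s'T q1 q2; have ss' : s <= s' by case/andP: ss.
    have s'S : s' <= S by rewrite /S (le_trans s'T)// lerDl.
    apply: (le_trans (hC s s' ss s'S)).
    rewrite [leRHS](splitr (d / 3)) lerD//; last exact: hA.
    apply: (@le_trans _ _ (`|C| * (s' - s))); first by rewrite ler_wpM2r ?ler_norm// subr_ge0.
    apply: (le_trans (ler_wpM2l (normr_ge0 C) q2)); exact: (frac_le (normr_ge0 C) (ltW d6)).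
  have uu : \int[lebN]_x `|u_ n0 (x, t) - u_ n0 (x, t0)| <= d / 3.
    have [/andP[t0' tT'] /andP[t00 t0T']] := (tT, t0T).
    have [tt|/ltW tt] := leP t0 t.
      rewrite ger0_norm ?subr_ge0// in ht1 ht2.
      by apply: inc => //; rewrite ?t00// ltW.
    rewrite distrC ger0_norm ?subr_ge0// in ht1; rewrite distrC ger0_norm ?subr_ge0// in ht2.
    under eq_Rintegral do rewrite distrC.
    by apply: inc => //; rewrite ?t0'// ltW.
  pose b x : R := \1_(ball (0 : V) r) x.
  have bb s s' : 0 <= s <= T -> 0 <= s' <= T -> L1 lebN (fun x => b x * `|u_ n0 (x, s) - u (x, s')|).
    move=> sT s'T; apply: (@bm_L1 _ _ _ lebN 1 _ b); first exact: ball0_bm.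
    by apply: L1_norm; apply: L1B; [exact: (proj1 (ujL n0 s sT))|exact: (proj1 (uL s' s'T))].
  have u1 : L1 lebN (fun x => `|u_ n0 (x, t) - u_ n0 (x, t0)|).
    by apply: L1_norm; apply: L1B; [exact: (proj1 (ujL n0 t tT))|exact: (proj1 (ujL n0 t0 t0T))].
  have uu1 : L1 lebN (fun x => b x * `|u (x, t) - u (x, t0)|).
    apply: (@bm_L1 _ _ _ lebN 1 _ b); first exact: ball0_bm.
    by apply: L1_norm; apply: L1B; [exact: (proj1 (uL t tT))|exact: (proj1 (uL t0 t0T))].
  apply: (@le_trans _ _ (\int[lebN]_x (b x * `|u_ n0 (x, t) - u (x, t)| +
      (`|u_ n0 (x, t) - u_ n0 (x, t0)| + b x * `|u_ n0 (x, t0) - u (x, t0)|)))).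
    apply: le_int => //; first by apply: L1D; [exact: bb|apply: L1D => //; exact: bb].
    move=> x; have b0 : 0 <= b x by exact: ball0_ge0.
    have b1 : b x <= 1 by exact: ball0_ge1.
    have h := tri3 (u (x, t)) (u_ n0 (x, t)) (u_ n0 (x, t0)) (u (x, t0)).
    apply: (le_trans (ler_wpM2l b0 h)); rewrite !mulrDr [`|u (x, t) - _|]distrC lerD2l lerD2r.
    exact: ler_piMl.
  rewrite intD; [|exact: bb|by apply: L1D => //; exact: bb].
  rewrite intD//; last exact: bb.
  apply: (le_trans (lerD (hn n0 (leqnn _) t tT) (lerD uu (hn n0 (leqnn _) t0 t0T)))).
  by rewrite le_eqVlt; apply/orP; left; apply/eqP; field.
move=> psi tpsi; exact: (weak_limit tpsi ap mu' uB loc).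
Qed.
End construction.

(** * Essential bounds and representatives of the data *)

Lemma ge0_le_integral_nomeas d (X : measurableType d) (R : realType) (m : {measure set X -> \bar R})
  (D : set X) (f g : X -> \bar R) : (forall x, D x -> (0 <= f x)%E) ->
  (forall x, D x -> (f x <= g x)%E) -> (\int[m]_(x in D) f x <= \int[m]_(x in D) g x)%E.
Proof.
move=> f0 fg; have g0 x : D x -> (0 <= g x)%E by move=> Dx; exact: le_trans (f0 x Dx) (fg x Dx).
rewrite ge0_integralE// ge0_integralE//; apply: le_ereal_sup => _ [h hf <-].
exists h => // x; apply: (le_trans (hf x)); rewrite !patchE.
by case: ifPn => // /set_mem /fg.
Qed.

(** If the whole space is null, every property holds almost everywhere; otherwise the norm is an
    essential supremum. *)
Lemma Linfty_ae d (X : measurableType d) (R : realType) (m : {measure set X -> \bar R})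
  (f : X -> \bar R) : {ae m, forall x, (`|f x| <= Lnorm m +oo f)%E}.
Proof.
rewrite unlock /=; case: ifPn => [_|]; first exact: ess_sup_ge.
rewrite -leNgt => m0; exists [set: X]; split => //.
by apply/eqP; rewrite eq_le m0 measure_ge0.
Qed.

Lemma Linfty_bound d (X : measurableType d) (R : realType) (m : {measure set X -> \bar R})
  (f : X -> R) : (Lnorm m +oo (EFin \o f) < +oo)%E ->
  exists2 B, 0 <= B & {ae m, forall x, `|f x| <= B}.
Proof.
move=> h; have h0 := Lnorm_ge0 m +oo (EFin \o f).
exists (fine (Lnorm m +oo (EFin \o f))); first exact: fine_ge0.
apply: filterS (Linfty_ae m (EFin \o f)) => x /=; rewrite -lee_fin fineK//.
by rewrite ge0_fin_numE.
Qed.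

Lemma L1_ae_eq d (X : measurableType d) (R : realType) (m : {measure set X -> \bar R})
  (f g : X -> R) : measurable_fun [set: X] g -> L1 m f -> {ae m, forall x, f x = g x} -> L1 m g.
Proof.
move=> mg f1 fg; apply: L1P => //.
rewrite (_ : (\int[m]_x _ = \int[m]_x `|f x|%:E)%E); first exact: L1_lty.
apply: ae_eq_integral => //.
- by apply/measurable_EFinP; exact: measurableT_comp.
- by apply/measurable_EFinP; apply: measurableT_comp => //; exact: L1_measurable f1.
by apply: filterS fg => x -> _.
Qed.

Lemma truncate_L1 d (X : measurableType d) (R : realType) (m : {measure set X -> \bar R})
  (f : X -> R) : L1 m f -> (Lnorm m +oo (EFin \o f) < +oo)%E ->
  exists B g, [/\ 0 <= B, bm B g, L1 m g & {ae m, forall x, g x = f x}].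
Proof.
move=> f1 /Linfty_bound[B B0 hB]; have mf := L1_measurable f1.
pose g x := (`|f x| <= B)%R%:R * f x; exists B, g.
have mg : measurable_fun [set: X] g.
  apply: measurable_funM => //; apply: measurable_boolR.
  by apply: measurable_fun_ler => //; exact: measurableT_comp.
split => //.
- by split => // x; rewrite /g; have [h|_] := boolP (`|f x| <= B); rewrite ?mul1r// mul0r normr0.
- apply: (L1_le mg (L1_norm f1)) => x.
  by rewrite /g; have [h|_] := boolP (`|f x| <= B); rewrite ?mul1r// mul0r normr0.
by apply: filterS hB => x hx; rewrite /g hx mul1r.
Qed.

(** * Null sets and their slices; a pointwise bound for the source *)

Section space_time_ae.
Variables (R : realType) (N : nat).
Local Notation V := 'rV[R]_N.
Local Notation lebN := (lebesgue_rV R N).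
Local Notation M := (lebX R N).

Lemma ae_slice (g : V * R -> R) : measurable_fun [set: V * R] g ->
  {ae M, forall p, g p = 0} -> {ae lebR R, forall t, {ae lebN, forall x, g (x, t) = 0}}.
Proof.
move=> mg g0; have m0 : measurable_fun [set: V * R] (fun=> 0 : R) by exact: measurable_cst.
have g1 : L1 M (fun p => `|g p|).
  apply: L1_norm; apply: (L1_ae_eq mg (L10 M)).
  by apply: filterS g0 => p ->.
have i0 : \int[M]_p `|g p| = 0.
  rewrite -(int0 M); apply: eq_int_ae => //; first exact: L1_measurable g1.
  by apply: filterS g0 => p ->; rewrite normr0.
rewrite (intX2 g1) in i0.
have h := int0_ae (L1X_int2 g1) (fun t => int_ge0 _ (fun x => normr_ge0 (g (x, t)))).
have {}h := h ltac:(by rewrite i0).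
apply: filterS2 h (L1X_ae2 g1) => t ht h1.
have := int0_ae h1 (fun x => normr_ge0 _); rewrite ht => /(_ (lexx _)).
by apply: filterS => x /normr0_eq0.
Qed.

Lemma ae_unslice (g : V * R -> R) : measurable_fun [set: V * R] g -> (forall p, 0 <= g p) ->
  {ae lebR R, forall t, {ae lebN, forall x, g (x, t) = 0}} -> {ae M, forall p, g p = 0}.
Proof.
move=> mg g0 h.
have i0 : (\int[M]_p (g p)%:E = 0)%E.
  rewrite tonelliX2//.
  have mi : measurable_fun [set: R] (fun t => \int[lebN]_x (g (x, t))%:E)%E by exact: measurable_eint2.
  rewrite -[RHS](integral0 (lebR R) [set: R]); apply: ae_eq_integral => //.
  apply: filterS h => t ht _.
  rewrite -[RHS](integral0 lebN [set: V]); apply: ae_eq_integral => //.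
    by apply/measurable_EFinP; exact: (measurable_slice2 t mg).
  by apply: filterS ht => x -> _.
have g1 : L1 M g.
  apply: L1P => //; under eq_integral do rewrite ger0_norm//.
  by rewrite i0.
by apply: int0_ae => //; rewrite -lee_fin EFin_int// i0.
Qed.

Section source.
Variables (T : R) (f : V * R -> R).
Hypotheses (T0 : 0 < T) (mf : measurable_fun (QT T) f).
Hypothesis fint : (\int[@lebesgue_measure R]_(t in `]0%R, T[)
     (Lnorm lebN 1 (fun x => (f (x, t))%:E) + Lnorm lebN +oo (fun x => (f (x, t))%:E)) < +oo)%E.

(** The measurability of t -> |f(., t)|_oo is not given. A measurable substitute [h] is built as the
    supremum of the levels [cc n], which range over the nonnegative rationals, whose superlevel set
    in the slice has positive measure; Tonelli makes each of these conditions measurable in t. *)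
Let cc n : R := if @unpickle rat n is Some r then `|ratr r| else 0.
Let g p := slab T p * f p.
Let mg : measurable_fun [set: V * R] g. Proof. exact: slab_measurable. Qed.
Let E n s := (\int[lebN]_x ((cc n < `|g (x, s)|)%R%:R)%:E)%E.
Let Qn n s := ((cc n)%:E * (\1_[set s | (0 < E n s)%E] s)%:E)%E.
Let h s := esups (fun n => Qn n s) 0.

Let cc0 n : 0 <= cc n. Proof. by rewrite /cc; case: unpickle. Qed.

Let mchi n : measurable_fun [set: V * R] (fun p => (cc n < `|g p|)%R%:R : R).
Proof. by apply: measurable_boolR; apply: measurable_fun_ltr => //; exact: measurableT_comp. Qed.

Let mE n : measurable_fun [set: R] (E n). Proof. exact: (measurable_eint2 _ (mchi n)). Qed.

Let mEpos n : measurable [set s | (0 < E n s)%E].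
Proof.
rewrite (_ : [set s | _] = [set: R] `&` E n @^-1` `]0%E, +oo[%classic); last first.
  by apply/seteqP; split => s /=; rewrite in_itv/= andbT => // -[].
by apply: mE => //; exact: emeasurable_itv.
Qed.

Let mh : measurable_fun [set: R] h.
Proof.
apply: measurable_fun_esups => n; apply: emeasurable_funM; first exact: measurable_cst.
by apply/measurable_EFinP; exact: measurable_indic.
Qed.

Let Q0 n s : (0 <= Qn n s)%E.
Proof. by rewrite mule_ge0 ?lee_fin ?cc0. Qed.

Let Qh n s : (Qn n s <= h s)%E.
Proof. by apply: ereal_sup_ubound; exists n. Qed.

Let h0 s : (0 <= h s)%E. Proof. exact: le_trans (Q0 0 s) (Qh 0 s). Qed.

Let E_ae0 n s : {ae lebN, forall x, ~~ (cc n < `|g (x, s)|)} -> E n s = 0%E.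
Proof.
move=> hx; rewrite /E -[RHS](integral0 lebN [set: V]); apply: ae_eq_integral => //.
  by apply/measurable_EFinP; exact: (measurable_slice2 s (mchi n)).
by apply: filterS hx => x /negbTE -> _.
Qed.

Let h_out s : ~~ (0 < s < T) -> h s = 0%E.
Proof.
move=> hs; apply/eqP; rewrite eq_le h0 andbT; apply: ge_ereal_sup => _ [n _ <-].
rewrite /Qn indicE memNset ?mule0//= E_ae0 ?ltxx//.
by apply: nearW => x; rewrite /g /slab /= (negbTE hs) mul0r normr0 -leNgt cc0.
Qed.

Let h_le s : 0 < s < T -> (h s <= Lnorm lebN +oo (fun x => (f (x, s))%:E))%E.
Proof.
move=> hs; apply: ge_ereal_sup => _ [n _ <-]; rewrite /Qn indicE.
have [En|En] := boolP (s \in _); last by rewrite mule0; exact: Lnorm_ge0.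
rewrite mule1 leNgt; apply/negP => hlt; move/set_mem: En => /=; rewrite E_ae0 ?ltxx//.
apply: filterS (Linfty_ae lebN (fun x => (f (x, s))%:E)) => x hx.
by rewrite /g /slab /= hs mul1r -leNgt -lee_fin (le_trans hx)// ltW.
Qed.

Let to_time (k : R -> \bar R) : measurable_fun [set: R] k -> (forall s, (0 <= k s)%E) ->
  (forall s, ~~ (0 < s < T) -> k s = 0%E) ->
  (forall s, 0 < s < T -> (k s <= Lnorm lebN 1 (fun x => (f (x, s))%:E) + Lnorm lebN +oo (fun x => (f (x, s))%:E))%E) ->
  (\int[lebR R]_s k s < +oo)%E.
Proof.
move=> mk k0 kout kle; rewrite -(mpres_ge0 (mpres_lebR R) mk k0).
apply: le_lt_trans fint; rewrite [leRHS]integral_mkcond.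
apply: ge0_le_integral_nomeas => // s _; rewrite patchE.
case: ifPn => [/set_mem|]; first by rewrite /= in_itv/=; exact: kle.
by move=> hs; rewrite kout//; apply: contra hs => hs; apply/mem_set; rewrite /= in_itv.
Qed.

Let g1 : L1 M g.
Proof.
have mn : measurable_fun [set: V * R] (fun p => `|g p|) by exact: measurableT_comp.
apply: (L1X_prod2 mg); apply: to_time.
- exact: (measurable_eint2 _ mn).
- by move=> s; exact: integral_ge0.
- by move=> s hs; rewrite integral0_eq// => x _; rewrite /g /slab /= (negbTE hs) mul0r normr0.
move=> s hs; apply: (@le_trans _ _ (Lnorm lebN 1 (fun x => (f (x, s))%:E))); last by rewrite leeDl// Lnorm_ge0.
rewrite Lnorm1; apply: ge0_le_integral_nomeas => // x _.
by rewrite /g /slab /= hs mul1r.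
Qed.

Let m s := fine (h s).
Let m0 s : 0 <= m s. Proof. exact: fine_ge0. Qed.
Let hint : (\int[lebR R]_s h s < +oo)%E.
Proof.
apply: to_time => // s hs; apply: (le_trans (h_le hs)).
by rewrite leeDr// Lnorm_ge0.
Qed.
Let hI : (lebR R).-integrable [set: R] h.
Proof. by apply/integrableP; split => //; under eq_integral do rewrite gee0_abs//. Qed.

(** The source is set to 0 where it exceeds the slice bound [m], which changes it on a null set only
    and makes the bound hold everywhere. *)
Lemma source_bound : exists F m, [/\ L1 M F, L1 (lebR R) m, forall x s, `|F (x, s)| <= m s &
  {ae M, forall p, F p = slab T p * f p}].
Proof.
pose F p := (`|g p| <= m p.2)%R%:R * g p.
have mm : measurable_fun [set: R] m by exact: measurable_fine.
have mm2 : measurable_fun [set: V * R] (fun p => m p.2).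
  by apply: (measurableT_comp mm); exact: measurable_snd.
have mF : measurable_fun [set: V * R] F.
  apply: measurable_funM => //; apply: measurable_boolR.
  by apply: measurable_fun_ler => //; exact: measurableT_comp.
exists F, m; split.
- by apply: (L1_le mF (L1_norm g1)) => p; rewrite /F; have [hp|_] := boolP (`|g p| <= m p.2); rewrite ?mul1r// mul0r normr0.
- apply: L1P => //; apply: le_lt_trans hint; apply: ge0_le_integral_nomeas => s _; first by [].
  rewrite ger0_norm// /m; have := h0 s; case: (h s) => //= _; exact: lee0y.
- by move=> x s; rewrite /F /=; have [hp|_] := boolP (`|g (x, s)| <= m s); rewrite ?mul1r// mul0r normr0.
have mbad : measurable_fun [set: V * R] (fun p => (m p.2 < `|g p|)%R%:R : R).
  by apply: measurable_boolR; apply: measurable_fun_ltr => //; exact: measurableT_comp.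
suff bad : {ae M, forall p, (m p.2 < `|g p|)%R%:R = 0 :> R}.
  apply: filterS bad => p; rewrite /F; have [h1|h1] := leP `|g p| (m p.2); first by rewrite mul1r.
  by rewrite /= => /eqP; rewrite oner_eq0.
apply: ae_unslice => //; apply: filterS (integrable_ae measurableT hI) => s /(_ Logic.I) hfin.
have hn n : {ae lebN, forall x, (0 < E n s)%E \/ ~~ (cc n < `|g (x, s)|)}.
  have [En|En] := ltP 0%E (E n s); first by apply: nearW => x; left.
  have En0 : E n s = 0%E by apply/eqP; rewrite eq_le En; exact: integral_ge0.
  have ms := measurable_slice2 s (mchi n).
  have L : L1 lebN (fun x => (cc n < `|g (x, s)|)%R%:R).
    by apply: L1P => //; under eq_integral do rewrite ger0_norm//; rewrite -/(E n s) En0.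
  have : {ae lebN, forall x, (cc n < `|g (x, s)|)%R%:R = 0 :> R}.
    by apply: int0_ae => //; rewrite -lee_fin EFin_int// -/(E n s) En0.
  by apply: filterS => x hx; right; case: (_ < _) hx => //= /eqP; rewrite oner_eq0.
have : {ae lebN, forall x, forall n, (0 < E n s)%E \/ ~~ (cc n < `|g (x, s)|)} by exact: ae_foralln.
apply: filterS => x hx /=; have [hlt|//] := ltP (m s) `|g (x, s)|.
(* A rational strictly between m s and |g (x, s)| is a level whose superlevel set is either
   non-null, so m s is at least that level, or null and avoided by x. *)
have [r] := rat_in_itvoo hlt; rewrite in_itv/= => /andP[r1 r2].
have rr : cc (pickle r) = ratr r.
  by rewrite /cc pickleK ger0_norm// ltW// (le_lt_trans (m0 s)).
case: (hx (pickle r)) => [Ep|]; last by rewrite rr r2.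
have := Qh (pickle r) s; rewrite /Qn indicE mem_set// mule1 rr -(fineK hfin) lee_fin.
by rewrite leNgt r1.
Qed.
End source.
End space_time_ae.

(** * Local integrability and continuity on compact sets *)

Section compact_sets.
Variables (R : realType) (N : nat).
Local Notation V := 'rV[R]_N.
Local Notation lebN := (lebesgue_rV R N).

Lemma compact_measurable_rV (K : set V) : compact K -> measurable K.
Proof.
move=> cK; rewrite -(setCK K); apply: measurableC; apply: open_measurable_rV.
by apply: closed_openC; apply: compact_closed => //; exact: norm_hausdorff.
Qed.

Lemma compact_indic_bm (K : set V) : compact K -> bm 1 (\1_K : V -> R).
Proof.
move=> cK; split; first exact: measurable_indic (compact_measurable_rV cK).
by move=> x; rewrite indicE; case: (_ \in _); rewrite ?normr1 ?normr0.
Qed.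

Lemma compact_patch (K : set V) (g : V -> R) :
  ((EFin \o g) \_ K) = EFin \o (fun x => \1_K x * g x).
Proof.
by apply/funext => x; rewrite patchE /= indicE; case: (x \in K); rewrite ?mul1r ?mul0r.
Qed.

Lemma compact_L1 (K : set V) (g : V -> R) : compact K ->
  lebN.-integrable K (EFin \o g) <-> L1 lebN (fun x => \1_K x * g x).
Proof.
by move=> cK; rewrite integrable_mkcond ?compact_patch//; exact: compact_measurable_rV.
Qed.

Lemma compact_int (K : set V) (g : V -> R) : L1 lebN (fun x => \1_K x * g x) ->
  (\int[lebN]_(x in K) (g x)%:E = (\int[lebN]_x (\1_K x * g x))%:E)%E.
Proof. by move=> h; rewrite integral_mkcond EFin_int// (compact_patch K g). Qed.

Lemma curve_modulus T (v : R -> V -> R) (K : set V) t0 d : compact K -> 0 <= t0 <= T ->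
  (forall t, 0 <= t <= T -> L1loc_RN (v t)) ->
  (\int[lebN]_(x in K) `|v t x - v t0 x|%:E)%E @[t --> within `[0, T] (nbhs t0)] --> 0%E ->
  0 < d -> exists2 h, 0 < h & forall t, 0 <= t <= T -> `|t - t0| < h ->
    \int[lebN]_x (\1_K x * `|v t x - v t0 x|) <= d.
Proof.
move=> cK t0T vL /fine_cvgP[_ /cvgrPdist_le h] d0.
have := h d d0; rewrite near_withinE => /nbhs_ballP[r /= r0 hr].
exists r => // t tT tr.
have := hr t; rewrite /ball /= distrC => /(_ tr); rewrite in_itv /= => /(_ tT).
have dK : L1 lebN (fun x => \1_K x * `|v t x - v t0 x|).
  have a1 := (proj1 (compact_L1 (v t) cK)) ((proj2 (vL t tT)) K cK).
  have a2 := (proj1 (compact_L1 (v t0) cK)) ((proj2 (vL t0 t0T)) K cK).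
  apply: (L1_eq _ (L1_norm (L1B a1 a2))) => x.
  by rewrite -mulrBr normrM ger0_norm// indicE ler0n.
rewrite (compact_int dK) /= sub0r normrN ger0_norm//.
by apply: int_ge0 => x; rewrite mulr_ge0// indicE ler0n.
Qed.
End compact_sets.

(** * From the analytic results to the stated notions of solution *)

Section problem.
Variables (R : realType) (N P : nat) (sigma : 'M[R]_(N, P)).
Local Notation V := 'rV[R]_N.
Local Notation lebN := (lebesgue_rV R N).
Local Notation leb1 := (@lebesgue_measure R).
Local Notation lebQ := (lebN \x leb1)%E.
Local Notation M := (lebX R N).
Variable mu : {measure set V -> \bar R}.
Variables (nu : nat -> {sigma_finite_measure set V -> \bar R}) (e : nat -> R) (c : R).
Hypothesis e0 : e @ \oo --> (0 : R).
Hypothesis knu : forall n, kern (nu n) (fun=> 1).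
Hypothesis levyE : forall A r g n x, levy_nice sigma A r g ->
  `|levy_op sigma mu g x - \int[nu n]_z (g (x + z) - g x)| <=
  A * e n * \1_(ball (0 : V) (r + c)) x.
Variable phi : R -> R.
Hypothesis phi_le : {homo phi : x y / x <= y}.
Hypothesis cphi : continuous phi.
Variables (T M0 : R) (u0 U0 : V -> R) (f F : V * R -> R).
Hypotheses (T0 : 0 < T) (u01 : L1 lebN u0) (Ub : bm M0 U0) (U1 : L1 lebN U0).
Hypothesis Uu : {ae lebN, forall x, U0 x = u0 x}.
Hypotheses (mf : measurable_fun (QT T) f) (F1 : L1 M F).
Hypothesis Ff : {ae M, forall p, F p = slab T p * f p}.

Let mphi : measurable_fun [set: R] phi.
Proof. by apply: nondecreasing_measurable => // x y _ _; exact: phi_le. Qed.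

Let slab01 (p : V * R) : slab T p = 1 \/ slab T p = 0.
Proof. by rewrite /slab; case: (_ < _ < _); [left|right]. Qed.

Definition weak_form (u psi : V * R -> R) : R :=
  \int[M]_p (u p * dtest T psi p) + \int[M]_p (phi (u p) * ltest sigma mu T psi p) +
  \int[M]_p (F p * (slab T p * psi p)) + \int[lebN]_x (U0 x * psi (x, 0)).

(** Translates the extended integrals of the definition into the real number [weak_form], while
    replacing u, u0 and f by their bounded representatives u', U0 and F. *)
Lemma weak_value (u u' psi : V * R -> R) B : test_function T psi ->
  measurable_fun [set: V * R] (fun p => slab T p * u p) -> bm B u' ->
  {ae M, forall p, u' p = slab T p * u p} ->
  L1 M (fun p => slab T p * (phi (u p) * levy_op sigma mu (fun y => psi (y, p.2)) p.1)) ->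
  (\int[leb1]_(t in `]0%R, T[) \int[lebN]_x
     (u (x, t) * derive1 (fun s => psi (x, s)) t +
      phi (u (x, t)) * levy_op sigma mu (fun y => psi (y, t)) x + f (x, t) * psi (x, t))%:E +
   \int[lebN]_x (u0 x * psi (x, 0%R))%:E = (weak_form u' psi)%:E)%E.
Proof.
move=> tpsi mu' ub uu IL.
have [A' [Bl [Cl [Pb P1 Lb L1' _]]]] := test_levy e0 knu levyE tpsi.
have [a [r [a0 _ Db _]]] := dtest_bm tpsi.
have D1 : L1 M (dtest T psi) := dtest_L1 tpsi.
have [Cp Cp0 hCp] := phi_bounded phi_le B.
have [_ UL _] := weak_initial T0 Ub tpsi.
have k1 : Ck 1 psi by case: tpsi => h _; exact: (h 1%N).
have cpsi : continuous psi by exact: Ck_continuous k1.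
pose G (p : V * R) := u p * derive1 (fun s => psi (p.1, s)) p.2 +
  phi (u p) * levy_op sigma mu (fun y => psi (y, p.2)) p.1 + f p * psi p.
pose GG p := slab T p * G p.
pose H p := u' p * dtest T psi p + phi (u' p) * ltest sigma mu T psi p + F p * (slab T p * psi p).
have h1 : L1 M (fun p => u' p * dtest T psi p) := bm_L1 ub D1.
have pb : bm Cp (fun p => phi (u' p)).
  by split; [exact: (measurableT_comp mphi (proj1 ub))|move=> p; apply: hCp; exact: (proj2 ub)].
have h2 : L1 M (fun p => phi (u' p) * ltest sigma mu T psi p) := bm_L1 pb L1'.
have h3 : L1 M (fun p => F p * (slab T p * psi p)) := L1_bm F1 Pb.
have H1 : L1 M H by apply: L1D => //; exact: L1D.
have GE p : GG p = (slab T p * u p) * dtest T psi p +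
    slab T p * (phi (u p) * levy_op sigma mu (fun y => psi (y, p.2)) p.1) +
    (slab T p * f p) * (slab T p * psi p).
  case: p => x t; rewrite /GG /G /dtest /=; have [_ ->] := D_time x t k1.
  by case: (slab01 (x, t)) => ->; ring.
have mG : measurable_fun [set: V * R] GG.
  rewrite (funext GE); apply: measurable_funD; last first.
    apply: measurable_funM; first exact: slab_measurable.
    exact: (proj1 Pb).
  apply: measurable_funD; last exact: L1_measurable IL.
  by apply: measurable_funM => //; exact: (proj1 Db).
have HG : {ae M, forall p, H p = GG p}.
  apply: filterS2 uu Ff => p hu hF; rewrite GE /H hu hF /ltest /dtest.
  by case: (slab01 p) => ->; rewrite ?mul1r ?mul0r ?mulr0.
have G1 : L1 M GG := L1_ae_eq mG H1 HG.
rewrite [X in (X + _)%E](_ : _ = (\int[M]_p GG p)%:E); last first.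
  by apply: (@weakE _ _ _ G GG G1) => p.
rewrite [X in (_ + X)%E](_ : _ = (\int[lebN]_x (U0 x * psi (x, 0)))%:E); last first.
  rewrite EFin_int//; apply: ae_eq_integral => //.
  - apply/measurable_EFinP; apply: measurable_funM; first exact: L1_measurable u01.
    apply: (measurable_slice2 (F := psi) 0); exact: continuous_measurable_VR.
  - by apply/measurable_EFinP; exact: L1_measurable UL.
  by apply: filterS Uu => x -> _.
rewrite -EFinD; congr (_%:E); rewrite /weak_form; congr (_ + _).
rewrite -(eq_int_ae (L1_measurable H1) mG HG) /H intD//; last exact: L1D.
by rewrite intD.
Qed.

(** Cut off at its essential bound and extended by 0 outside the slab, a solution satisfies
    everywhere what [unique_core] asks of functions on the whole of space-time. *)
Lemma bounded_representative u : distributional_solution sigma mu phi T u0 f u ->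
  L1_QT T u -> Linfty_QT T u -> exists B u', [/\ bm B u', L1 M u',
    forall p, ~~ (0 < p.2 < T) -> u' p = 0, {ae M, forall p, u' p = slab T p * u p} &
    forall psi, test_function T psi -> weak_form u' psi = 0].
Proof.
move=> [_ ds] /QT_L1 u1 [_]; rewrite slab_patch => /Linfty_bound[B B0 hB].
have {}hB : {ae M, forall p, `|slab T p * u p| <= B} by exact: (mpres_ae (mpres_XQ R N) hB).
pose g p := slab T p * u p; pose u' p := (`|g p| <= B)%R%:R * g p.
have mg : measurable_fun [set: V * R] g := L1_measurable u1.
have mu' : measurable_fun [set: V * R] u'.
  apply: measurable_funM => //; apply: measurable_boolR.
  by apply: measurable_fun_ler => //; exact: measurableT_comp.
have ub : bm B u'.
  by split => // p; rewrite /u'; have [h|_] := boolP (`|g p| <= B); rewrite ?mul1r// mul0r normr0.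
have uu : {ae M, forall p, u' p = slab T p * u p}.
  by apply: filterS hB => p hp; rewrite /u' /g hp mul1r.
exists B, u'; split => //.
- apply: (L1_le mu' (L1_norm u1)) => p.
  by rewrite /u' /g; have [h|_] := boolP (`|slab T p * u p| <= B); rewrite ?mul1r// mul0r normr0.
- by move=> p hp; rewrite /u' /g /slab (negbTE hp) !mul0r mulr0.
move=> psi tpsi; have [IL EQ] := ds psi tpsi.
have IL' := (proj1 (QT_L1 _ _)) IL.
have := weak_value tpsi mg ub uu IL'; rewrite /= in EQ *; rewrite EQ => /esym h.
by apply/eqP; rewrite -eqe; apply/eqP; exact: h.
Qed.

Lemma solution_admissible (u : V * R -> R) B : measurable_fun [set: V * R] u -> (forall p, `|u p| <= B) ->
  L1 M (fun p => slab T p * u p) -> (forall t, 0 <= t <= T -> L1 lebN (fun x => u (x, t))) ->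
  (forall r t0 d, 0 <= t0 <= T -> 0 < d -> exists2 h, 0 < h & forall t, 0 <= t <= T ->
    `|t - t0| < h -> \int[lebN]_x (\1_(ball (0 : V) r) x * `|u (x, t) - u (x, t0)|) <= d) ->
  (forall psi, test_function T psi -> weak_form u psi = 0) ->
  [/\ distributional_solution sigma mu phi T u0 f u, L1_QT T u, Linfty_QT T u & C_L1loc T u].
Proof.
move=> mu' uB u1 ut uc uw.
have uQ : L1_QT T u by apply/QT_L1.
have su : bm B (fun p => slab T p * u p).
  split; first exact: L1_measurable u1.
  by move=> p; case: (slab01 p) => ->; rewrite ?mul1r// mul0r normr0 (le_trans _ (uB p)).
split => //.
- split.
    split; first exact: measurable_funTS.
    move=> K cK KQ; apply/integrableP; split.
      by apply/measurable_EFinP; exact: measurable_funTS.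
    have /integrableP[_] := uQ; apply: le_lt_trans.
    rewrite integral_mkcond [leRHS]integral_mkcond; apply: ge0_le_integral_nomeas => p _.
      by rewrite patchE; case: ifP.
    rewrite [X in (X <= _)%E]patchE [X in (_ <= X)%E]patchE.
    have [Kp|Kp] := boolP (p \in K); last by case: ifP => _; [exact: abse_ge0|exact: lexx].
    by rewrite mem_set//; apply: KQ; exact: set_mem.
  move=> psi tpsi Lpsi.
  have [A' [Bl [Cl [_ _ _ L1' _]]]] := test_levy e0 knu levyE tpsi.
  have [Cp Cp0 hCp] := phi_bounded phi_le B.
  have pb : bm Cp (fun p => phi (u p)).
    by split; [exact: (measurableT_comp mphi mu')|move=> p; exact: hCp].
  have IL : L1 M (fun p => slab T p * (phi (u p) * Lpsi p)).
    by apply: (L1_eq _ (bm_L1 pb L1')) => p; rewrite /ltest mulrCA.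
  split; first by apply/QT_L1.
  have ae1 : {ae M, forall p, slab T p * u p = slab T p * u p} by exact: nearW.
  rewrite (weak_value tpsi (proj1 su) su ae1 IL); congr (_%:E).
  rewrite -(uw psi tpsi) /weak_form; congr (_ + _ + _ + _); apply: eq_Rintegral => p _.
    by rewrite /dtest; case: (slab01 p) => ->; rewrite ?mul1r// !mul0r mulr0.
  by rewrite /ltest; case: (slab01 p) => ->; rewrite ?mul1r// !mul0r !mulr0.
- split; first exact: measurable_funTS.
  rewrite slab_patch unlock /=; case: ifPn => _; last exact: ltry.
  apply: (@le_lt_trans _ _ B%:E); last exact: ltry.
  by apply/ess_supP; apply: nearW => p /=; rewrite lee_fin; exact: (proj2 su).
(* The constructed solution is its own continuous curve; a compact set is enclosed in a ball for the
   modulus. *)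
exists (fun t x => u (x, t)); split.
- move=> t tT; split; first exact: (measurable_slice2 t mu').
  move=> K cK; apply/(compact_L1 (fun x => u (x, t)) cK); apply: (bm_L1 (compact_indic_bm cK)); exact: ut.
- move=> K cK t0 t0T.
  have dK t : 0 <= t <= T -> L1 lebN (fun x => \1_K x * `|u (x, t) - u (x, t0)|).
    move=> tT; apply: (bm_L1 (compact_indic_bm cK)); apply: L1_norm; apply: L1B; exact: ut.
  have [r0 [_ hr]] := compact_bounded cK.
  have Kr x : K x -> `|x| < r0 + 2.
    move=> Kx; apply: (@le_lt_trans _ _ (r0 + 1)); last by rewrite ltrD2l ltr1n.
    by apply: (hr (r0 + 1)) => //; rewrite ltrDl.
  have FF : Filter (within `[0, T] (nbhs t0)) by apply: within_filter; exact: nbhs_filter.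
  apply/fine_cvgP; split.
    rewrite near_withinE; apply: nearW => t; rewrite /= in_itv /= => tT.
    by rewrite (compact_int (dK t tT)).
  apply/cvgrPdist_le => d d0; rewrite near_withinE.
  have [h h0 hh] := uc (r0 + 2) t0 d t0T d0.
  apply/nbhs_ballP; exists h => //= t; rewrite /ball /= distrC => th; rewrite in_itv /= => tT.
  rewrite (compact_int (dK t tT)) /= sub0r normrN ger0_norm; last first.
    by apply: int_ge0 => x; rewrite mulr_ge0// indicE ler0n.
  apply: le_trans (hh t tT th); apply: le_int; first exact: dK.
    apply: (bm_L1 (ball0_bm N (r0 + 2))); apply: L1_norm; apply: L1B; exact: ut.
  move=> x; rewrite ler_wpM2r// ball0E indicE; have [Kx|_] := boolP (x \in K); last by rewrite ler0n.
  by rewrite (Kr x)//; exact: set_mem.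
by apply: nearW => t _; exact: nearW.
Qed.

Lemma solution_unique u v :
  distributional_solution sigma mu phi T u0 f u -> L1_QT T u -> Linfty_QT T u -> C_L1loc T u ->
  distributional_solution sigma mu phi T u0 f v -> L1_QT T v -> Linfty_QT T v -> C_L1loc T v ->
  {ae lebQ, forall p, QT T p -> v p = u p}.
Proof.
move=> du u1 ui [cu [cuL cuc cua]] dv v1 vi [cv' [cvL cvc cva]].
have [Bu [u' [ub u'1 uout uu uw]]] := bounded_representative du u1 ui.
have [Bv [v' [vb v'1 vout vv vw]]] := bounded_representative dv v1 vi.
have Bu0 := bm_ge0 ((0 : V), (0 : R)) ub; have Bv0 := bm_ge0 ((0 : V), (0 : R)) vb.
pose B := Bu + Bv.
have {}ub : bm B u' by apply: bm_le ub; rewrite lerDl.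
have {}vb : bm B v' by apply: bm_le vb; rewrite lerDr.
have [Cp Cp0 hCp] := phi_bounded phi_le B.
pose w p := v' p - u' p; pose z p := phi (v' p) - phi (u' p).
have pub : bm Cp (fun p => phi (u' p)).
  by split; [exact: (measurableT_comp mphi (proj1 ub))|move=> p; apply: hCp; exact: (proj2 ub)].
have pvb : bm Cp (fun p => phi (v' p)).
  by split; [exact: (measurableT_comp mphi (proj1 vb))|move=> p; apply: hCp; exact: (proj2 vb)].
have Z00 : 0 < Cp + Cp + 1 by rewrite ltr_wpDl// addr_ge0.
have zb : bm (Cp + Cp + 1) z by apply: bm_le (bmB pvb pub); rewrite lerDl.
have wb : bm (B + B) w := bmB vb ub.
have w1 : L1 M w := L1B v'1 u'1.
have zw0 p : 0 <= z p * w p.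
  rewrite /z /w; have [h|/ltW h] := leP (u' p) (v' p).
    by rewrite mulr_ge0// subr_ge0//; exact: phi_le.
  by rewrite mulr_le0// subr_le0//; exact: phi_le.
have zs k : 0 < k -> exists2 s, 0 < s & forall p, `|z p| <= k \/ s * `|z p| <= z p * w p.
  move=> k0; have [h h0 hh] := unif_cont cphi B k0; exists h => // p.
  have [wh|wh] := ltP `|w p| h; [left|right].
    by apply: hh => //; exact: (proj2 ub).
  by rewrite -(ger0_norm (zw0 p)) normrM mulrC ler_wpM2l.
have wout p : ~~ (0 < p.2 < T) -> w p = 0 by move=> hp; rewrite /w uout// vout// subrr.
have zout p : ~~ (0 < p.2 < T) -> z p = 0 by move=> hp; rewrite /z uout// vout// subrr.
have weak psi : test_function T psi ->
    \int[M]_p (w p * dtest T psi p) + \int[M]_p (z p * ltest sigma mu T psi p) = 0.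
  move=> tpsi; have D1 : L1 M (dtest T psi) := dtest_L1 tpsi.
  have [A' [Bl [Cl [_ _ _ L1' _]]]] := test_levy e0 knu levyE tpsi.
  have -> : \int[M]_p (w p * dtest T psi p) =
      \int[M]_p (v' p * dtest T psi p) - \int[M]_p (u' p * dtest T psi p).
    rewrite -intB; [|exact: (bm_L1 vb D1)|exact: (bm_L1 ub D1)].
    by apply: eq_Rintegral => p _; rewrite /w mulrBl.
  have -> : \int[M]_p (z p * ltest sigma mu T psi p) =
      \int[M]_p (phi (v' p) * ltest sigma mu T psi p) - \int[M]_p (phi (u' p) * ltest sigma mu T psi p).
    rewrite -intB; [|exact: (bm_L1 pvb L1')|exact: (bm_L1 pub L1')].
    by apply: eq_Rintegral => p _; rewrite /z mulrBl.
  have := vw psi tpsi; have := uw psi tpsi; rewrite /weak_form.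
  set i1 := \int[M]_p (u' p * _); set i2 := \int[M]_p (phi (u' p) * _).
  set i3 := \int[M]_p (F p * _); set i4 := \int[lebN]_x _.
  set i5 := \int[M]_p (v' p * _); set i6 := \int[M]_p (phi (v' p) * _).
  move=> g1 g2; have g : (i5 + i6 + i3 + i4) - (i1 + i2 + i3 + i4) = 0 by rewrite g1 g2 subrr.
  rewrite -[RHS]g; ring.
(* A null set of space-time has null slices at almost every time, so the representative agrees with
   the curve on almost every slice. *)
have slice (a a' : V * R -> R) (ca : R -> V -> R) : L1 M a' -> L1 M (fun p => slab T p * a p) ->
    {ae M, forall p, a' p = slab T p * a p} ->
    {ae leb1, forall t, 0 < t < T -> {ae lebN, forall x, a (x, t) = ca t x}} ->
    {ae lebR R, forall t, 0 < t < T -> {ae lebN, forall x, a' (x, t) = ca t x}}.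
  move=> a'1 a1 aa ha.
  have ha' : {ae lebR R, forall t, 0 < t < T -> {ae lebN, forall x, a (x, t) = ca t x}}.
    exact: (mpres_ae (mpres_lebR_inv R) ha).
  have dm : measurable_fun [set: V * R] (fun p => a' p - slab T p * a p).
    exact: L1_measurable (L1B a'1 a1).
  have d0 : {ae M, forall p, a' p - slab T p * a p = 0} by apply: filterS aa => p ->; rewrite subrr.
  apply: filterS2 ha' (ae_slice dm d0) => t h1 h2 tT.
  apply: filterS2 (h1 tT) h2 => x <- /eqP; rewrite subr_eq0 => /eqP ->.
  by rewrite /slab /= tT mul1r.
have u1' := (proj1 (QT_L1 _ _)) u1; have v1' := (proj1 (QT_L1 _ _)) v1.
pose cw t x := cv' t x - cu t x.
have vae : {ae lebR R, forall t, 0 < t < T -> {ae lebN, forall x, w (x, t) = cw t x}}.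
  apply: filterS2 (slice _ _ _ u'1 u1' uu cua) (slice _ _ _ v'1 v1' vv cva) => t h1 h2 tT.
  by apply: filterS2 (h1 tT) (h2 tT) => x g1 g2; rewrite /w g1 g2.
have tw t : 0 < t < T -> 0 <= t <= T by move=> /andP[/ltW -> /ltW ->].
have cL (ca : R -> V -> R) K t : (forall t, 0 <= t <= T -> L1loc_RN (ca t)) -> compact K ->
    0 < t < T -> L1 lebN (fun x => \1_K x * ca t x).
  move=> caL cK tT; apply: (proj1 (compact_L1 (ca t) cK)); exact: ((proj2 (caL t (tw t tT))) K cK).
have vL1 K t : compact K -> 0 < t < T -> L1 lebN (fun x => \1_K x * cw t x).
  move=> cK tT; apply: (L1_eq _ (L1B (cL _ _ _ cvL cK tT) (cL _ _ _ cuL cK tT))) => x.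
  by rewrite /cw mulrBr.
have dL (ca : R -> V -> R) K t t0 : (forall t, 0 <= t <= T -> L1loc_RN (ca t)) -> compact K ->
    0 < t < T -> 0 < t0 < T -> L1 lebN (fun x => \1_K x * `|ca t x - ca t0 x|).
  move=> caL cK tT t0T; apply: (L1_eq _ (L1_norm (L1B (cL _ _ _ caL cK tT) (cL _ _ _ caL cK t0T)))) => x.
  by rewrite -mulrBr normrM ger0_norm// indicE ler0n.
have vcont K t0 d : compact K -> 0 < t0 < T -> 0 < d -> exists2 h, 0 < h &
    forall t, 0 < t < T -> `|t - t0| < h -> \int[lebN]_x (\1_K x * `|cw t x - cw t0 x|) <= d.
  move=> cK t0T d0; have d2 : 0 < d / 2 by rewrite divr_gt0.
  have [h1 h10 hh1] := curve_modulus cK (tw _ t0T) cuL (cuc K cK t0 (tw _ t0T)) d2.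
  have [h2 h20 hh2] := curve_modulus cK (tw _ t0T) cvL (cvc K cK t0 (tw _ t0T)) d2.
  exists (Num.min h1 h2); first by rewrite lt_min h10.
  move=> t tT; rewrite lt_min => /andP[th1 th2].
  have L2 := dL _ _ _ _ cvL cK tT t0T; have L3 := dL _ _ _ _ cuL cK tT t0T.
  have cwE x : cw t x - cw t0 x = (cv' t x - cv' t0 x) - (cu t x - cu t0 x) by rewrite /cw; ring.
  apply: (@le_trans _ _ (\int[lebN]_x (\1_K x * `|cv' t x - cv' t0 x| + \1_K x * `|cu t x - cu t0 x|))).
    apply: le_int; [|exact: L1D|].
      apply: (L1_eq _ (L1_norm (L1B (vL1 K t cK tT) (vL1 K t0 cK t0T)))) => x.
      by rewrite -mulrBr normrM ger0_norm// indicE ler0n.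
    move=> x; rewrite -mulrDr cwE ler_wpM2l ?indicE ?ler0n//; exact: ler_normB.
  by rewrite intD// [leRHS](splitr d) lerD//; [apply: hh2 => //|apply: hh1 => //]; exact: tw.
have wae := unique_core e0 knu levyE T0 Z00 wb w1 zb zw0 zs wout zout weak vae vL1 vcont.
have toQ (Pp : set (V * R)) : {ae M, forall p, Pp p} -> {ae lebQ, forall p, Pp p}.
  by move=> h; exact: (mpres_ae (mpres_QX R N) h).
have all3 : {ae M, forall p, 0 < p.2 < T -> v p = u p}.
  apply: filterS3 wae uu vv => p + hu hv pT.
  by rewrite /w hu hv /slab pT !mul1r => /eqP; rewrite subr_eq0 => /eqP.
apply: (toQ (fun p => QT T p -> v p = u p)); apply: filterS all3 => p h [_ hp].
by apply: h; rewrite /= in_itv in hp.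
Qed.
End problem.

Theorem theorem2p16 (R : realType) (N P : nat) (T : R) (phi : R -> R)
  (u0 : 'rV[R]_N -> R) (f : 'rV[R]_N * R -> R) (sigma : 'M[R]_(N, P))
  (mu : {measure set 'rV[R]_N -> \bar R}) :
  0 < T ->
  {homo phi : x y / x <= y} ->
  continuous phi ->
  (lebesgue_rV R N).-integrable [set: 'rV[R]_N] (EFin \o u0) ->
  (Lnorm (lebesgue_rV R N) +oo (EFin \o u0) < +oo)%E ->
  measurable_fun (QT T) f ->
  (\int[@lebesgue_measure R]_(t in `]0%R, T[)
     (Lnorm (lebesgue_rV R N) 1 (fun x => (f (x, t))%:E) +
      Lnorm (lebesgue_rV R N) +oo (fun x => (f (x, t))%:E)) < +oo)%E ->
  radon_punctured mu ->
  symmetric_punctured mu ->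
  levy_integrable mu ->
  let admissible u :=
    [/\ distributional_solution sigma mu phi T u0 f u,
        L1_QT T u, Linfty_QT T u & C_L1loc T u] in
  exists u : 'rV[R]_N * R -> R, admissible u /\
    forall v : 'rV[R]_N * R -> R, admissible v ->
      {ae (lebesgue_rV R N \x @lebesgue_measure R)%E,
        forall p, QT T p -> v p = u p}.
Proof.
move=> T0 phi_le cphi u01 u0i mf fint _ musym muint admissible.
have [nu [e [c [e0 knu levyE]]]] := levy_approx sigma musym muint.
(* Source and initial datum are exchanged for almost everywhere equal representatives whose bounds
   hold at every point, as the scheme requires. *)
have [F [m [F1 m1 Fm Ff]]] := source_bound mf fint.
have [M0 [U0 [_ Ub U1 Uu]]] := truncate_L1 u01 u0i.
have [u [mu' [B uB] [u1 ut] uc uw]] :=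
  solution_exists e0 knu levyE phi_le cphi T0 Ub U1 F1 m1 Fm.
have adm := solution_admissible e0 knu levyE phi_le T0 u01 Ub Uu mf F1 Ff mu' uB u1 ut uc uw.
exists u; split; first exact: adm.
case: adm => du ul ui uC v [dv vl vi vC].
exact: (solution_unique e0 knu levyE phi_le cphi T0 u01 Ub Uu mf F1 Ff du ul ui uC dv vl vi vC).
Qed.
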